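(* Let $(\phi_h,\psi_h)$, $h\in(-1/6,0)$, be the periodic annulus of traveling waves (wave speed $c=-1/2$) of the hyperbolic Burgers–Fisher model $$u_t+v_x=u(1-u),\qquad v_t+u_x=\tfrac12u^2-v,$$ as described in the context, let $\mathcal{L}^3$ be the linearized operator about $(\phi_h,\psi_h)$, and let $$\lambda_1(\mu)=\mathbf{i}\tfrac{\mu}{2}+\sqrt{1-\mu^2},\qquad \lambda_2(\mu)=\mathbf{i}\tfrac{\mu}{2}-\sqrt{1-\mu^2},\qquad\mu\in\mathbb{R}.$$ Then the following hold for $h<0$ with $|h|$ sufficiently small. (i) There exists only one $\lambda_h(\mu)$ in the spectrum of $\mathcal{L}^3$ perturbed from each $\lambda_j(\mu)$, for $j=1,2$ and $\mu\neq\pm1$, and two eigenvalues $\lambda_h^{1,2}(\pm1)$ perturbed from $\lambda=\pm\mathbf{i}/2$. (ii) For a connected closed set $\mathcal{I}\subset\mathbb{R}$ bounded away from $\mu=k/\sqrt3$ for all $k\in\mathbb{Z}$ and from $\mu=\pm1$, there exists a continuous curve in the spectrum of $\mathcal{L}^3$ perturbed from $\{\lambda\in\mathbb{C}:\lambda=\mathbf{i}\frac{\mu}{2}\pm\sqrt{1-\mu^2},\ \mu\in\mathcal{I}\}$ (for each choice of sign, i.e. for each of $\lambda_1,\lambda_2$). (iii) There exists a sufficiently small $h_0>0$ such that the periodic traveling waves $(\phi_h,\psi_h)$ for $h\in(-h_0,0)$ are spectrally unstable, i.e. the spectrum of $\mathcal{L}^3$ intersects $\{\mathrm{Re}\,\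lambda>0\}$.
   Context: The model is $u_t+v_x=g(u)$, $\alpha v_t+u_x=f(u)-v$ with $g(u)=u(1-u)$, $f(u)=\frac12u^2$, here with $\alpha=1$. Traveling waves $(u,v)=(\phi(x+ct),\psi(x+ct))$ with $c=-1/2$ satisfy, with $\xi=x+ct$ and $'=d/d\xi$, $$u'=\tfrac23u-\tfrac43v,\qquad v'=-u^2+\tfrac43u-\tfrac23v,$$ an integrable system with first integral $H(u,v)=-\frac23u^2+\frac13u^3+\frac23uv-\frac23v^2$, a center at $(0,0)$ and a saddle at $(1,1/2)$. For $h\in(-1/6,0)$, $(\phi_h,\psi_h)$ is the periodic solution whose orbit is the closed component, surrounding $(0,0)$, of $\{H=h\}$; its period $T(h)$ satisfies $T(h)\to\sqrt3\pi$ as $h\to0^-$. The linearized operator is $\mathcal{L}^3=a_1\partial_\xi+a_0$ on $L^2(\mathbb{R};\mathbb{C}^2)$ with domain $H^1(\mathbb{R};\mathbb{C}^2)$, where $$a_1=\begin{pmatrix}1/2&-1\\-1&1/2\end{pmatrix},\qquad a_0(\xi)=\begin{pmatrix}g'(\phi_h(\xi))&0\\ f'(\phi_h(\xi))&-1\end{pmatrix}.$$ Here $\sqrt{1-\mu^2}=\mathbf{i}\sqrt{\mu^2-1}$ for $|\mu|>1$. Meaning of ''perturbed from''. For $\mu\in\mathbb{R}$ let $\mathcal{L}^3_\mu=a_1(\partial_\xi+\mathbf{i}\mu)+a_0$ acting on $T(h)$-periodic functions; then $\sigma(\mathcal{L}^3)=\bigcup_\mu\sigma_{\rm pt}(\mathcal{L}^3_\mu)$.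 A spectral point $\lambda_h(\mu)$ perturbed from $\lambda_j(\mu)$ is an eigenvalue of $\mathcal{L}^3_\mu$ with $\lambda_h(\mu)\to\lambda_j(\mu)$ as $h\to0^-$; spectral points are counted with algebraic multiplicity. In (i), the points at $\mu=1$ are perturbed from $\mathbf{i}/2=\lambda_1(1)=\lambda_2(1)$ and those at $\mu=-1$ from $-\mathbf{i}/2=\lambda_1(-1)=\lambda_2(-1)$. A continuous spectral curve perturbed from $\{\lambda_j(\mu):\mu\in\mathcal{I}\}$ is a continuous curve $\mu\mapsto\lambda_{j,h}(\mu)\in\sigma(\mathcal{L}^3)$, $\mu\in\mathcal{I}$, converging to $\{\lambda_j(\mu):\mu\in\mathcal{I}\}$ in the Hausdorff distance as $h\to0^-$.
   Formalization: In (i), for μ≠±1 where λ_j(μ) equals some λ_j'(μ+2k/√3) with k≠0 (e.g. λ_2(2/√3)=λ_1(-2/√3)=0), exactly two eigenvalues, counted with multiplicity, are perturbed from λ_j(μ); exactly one is asserted for all other μ≠±1, as the literal count of one fails there. *)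

(* Defs.v *)
From HB Require Import structures.
From mathcomp Require Import all_boot all_order all_algebra.
From mathcomp Require Import complex.
From mathcomp Require Import all_classical all_reals all_analysis.

Set Implicit Arguments.
Unset Strict Implicit.
Unset Printing Implicit Defensive.

Import Order.TTheory GRing.Theory Num.Theory.
Import numFieldNormedType.Exports.

Local Open Scope classical_set_scope.
Local Open Scope complex_scope.
Local Open Scope ring_scope.

Section BurgersFisher.
Context {R : realType}.

(* The library puts no topology on R[i], so limits, continuity, derivatives,
   measurability and integrals of complex quantities go through normc or
   through real and imaginary parts. *)
Definition cabs (z : R[i]) : R := Normc.normc z.

Definition continuous_curve (I : set R) (c : R -> R[i]) : Prop :=
  {within I, continuous (fun mu => complex.Re (c mu))} /\
  {within I, continuous (fun mu => complex.Im (c mu))}.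

Definition mx22 (a b c d : R[i]) : 'M[R[i]]_2 :=
  \matrix_(i < 2, j < 2)
    (if i == 0 then (if j == 0 then a else b) else (if j == 0 then c else d)).

Definition g_BF (u : R) : R := u * (1 - u).
Definition f_BF (u : R) : R := u ^+ 2 / 2.

Definition H_BF (p : R * R) : R :=
  - (2 / 3) * p.1 ^+ 2 + p.1 ^+ 3 / 3 + (2 / 3) * p.1 * p.2
  - (2 / 3) * p.2 ^+ 2.

Definition wave_ode (phi psi : R -> R) : Prop := forall xi : R,
  is_derive xi 1 phi ((2 / 3) * phi xi - (4 / 3) * psi xi) /\
  is_derive xi 1 psi (- phi xi ^+ 2 + (4 / 3) * phi xi - (2 / 3) * psi xi).

Definition surrounds (C : set (R * R)) (p : R * R) : Prop :=
  ~ C p /\ bounded_set (connected_component (~` C) p).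

Definition is_period (phi psi : R -> R) (S : R) : Prop :=
  forall xi, phi (xi + S) = phi xi /\ psi (xi + S) = psi xi.

(* [T] is the minimal period.  The solution is determined by [h] up to a
   translation in [xi]. *)
Definition periodic_wave (h : R) (phi psi : R -> R) (T : R) : Prop :=
  let orbit := range (fun xi => (phi xi, psi xi)) in
  [/\ wave_ode phi psi,
      0 < T,
      is_period phi psi T,
      (forall S, 0 < S -> is_period phi psi S -> T <= S) &
      orbit = connected_component [set p | H_BF p = h] (phi 0, psi 0) /\
      surrounds orbit (0, 0)].

Definition a1 : 'M[R[i]]_2 := mx22 (2^-1)%:C (-1) (-1) (2^-1)%:C.

Definition a0 (phi : R -> R) (xi : R) : 'M[R[i]]_2 :=
  mx22 (derive1 g_BF (phi xi))%:C 0 (derive1 f_BF (phi xi))%:C (-1).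

Definition sqnormL2 (U : R -> 'cV[R[i]]_2) : \bar R :=
  \int[lebesgue_measure]_(xi in [set: R])
    (\sum_(i < 2) cabs (U xi i 0) ^+ 2)%:E.

Definition inL2 (U : R -> 'cV[R[i]]_2) : Prop :=
  (forall i : 'I_2,
     measurable_fun setT (fun xi : R => complex.Re (U xi i 0)) /\
     measurable_fun setT (fun xi : R => complex.Im (U xi i 0))) /\
  (sqnormL2 U < +oo)%E.

(* [U] is the absolutely continuous representative of an element of
   H^1(R; C^2) and [dU] (determined up to a null set) is its derivative. *)
Definition inH1 (U dU : R -> 'cV[R[i]]_2) : Prop :=
  [/\ inL2 U, inL2 dU &
      forall (x y : R) (i : 'I_2), x <= y ->
        complex.Re (U y i 0) - complex.Re (U x i 0) =
          \int[lebesgue_measure]_(t in `[x, y]) complex.Re (dU t i 0) /\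
        complex.Im (U y i 0) - complex.Im (U x i 0) =
          \int[lebesgue_measure]_(t in `[x, y]) complex.Im (dU t i 0)].

Definition opL3 (phi : R -> R) (U dU : R -> 'cV[R[i]]_2) (xi : R) :
    'cV[R[i]]_2 :=
  a1 *m dU xi + a0 phi xi *m U xi.

Definition resL3 (phi : R -> R) (lam : R[i]) (U dU : R -> 'cV[R[i]]_2)
    (xi : R) : 'cV[R[i]]_2 :=
  opL3 phi U dU xi - lam *: U xi.

(* [lam] is in the resolvent set when L^3 - lam : H^1 -> L^2 is onto and
   bounded below, i.e. bijective with bounded inverse. *)
Definition resolvent_set (phi : R -> R) : set R[i] := [set lam |
  (forall F, inL2 F -> exists U dU, inH1 U dU /\
     {ae lebesgue_measure, forall xi : R,
        resL3 phi lam U dU xi = F xi}) /\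
  (exists C : R, forall U dU, inH1 U dU ->
     (sqnormL2 U <= C%:E * sqnormL2 (resL3 phi lam U dU))%E)].

Definition spectrum (phi : R -> R) : set R[i] := ~` resolvent_set phi.

Definition is_cderive (U dU : R -> 'cV[R[i]]_2) : Prop :=
  forall (xi : R) (i : 'I_2),
    is_derive xi 1 (fun t : R => complex.Re (U t i 0)) (complex.Re (dU xi i 0))
    /\
    is_derive xi 1 (fun t : R => complex.Im (U t i 0)) (complex.Im (dU xi i 0)).

(* Graph of L^3_mu : [P] is T-periodic and L^3_mu P = W. *)
Definition bloch (phi : R -> R) (T mu : R) (P W : R -> 'cV[R[i]]_2) : Prop :=
  (forall xi, P (xi + T) = P xi) /\
  exists dP, is_cderive P dP /\ forall xi,
    W xi = a1 *m (dP xi + (0 +i* mu) *: P xi) + a0 phi xi *m P xi.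

(* [P] is in the kernel of (L^3_mu - lam)^n. *)
Fixpoint in_ker_pow (phi : R -> R) (T mu : R) (lam : R[i]) (n : nat)
    (P : R -> 'cV[R[i]]_2) : Prop :=
  if n is n'.+1 then
    exists Q : R -> 'cV[R[i]]_2,
      bloch phi T mu P (fun xi => Q xi + lam *: P xi) /\
      in_ker_pow phi T mu lam n' Q
  else forall xi, P xi = 0.

Definition gen_eigenspace (phi : R -> R) (T mu : R) (lam : R[i]) :
  set (R -> 'cV[R[i]]_2) := [set P | exists n, in_ker_pow phi T mu lam n P].

Definition has_dim (E : set (R -> 'cV[R[i]]_2)) (m : nat) : Prop :=
  exists B : 'I_m -> R -> 'cV[R[i]]_2,
    (forall c : 'I_m -> R[i],
       (forall xi, \sum_(i < m) c i *: B i xi = 0) -> forall i, c i = 0) /\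
    E = [set P | exists c : 'I_m -> R[i],
           forall xi, P xi = \sum_(i < m) c i *: B i xi].

(* [lam] is an eigenvalue of L^3_mu of algebraic multiplicity [m];
   [m = 0] means that it is not an eigenvalue. *)
Definition alg_mult (phi : R -> R) (T mu : R) (lam : R[i]) (m : nat) : Prop :=
  has_dim (gen_eigenspace phi T mu lam) m.

Definition csqrt1m (mu : R) : R[i] :=
  if `|mu| <= 1 then (Num.sqrt (1 - mu ^+ 2))%:C
  else 0 +i* Num.sqrt (mu ^+ 2 - 1).

Definition lambda1 (mu : R) : R[i] := 0 +i* (mu / 2) + csqrt1m mu.
Definition lambda2 (mu : R) : R[i] := 0 +i* (mu / 2) - csqrt1m mu.
Definition lambda_ (j : 'I_2) : R -> R[i] :=
  if j == 0 then lambda1 else lambda2.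

(* Exactly [n] spectral points, counted with algebraic multiplicity, are
   perturbed from [z]: for small h < 0 the eigenvalues of L^3_mu in a fixed disc
   about [z] are [lam i h], i < n, each repeated according to its
   multiplicity; all of them tend to [z]. *)
Definition perturbed (phi : R -> R -> R) (T : R -> R) (mu : R) (z : R[i])
    (n : nat) : Prop :=
  exists lam : 'I_n -> R -> R[i],
    (forall i, cabs (lam i h - z) @[h --> 0^'-] --> (0 : R)) /\
    exists r h0 : R, [/\ 0 < r, 0 < h0 &
      forall h, - h0 < h < 0 ->
        (forall i, cabs (lam i h - z) < r /\ spectrum (phi h) (lam i h)) /\
        (forall w, cabs (w - z) < r ->
           alg_mult (phi h) (T h) mu w #|[set i | lam i h == w]%SET|)].

(* At h = 0 the functions are sqrt 3 * pi periodic, so the eigenvalues of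
   L^3_mu are the points lambda_j(mu + 2 k / sqrt 3), k in Z.  [resonant j mu]
   says that the value lambda_j(mu) is attained for a second k (for example
   lambda_2(2 / sqrt 3) = lambda_1(- 2 / sqrt 3) = 0).  Two spectral points,
   one for each index, are then perturbed from that value. *)
Definition resonant (j : 'I_2) (mu : R) : Prop :=
  exists (j' : 'I_2) (k : int),
    k != 0 /\ lambda_ j' (mu + 2 * k%:~R / Num.sqrt 3) = lambda_ j mu.

Definition hausdorff_dist (A B : set R[i]) : \bar R :=
  ereal_inf [set e%:E | e in [set e : R | 0 < e /\
    (forall a, A a -> exists2 b, B b & cabs (a - b) < e) /\
    (forall b, B b -> exists2 a, A a & cabs (a - b) < e)]].

Definition perturbed_curve (phi : R -> R -> R) (I : set R) (z : R -> R[i]) :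
    Prop :=
  exists lam : R -> R -> R[i],
    (exists2 h0 : R, 0 < h0 & forall h, - h0 < h < 0 ->
       continuous_curve I (lam h) /\
       forall mu, I mu -> spectrum (phi h) (lam h mu)) /\
    hausdorff_dist (lam h @` I) (z @` I) @[h --> 0^'-] --> (0 : \bar R).

Definition spectrally_unstable (phi : R -> R) : Prop :=
  exists2 lam, spectrum phi lam & 0 < complex.Re lam.

End BurgersFisher.

(* Main.v *)
(* Instead of single eigenfunctions, consider 2x2 matrix solutions [U] of
   [a1 U' + a0 U = U L] with a constant matrix [L] and [U (T) = e^(i mu T) U (0)].
   At [h = 0] such frames consist of two modes [e^(i k x) v] with [k] congruent to
   [mu] modulo [2 / sqrt 3]. Newton's method continues them to small [h < 0], and
   every generalized Bloch eigenfunction whose eigenvalue is close to the chosen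
   point lies in the span of their columns, so eigenvalues and multiplicities are
   those of the matrix [L]. This gives (i), and (iii) at [mu = 0], where
   [lambda_1 (0) = 1].

   For (ii), a quasi-periodic approximate frame with diagonal matrix [D] satisfies
   [|L - D| <= C * residual]. Away from resonances the modes of the rest state are
   accurate enough. At a resonance two imaginary points cross; a quadratic
   polynomial in the wave, corrected with the help of the first integral, solves
   the system up to O(|h|^(3/2)), while the order [h] shifts of the two branches
   have different real parts. Hence the branches do not reconnect. Local branches
   are glued at nonresonant quasi-momenta, where the eigenvalue is unique by (i). *)
From HB Require Import structures.
Require Import Defs.
From mathcomp Require Import all_boot all_order all_algebra.
From mathcomp Require Import complex.
From mathcomp Require Import all_classical all_reals all_analysis.
From mathcomp Require Import measurable_realfun.
From mathcomp Require Import ring lra.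
Set Implicit Arguments.
Unset Strict Implicit.
Unset Printing Implicit Defensive.
Import Order.TTheory GRing.Theory Num.Theory.
Import numFieldNormedType.Exports.
Local Open Scope classical_set_scope.
Local Open Scope complex_scope.
Local Open Scope ring_scope.

(** * Calculus on the line *)

Section RealCalculus.
Context {R : realType}.
Implicit Types (f g df dg : R -> R) (a b x y : R).

(** At resonances and at [mu = 1], [mu = -1] the rest state has a double eigenvalue, and a single
    eigenfunction cannot be continued by an implicit function argument. The frame equation stays
    nondegenerate: with [U 0 = V] fixed, the four entries of [L] face the four equations
    [U T = rho *: V], and the derivative in [L] is injective as soon as no nonzero forcing
    [U0 *m Ga] can be undone over one period ([forcing_faithful]). For the rest state this is
    checked mode by mode with left null vectors of the symbol. All estimates concern initial value
    problems on one period, with Gronwall constants uniform in [h] and [mu]. The points [k / sqrt 3]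
    excluded in (ii) have a concrete role. Two resonant modes [k1], [k2] differ by a multiple of
    [2 / sqrt 3], and the real parts of their order [h] shifts differ by a nonzero factor times
    [k1 + k2]. This sum vanishes only if both modes are multiples of [1 / sqrt 3]. *)

Lemma drD f g (x a b : R) : is_derive x 1 f a -> is_derive x 1 g b -> is_derive x 1 (fun t => f t + g t) (a + b).
Proof. exact: is_deriveD. Qed.
Lemma drB f g (x a b : R) : is_derive x 1 f a -> is_derive x 1 g b -> is_derive x 1 (fun t => f t - g t) (a - b).
Proof. exact: is_deriveB. Qed.
Lemma drN f (x a : R) : is_derive x 1 f a -> is_derive x 1 (fun t => - f t) (- a).
Proof. exact: is_deriveN. Qed.
Lemma drM f g (x a b : R) : is_derive x 1 f a -> is_derive x 1 g b -> is_derive x 1 (fun t => f t * g t) (a * g x + f x * b).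
Proof. move=> Hf Hg; have := is_deriveM Hf Hg; rewrite [a * _]mulrC addrC; exact. Qed.
Lemma drC (c x : R) : is_derive x 1 (fun=> c) (0 : R).
Proof. exact: is_derive_cst. Qed.
Lemma drI (x : R) : is_derive x 1 (fun t => t) (1 : R).
Proof. exact: is_derive_id. Qed.
Lemma dr_comp f g (x a b : R) : is_derive (g x) 1 f a -> is_derive x 1 g b -> is_derive x 1 (fun t => f (g t)) (a * b).
Proof. move=> Hf Hg; exact: (is_derive1_comp Hf Hg). Qed.
Lemma drE f (x a b : R) : is_derive x 1 f a -> a = b -> is_derive x 1 f b.
Proof. by move=> ? <-. Qed.

Lemma mean_value f df a b : a <= b ->
  (forall x, a <= x <= b -> is_derive x 1 f (df x)) ->
  exists2 c, a <= c <= b & f b - f a = df c * (b - a).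
Proof.
move=> ab fd.
have H1 x : x \in `]a, b[ -> is_derive x 1 f (df x).
  by rewrite in_itv /= => /andP[/ltW ? /ltW ?]; apply: fd; apply/andP.
have H2 : {within `[a, b], continuous f}.
  apply: derivable_within_continuous => x; rewrite in_itv /= => /fd H.
  exact: ex_derive.
have [c ci e] := MVT_segment ab H1 H2.
by exists c => //; move: ci; rewrite in_itv.
Qed.

Lemma nondecreasing_deriv f df a b : a <= b ->
  (forall x, a <= x <= b -> is_derive x 1 f (df x)) ->
  (forall x, a <= x <= b -> 0 <= df x) -> f a <= f b.
Proof.
move=> ab fd df0; have [c cab e] := mean_value ab fd.
by rewrite -subr_ge0 e mulr_ge0 ?df0 ?subr_ge0.
Qed.

Lemma derive0_eq f : (forall x, is_derive x 1 f 0) -> forall x y, f x = f y.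
Proof.
move=> fd x y; wlog xy : x y / x <= y.
  by move=> H; case: (leP x y) => [/H//|/ltW /H ->].
have [c _ ] := mean_value xy (fun z _ => fd z).
by rewrite mul0r => /eqP; rewrite subr_eq0 => /eqP.
Qed.

(** Both [g - f] and [g + f] are nondecreasing on [[0, y]]. *)
Lemma normr_deriv_le f df g dg : f 0 = 0 -> 0 <= g 0 ->
  (forall x, is_derive x 1 f (df x)) ->
  (forall x, is_derive x 1 g (dg x)) ->
  forall y, 0 <= y -> (forall x, 0 <= x <= y -> `|df x| <= dg x) -> `|f y| <= g y.
Proof.
move=> f0 g0 fd gd y y0 dfg.
have H1 : g 0 - f 0 <= g y - f y.
  apply: (nondecreasing_deriv (f := fun t => g t - f t) (df := fun t => dg t - df t)) => // x xy /=.
  by rewrite subr_ge0 (le_trans (ler_norm _)) ?dfg.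
have H2 : g 0 + f 0 <= g y + f y.
  apply: (nondecreasing_deriv (f := fun t => g t + f t) (df := fun t => dg t + df t)) => // x xy /=.
  have := dfg x xy; rewrite ler_norml => /andP[+ _]; lra.
by rewrite ler_norml; lra.
Qed.

Lemma normr_le_linear f df c : f 0 = 0 ->
  (forall x, is_derive x 1 f (df x)) ->
  forall y, 0 <= y -> (forall x, 0 <= x <= y -> `|df x| <= c) -> `|f y| <= c * y.
Proof.
move=> f0 fd y y0 H.
apply: (normr_deriv_le (g := fun x => c * x) (dg := fun => c) f0 _ fd _ y0 H).
  by rewrite mulr0.
by move=> x; apply: drE (drM (drC c x) (drI x)) _; rewrite mul0r add0r mulr1.
Qed.

Lemma dr_opp_arg f (x a : R) : is_derive (- x) 1 f a ->
  is_derive x 1 (fun t => f (- t)) (- a).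
Proof.
by move=> H; apply: drE (dr_comp H (drN (drI x))) _; rewrite mulrN1.
Qed.

Lemma continuous_integrable f : continuous f -> forall a b,
  (@lebesgue_measure R).-integrable `[a, b] (EFin \o f).
Proof.
move=> fc a b; apply: continuous_compact_integrable; first exact: segment_compact.
by apply: continuous_subspaceT.
Qed.

Lemma antiderivative f : continuous f ->
  exists F, F 0 = 0 /\ forall x, is_derive x 1 F (f x).
Proof.
move=> fc.
pose I a x := \int[@lebesgue_measure R]_(t in `[a, x]) f t.
have Id a x : a < x -> is_derive x 1 (I a) (f x).
  move=> ax.
  have [d e] := @continuous_FTC1_closed R f a x (x + 1)
    (ltac:(by rewrite ltrDl)) (continuous_integrable fc a (x + 1)) ax (fc x).
  by split; [exact: d|rewrite -e derive1E].
pose G a x := I a x - I a 0.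
have Gd a x : a < x -> is_derive x 1 (G a) (f x).
  by move=> ax; rewrite -[f x]subr0; apply: drB; exact: Id.
have GG a b x : b <= a -> a < 0 -> a < x -> G b x = G a x.
  move=> ba a0 ax.
  have S y : a < y -> I b y - I b a = I a y.
    move=> ay; rewrite /I (Rintegral_itvB (continuous_integrable fc b y)) ?bnd_simp ?(ltW ay) //.
    rewrite Rintegral_itv_obnd_cbnd //.
    have := continuous_integrable fc a y; apply: integrableS => //.
    by apply: subset_itvr; rewrite bnd_simp.
  by rewrite /G -(S _ ax) -(S _ a0); lra.
(* An integral over [[a, x]] needs a base point to the left of both [0] and [x]. The base moves with
   [x], but by [GG] the value does not depend on it, so near [x] the function agrees with a
   primitive from one fixed base. *)
pose F x := G (- (`|x| + 1)) x.
exists F; split; first by rewrite /F /G; lra.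
move=> x.
have E : {near x, F =1 G (- (`|x| + 2))}.
  near=> y.
  have yx : `|y - x| < 1.
    by near: y; apply: (@cvgr_distC_lt _ _ _ _ _ id x) => //; exact: cvg_id.
  have y0 : `|y| <= `|x| + 1.
    have := ler_normD (y - x) x; rewrite subrK; lra.
  have Hn := ler_norm (- y); rewrite normrN in Hn.
  have := normr_ge0 y; have := normr_ge0 x => hx hy.
  rewrite /F; apply/esym/GG; lra.
have Hn := ler_norm (- x); rewrite normrN in Hn.
have D := Gd (- (`|x| + 2)) x (ltac:(have := normr_ge0 x; lra)).
apply: near_eq_is_derive D; near=> y; apply/esym; near: y; exact: E.
Unshelve. all: by end_near. Qed.

End RealCalculus.

(** * Picard iteration on the whole line *)

Section LinearODE.
Context {R : realType}.

(** The intervals of radius [2 * w j / 2 ^+ n] about [u n j] are nested, so the supremum of their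
    left ends is the limit and comes with an explicit error. *)
Lemma geometric_limit (J : Type) (u : nat -> J -> R) (w : J -> R) :
  (forall n j, `|u n.+1 j - u n j| <= w j / 2 ^+ n) ->
  exists l : J -> R, forall n j, `|l j - u n j| <= 2 * w j / 2 ^+ n.
Proof.
move=> H.
have lim j : exists l : R, forall n, `|l - u n j| <= 2 * w j / 2 ^+ n.
  pose lo n := u n j - 2 * w j / 2 ^+ n.
  pose hi n := u n j + 2 * w j / 2 ^+ n.
  have w0 : 0 <= w j by have := le_trans (normr_ge0 _) (H 0 j); rewrite divr1.
  have half n : 2 * w j / 2 ^+ n = 2 * (2 * w j / 2 ^+ n.+1).
    by rewrite exprS invfM; field; rewrite expf_neq0.
  have half' n : w j / 2 ^+ n = 2 * w j / 2 ^+ n.+1.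
    by rewrite exprS invfM; field; rewrite expf_neq0.
  have lo1 n : lo n <= lo n.+1.
    have := H n j; rewrite /lo (half n) (half' n) ler_norml => /andP[h1 h2]; lra.
  have hi1 n : hi n.+1 <= hi n.
    have := H n j; rewrite /hi (half n) (half' n) ler_norml => /andP[h1 h2]; lra.
  have loP n m : (n <= m)%N -> lo n <= lo m.
    by apply: (homo_leq (@lexx _ _) (fun x y z => @le_trans _ _ x y z)).
  have hiP n m : (n <= m)%N -> hi m <= hi n.
    apply: (homo_leq (f := hi) (r := fun x y => y <= x)) => //.
    by move=> x y z yx zx; exact: le_trans zx yx.
  have lohi n m : lo n <= hi m.
    rewrite (le_trans (loP n (maxn n m) (leq_maxl _ _)))//.
    rewrite (le_trans _ (hiP m (maxn n m) (leq_maxr _ _)))//.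
    by rewrite /lo /hi lerD2l ge0_cp // divr_ge0 ?mulr_ge0 ?exprn_ge0.
  exists (sup (range lo)) => n.
  have ub m : ubound (range lo) (hi m) by move=> _ [k _ <-].
  have le1 : lo n <= sup (range lo).
    apply: sup_ubound; last by exists n.
    by exists (hi 0).
  have le2 : sup (range lo) <= hi n by apply: ge_sup => //; exists (lo 0), 0.
  by rewrite ler_distl; apply/andP.
by have [l lP] := choice lim; exists l => n j; exact: lP.
Qed.

Lemma vanish_geometric (a b : R) : (forall n, `|a| <= b / 2 ^+ n) -> a = 0.
Proof.
move=> H; apply/normr0_eq0/eqP; rewrite eq_le normr_ge0 andbT.
rewrite leNgt; apply/negP => a0.
have b0 : 0 <= b by have := le_trans (normr_ge0 _) (H 0); rewrite divr1.
have [n hn] : exists n, b / `|a| < 2 ^+ n.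
  have ba : 0 <= b / `|a| by rewrite divr_ge0.
  exists (Num.truncn (b / `|a|)).+1.
  have /andP[_ h] := truncn_itv ba.
  by rewrite (lt_trans h) // -natrX ltr_nat ltn_expl.
have := H n; rewrite leNgt => /negP; apply.
by rewrite ltr_pdivrMr ?exprn_gt0 // mulrC -ltr_pdivrMr.
Qed.

Lemma normr_deriv_le_abs (f df g dg : R -> R) : f 0 = 0 -> 0 <= g 0 ->
  (forall x : R, is_derive x 1 f (df x)) -> (forall x : R, is_derive x 1 g (dg x)) ->
  (forall x, `|df x| <= dg `|x|) -> forall x, `|f x| <= g `|x|.
Proof.
move=> f0 g0 fd gd H x; have [x0|x0] := leP 0 x.
  rewrite (ger0_norm x0); apply: (normr_deriv_le f0 g0 fd gd x0) => z /andP[z0 _].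
  by have := H z; rewrite (ger0_norm z0).
have x0' : 0 <= - x by rewrite oppr_ge0 ltW.
rewrite (ltr0_norm x0).
suff : `|f (- (- x))| <= g (- x) by rewrite opprK.
apply: (normr_deriv_le (f := fun t => f (- t)) (df := fun t => - df (- t)) _ g0 _ gd x0').
- by rewrite oppr0.
- by move=> z; apply: dr_opp_arg; exact: fd.
- by move=> z /andP[z0 _]; rewrite normrN; have := H (- z); rewrite normrN (ger0_norm z0).
Qed.

Lemma dr_exp_lin (c x : R) : is_derive x 1 (fun t => expR (c * t)) (c * expR (c * x)).
Proof.
apply: drE (dr_comp (is_derive_expR _) (drM (drC c x) (drI x))) _.
by rewrite mul0r add0r mulr1 mulrC.
Qed.

Lemma dr_continuous (f df : R -> R) :
  (forall x : R, is_derive x 1 f (df x)) -> continuous f.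
Proof.
move=> fd x; apply/differentiable_continuous/derivable1_diffP.
by have := fd x => H; exact: ex_derive.
Qed.

Lemma continuous_limit (u : nat -> R -> R) (l w : R -> R) :
  (forall n, continuous (u n)) -> (forall x y, `|x| <= y -> w x <= w y) ->
  (forall n x, `|l x - u n x| <= w x / 2 ^+ n) -> continuous l.
Proof.
move=> uc wm H x.
apply/cvgrPdist_lt => e e0.
pose W := w (`|x| + 1).
have W0 : 0 <= W by have := le_trans (normr_ge0 _) (H 0 (`|x| + 1)); rewrite divr1.
have [n hn] : exists n, W / 2 ^+ n < e / 3.
  apply: contrapT => /forallNP N.
  have : e / 3 = 0; last by apply/eqP; rewrite gt_eqF // divr_gt0.
  apply: (@vanish_geometric _ W) => n; rewrite ger0_norm ?divr_ge0 ?(ltW e0) //.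
  by rewrite leNgt; apply/negP => ?; exact: (N n).
have /cvgrPdist_lt /(_ (e / 3)) := uc n x.
rewrite divr_gt0 // => /(_ isT) ucx.
near=> y.
have yx : `|y - x| < 1.
  by near: y; apply: (@cvgr_distC_lt _ _ _ _ _ id x) => //; exact: cvg_id.
have y1 : `|y| <= `|x| + 1.
  have := ler_normD (y - x) x; rewrite subrK; lra.
have b1 : `|l y - u n y| < e / 3.
  by apply: le_lt_trans (H n y) (le_lt_trans _ hn); rewrite ler_wpM2r ?invr_ge0 ?exprn_ge0 // wm.
have b2 : `|l x - u n x| < e / 3.
  apply: le_lt_trans (H n x) (le_lt_trans _ hn).
  by rewrite ler_wpM2r ?invr_ge0 ?exprn_ge0 // wm // lerDl.
have b3 : `|u n x - u n y| < e / 3 by near: y.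
move: b1 b2 b3; rewrite !ltr_norml => /andP[? ?] /andP[? ?] /andP[? ?]; apply/andP; split; lra.
Unshelve. all: by end_near. Qed.

Variables (I : Type) (F : R -> (I -> R) -> I -> R) (K M : R).
Hypothesis K0 : 0 < K.
Hypothesis F_lipschitz : forall x y z (g : R), 0 <= g ->
  (forall j, `|y j - z j| <= g) -> forall i, `|F x y i - F x z i| <= K * g.
Hypothesis F_continuous : forall Y : R -> I -> R,
  (forall i, continuous (Y^~ i)) -> forall i, continuous (fun x => F x (Y x) i).

(** In the norm weighted by [exp (- 2 K |x|)] integration contracts by the factor [1/2], so the
    iteration converges on the whole line at once and no local solutions have to be continued. The
    index type is arbitrary so that real and imaginary parts of matrix entries can serve as
    coordinates. *)
Lemma global_ode_solution (y0 : I -> R) : (forall x i, `|F x y0 i| <= M) ->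
  exists Y : R -> I -> R, (forall i, Y 0 i = y0 i) /\
    forall (x : R) i, is_derive x 1 (Y^~ i) (F x (Y x) i).
Proof.
move=> FM.
(* A primitive is chosen for all functions at once, which makes [step] a total operation; on
   discontinuous functions its value is arbitrary. *)
have [A AP] : exists A : (R -> R) -> R -> R, forall f, continuous f ->
    A f 0 = 0 /\ forall x : R, is_derive x 1 (A f) (f x).
  suff P (f : R -> R) : exists A : R -> R, continuous f -> A 0 = 0 /\ forall x : R, is_derive x 1 A (f x).
    by have [A AP] := choice P; exists A.
  have [fc|fc] := pselect (continuous f); last by exists f.
  by have [G GP] := antiderivative fc; exists G.
pose step (Y : R -> I -> R) x i := y0 i + A (fun t => F t (Y t) i) x.
pose Y := fix Y n := if n is n'.+1 then step (Y n') else fun _ => y0.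
have stepD Z : (forall i, continuous (Z^~ i)) ->
    forall (x : R) i, is_derive x 1 ((step Z)^~ i) (F x (Z x) i).
  move=> Zc x i; have [_ D] := AP _ (@F_continuous _ Zc i).
  by apply: drE (drD (drC (y0 i) x) (D x)) _; rewrite add0r.
have Yc n i : continuous ((Y n)^~ i).
  elim: n i => [|n IH] i /=; first exact: cst_continuous.
  exact: dr_continuous (fun x => stepD _ IH x i).
have Y0 n i : Y n 0 i = y0 i.
  case: n => //= n; have [A0 _] := AP _ (@F_continuous _ (Yc n) i).
  by rewrite /step A0 addr0.
have M0 : forall i : I, 0 <= M by move=> i; exact: le_trans (normr_ge0 _) (FM 0 i).
(* The derivative of [c * E] is [M * E], which dominates the first Picard step. *)
pose c := M / (2 * K).
pose E x : R := expR (2 * K * x).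
have E0 x : 0 < E x by exact: expR_gt0.
have step_bound (Z1 Z2 : R -> I -> R) b : 0 <= b ->
    (forall i, continuous (Z1^~ i)) -> (forall i, continuous (Z2^~ i)) ->
    (forall x i, `|Z1 x i - Z2 x i| <= b * E `|x|) ->
    forall x i, `|step Z1 x i - step Z2 x i| <= b / 2 * E `|x|.
  move=> b0 c1 c2 H x i.
  apply: (@normr_deriv_le_abs (fun x => step Z1 x i - step Z2 x i)
    (fun x => F x (Z1 x) i - F x (Z2 x) i) (fun x => b / 2 * E x)
    (fun x => K * (b * E x))).
  - have [A1 _] := AP _ (@F_continuous _ c1 i).
    by have [A2 _] := AP _ (@F_continuous _ c2 i); rewrite /step A1 A2 subrr.
  - by rewrite mulr_ge0 ?divr_ge0 // ltW.
  - by move=> z; apply: drB; exact: stepD.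
  - move=> z; apply: drE (drM (drC (b / 2) z) (dr_exp_lin (2 * K) z)) _.
    by rewrite mul0r add0r /E; field.
  - by move=> z; apply: F_lipschitz => //; rewrite mulr_ge0 // ltW.
have Ydist n x i : `|Y n.+1 x i - Y n x i| <= c * E `|x| / 2 ^+ n.
  rewrite mulrAC; elim: n x i => [|n IH] x i.
    rewrite divr1 /=.
    apply: (@normr_deriv_le_abs (fun x => step (fun=> y0) x i - y0 i)
      (fun x => F x y0 i) (fun x => c * E x) (fun x => M * E x)).
    - by have [A1 _] := AP _ (@F_continuous _ (Yc 0) i); rewrite /step A1 addr0 subrr.
    - by rewrite mulr_ge0 ?divr_ge0 ?(M0 i) ?mulr_ge0 ?ltW.
    - move=> z; rewrite -[F z y0 i]subr0; apply: drB; exact: (stepD _ (Yc 0%N)).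
    - move=> z; apply: drE (drM (drC c z) (dr_exp_lin (2 * K) z)) _.
      by rewrite mul0r add0r /c /E; field; rewrite gt_eqF.
    - move=> z; rewrite (le_trans (FM z i)) // ler_peMr ?(M0 i) //.
      by rewrite -[leLHS]expR0 ler_expR mulr_ge0 // mulr_ge0 // ltW.
  rewrite (_ : c / 2 ^+ n.+1 = c / 2 ^+ n / 2); last by rewrite exprS; field; rewrite expf_neq0.
  apply: step_bound => //; first by rewrite divr_ge0 ?exprn_ge0 // divr_ge0 ?(M0 i) // mulr_ge0 ?ltW.
  exact: (Yc n.+1).
have [l lP] := @geometric_limit (R * I) (fun n p => Y n p.1 p.2)
  (fun p => c * E `|p.1|) (fun n p => Ydist n p.1 p.2).
pose L x i := l (x, i).
have LY n x i : `|L x i - Y n x i| <= 2 * c / 2 ^+ n * E `|x|.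
  have := lP n (x, i); rewrite /= mulrA; congr (_ <= _); ring.
have Lc i : continuous (L^~ i).
  apply: (@continuous_limit (fun n => (Y n)^~ i) _ (fun x => 2 * c * E `|x|)) => //.
    move=> x y xy; rewrite ler_wpM2l //.
      by rewrite mulr_ge0 // divr_ge0 ?(M0 i) // mulr_ge0 // ltW.
    rewrite ler_expR ler_wpM2l ?mulr_ge0 ?(ltW K0) //.
    exact: le_trans xy (ler_norm _).
  by move=> n x; have := LY n x i; congr (_ <= _); ring.
exists L.
(* [L] and [step L] are both close to the iterate [Y n.+1], with errors that halve at every step. *)
have LE x i : L x i = step L x i.
  apply/eqP; rewrite -subr_eq0; apply/eqP.
  apply: (@vanish_geometric _ (2 * c * E `|x|)) => n.
  have h1 := LY n.+1 x i.
  have h2 : `|step L x i - Y n.+1 x i| <= 2 * c / 2 ^+ n / 2 * E `|x|.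
    apply: step_bound => //.
    by rewrite divr_ge0 ?exprn_ge0 // mulr_ge0 // divr_ge0 ?(M0 i) // mulr_ge0 // ltW.
  have -> : 2 * c * E `|x| / 2 ^+ n = 2 * c / 2 ^+ n.+1 * E `|x| + 2 * c / 2 ^+ n / 2 * E `|x|.
    by rewrite exprS; field; rewrite expf_neq0.
  rewrite (_ : L x i - step L x i = (L x i - Y n.+1 x i) - (step L x i - Y n.+1 x i)); last by ring.
  exact: le_trans (ler_normB _ _) (lerD h1 h2).
split=> [i|x i].
  by rewrite LE /step; have [-> _] := AP _ (@F_continuous _ Lc i); rewrite addr0.
rewrite (_ : L^~ i = (step L)^~ i); first exact: stepD.
by apply/funext => z; exact: LE.
Qed.
End LinearODE.

(** The function [be * t - f t * expR (- al * t)] is nondecreasing on [[0, x]]. *)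
Lemma gronwall (R : realType) (f df : R -> R) (al be x : R) :
  0 <= al -> 0 <= be -> 0 <= x ->
  (forall t : R, is_derive t 1 f (df t)) ->
  (forall t, 0 <= t <= x -> df t <= al * f t + be) ->
  f x <= (f 0 + be * x) * expR (al * x).
Proof.
move=> al0 be0 x0 fd H.
pose E t := expR (- al * t).
have : be * 0 - f 0 * E 0 <= be * x - f x * E x.
  apply: (nondecreasing_deriv (f := fun t => be * t - f t * E t)
    (df := fun t => be - (df t * E t + f t * (- al * E t)))) => // t tx.
    apply: drB; last by apply: drM; exact: dr_exp_lin.
    by apply: drE (drM (drC be t) (drI t)) _; rewrite mul0r add0r mulr1.
  have Et0 : 0 <= E t by exact: expR_ge0.
  have Et1 : E t <= 1.
    rewrite -[leRHS]expR0 ler_expR mulNr oppr_le0 mulr_ge0 //.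
    by case/andP: tx.
  have h := ler_wpM2r Et0 (H t tx).
  have h2 : be * E t <= be by rewrite ler_piMr.
  move: h h2; rewrite !mulrDl !mulNr; lra.
rewrite /E !mulr0 expR0 mulr1 sub0r mulNr expRN => h.
rewrite -ler_pdivrMr ?expR_gt0 //; lra.
Qed.

Lemma dr_sqr (R : realType) (f : R -> R) (x a : R) :
  is_derive x 1 f a -> is_derive x 1 (fun t => f t ^+ 2) (2 * f x * a).
Proof.
move=> h; rewrite (_ : (fun _ => _) = fun t => f t * f t).
  by apply: drE (drM h h) _; ring.
by apply/funext => t; rewrite expr2.
Qed.

(** * Complex and matrix-valued functions *)

Section ComplexCalculus.
Context {R : realType}.
Local Notation C := R[i].
Implicit Types (f g : R -> C) (x : R) (z w : C).

Lemma cabs_ge0 z : 0 <= cabs z.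
Proof. by case: z => a b; rewrite /cabs /= sqrtr_ge0. Qed.
Lemma cabs0 : cabs (0 : C) = 0. Proof. exact: Normc.normc0. Qed.
Lemma cabs_eq0 z : cabs z = 0 -> z = 0. Proof. exact: Normc.eq0_normc. Qed.
Lemma cabsM z w : cabs (z * w) = cabs z * cabs w. Proof. exact: Normc.normcM. Qed.
Lemma cabsV z : cabs z^-1 = (cabs z)^-1. Proof. exact: Normc.normcV. Qed.
Lemma cabsN z : cabs (- z) = cabs z. Proof. exact: normcN. Qed.
Lemma cabsD z w : cabs (z + w) <= cabs z + cabs w. Proof. exact: le_normcD. Qed.
Lemma cabsB z w : cabs (z - w) <= cabs z + cabs w.
Proof. by rewrite -(cabsN w); exact: cabsD. Qed.
Lemma cabs_distC z w : cabs (z - w) = cabs (w - z).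
Proof. by rewrite -cabsN opprB. Qed.
Lemma cabs_gt0 z : z != 0 -> 0 < cabs z.
Proof.
by move=> z0; rewrite lt_neqAle cabs_ge0 andbT eq_sym; apply: contra z0 => /eqP/cabs_eq0->.
Qed.
Lemma cabs_triangle w z1 z2 : cabs (z1 - z2) <= cabs (z1 - w) + cabs (w - z2).
Proof. by rewrite -[X in cabs X <= _](_ : (z1 - w) + (w - z2) = _) ?cabsD //; ring. Qed.
Lemma cabsE z : cabs z ^+ 2 = complex.Re z ^+ 2 + complex.Im z ^+ 2.
Proof. by case: z => a b; rewrite /cabs /= sqr_sqrtr // addr_ge0 ?sqr_ge0. Qed.
Lemma Re_le_cabs z : `|complex.Re z| <= cabs z.
Proof.
rewrite -(@ler_pXn2r _ 2) ?nnegrE ?cabs_ge0 //.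
by rewrite cabsE real_normK ?num_real // lerDl sqr_ge0.
Qed.
Lemma Im_le_cabs z : `|complex.Im z| <= cabs z.
Proof.
rewrite -(@ler_pXn2r _ 2) ?nnegrE ?cabs_ge0 //.
by rewrite cabsE real_normK ?num_real // lerDr sqr_ge0.
Qed.
Lemma cabs_real (a : R) : cabs a%:C = `|a|.
Proof. by rewrite /cabs /= expr0n /= addr0 sqrtr_sqr. Qed.
Lemma cabs_imag (a : R) : cabs (0 +i* a) = `|a|.
Proof. by rewrite /cabs /= expr0n /= add0r sqrtr_sqr. Qed.
Lemma cabs_le_ReIm z : cabs z <= `|complex.Re z| + `|complex.Im z|.
Proof.
rewrite -[X in cabs X](_ : (complex.Re z)%:C + (0 +i* complex.Im z) = _).
  by rewrite (le_trans (cabsD _ _)) // cabs_real cabs_imag.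
by case: z => a b; apply/eqP; rewrite eq_complex /= addr0 add0r !eqxx.
Qed.
Lemma cabs_sum (I : Type) (r : seq I) (P : pred I) (F : I -> C) :
  cabs (\sum_(i <- r | P i) F i) <= \sum_(i <- r | P i) cabs (F i).
Proof.
elim/big_ind2 : _ => [|z a w b za wb|//]; first by rewrite cabs0.
exact: le_trans (cabsD _ _) (lerD za wb).
Qed.

Lemma cReM z w : complex.Re (z * w) =
  complex.Re z * complex.Re w - complex.Im z * complex.Im w.
Proof. by case: z => a b; case: w. Qed.
Lemma cImM z w : complex.Im (z * w) =
  complex.Re z * complex.Im w + complex.Im z * complex.Re w.
Proof. by case: z => a b; case: w => c d /=. Qed.
Lemma cReD z w : complex.Re (z + w) = complex.Re z + complex.Re w.
Proof. by case: z => a b; case: w. Qed.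
Lemma cImD z w : complex.Im (z + w) = complex.Im z + complex.Im w.
Proof. by case: z => a b; case: w. Qed.
Lemma cReN z : complex.Re (- z) = - complex.Re z. Proof. by case: z. Qed.
Lemma cImN z : complex.Im (- z) = - complex.Im z. Proof. by case: z. Qed.
Definition ReImE := (cReM, cImM, cReD, cImD, cReN, cImN).
Lemma complex_ext z w : complex.Re z = complex.Re w -> complex.Im z = complex.Im w -> z = w.
Proof. by case: z => a b; case: w => c d /= -> ->. Qed.

Definition cder f x z := is_derive x 1 (fun t => complex.Re (f t)) (complex.Re z) /\
  is_derive x 1 (fun t => complex.Im (f t)) (complex.Im z).

Lemma cder_eq f x z w : cder f x z -> z = w -> cder f x w.
Proof. by move=> ? <-. Qed.
Lemma cderC z x : cder (fun=> z) x 0.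
Proof. by split; exact: drC. Qed.
Lemma cderD f g x z w : cder f x z -> cder g x w -> cder (fun t => f t + g t) x (z + w).
Proof.
move=> [f1 f2] [g1 g2]; split.
  by rewrite cReD (_ : (fun _ => _) = fun t => complex.Re (f t) + complex.Re (g t));
    [exact: drD|apply/funext => t; rewrite cReD].
by rewrite cImD (_ : (fun _ => _) = fun t => complex.Im (f t) + complex.Im (g t));
  [exact: drD|apply/funext => t; rewrite cImD].
Qed.
Lemma cderM f g x z w : cder f x z -> cder g x w ->
  cder (fun t => f t * g t) x (z * g x + f x * w).
Proof.
move=> [f1 f2] [g1 g2]; split.
  rewrite (_ : (fun _ => _) = fun t => complex.Re (f t) * complex.Re (g t) -
    complex.Im (f t) * complex.Im (g t)); last by apply/funext => t; rewrite cReM.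
  by apply: drE (drB (drM f1 g1) (drM f2 g2)) _; rewrite !ReImE; ring.
rewrite (_ : (fun _ => _) = fun t => complex.Re (f t) * complex.Im (g t) +
  complex.Im (f t) * complex.Re (g t)); last by apply/funext => t; rewrite cImM.
by apply: drE (drD (drM f1 g2) (drM f2 g1)) _; rewrite !ReImE; ring.
Qed.
Lemma cderZ z f x w : cder f x w -> cder (fun t => z * f t) x (z * w).
Proof. by move=> h; apply: cder_eq (cderM (cderC z x) h) _; rewrite mul0r add0r. Qed.
Lemma cderN f x w : cder f x w -> cder (fun t => - f t) x (- w).
Proof.
move=> /(cderZ (-1)) h; rewrite (_ : (fun _ => _) = fun t => -1 * f t).
  by apply: cder_eq h _; rewrite mulN1r.
by apply/funext => t; rewrite mulN1r.
Qed.
Lemma cderB f g x z w : cder f x z -> cder g x w -> cder (fun t => f t - g t) x (z - w).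
Proof. by move=> hf hg; apply: cderD hf (cderN hg). Qed.
Lemma cder_sum (I : Type) (r : seq I) (F : I -> R -> C) (z : I -> C) x :
  (forall i, cder (F i) x (z i)) ->
  cder (fun t => \sum_(i <- r) F i t) x (\sum_(i <- r) z i).
Proof.
move=> H; elim: r => [|i r IH].
  rewrite big_nil (_ : (fun _ => _) = fun=> 0); first exact: cderC.
  by apply/funext => t; rewrite big_nil.
rewrite big_cons (_ : (fun _ => _) = fun t => F i t + \sum_(j <- r) F j t).
  exact: cderD.
by apply/funext => t; rewrite big_cons.
Qed.
Lemma cder_real (f : R -> R) x (a : R) : is_derive x 1 f a -> cder (fun t => (f t)%:C) x a%:C.
Proof. by move=> h; split => //=; exact: drC. Qed.

Lemma cder0_eq f : (forall x, cder f x 0) -> forall x y, f x = f y.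
Proof.
move=> H x y; apply: complex_ext.
  by apply: (derive0_eq (f := fun t => complex.Re (f t))) => z; case: (H z).
by apply: (derive0_eq (f := fun t => complex.Im (f t))) => z; case: (H z).
Qed.

Definition cexp z : C := (expR (complex.Re z))%:C *
  (cos (complex.Im z) +i* sin (complex.Im z)).
Lemma cexpE z : cexp z = (expR (complex.Re z) * cos (complex.Im z)) +i*
  (expR (complex.Re z) * sin (complex.Im z)).
Proof. by rewrite /cexp; apply/eqP; rewrite eq_complex /= !mul0r subr0 addr0 !eqxx. Qed.
Lemma cexpD z w : cexp (z + w) = cexp z * cexp w.
Proof.
rewrite !cexpE cReD cImD expRD cosD sinD; apply: complex_ext; rewrite /=; ring.
Qed.
Lemma cexp0 : cexp 0 = 1.
Proof. by rewrite cexpE /= expR0 cos0 sin0 mulr0 mul1r. Qed.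
Lemma cexpN z : cexp (- z) * cexp z = 1.
Proof. by rewrite -cexpD addNr cexp0. Qed.
Lemma cexp_neq0 z : cexp z != 0.
Proof.
apply/negP => /eqP h; have := cexpN z; rewrite h mulr0 => /eqP.
by rewrite eq_sym oner_eq0.
Qed.
Lemma cabs_cexp z : cabs (cexp z) = expR (complex.Re z).
Proof.
rewrite /cexp cabsM cabs_real /cabs /= cos2Dsin2 sqrtr1 mulr1.
by rewrite ger0_norm // expR_ge0.
Qed.
Lemma cder_cexp z x : cder (fun t : R => cexp (z * t%:C)) x (z * cexp (z * x%:C)).
Proof.
pose a := complex.Re z; pose b := complex.Im z.
have E t : cexp (z * t%:C) = (expR (a * t) * cos (b * t)) +i* (expR (a * t) * sin (b * t)).
  by rewrite cexpE !ReImE /= !mulr0 subr0 add0r.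
have L c : is_derive x 1 (fun t : R => c * t) c.
  by apply: drE (drM (drC c x) (drI x)) _; rewrite mul0r add0r mulr1.
have D1 := dr_comp (is_derive_cos _) (L b).
have D2 := dr_comp (is_derive_sin _) (L b).
have D3 := dr_exp_lin a x.
rewrite (_ : (fun _ => _) = fun t => (expR (a * t) * cos (b * t)) +i* (expR (a * t) * sin (b * t)));
  last by apply/funext => t; rewrite E.
rewrite E; split => /=.
  by apply: drE (drM D3 D1) _; rewrite cReM /= -/a -/b; ring.
by apply: drE (drM D3 D2) _; rewrite cImM /= -/a -/b; ring.
Qed.

Definition ccont f := continuous (fun t => complex.Re (f t)) /\
  continuous (fun t => complex.Im (f t)).
Lemma cder_ccont f (df : R -> C) : (forall x, cder f x (df x)) -> ccont f.
Proof.
move=> H; split.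
  by apply: (dr_continuous (df := fun x => complex.Re (df x))) => x; case: (H x).
by apply: (dr_continuous (df := fun x => complex.Im (df x))) => x; case: (H x).
Qed.
Lemma ccontC z : ccont (fun=> z).
Proof. by split; exact: cst_continuous. Qed.
Lemma ccontD f g : ccont f -> ccont g -> ccont (fun t => f t + g t).
Proof.
move=> [f1 f2] [g1 g2]; split => x.
  rewrite (_ : (fun _ => _) = fun t => complex.Re (f t) + complex.Re (g t));
    [exact: cvgD (f1 x) (g1 x)|by apply/funext => t; rewrite cReD].
rewrite (_ : (fun _ => _) = fun t => complex.Im (f t) + complex.Im (g t));
  [exact: cvgD (f2 x) (g2 x)|by apply/funext => t; rewrite cImD].
Qed.
Lemma ccontM f g : ccont f -> ccont g -> ccont (fun t => f t * g t).
Proof.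
move=> [f1 f2] [g1 g2]; split => x.
  rewrite (_ : (fun _ => _) = fun t => complex.Re (f t) * complex.Re (g t) -
    complex.Im (f t) * complex.Im (g t)); last by apply/funext => t; rewrite cReM.
  exact: cvgB (cvgM (f1 x) (g1 x)) (cvgM (f2 x) (g2 x)).
rewrite (_ : (fun _ => _) = fun t => complex.Re (f t) * complex.Im (g t) +
  complex.Im (f t) * complex.Re (g t)); last by apply/funext => t; rewrite cImM.
exact: cvgD (cvgM (f1 x) (g2 x)) (cvgM (f2 x) (g1 x)).
Qed.
Lemma ccontN f : ccont f -> ccont (fun t => - f t).
Proof.
move=> h; rewrite (_ : (fun _ => _) = fun t => -1 * f t); last first.
  by apply/funext => t; rewrite mulN1r.
exact: ccontM (ccontC _) h.
Qed.
Lemma ccont_sum (I : Type) (r : seq I) (F : I -> R -> C) :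
  (forall i, ccont (F i)) -> ccont (fun t => \sum_(i <- r) F i t).
Proof.
move=> H; elim: r => [|i r IH].
  rewrite (_ : (fun _ => _) = fun=> 0); first exact: ccontC.
  by apply/funext => t; rewrite big_nil.
rewrite (_ : (fun _ => _) = fun t => F i t + \sum_(j <- r) F j t).
  exact: ccontD.
by apply/funext => t; rewrite big_cons.
Qed.
Lemma ccont_real (f : R -> R) : continuous f -> ccont (fun t => (f t)%:C).
Proof. by move=> fc; split => //=; exact: cst_continuous. Qed.
End ComplexCalculus.

(** * Entrywise norm, matrix derivatives and a uniform Gronwall bound *)

Section MatrixCalculus.
Context {R : realType}.
Local Notation C := R[i].

Definition mnorm m n (A : 'M[C]_(m, n)) : R := \sum_i \sum_j cabs (A i j).
Lemma mnorm_ge0 m n (A : 'M[C]_(m, n)) : 0 <= mnorm A.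
Proof. by apply: sumr_ge0 => i _; apply: sumr_ge0 => j _; exact: cabs_ge0. Qed.
Lemma cabs_le_mnorm m n (A : 'M[C]_(m, n)) i j : cabs (A i j) <= mnorm A.
Proof.
rewrite /mnorm (bigD1 i) //= (bigD1 j) //= -addrA lerDl addr_ge0 //.
  by apply: sumr_ge0 => k _; exact: cabs_ge0.
by apply: sumr_ge0 => k _; apply: sumr_ge0 => l _; exact: cabs_ge0.
Qed.
Lemma mnorm_le m n (A : 'M[C]_(m, n)) c : (forall i j, cabs (A i j) <= c) ->
  mnorm A <= (m * n)%:R * c.
Proof.
move=> H; apply: le_trans (_ : \sum_(i < m) \sum_(j < n) c <= _).
  by apply: ler_sum => i _; apply: ler_sum => j _.
by rewrite !sumr_const !card_ord -mulrnA mulr_natl mulnC.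
Qed.
Lemma mnorm0 m n : mnorm (0 : 'M[C]_(m, n)) = 0.
Proof. by rewrite /mnorm big1 // => i _; rewrite big1 // => j _; rewrite mxE cabs0. Qed.
Lemma mnorm_eq0 m n (A : 'M[C]_(m, n)) : mnorm A <= 0 -> A = 0.
Proof.
move=> h; apply/matrixP => i j; rewrite mxE; apply: cabs_eq0.
by apply/eqP; rewrite eq_le cabs_ge0 andbT (le_trans (cabs_le_mnorm _ _ _)).
Qed.
Lemma mnormD m n (A B : 'M[C]_(m, n)) : mnorm (A + B) <= mnorm A + mnorm B.
Proof.
rewrite /mnorm -big_split /=; apply: ler_sum => i _; rewrite -big_split /=.
by apply: ler_sum => j _; rewrite mxE cabsD.
Qed.
Lemma mnormN m n (A : 'M[C]_(m, n)) : mnorm (- A) = mnorm A.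
Proof. by apply: eq_bigr => i _; apply: eq_bigr => j _; rewrite mxE cabsN. Qed.
Lemma mnormB m n (A B : 'M[C]_(m, n)) : mnorm (A - B) <= mnorm A + mnorm B.
Proof. by rewrite -(mnormN B); exact: mnormD. Qed.
Lemma mnormZ m n (a : C) (A : 'M[C]_(m, n)) : mnorm (a *: A) = cabs a * mnorm A.
Proof.
rewrite /mnorm mulr_sumr; apply: eq_bigr => i _; rewrite mulr_sumr.
by apply: eq_bigr => j _; rewrite mxE cabsM.
Qed.
Lemma mnormM m n p (A : 'M[C]_(m, n)) (B : 'M[C]_(n, p)) :
  mnorm (A *m B) <= mnorm A * mnorm B.
Proof.
rewrite /mnorm mulr_suml; apply: ler_sum => i _.
apply: le_trans (_ : \sum_(j < p) \sum_(k < n) cabs (A i k) * cabs (B k j) <= _).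
  apply: ler_sum => j _; rewrite mxE (le_trans (cabs_sum _ _ _)) //.
  by apply: ler_sum => k _; rewrite cabsM.
rewrite exchange_big /= mulr_suml; apply: ler_sum => k _.
rewrite -mulr_sumr ler_wpM2l ?cabs_ge0 // (bigD1 k) //= lerDl.
by apply: sumr_ge0 => l _; apply: sumr_ge0 => j _; exact: cabs_ge0.
Qed.

Definition mder m n (F : R -> 'M[C]_(m, n)) x (D : 'M[C]_(m, n)) :=
  forall i j, cder (fun t => F t i j) x (D i j).
Lemma mder_eq m n (F : R -> 'M[C]_(m, n)) x D D' : mder F x D -> D = D' -> mder F x D'.
Proof. by move=> ? <-. Qed.
Lemma mderC m n (A : 'M[C]_(m, n)) x : mder (fun=> A) x 0.
Proof. by move=> i j; rewrite mxE; exact: cderC. Qed.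
Lemma mderD m n (F G : R -> 'M[C]_(m, n)) x A B : mder F x A -> mder G x B ->
  mder (fun t => F t + G t) x (A + B).
Proof.
move=> hF hG i j; rewrite mxE (_ : (fun _ => _) = fun t => F t i j + G t i j).
  exact: cderD.
by apply/funext => t; rewrite mxE.
Qed.
Lemma mderN m n (F : R -> 'M[C]_(m, n)) x A : mder F x A -> mder (fun t => - F t) x (- A).
Proof.
move=> hF i j; rewrite mxE (_ : (fun _ => _) = fun t => - F t i j); first exact: cderN.
by apply/funext => t; rewrite mxE.
Qed.
Lemma mderB m n (F G : R -> 'M[C]_(m, n)) x A B : mder F x A -> mder G x B ->
  mder (fun t => F t - G t) x (A - B).
Proof. by move=> hF hG; apply: mderD hF (mderN hG). Qed.
Lemma mderM m n p (F : R -> 'M[C]_(m, n)) (G : R -> 'M[C]_(n, p)) x A B :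
  mder F x A -> mder G x B -> mder (fun t => F t *m G t) x (A *m G x + F x *m B).
Proof.
move=> hF hG i j.
rewrite (_ : (fun _ => _) = fun t => \sum_k F t i k * G t k j); last first.
  by apply/funext => t; rewrite mxE.
apply: cder_eq (cder_sum _ (F := fun k t => F t i k * G t k j) (fun k => cderM (hF i k) (hG k j))) _.
by rewrite !mxE -big_split.
Qed.
Lemma mderMr m n p (F : R -> 'M[C]_(m, n)) (B : 'M[C]_(n, p)) x A :
  mder F x A -> mder (fun t => F t *m B) x (A *m B).
Proof. by move=> h; apply: mder_eq (mderM h (mderC B x)) _; rewrite mulmx0 addr0. Qed.
Lemma mderMl m n p (B : 'M[C]_(m, n)) (F : R -> 'M[C]_(n, p)) x A :
  mder F x A -> mder (fun t => B *m F t) x (B *m A).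
Proof. by move=> h; apply: mder_eq (mderM (mderC B x) h) _; rewrite mul0mx add0r. Qed.
Lemma mderZ m n (f : R -> C) (F : R -> 'M[C]_(m, n)) x a A : cder f x a -> mder F x A ->
  mder (fun t => f t *: F t) x (a *: F x + f x *: A).
Proof.
move=> hf hF i j; rewrite (_ : (fun _ => _) = fun t => f t * F t i j).
  by apply: cder_eq (cderM hf (hF i j)) _; rewrite !mxE.
by apply/funext => t; rewrite mxE.
Qed.

Definition mcont m n (F : R -> 'M[C]_(m, n)) := forall i j, ccont (fun t => F t i j).
Lemma mder_mcont m n (F D : R -> 'M[C]_(m, n)) : (forall x, mder F x (D x)) -> mcont F.
Proof. by move=> H i j; apply: cder_ccont => x; exact: H. Qed.
Lemma mcontC m n (A : 'M[C]_(m, n)) : mcont (fun=> A).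
Proof. by move=> i j; exact: ccontC. Qed.
Lemma mcontD m n (F G : R -> 'M[C]_(m, n)) : mcont F -> mcont G -> mcont (fun t => F t + G t).
Proof.
move=> hF hG i j; rewrite (_ : (fun _ => _) = fun t => F t i j + G t i j).
  exact: ccontD.
by apply/funext => t; rewrite mxE.
Qed.
Lemma mcontN m n (F : R -> 'M[C]_(m, n)) : mcont F -> mcont (fun t => - F t).
Proof.
move=> hF i j; rewrite (_ : (fun _ => _) = fun t => - F t i j); first exact: ccontN.
by apply/funext => t; rewrite mxE.
Qed.
Lemma mcontM m n p (F : R -> 'M[C]_(m, n)) (G : R -> 'M[C]_(n, p)) :
  mcont F -> mcont G -> mcont (fun t => F t *m G t).
Proof.
move=> hF hG i j.
rewrite (_ : (fun _ => _) = fun t => \sum_k F t i k * G t k j); last first.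
  by apply/funext => t; rewrite mxE.
by apply: (ccont_sum _ (F := fun k t => F t i k * G t k j)) => k; exact: ccontM.
Qed.
Lemma mcontZ m n (f : R -> C) (F : R -> 'M[C]_(m, n)) : ccont f -> mcont F ->
  mcont (fun t => f t *: F t).
Proof.
move=> hf hF i j; rewrite (_ : (fun _ => _) = fun t => f t * F t i j).
  exact: ccontM.
by apply/funext => t; rewrite mxE.
Qed.

(** The norm [mnorm] is not differentiable where an entry vanishes, so Gronwall is applied to the
    sum of squares [N], which is comparable to its square. The constant depends only on the size,
    [X] and [K]; the uniformity of all later estimates in [h] and [mu] rests on this. *)
Lemma matrix_gronwall (m n : nat) (X K : R) : 0 <= X -> 0 <= K ->
  exists2 c : R, 0 < c & forall (Y dY : R -> 'M[C]_(m, n)) (b : R), 0 <= b ->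
    (forall x, mder Y x (dY x)) ->
    (forall x : R, 0 <= x <= X -> mnorm (dY x) <= K * mnorm (Y x) + b) ->
    forall x : R, 0 <= x <= X -> mnorm (Y x) <= c * (mnorm (Y 0) + b).
Proof.
move=> X0 K0.
pose N (A : 'M[C]_(m, n)) : R := \sum_i \sum_j (complex.Re (A i j) ^+ 2 + complex.Im (A i j) ^+ 2).
have NE A : N A = \sum_i \sum_j cabs (A i j) ^+ 2.
  by apply: eq_bigr => i _; apply: eq_bigr => j _; rewrite cabsE.
have N0 A : 0 <= N A.
  by rewrite NE; apply: sumr_ge0 => i _; apply: sumr_ge0 => j _; exact: sqr_ge0.
pose d : R := (m * n)%:R.
have d0 : 0 <= d by exact: ler0n.
have mN A : mnorm A <= d * Num.sqrt (N A).
  apply: mnorm_le => i j.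
  rewrite -(@ler_pXn2r _ 2) ?nnegrE ?cabs_ge0 ?sqrtr_ge0 // sqr_sqrtr //.
  rewrite NE (bigD1 i) //= (bigD1 j) //= -addrA lerDl addr_ge0 //.
    by apply: sumr_ge0 => k _; exact: sqr_ge0.
  by apply: sumr_ge0 => k _; apply: sumr_ge0 => l _; exact: sqr_ge0.
have Nm A : N A <= mnorm A ^+ 2.
  rewrite NE expr2 {1}/mnorm mulr_suml; apply: ler_sum => i _; rewrite mulr_suml.
  by apply: ler_sum => j _; rewrite expr2 ler_wpM2l ?cabs_ge0 // cabs_le_mnorm.
pose al := 1 + 2 * K ^+ 2 * d ^+ 2.
have al0 : 0 <= al by rewrite addr_ge0 // !mulr_ge0 // exprn_ge0.
pose c2 := (1 + 2 * X) * expR (al * X).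
have c20 : 0 < c2 by rewrite mulr_gt0 ?expR_gt0 // ltr_pwDl ?mulr_ge0.
exists (d * Num.sqrt c2 + 1); first by rewrite ltr_pwDr ?mulr_ge0 ?sqrtr_ge0.
move=> Y dY b b0 YD H x /andP[x0 xX].
pose dN t := \sum_i \sum_j (2 * complex.Re (Y t i j) * complex.Re (dY t i j) +
   2 * complex.Im (Y t i j) * complex.Im (dY t i j)).
have Nd (t : R) : is_derive t 1 (fun s => N (Y s)) (dN t).
  have sumd (p : nat) (f : 'I_p -> R -> R) (g : 'I_p -> R) :
      (forall i, is_derive t 1 (f i) (g i)) ->
      is_derive t 1 (fun s => \sum_i f i s) (\sum_i g i).
    move=> fg; rewrite (_ : (fun _ => _) = \sum_i f i); first exact: is_derive_sum.
    by apply/funext => s; rewrite fct_sumE.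
  have sumd2 := sumd; apply: sumd => i; apply: sumd2 => j; have [h1 h2] := YD t i j.
  by apply: drD; [exact: dr_sqr h1|exact: dr_sqr h2].
have dNle (t : R) : 0 <= t <= x -> dN t <= al * N (Y t) + 2 * b ^+ 2.
  move=> /andP[t0 tx].
  have h1 : dN t <= N (Y t) + N (dY t).
    rewrite /dN /N -big_split /=; apply: ler_sum => i _; rewrite -big_split /=.
    apply: ler_sum => j _.
    have := sqr_ge0 (complex.Re (Y t i j) - complex.Re (dY t i j)).
    have := sqr_ge0 (complex.Im (Y t i j) - complex.Im (dY t i j)).
    by rewrite !sqrrB; lra.
  have h2 : mnorm (dY t) <= K * mnorm (Y t) + b by apply: H; rewrite t0 (le_trans tx).
  have h3 : mnorm (dY t) ^+ 2 <= 2 * K ^+ 2 * mnorm (Y t) ^+ 2 + 2 * b ^+ 2.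
    apply: le_trans (_ : (K * mnorm (Y t) + b) ^+ 2 <= _).
      by rewrite ler_pXn2r ?nnegrE ?mnorm_ge0 // addr_ge0 ?mulr_ge0 ?mnorm_ge0.
    have := sqr_ge0 (K * mnorm (Y t) - b); rewrite sqrrB sqrrD exprMn; lra.
  have h4 : mnorm (Y t) ^+ 2 <= d ^+ 2 * N (Y t).
    rewrite -(sqr_sqrtr (N0 (Y t))) -exprMn ler_pXn2r ?nnegrE ?mnorm_ge0 //.
    by rewrite mulr_ge0 ?sqrtr_ge0.
  have h5 : 2 * K ^+ 2 * mnorm (Y t) ^+ 2 <= 2 * K ^+ 2 * (d ^+ 2 * N (Y t)).
    by rewrite ler_wpM2l // mulr_ge0 // exprn_ge0.
  have := Nm (dY t); rewrite /al; move: h1 h3 h5; lra.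
have b2 : 0 <= 2 * b ^+ 2 by rewrite mulr_ge0 // sqr_ge0.
have G := gronwall al0 b2 x0 Nd dNle.
have m0 := mnorm_ge0 (Y 0).
have G2 : N (Y x) <= c2 * (mnorm (Y 0) + b) ^+ 2.
  apply: le_trans G _; rewrite [leLHS]mulrC /c2.
  rewrite (_ : (1 + 2 * X) * expR (al * X) * (mnorm (Y 0) + b) ^+ 2 = expR (al * X) * ((1 + 2 * X) * (mnorm (Y 0) + b) ^+ 2)); last by ring.
  apply: ler_pM; rewrite ?expR_ge0 ?addr_ge0 ?mulr_ge0 //.
    by rewrite ler_expR ler_wpM2l.
  have h1 := Nm (Y 0).
  have h2 : 2 * b ^+ 2 * x <= 2 * b ^+ 2 * X by rewrite ler_wpM2l.
  have h3 : 0 <= mnorm (Y 0) * b by rewrite mulr_ge0.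
  have h4 : 0 <= X * mnorm (Y 0) ^+ 2 by rewrite mulr_ge0 ?sqr_ge0.
  have h5 : 0 <= X * (mnorm (Y 0) * b) by rewrite mulr_ge0.
  have h6 := sqr_ge0 b.
  rewrite mulrDl mul1r sqrrD !mulrDr; lra.
apply: le_trans (mN _) _.
have G3 : Num.sqrt (N (Y x)) <= Num.sqrt c2 * (mnorm (Y 0) + b).
  have -> : Num.sqrt c2 * (mnorm (Y 0) + b) = Num.sqrt (c2 * (mnorm (Y 0) + b) ^+ 2).
    by rewrite [RHS]sqrtrM ?ltW // sqrtr_sqr ger0_norm // addr_ge0.
  by apply: ler_wsqrtr.
apply: le_trans (ler_wpM2l d0 G3) _.
by rewrite mulrA ler_wpM2r ?addr_ge0 // lerDl.
Qed.
End MatrixCalculus.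

(** * The linearized system *)

Section LinearizedFlow.
Context {R : realType}.
Local Notation C := R[i].

Definition A0 : 'M[C]_2 := mx22 1 0 0 (-1).
Definition N0 : 'M[C]_2 := mx22 (- 2) 0 1 0.
Definition a1inv : 'M[C]_2 := mx22 (- (2 / 3)) (- (4 / 3)) (- (4 / 3)) (- (2 / 3)).

Lemma mx22_eq (a b c d a' b' c' d' : C) : a = a' -> b = b' -> c = c' -> d = d' ->
  mx22 a b c d = mx22 a' b' c' d'.
Proof. by move=> -> -> -> ->. Qed.
Lemma mx22E (A : 'M[C]_2) : A = mx22 (A 0 0) (A 0 1) (A 1 0) (A 1 1).
Proof.
apply/matrixP => i j; rewrite mxE.
by case: (@splitP 1 1 i) => k; rewrite !ord1 => ik; case: (@splitP 1 1 j) => l; rewrite !ord1 => jl;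
  [have -> : i = 0 by exact/val_inj|have -> : i = 0 by exact/val_inj|
   have -> : i = 1 by exact/val_inj|have -> : i = 1 by exact/val_inj];
  [have -> : j = 0 by exact/val_inj|have -> : j = 1 by exact/val_inj|
   have -> : j = 0 by exact/val_inj|have -> : j = 1 by exact/val_inj].
Qed.
Lemma mx22_mul (a b c d a' b' c' d' : C) : mx22 a b c d *m mx22 a' b' c' d' =
  mx22 (a * a' + b * c') (a * b' + b * d') (c * a' + d * c') (c * b' + d * d').
Proof. by rewrite [LHS]mx22E; congr mx22; rewrite !mxE !big_ord_recl big_ord0 !mxE /= addr0. Qed.
Lemma mx22_add (a b c d a' b' c' d' : C) : mx22 a b c d + mx22 a' b' c' d' =
  mx22 (a + a') (b + b') (c + c') (d + d').
Proof. by rewrite [LHS]mx22E; congr mx22; rewrite !mxE. Qed.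
Lemma mx22_scale (e a b c d : C) : e *: mx22 a b c d = mx22 (e * a) (e * b) (e * c) (e * d).
Proof. by rewrite [LHS]mx22E; congr mx22; rewrite !mxE. Qed.
Lemma mx22_1 : 1%:M = mx22 1 0 0 1 :> 'M[C]_2.
Proof. by rewrite [LHS]mx22E; congr mx22; rewrite !mxE. Qed.

Lemma mnorm22 (a b c d : C) : mnorm (mx22 a b c d) = cabs a + cabs b + (cabs c + cabs d).
Proof. by rewrite /mnorm !big_ord_recl !big_ord0 !mxE /= !addr0. Qed.

Lemma halfC : (2^-1 : R)%:C = (2 : C)^-1.
Proof. by rewrite fmorphV rmorph_nat. Qed.

Lemma mul_a1_a1inv : a1 *m a1inv = 1%:M :> 'M[C]_2.
Proof. by rewrite /a1 /a1inv mx22_mul mx22_1 halfC; apply: mx22_eq; field. Qed.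
Lemma mul_a1inv_a1 : a1inv *m a1 = 1%:M :> 'M[C]_2.
Proof. by rewrite /a1 /a1inv mx22_mul mx22_1 halfC; apply: mx22_eq; field. Qed.

(** Both nonlinearities are quadratic, so the wave enters the coefficients linearly and [phi] times
    [N0] is the whole perturbation of the rest state. *)
Lemma a0E (phi : R -> R) (x : R) : a0 phi x = A0 + (phi x)%:C *: N0.
Proof.
have D1 (u : R) : derive1 g_BF u = 1 - 2 * u.
  rewrite derive1E; have : is_derive u 1 (@g_BF R) (1 - 2 * u).
    apply: drE (drM (drI u) (drB (drC 1 u) (drI u))) _; ring.
  by move=> H; rewrite derive_val.
have D2 (u : R) : derive1 f_BF u = u.
  rewrite derive1E; have : is_derive u 1 (@f_BF R) u.
    by apply: drE (drM (dr_sqr (drI u)) (drC 2^-1 u)) _; field.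
  by move=> H; rewrite derive_val.
rewrite /a0 /A0 /N0 D1 D2 mx22_scale mx22_add; apply: mx22_eq; rewrite ?mulr0 ?addr0 ?mulr1 ?add0r //.
by rewrite rmorphB rmorphM rmorph1 rmorph_nat; ring.
Qed.

(* [a1 Y' + a0 Y = Y L + G] solved for [Y']. *)
Definition vf n (u : R) (L : 'M[C]_n) (G Y : 'M[C]_(2, n)) : 'M[C]_(2, n) :=
  a1inv *m (Y *m L + G - (A0 + u%:C *: N0) *m Y).

Definition flow n (phi : R -> R) (L : 'M[C]_n) (G Y : R -> 'M[C]_(2, n)) :=
  forall x : R, mder Y x (vf (phi x) L (G x) (Y x)).

Lemma vfB n u (L : 'M[C]_n) G Y Z : vf u L G Y - vf u L G Z = vf u L 0 (Y - Z).
Proof.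
rewrite /vf -mulmxBr; congr (_ *m _).
by rewrite mulmxBl mulmxBr addr0 !opprB !opprD !addrA; apply/matrixP => i j; rewrite !mxE; ring.
Qed.

Lemma mnorm_vf n u (L : 'M[C]_n) G Y (P : R) : `|u| <= P ->
  mnorm (vf u L G Y) <=
  mnorm a1inv * (mnorm L + mnorm A0 + P * mnorm N0) * mnorm Y + mnorm a1inv * mnorm G.
Proof.
move=> uP; rewrite /vf (le_trans (mnormM _ _)) // -mulrA -mulrDr ler_wpM2l ?mnorm_ge0 //.
rewrite (le_trans (mnormB _ _)) //.
have h1 := mnormD (Y *m L) G; have h2 := mnormM Y L.
have h3 := mnormM (A0 + u%:C *: N0) Y.
have h4 : mnorm (A0 + u%:C *: N0) <= mnorm A0 + P * mnorm N0.
  by rewrite (le_trans (mnormD _ _)) // lerD2l mnormZ cabs_real ler_wpM2r ?mnorm_ge0.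
have h5 := ler_wpM2r (mnorm_ge0 Y) h4; rewrite mulrDl in h5.
rewrite !mulrDl; move: h1 h2 h3 h5; rewrite [mnorm Y * _]mulrC; lra.
Qed.

Lemma flow_exists n (phi : R -> R) (L : 'M[C]_n) (G : R -> 'M[C]_(2, n)) (P M : R) :
  continuous phi -> (forall x, `|phi x| <= P) -> mcont G -> (forall x, mnorm (G x) <= M) ->
  forall Y0 : 'M[C]_(2, n), exists Y, Y 0 = Y0 /\ flow phi L G Y.
Proof.
move=> phic phiP Gc GM Y0.
(* The coordinates are the real and imaginary parts of the entries; the boolean selects the
   imaginary part. *)
pose I := ('I_2 * 'I_n * bool)%type.
pose part (b : bool) (z : C) : R := if b then complex.Im z else complex.Re z.
pose dec (y : I -> R) : 'M[C]_(2, n) := \matrix_(i, j) (y (i, j, false) +i* y (i, j, true)).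
pose enc (A : 'M[C]_(2, n)) (p : I) : R := part p.2 (A p.1.1 p.1.2).
have partB b z w : part b (z - w) = part b z - part b w by case: b; rewrite /part !ReImE.
have part_le b z : `|part b z| <= cabs z by case: b; [exact: Im_le_cabs|exact: Re_le_cabs].
have encK A : dec (enc A) = A.
  by apply/matrixP => i j; rewrite mxE /enc /=; case: (A i j).
have enc_le A p : `|enc A p| <= mnorm A by rewrite (le_trans (part_le _ _)) // cabs_le_mnorm.
have decB y z : dec y - dec z = dec (fun p => y p - z p).
  by apply/matrixP => i j; rewrite !mxE; apply: complex_ext.
have dec_le y (g : R) : (forall p, `|y p| <= g) -> mnorm (dec y) <= (2 * n)%:R * (2 * g).
  move=> H; apply: mnorm_le => i j; rewrite mxE (le_trans (cabs_le_ReIm _)) //=.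
  by have := H (i, j, false); have := H (i, j, true); lra.
pose F x (y : I -> R) := enc (vf (phi x) L (G x) (dec y)).
have P0 : 0 <= P by exact: le_trans (normr_ge0 _) (phiP 0).
pose k := mnorm a1inv * (mnorm L + mnorm A0 + P * mnorm N0).
have k0 : 0 <= k by rewrite !mulr_ge0 ?addr_ge0 ?mulr_ge0 ?mnorm_ge0.
pose K := k * ((2 * n)%:R * 2) + 1.
have K0 : 0 < K by rewrite ltr_pwDr // mulr_ge0 // mulr_ge0 // ler0n.
have subE (A B : 'M[C]_(2, n)) i j : (A - B) i j = A i j - B i j by rewrite !mxE.
have Flip x y z (g : R) : 0 <= g -> (forall p, `|y p - z p| <= g) ->
    forall p, `|F x y p - F x z p| <= K * g.
  move=> g0 yz p; rewrite /F /enc -partB.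
  have -> : vf (phi x) L (G x) (dec y) p.1.1 p.1.2 - vf (phi x) L (G x) (dec z) p.1.1 p.1.2 =
      vf (phi x) L 0 (dec y - dec z) p.1.1 p.1.2 by rewrite -(vfB _ _ (G x)) subE.
  apply: le_trans (enc_le _ p) _.
  apply: le_trans (mnorm_vf _ _ _ (phiP x)) _.
  rewrite mnorm0 mulr0 addr0 decB -/k /K mulrDl -mulrA -mulrA.
  by rewrite ler_wpDr ?mul1r // ler_wpM2l //; exact: dec_le.
have Fcont (Y : R -> I -> R) : (forall p, continuous (Y^~ p)) ->
    forall p, continuous (fun x => F x (Y x) p).
  move=> Yc p.
  have dc : mcont (fun x => dec (Y x)).
    move=> i j; split.
      rewrite (_ : (fun _ => _) = Y^~ (i, j, false)); first exact: Yc.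
      by apply/funext => t; rewrite mxE.
    rewrite (_ : (fun _ => _) = Y^~ (i, j, true)); first exact: Yc.
    by apply/funext => t; rewrite mxE.
  have vc : mcont (fun x => vf (phi x) L (G x) (dec (Y x))).
    apply: mcontM; first exact: mcontC.
    apply: mcontD.
      by apply: mcontD => //; apply: mcontM => //; exact: mcontC.
    apply: mcontN; apply: mcontM => //; apply: mcontD; first exact: mcontC.
    by apply: mcontZ; [exact: ccont_real|exact: mcontC].
  by case: p => [[i j] b]; have [v1 v2] := vc i j; case: b.
have Fbound x p : `|F x (enc Y0) p| <= k * mnorm Y0 + mnorm a1inv * M.
  apply: le_trans (enc_le _ p) _; rewrite encK.
  apply: le_trans (mnorm_vf _ _ _ (phiP x)) _.
  by rewrite -/k lerD2l ler_wpM2l ?mnorm_ge0.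
have [Y [Y0E YD]] := global_ode_solution K0 Flip Fcont Fbound.
exists (fun x => dec (Y x)); split.
  rewrite -[RHS]encK; congr dec; apply/funext => p; exact: Y0E.
move=> x i j; split.
  rewrite (_ : (fun _ => _) = Y^~ (i, j, false)); first exact: (YD x (i, j, false)).
  by apply/funext => t; rewrite mxE.
rewrite (_ : (fun _ => _) = Y^~ (i, j, true)); first exact: (YD x (i, j, true)).
by apply/funext => t; rewrite mxE.
Qed.

(** The discrepancy is measured along the rest-state solution [Y'] only, so no bound on [Y] has to
    be known beforehand. The constant depends on [n], [X] and [K] alone, hence is uniform over waves
    and matrices. *)
Lemma flow_dist n (X K : R) : 0 <= X -> 0 <= K -> exists2 c : R, 0 < c &
  forall (phi : R -> R) (L L' : 'M[C]_n) (G G' Y Y' : R -> 'M[C]_(2, n)) (b : R),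
    mnorm L <= K -> 0 <= b ->
    flow phi L G Y -> flow (fun=> 0) L' G' Y' ->
    (forall x : R, 0 <= x <= X -> `|phi x| <= 1 /\
      mnorm (Y' x *m (L - L')) + `|phi x| * mnorm (N0 *m Y' x) + mnorm (G x - G' x) <= b) ->
    forall x : R, 0 <= x <= X -> mnorm (Y x - Y' x) <= c * (mnorm (Y 0 - Y' 0) + b).
Proof.
move=> X0 K0.
pose k := mnorm a1inv * (K + mnorm A0 + 1 * mnorm N0).
have k0 : 0 <= k by rewrite mulr_ge0 ?addr_ge0 ?mulr_ge0 ?mnorm_ge0.
have [c c0 cP] := @matrix_gronwall R 2 n X k X0 k0.
exists (c * (1 + mnorm a1inv)); first by rewrite mulr_gt0 // ltr_pwDl ?mnorm_ge0.
move=> phi L L' G G' Y Y' b LK b0 hY hY' H x xX.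
have D z : mder (fun t => Y t - Y' t) z (vf (phi z) L (G z) (Y z) - vf 0 L' (G' z) (Y' z)).
  exact: mderB (hY z) (hY' z).
have b0' : 0 <= mnorm a1inv * b by rewrite mulr_ge0 ?mnorm_ge0.
apply: le_trans (cP _ _ _ b0' D _ x xX) _; last first.
  rewrite -mulrA ler_wpM2l ?(ltW c0) // mulrDl mul1r mulrDr.
  have h1 := mnorm_ge0 (Y 0 - Y' 0).
  have h2 : 0 <= mnorm a1inv * mnorm (Y 0 - Y' 0) by rewrite mulr_ge0 ?mnorm_ge0.
  lra.
move=> t tX; have [p1 p2] := H t tX.
(* With the difference of the coefficients moved into the forcing, [Y - Y'] solves the perturbed
   system itself. *)
pose E := Y' t *m (L - L') - (phi t)%:C *: (N0 *m Y' t) + (G t - G' t).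
have -> : vf (phi t) L (G t) (Y t) - vf 0 L' (G' t) (Y' t) = vf (phi t) L E (Y t - Y' t).
  rewrite /vf -mulmxBr /E; congr (_ *m _).
  rewrite !mulmxBl !mulmxBr !mulmxDl -!scalemxAl scale0r addr0.
  move: (Y t *m L) (Y' t *m L) (Y' t *m L') (A0 *m Y t) (A0 *m Y' t) (N0 *m Y t) (N0 *m Y' t) (G t) (G' t).
  by move=> ? ? ? ? ? ? ? ? ?; apply/matrixP => i j; rewrite !mxE; ring.
apply: le_trans (mnorm_vf _ _ _ p1) _; apply: lerD.
  rewrite ler_wpM2r ?mnorm_ge0 // ler_wpM2l ?mnorm_ge0 // lerD2r lerD2r //.
rewrite ler_wpM2l ?mnorm_ge0 //; apply: le_trans p2.
rewrite /E (le_trans (mnormD _ _)) // lerD2r (le_trans (mnormB _ _)) // lerD2l.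
by rewrite mnormZ cabs_real.
Qed.

Lemma flow_unique n (phi : R -> R) (P : R) (L : 'M[C]_n) (G Y Y' : R -> 'M[C]_(2, n)) :
  (forall x, `|phi x| <= P) -> flow phi L G Y -> flow phi L G Y' -> Y 0 = Y' 0 ->
  forall x, 0 <= x -> Y x = Y' x.
Proof.
move=> phiP hY hY' Y0 x x0.
have P0 : 0 <= P by exact: le_trans (normr_ge0 _) (phiP 0).
pose k := mnorm a1inv * (mnorm L + mnorm A0 + P * mnorm N0).
have k0 : 0 <= k by rewrite mulr_ge0 ?addr_ge0 ?mulr_ge0 ?mnorm_ge0.
have [c c0 cP] := @matrix_gronwall R 2 n x k x0 k0.
have D z : mder (fun t => Y t - Y' t) z (vf (phi z) L 0 (Y z - Y' z)).
  by apply: mder_eq (mderB (hY z) (hY' z)) _; rewrite vfB.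
apply/eqP; rewrite -subr_eq0; apply/eqP; apply: mnorm_eq0.
have := cP _ _ 0 (lexx _) D _ x; rewrite Y0 subrr mnorm0 addr0 mulr0; apply; last by rewrite x0 lexx.
move=> t _; apply: le_trans (mnorm_vf _ _ _ (phiP t)) _.
by rewrite mnorm0 mulr0.
Qed.
End LinearizedFlow.

(** * Persistence of Floquet frames *)

Section LinearMaps.
Context {R : realType}.
Local Notation C := R[i].

Lemma mnorm_linear_le m n p q (f : 'M[C]_(m, n) -> 'M[C]_(p, q)) :
  (forall a A B, f (a *: A + B) = a *: f A + f B) ->
  exists2 c, 0 < c & forall A, mnorm (f A) <= c * mnorm A.
Proof.
move=> fl.
pose fL : {linear 'M[C]_(m, n) -> 'M[C]_(p, q)} :=
  HB.pack f (@GRing.isLinear.Build _ _ _ _ f fl).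
pose c := \sum_i \sum_j mnorm (f (delta_mx i j)).
have c0 : 0 <= c.
  by apply: sumr_ge0 => i _; apply: sumr_ge0 => j _; exact: mnorm_ge0.
exists (c + 1) => [|A]; first by rewrite ltr_wpDl.
have -> : f A = \sum_i \sum_j A i j *: f (delta_mx i j).
  rewrite {1}[A]matrix_sum_delta -[LHS]/(fL _) linear_sum; apply: eq_bigr => i _.
  by rewrite linear_sum; apply: eq_bigr => j _; rewrite linearZ.
have mS (I : finType) (g : I -> 'M[C]_(p, q)) : mnorm (\sum_i g i) <= \sum_i mnorm (g i).
  elim/big_ind2 : _ => [|a b x y ha hb|//]; first by rewrite mnorm0.
  exact: le_trans (mnormD _ _) (lerD ha hb).
apply: le_trans (mS _ _) _; apply: le_trans (_ : c * mnorm A <= _); last first.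
  by rewrite ler_wpM2r ?mnorm_ge0 // lerDl.
rewrite mulr_suml; apply: ler_sum => i _.
apply: le_trans (mS _ _) _; rewrite mulr_suml; apply: ler_sum => j _.
by rewrite mnormZ mulrC ler_wpM2l ?mnorm_ge0 // cabs_le_mnorm.
Qed.

Lemma linear_injective_inverse m n (f : 'M[C]_(m, n) -> 'M[C]_(m, n)) :
  (forall a A B, f (a *: A + B) = a *: f A + f B) -> (forall A, f A = 0 -> A = 0) ->
  exists g : 'M[C]_(m, n) -> 'M[C]_(m, n),
    [/\ cancel g f, cancel f g & forall A B, g (A - B) = g A - g B] /\
    exists2 c, 0 < c & forall A, mnorm (g A) <= c * mnorm A.
Proof.
move=> fl finj.
pose fL : {linear 'M[C]_(m, n) -> 'M[C]_(m, n)} :=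
  HB.pack f (@GRing.isLinear.Build _ _ _ _ f fl).
pose h := linfun fL.
have hE A : h A = f A by rewrite lfunE.
have k0 : lker h == 0%VS.
  apply/eqP/vspaceP => A; rewrite memv_ker memv0 hE.
  apply/idP/idP => [/eqP/finj->//|/eqP->].
  by rewrite -[X in X == _]/(fL 0) linear0.
pose g A := (h^-1)%VF A.
have fg : cancel f g by move=> A; rewrite /g -hE; exact: lker0_lfunK k0 A.
have gf : cancel g f.
  move=> A; rewrite /g -hE; apply: limg_lfunVK; rewrite lker0_limgf //; exact: memvf.
exists g; split.
  by split => // A B; rewrite /g linearB.
by apply: mnorm_linear_le => a A B; rewrite /g linearP.
Qed.

(** Newton's method with the fixed inverse [g]: the map [A - g (F A)] halves distances on the ball,
    because [g] inverts [f] and [F] differs from [f] by a term with a small Lipschitz constant.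
    Differentiability of [F] never has to be established. *)
Lemma newton_matrix m n (f g F : 'M[C]_(m, n) -> 'M[C]_(m, n)) (c r : R) (A0 : 'M[C]_(m, n)) :
  cancel g f -> cancel f g -> (forall A B, g (A - B) = g A - g B) ->
  0 < c -> 0 <= r -> (forall A, mnorm (g A) <= c * mnorm A) ->
  (forall A B, mnorm (A - A0) <= r -> mnorm (B - A0) <= r ->
     mnorm (F A - F B - f (A - B)) <= mnorm (A - B) / (2 * c)) ->
  mnorm (F A0) <= r / (2 * c) / (4 * (m * n)%:R + 1) ->
  exists2 A, mnorm (A - A0) <= r & F A = 0.
Proof.
move=> gf fg gB c0 r0 gc FF F0.
have g0 : g 0 = 0 by have := gB 0 0; rewrite !subrr.
(* Limits are taken separately for the real and imaginary parts of the [m * n] entries. Returning to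
   [mnorm] costs the factor [4 * (m * n)], which the smallness of [F A0] absorbs so that the limit
   stays in the ball. *)
pose d : R := 4 * (m * n)%:R + 1.
have d0 : 0 < d by rewrite ltr_wpDl // mulr_ge0 // ler0n.
pose N A := A - g (F A).
have Nc A B : mnorm (A - A0) <= r -> mnorm (B - A0) <= r ->
    mnorm (N A - N B) <= mnorm (A - B) / 2.
  move=> hA hB.
  have -> : N A - N B = - g (F A - F B - f (A - B)).
    rewrite !gB fg /N; move: (g _) (g _) => ? ?.
    by apply/matrixP => i j; rewrite !mxE; ring.
  rewrite mnormN (le_trans (gc _)) //.
  apply: le_trans (ler_wpM2l (ltW c0) (FF _ _ hA hB)) _.
  by rewrite le_eqVlt; apply/orP; left; apply/eqP; field; rewrite gt_eqF.
pose e := r / d / 2.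
have e0 : 0 <= e by rewrite !divr_ge0 // ltW.
have N0 : mnorm (N A0 - A0) <= e.
  rewrite (_ : N A0 - A0 = - g (F A0)); last by rewrite /N addrAC subrr add0r.
  rewrite mnormN (le_trans (gc _)) // (le_trans (ler_wpM2l (ltW c0) F0)) //.
  rewrite le_eqVlt; apply/orP; left; apply/eqP; rewrite /e -/d; field.
  by rewrite !gt_eqF.
pose u j := iter j N A0.
have er : 2 * e <= r.
  have h : e * d = r / 2 by rewrite /e; field; rewrite gt_eqF.
  have h1 : 0 <= e * (4 * (m * n)%:R) by rewrite mulr_ge0 // mulr_ge0 // ler0n.
  by move: h; rewrite /d mulrDr mulr1; lra.
have pow0 j : 0 < (2 : R) ^+ j by rewrite exprn_gt0.
have in_r i : 2 * e * (1 - (2 ^+ i)^-1) <= r.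
  apply: le_trans er; apply: ler_piMr; first by rewrite mulr_ge0.
  by rewrite gerBl invr_ge0 ltW.
have uP j : mnorm (u j - A0) <= 2 * e * (1 - (2 ^+ j)^-1) /\
    mnorm (u j.+1 - u j) <= e / 2 ^+ j.
  elim: j => [|j [IH1 IH2]].
    by rewrite /u /= subrr mnorm0 !expr0 invr1 subrr mulr0 mulr1; split.
  have h1 : mnorm (u j.+1 - A0) <= 2 * e * (1 - (2 ^+ j.+1)^-1).
    rewrite -[_ - A0](_ : (u j.+1 - u j) + (u j - A0) = _); last by rewrite addrA subrK.
    apply: le_trans (mnormD _ _) _; apply: le_trans (lerD IH2 IH1) _.
    rewrite exprS le_eqVlt; apply/orP; left; apply/eqP; field.
    by rewrite gt_eqF.
  split => //=; apply: le_trans (Nc _ _ (le_trans h1 (in_r _)) (le_trans IH1 (in_r _))) _.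
  apply: le_trans (_ : e / 2 ^+ j / 2 <= _); first by rewrite ler_wpM2r.
  by rewrite exprS le_eqVlt; apply/orP; left; apply/eqP; field; rewrite gt_eqF.
pose J := ('I_m * 'I_n * bool)%type.
pose part (b : bool) (z : C) : R := if b then complex.Im z else complex.Re z.
have partB b z w : part b (z - w) = part b z - part b w by case: b; rewrite /part !ReImE.
have part_le b z : `|part b z| <= cabs z by case: b; [exact: Im_le_cabs|exact: Re_le_cabs].
have subE (A B : 'M[C]_(m, n)) i j : (A - B) i j = A i j - B i j by rewrite !mxE.
have ud j (p : J) : `|part p.2 (u j.+1 p.1.1 p.1.2) - part p.2 (u j p.1.1 p.1.2)| <= e / 2 ^+ j.
  rewrite -partB -subE (le_trans (part_le _ _)) // (le_trans (cabs_le_mnorm _ _ _)) //.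
  by case: (uP j).
have [l lP] := geometric_limit ud.
pose A := \matrix_(i, j) (l (i, j, false) +i* l (i, j, true)) : 'M[C]_(m, n).
have Au j : mnorm (A - u j) <= d * e / 2 ^+ j.
  apply: le_trans (mnorm_le (c := 4 * e / 2 ^+ j) _) _.
    move=> p q; rewrite subE mxE (le_trans (cabs_le_ReIm _)) // !ReImE.
    have h1 := lP j (p, q, false); have h2 := lP j (p, q, true).
    apply: le_trans (lerD h1 h2) _.
    by rewrite le_eqVlt; apply/orP; left; apply/eqP; field; rewrite gt_eqF.
  rewrite (_ : (m * n)%:R * (4 * e / 2 ^+ j) = 4 * (m * n)%:R * (e / 2 ^+ j)); last by ring.
  rewrite -[leRHS]mulrA; apply: ler_wpM2r; first by rewrite divr_ge0 // ltW.
  by rewrite /d lerDl.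
have Ar : mnorm (A - A0) <= r.
  have := Au 0; rewrite /u /= divr1 /e => h; apply: le_trans h _.
  rewrite (_ : d * _ = r / 2); last by field; rewrite gt_eqF.
  lra.
exists A => //.
have ur j : mnorm (u j - A0) <= r.
  by have [h _] := uP j; apply: le_trans h (in_r j).
suff : g (F A) = 0 by move/(congr1 f); rewrite gf => ->; rewrite -[RHS](gf 0) g0.
apply/matrixP => p q; rewrite [RHS]mxE.
apply: cabs_eq0; apply: (vanish_geometric (b := 2 * d * e + e)) => j.
rewrite ger0_norm ?cabs_ge0 //.
apply: le_trans (cabs_le_mnorm _ _ _) _.
(* The defect at the limit is compared with the defects of the iterates, so it is at most a multiple
   of [1 / 2 ^+ j] for every [j]. *)
have -> : g (F A) = (A - u j) - (N A - N (u j)) - (u j.+1 - u j).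
  rewrite {1}/N /= ; move: (g (F A)) (N (u j)) (u j) => ? ? ?.
  by apply/matrixP => a b; rewrite !mxE; ring.
apply: le_trans (mnormB _ _) _.
have [_ h3] := uP j.
rewrite mulrDl; apply: lerD h3.
apply: le_trans (mnormB _ _) _.
have h1 := Au j; have h2 := Nc _ _ Ar (ur j).
have := mnorm_ge0 (A - u j).
rewrite -2!mulrA; move: h1 h2; rewrite -mulrA; lra.
Qed.
End LinearMaps.

Section Frames.
Context {R : realType}.
Local Notation C := R[i].

Lemma mder_lipschitz m n (Y dY : R -> 'M[C]_(m, n)) (X c : R) : 0 <= X ->
  (forall x, mder Y x (dY x)) -> (forall x, 0 <= x <= X -> mnorm (dY x) <= c) ->
  forall a b, 0 <= a <= X -> 0 <= b <= X ->
  mnorm (Y a - Y b) <= (m * n)%:R * (2 * c * `|a - b|).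
Proof.
move=> X0 YD H a b aX bX; wlog ab : a b aX bX / b <= a.
  move=> W; have [h|/ltW h] := leP b a; first exact: W.
  by rewrite -mnormN opprB distrC; exact: W.
apply: mnorm_le => i j.
rewrite (_ : (Y a - Y b) i j = Y a i j - Y b i j); last by rewrite !mxE.
have P (f df : R -> R) : (forall x : R, is_derive x 1 f (df x)) ->
    (forall x, `|df x| <= mnorm (dY x)) -> `|f a - f b| <= c * `|a - b|.
  move=> fd fle; have [x /andP[bx xa] ->] := mean_value ab (fun x _ => fd x).
  rewrite normrM ler_wpM2r // (le_trans (fle x)) // H //.
  by case/andP: aX => _ aX; case/andP: bX => b0 _; rewrite (le_trans b0 bx) (le_trans xa aX).
apply: le_trans (cabs_le_ReIm _) _; rewrite !ReImE.
have h1 := P (fun x => complex.Re (Y x i j)) (fun x => complex.Re (dY x i j))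
  (fun x => proj1 (YD x i j)) (fun x => le_trans (Re_le_cabs _) (cabs_le_mnorm _ _ _)).
have h2 := P (fun x => complex.Im (Y x i j)) (fun x => complex.Im (dY x i j))
  (fun x => proj2 (YD x i j)) (fun x => le_trans (Im_le_cabs _) (cabs_le_mnorm _ _ _)).
by rewrite -mulrA; lra.
Qed.

Lemma vf_lin n u (L : 'M[C]_n) a G Y G' Y' :
  vf u L (a *: G + G') (a *: Y + Y') = a *: vf u L G Y + vf u L G' Y'.
Proof.
rewrite /vf scalemxAr -mulmxDr; congr (_ *m _).
rewrite mulmxDl mulmxDr -scalemxAl -scalemxAr.
move: (Y *m L) (Y' *m L) (_ *m Y) (_ *m Y') => ? ? ? ?.
by apply/matrixP => i j; rewrite !mxE; ring.
Qed.

Lemma flow_lin n phi (L : 'M[C]_n) a (G Y G' Y' : R -> 'M[C]_(2, n)) :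
  flow phi L G Y -> flow phi L G' Y' ->
  flow phi L (fun x => a *: G x + G' x) (fun x => a *: Y x + Y' x).
Proof.
move=> h h' x; rewrite vf_lin; apply: mderD; last exact: h'.
by apply: mder_eq (mderZ (cderC a x) (h x)) _; rewrite scale0r add0r.
Qed.

Lemma flow0 n phi (L : 'M[C]_n) : flow phi L (fun=> 0) (fun=> 0).
Proof. by move=> x; rewrite /vf mul0mx mulmx0 addr0 subr0 mulmx0; exact: mderC. Qed.

Lemma flow_ext n phi (L : 'M[C]_n) (G G' Y : R -> 'M[C]_(2, n)) :
  (forall x, G x = G' x) -> flow phi L G Y -> flow phi L G' Y.
Proof. by move=> /funext ->. Qed.

Variables (U0 : R -> 'M[C]_2) (M0 T0 : R).
Hypothesis T01 : 1 <= T0.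
Hypothesis U0c : mcont U0.
Hypothesis U0M : forall x, mnorm (U0 x) <= M0.

Let T00 : 0 <= T0. Proof. exact: le_trans ler01 T01. Qed.
Let M00 : 0 <= M0. Proof. exact: le_trans (mnorm_ge0 _) (U0M 0). Qed.
Let X := T0 + 1.
Let X0 : 0 <= X. Proof. by rewrite addr_ge0. Qed.

Let near_T0 (T eta : R) : eta <= 1 -> `|T - T0| <= eta -> 0 <= T <= X.
Proof. move=> e1; rewrite ler_norml => /andP[h1 h2]; have h3 := T01.
by apply/andP; split; rewrite ?/X; lra. Qed.

(* This property forces the eigenfunctions of nearby operators into the span of
   the columns of [U0]. *)
Definition forcing_faithful n (L : 'M[C]_n) := forall (Ga : 'M[C]_(2, n)) Y,
  flow (fun=> 0) L (fun x => U0 x *m Ga) Y -> Y 0 = 0 -> Y T0 = 0 -> Ga = 0.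

(** [S Ga] is the response at time [T0] to the forcing [U0 *m Ga], that is, the derivative of the
    end value of the frame with respect to its matrix. By the last clause perturbed data give the
    same response up to the relative error [k * eta]. The number of columns is left free: two for
    Newton's method, one for generalized eigenvectors. *)
Lemma variation n (L : 'M[C]_n) : exists S : 'M[C]_(2, n) -> 'M[C]_(2, n),
  [/\ forall a A B, S (a *: A + B) = a *: S A + S B,
      forcing_faithful L -> forall A, S A = 0 -> A = 0 &
  exists2 k, 0 < k & forall (eta : R) phi T L' U Ga P, 0 <= eta <= 1 ->
    (forall x, `|phi x| <= eta) -> `|T - T0| <= eta -> mnorm (L' - L) <= eta ->
    (forall x, 0 <= x <= X -> mnorm (U x - U0 x) <= eta) ->
    flow phi L' (fun x => U x *m Ga) P -> P 0 = 0 ->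
    mnorm (P T - S Ga) <= k * eta * mnorm Ga].
Proof.
have ex Ga : exists Y, Y 0 = 0 /\ flow (fun=> 0) L (fun x => U0 x *m Ga) Y.
  apply: (@flow_exists _ _ _ L _ 0 (M0 * mnorm Ga)).
  - exact: cst_continuous.
  - by move=> x; rewrite normr0.
  - by apply: mcontM => //; exact: mcontC.
  - by move=> x; rewrite (le_trans (mnormM _ _)) // ler_wpM2r ?mnorm_ge0.
have [Y YP] := choice ex.
exists (fun Ga => Y Ga T0); split.
- move=> a A B.
  have [YA0 YA] := YP A; have [YB0 YB] := YP B; have [YAB0 YAB] := YP (a *: A + B).
  have H := flow_lin a YA YB.
  apply: (flow_unique (P := 0) _ YAB (flow_ext _ H)) => //.
  + by move=> x; rewrite normr0.
  + by move=> x; rewrite mulmxDr scalemxAr.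
  + by rewrite YAB0 YA0 YB0 scaler0 addr0.
- by move=> ND A SA; have [YA0 YA] := YP A; exact: ND YA YA0 SA.
pose K := mnorm L + 1.
have K0 : 0 <= K by rewrite addr_ge0 ?mnorm_ge0.
have [c c0 cP] := @flow_dist R n X K X0 K0.
pose m := c * M0.
have m0 : 0 <= m by rewrite mulr_ge0 // ltW.
have LK : mnorm L <= K by rewrite /K lerDl.
have Ybd Ga x : 0 <= x <= X -> mnorm (Y Ga x) <= m * mnorm Ga.
  move=> xX; have [Y0 YG] := YP Ga.
  have := @cP (fun=> 0) L L _ (fun=> 0) _ (fun=> 0) (M0 * mnorm Ga) LK _ YG (flow0 _ L) _ x xX.
  rewrite subr0 Y0 subr0 mnorm0 add0r mulrA; apply.
    by rewrite mulr_ge0 ?mnorm_ge0.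
  move=> t tX; rewrite normr0 mul0r mul0mx mnorm0 !add0r; split => //.
  by rewrite subr0 (le_trans (mnormM _ _)) // ler_wpM2r ?mnorm_ge0.
pose k1 := m + mnorm N0 * m + 1.
have k10 : 0 < k1 by rewrite ltr_wpDl // addr_ge0 // mulr_ge0 // mnorm_ge0.
pose q := mnorm a1inv * (mnorm L + mnorm A0 + 0 * mnorm N0) * m + mnorm a1inv * M0.
have q0 : 0 <= q.
  by rewrite addr_ge0 // mulr_ge0 ?mnorm_ge0 // mulr_ge0 ?mnorm_ge0 // addr_ge0 ?mul0r ?addr_ge0 ?mnorm_ge0.
exists (c * k1 + (2 * n)%:R * (2 * q)).
  by rewrite ltr_pwDl ?mulr_gt0 // !mulr_ge0 // ler0n.
move=> eta phi T L' U Ga P /andP[e0 e1] phie Te Le Ue PG P0.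
have [Y0 YG] := YP Ga.
have TX := near_T0 e1 Te.
have T0X : 0 <= T0 <= X by rewrite T00 /X lerDl ler01.
have G0 := mnorm_ge0 Ga.
have LK' : mnorm L' <= K.
  rewrite /K; have := mnormD (L' - L) L; rewrite subrK; lra.
have h1 : mnorm (P T - Y Ga T) <= c * (k1 * eta * mnorm Ga).
  have b0 : 0 <= k1 * eta * mnorm Ga by rewrite !mulr_ge0 // ltW.
  have := @cP phi L' L _ _ _ _ _ LK' b0 PG YG _ T TX.
  rewrite P0 Y0 subrr mnorm0 add0r; apply => x xX; split.
    exact: le_trans (phie x) e1.
  have b1 : mnorm (Y Ga x *m (L' - L)) <= m * mnorm Ga * eta.
    rewrite (le_trans (mnormM _ _)) // ler_pM ?mnorm_ge0 //; exact: Ybd.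
  have b2 : `|phi x| * mnorm (N0 *m Y Ga x) <= eta * (mnorm N0 * (m * mnorm Ga)).
    apply: ler_pM; rewrite ?mnorm_ge0 //.
    by rewrite (le_trans (mnormM _ _)) // ler_wpM2l ?mnorm_ge0 // Ybd.
  have b3 : mnorm (U x *m Ga - U0 x *m Ga) <= eta * mnorm Ga.
    by rewrite -mulmxBl (le_trans (mnormM _ _)) // ler_wpM2r // Ue.
  apply: le_trans (lerD (lerD b1 b2) b3) _.
  by rewrite le_eqVlt; apply/orP; left; apply/eqP; rewrite /k1; ring.
have h2 : mnorm (Y Ga T - Y Ga T0) <= (2 * n)%:R * (2 * (q * mnorm Ga) * eta).
  apply: le_trans (mder_lipschitz X0 YG (c := q * mnorm Ga) _ TX T0X) _.
    move=> x xX.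
    have z0 : `|0 : R| <= 0 by rewrite normr0.
    apply: le_trans (mnorm_vf L _ _ z0) _.
    have i0 := mnorm_ge0 (@a1inv R).
    have i1 : 0 <= mnorm (@a1inv R) * (mnorm L + mnorm (@A0 R) + 0 * mnorm (@N0 R)).
      by rewrite !(mulr_ge0, addr_ge0, mnorm_ge0).
    have b1 := ler_wpM2l i1 (Ybd Ga x xX).
    have b2 := ler_wpM2l i0 (le_trans (mnormM (U0 x) Ga) (ler_wpM2r G0 (U0M x))).
    apply: le_trans (lerD b1 b2) _.
    by rewrite le_eqVlt; apply/orP; left; apply/eqP; rewrite /q; ring.
  by rewrite ler_wpM2l ?ler0n // ler_wpM2l // !mulr_ge0.
rewrite -[_ - _](_ : (P T - Y Ga T) + (Y Ga T - Y Ga T0) = _); last by rewrite addrA subrK.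
apply: le_trans (mnormD _ _) _; apply: le_trans (lerD h1 h2) _.
by rewrite le_eqVlt; apply/orP; left; apply/eqP; ring.
Qed.

Variables (V L0 : 'M[C]_2) (rho0 : C).
Hypothesis U0_flow : flow (fun=> 0) L0 (fun=> 0) U0.
Hypothesis U00 : U0 0 = V.
Hypothesis U0T : U0 T0 = rho0 *: V.

Lemma frame_close : exists2 k, 0 < k & forall (eta : R) phi L U, 0 <= eta <= 1 ->
  (forall x, `|phi x| <= eta) -> mnorm (L - L0) <= eta ->
  flow phi L (fun=> 0) U -> U 0 = V ->
  forall x, 0 <= x <= X -> mnorm (U x - U0 x) <= k * eta.
Proof.
pose K := mnorm L0 + 1.
have K0 : 0 <= K by rewrite addr_ge0 ?mnorm_ge0.
have [c c0 cP] := @flow_dist R 2 X K X0 K0.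
exists (c * (M0 + mnorm N0 * M0) + 1).
  by rewrite ltr_wpDl // mulr_ge0 ?(ltW c0) // addr_ge0 ?mulr_ge0 ?mnorm_ge0.
move=> eta phi L U /andP[e0 e1] phie Le UL UV x xX.
have LK : mnorm L <= K.
  rewrite /K; have := mnormD (L - L0) L0; rewrite subrK; lra.
have b0 : 0 <= (M0 + mnorm N0 * M0) * eta.
  by rewrite !(mulr_ge0, addr_ge0, mnorm_ge0).
apply: le_trans (_ : c * ((M0 + mnorm N0 * M0) * eta) <= _); last first.
  by rewrite mulrA mulrDl lerDl mul1r.
have := @cP phi L L0 _ _ _ _ _ LK b0 UL U0_flow _ x xX.
rewrite [mnorm (U 0 - _)](_ : _ = 0) ?UV ?U00 ?(subrr V) ?mnorm0 //.
rewrite [0 + (_ + _) * eta]add0r; apply => t tX; split.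
  exact: le_trans (phie t) e1.
rewrite subrr mnorm0 addr0 mulrDl; apply: lerD.
  by rewrite (le_trans (mnormM _ _)) // ler_pM ?mnorm_ge0.
rewrite mulrC; apply: ler_pM; rewrite ?mnorm_ge0 //.
by rewrite (le_trans (mnormM _ _)) // ler_wpM2l ?mnorm_ge0.
Qed.

(** A solution vanishing at both ends has zero response, so [S d] is at most a small multiple of
    [d]; since [S] has a bounded inverse, [d = 0]. Faithfulness thus passes from the rest state to
    the wave and to nearby eigenvalues. *)
Lemma frame_contain z : forcing_faithful (z%:M : 'M[C]_1) ->
  exists2 eta : R, 0 < eta & forall phi T L U w (d : 'cV[C]_2) P,
    (forall x, `|phi x| <= eta) -> `|T - T0| <= eta -> mnorm (L - L0) <= eta ->
    flow phi L (fun=> 0) U -> U 0 = V -> cabs (w - z) <= eta ->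
    flow phi (w%:M : 'M[C]_1) (fun x => U x *m d) P -> P 0 = 0 -> P T = 0 -> d = 0.
Proof.
move=> ND; have [S [Sl Si [k k0 kP]]] := variation (z%:M : 'M[C]_1).
have [g [[_ fg _] [c c0 gc]]] := linear_injective_inverse Sl (Si ND).
have [k' k'0 k'P] := frame_close.
pose q := 1 + k'.
have q0 : 0 < q by rewrite addr_gt0.
(* The first bound keeps [q * eta] at most [1], the second makes [c * k * q * eta] at most [1/2]. *)
pose eta := Num.min q^-1 ((2 * c * k * q)^-1).
have e0 : 0 < eta by rewrite lt_min !invr_gt0 q0 !mulr_gt0.
exists eta => // phi T L U w d P phie Te Le UL UV we PU P0 PT.
have e1 : eta <= q^-1 by rewrite ge_min lexx.
have e2 : eta <= (2 * c * k * q)^-1 by rewrite ge_min lexx orbT.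
have qe1 : q * eta <= 1 by rewrite mulrC -ler_pdivlMr // div1r.
have eqe : eta <= q * eta by rewrite ler_peMl ?(ltW e0) // lerDl ltW.
have eta1 : 0 <= eta <= 1 by rewrite (ltW e0) (le_trans eqe).
have qe : 0 <= q * eta <= 1 by rewrite qe1 mulr_ge0 // ltW.
have Uc x : 0 <= x <= X -> mnorm (U x - U0 x) <= q * eta.
  move=> xX; apply: le_trans (k'P eta phi L U eta1 phie Le UL UV x xX) _.
  by rewrite ler_wpM2r ?(ltW e0) // /q lerDr.
have h := kP (q * eta) phi T w%:M U d P qe (fun x => le_trans (phie x) eqe)
  (le_trans Te eqe) _ Uc PU P0.
have {}h : mnorm (S d) <= k * (q * eta) * mnorm d.
  rewrite PT sub0r mnormN in h; apply: h.
  apply: le_trans eqe; apply: le_trans we.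
  rewrite -rmorphB /= /mnorm !big_ord_recl !big_ord0 !addr0 !mxE /= mulr1n //.
apply: mnorm_eq0; have := gc (S d); rewrite fg => h1.
have h2 : c * (k * (q * eta) * mnorm d) <= mnorm d / 2.
  have : (c * k * q) * eta <= 1 / 2.
    apply: le_trans (ler_wpM2l _ e2) _; first by rewrite !mulr_ge0 // ltW.
    by rewrite le_eqVlt; apply/orP; left; apply/eqP; field; rewrite !gt_eqF.
  by move=> /(ler_wpM2r (mnorm_ge0 d)) h2; apply: le_trans (_ : c * k * q * eta * mnorm d <= _); lra.
have := ler_wpM2l (ltW c0) h; lra.
Qed.

Hypothesis ND : forcing_faithful L0.

(** The difference of two frames is exactly a solution forced by [U' *m (L - L')] with zero initial
    value, so [variation] yields the Lipschitz estimate that [newton_matrix] asks for. *)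
Let frame_expand : exists S g c, [/\ cancel g S, cancel S g,
    (forall A B, g (A - B) = g A - g B), 0 < c & forall A, mnorm (g A) <= c * mnorm A] /\
  exists2 eta : R, 0 < eta & forall phi T L L' U U',
    (forall x, `|phi x| <= eta) -> `|T - T0| <= eta ->
    mnorm (L - L0) <= eta -> mnorm (L' - L0) <= eta ->
    flow phi L (fun=> 0) U -> U 0 = V -> flow phi L' (fun=> 0) U' -> U' 0 = V ->
    mnorm (U T - U' T - S (L - L')) <= mnorm (L - L') / (2 * c).
Proof.
have [S [Sl Si [k k0 kP]]] := variation L0.
have [g [[gf fg gB] [c c0 gc]]] := linear_injective_inverse Sl (Si ND).
have [k' k'0 k'P] := frame_close.
exists S, g, c; split => //.
pose q := 1 + k'.
have q0 : 0 < q by rewrite addr_gt0.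
pose eta := Num.min q^-1 ((2 * c * k * q)^-1).
have e0 : 0 < eta by rewrite lt_min !invr_gt0 q0 !mulr_gt0.
exists eta => // phi T L L' U U' phie Te Le Le' UL UV UL' UV'.
have e1 : eta <= q^-1 by rewrite ge_min lexx.
have e2 : eta <= (2 * c * k * q)^-1 by rewrite ge_min lexx orbT.
have qe1 : q * eta <= 1 by rewrite mulrC -ler_pdivlMr // div1r.
have eqe : eta <= q * eta by rewrite ler_peMl ?(ltW e0) // lerDl ltW.
have eta1 : 0 <= eta <= 1 by rewrite (ltW e0) (le_trans eqe).
have qe : 0 <= q * eta <= 1 by rewrite qe1 mulr_ge0 // ltW.
have Uc x : 0 <= x <= X -> mnorm (U' x - U0 x) <= q * eta.
  move=> xX; apply: le_trans (k'P eta phi L' U' eta1 phie Le' UL' UV' x xX) _.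
  by rewrite ler_wpM2r ?(ltW e0) // /q lerDr.
have D : flow phi L (fun x => U' x *m (L - L')) (fun x => U x - U' x).
  move=> x; apply: mder_eq (mderB (UL x) (UL' x)) _.
  rewrite /vf -mulmxBr; congr (_ *m _).
  rewrite mulmxBl !mulmxBr.
  move: (U x *m L) (U' x *m L) (U' x *m L') (_ *m U x) (_ *m U' x) => ? ? ? ? ?.
  by apply/matrixP => i j; rewrite !mxE; ring.
have h := kP (q * eta) phi T L U' (L - L') _ qe (fun x => le_trans (phie x) eqe)
  (le_trans Te eqe) (le_trans Le eqe) Uc D.
apply: le_trans (h _) _; first by rewrite UV UV' subrr.
have h3 : k * (q * eta) <= (2 * c)^-1.
  apply: le_trans (_ : k * q * (2 * c * k * q)^-1 <= _).
    by rewrite mulrA ler_wpM2l // mulr_ge0 // ltW.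
  by rewrite le_eqVlt; apply/orP; left; apply/eqP; field; rewrite !gt_eqF.
by rewrite [leRHS]mulrC ler_wpM2r ?mnorm_ge0.
Qed.

(** The matrix of a frame is a Lipschitz function of its end value. This one estimate later gives
    uniqueness, the dependence on [mu] and the comparison with approximate frames. *)
Lemma frame_unique : exists2 c : R, 0 < c & exists2 eta : R, 0 < eta &
  forall phi T L L' U U',
    (forall x, `|phi x| <= eta) -> `|T - T0| <= eta ->
    mnorm (L - L0) <= eta -> mnorm (L' - L0) <= eta ->
    flow phi L (fun=> 0) U -> U 0 = V -> flow phi L' (fun=> 0) U' -> U' 0 = V ->
    mnorm (L - L') <= c * mnorm (U T - U' T).
Proof.
have [S [g [c [[gf fg gB c0 gc] [eta e0 eP]]]]] := frame_expand.
exists (2 * c); first by rewrite mulr_gt0.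
exists eta => // phi T L L' U U' h1 h2 h3 h4 h5 h6 h7 h8.
have h := eP phi T L L' U U' h1 h2 h3 h4 h5 h6 h7 h8.
have := gc (S (L - L')); rewrite fg => k1.
have k2 : mnorm (S (L - L')) <= mnorm (U T - U' T) + mnorm (L - L') / (2 * c).
  rewrite -[S _](_ : (U T - U' T) - (U T - U' T - S (L - L')) = _); last first.
    by rewrite opprB addrC subrK.
  by rewrite (le_trans (mnormB _ _)) // lerD2l.
have k3 := ler_wpM2l (ltW c0) k2; rewrite mulrDr in k3.
have k4 : c * (mnorm (L - L') / (2 * c)) = mnorm (L - L') / 2 by field; rewrite gt_eqF.
rewrite k4 in k3; lra.
Qed.

Lemma frame_exists (r : R) : 0 < r -> exists2 eta : R, 0 < eta &
  forall phi T rho, continuous phi -> (forall x, `|phi x| <= eta) -> `|T - T0| <= eta ->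
    cabs (rho - rho0) <= eta -> exists L U,
    [/\ mnorm (L - L0) <= r, flow phi L (fun=> 0) U, U 0 = V & U T = rho *: V].
Proof.
move=> r0.
have [S [g [c [[gf fg gB c0 gc] [eta e0 eP]]]]] := frame_expand.
have [k' k'0 k'P] := frame_close.
pose r1 := Num.min r eta.
have r10 : 0 < r1 by rewrite lt_min r0.
pose q := mnorm a1inv * (mnorm L0 + mnorm A0 + 0 * mnorm N0) * M0.
have q0 : 0 <= q by rewrite !(mulr_ge0, addr_ge0, mnorm_ge0).
(* [D] collects the contributions to the initial residual: [k'] from the wave, the term with [q]
   from the change of period, [mnorm V] from the change of multiplier. *)
pose D := k' + 4 * (2 * q) + mnorm V + 1.
have D0 : 0 < D.
  by rewrite ltr_wpDl // !(mulr_ge0, addr_ge0, mnorm_ge0) // ltW.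
pose d := r1 / (2 * c) / (4 * (2 * 2)%:R + 1).
have d0 : 0 < d by rewrite !divr_gt0 // ?mulr_gt0 // ltr_wpDl // mulr_ge0.
pose eta1 := Num.min (Num.min eta 1) (d / D).
have e10 : 0 < eta1 by rewrite !lt_min e0 ltr01 divr_gt0.
have e1e : eta1 <= eta by rewrite !ge_min lexx.
have e11 : eta1 <= 1 by rewrite !ge_min lexx orbT.
have e1d : D * eta1 <= d.
  by rewrite mulrC -ler_pdivlMr // !ge_min lexx !orbT.
exists eta1 => // phi T rho phic phie Te re.
have ex L : exists Y, Y 0 = V /\ flow phi L (fun=> 0) Y.
  have z (x : R) : mnorm ((fun=> 0 : 'M[C]_2) x) <= 0 by rewrite mnorm0.
  exact: (@flow_exists R 2 phi L (fun=> 0) eta1 0 phic phie (mcontC _) z V).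
have [Y YP] := choice ex.
have T0X : 0 <= T0 <= X by rewrite T00 /X lerDl ler01.
have TX := near_T0 e11 Te.
have [L Lr LF] : exists2 L, mnorm (L - L0) <= r1 & Y L T - rho *: V = 0.
  apply: (newton_matrix (F := fun L => Y L T - rho *: V) gf fg gB c0 (ltW r10) gc).
    move=> A B hA hB; have [YA0 YA] := YP A; have [YB0 YB] := YP B.
    rewrite (_ : Y A T - rho *: V - (Y B T - rho *: V) = Y A T - Y B T); last first.
      by rewrite opprB addrA subrK.
    apply: (eP phi) => //; try by move=> x; exact: le_trans (phie x) e1e.
    - exact: le_trans Te e1e.
    - by apply: le_trans hA _; rewrite ge_min lexx orbT.
    - by apply: le_trans hB _; rewrite ge_min lexx orbT.
  rewrite -/d; apply: le_trans e1d.
  have [Y0 YL] := YP L0.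
  have h1 : mnorm (Y L0 T - U0 T) <= k' * eta1.
    apply: (k'P eta1 phi L0) => //; first by rewrite (ltW e10) e11.
    by rewrite subrr mnorm0 ltW.
  have h2 : mnorm (U0 T - U0 T0) <= (2 * 2)%:R * (2 * q * eta1).
    apply: le_trans (mder_lipschitz X0 U0_flow (c := q) _ TX T0X) _.
      move=> x xX.
      have z0 : `|0 : R| <= 0 by rewrite normr0.
      apply: le_trans (mnorm_vf L0 _ _ z0) _.
      rewrite mnorm0 mulr0 addr0 /q ler_wpM2l //.
      by rewrite !(mulr_ge0, addr_ge0, mnorm_ge0).
    by rewrite ler_wpM2l ?ler0n // ler_wpM2l // mulr_ge0.
  have h3 : mnorm (rho0 *: V - rho *: V) <= eta1 * mnorm V.
    by rewrite -scalerBl mnormZ ler_wpM2r ?mnorm_ge0 // cabs_distC.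
  rewrite (_ : Y L0 T - rho *: V =
    (Y L0 T - U0 T) + (U0 T - U0 T0) + (rho0 *: V - rho *: V)); last first.
    rewrite U0T; move: (Y L0 T) (U0 T) (rho *: V) (rho0 *: V) => ? ? ? ?.
    by apply/matrixP => i j; rewrite !mxE; ring.
  apply: le_trans (mnormD _ _) _.
  have h4 := mnormD (Y L0 T - U0 T) (U0 T - U0 T0).
  have : D * eta1 = k' * eta1 + 4 * (2 * q * eta1) + eta1 * mnorm V + eta1.
    by rewrite /D; ring.
  rewrite natrM in h2; move: h1 h2 h3 h4 (ltW e10); lra.
have [Y0 YL] := YP L.
exists L, (Y L); split => //; first by rewrite (le_trans Lr) // ge_min lexx.
by apply/eqP; rewrite -subr_eq0 LF.
Qed.
End Frames.

(** * Small periodic waves *)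

Section Constants.
Context {R : realType}.
(* Limits of the frequency and of the period of the waves as [h -> 0-]. *)
Definition om0 : R := 2 / Num.sqrt 3.
Definition per0 : R := Num.sqrt 3 * pi.
Lemma sqrt3_gt0 : 0 < Num.sqrt 3 :> R. Proof. by rewrite sqrtr_gt0. Qed.
Lemma sqrt3_sqr : Num.sqrt 3 ^+ 2 = 3 :> R. Proof. by rewrite sqr_sqrtr. Qed.
Lemma sqrt3_ge1 : 1 <= Num.sqrt 3 :> R.
Proof. by rewrite -[X in X <= _]sqrtr1 ler_wsqrtr // ler1n. Qed.
Lemma om0_sqr : om0 ^+ 2 = 4 / 3.
Proof. by rewrite /om0 expr_div_n sqrt3_sqr; field. Qed.
Lemma om0_gt0 : 0 < om0. Proof. by rewrite divr_gt0 ?sqrt3_gt0. Qed.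
Lemma om0_le2 : om0 <= 2.
Proof. by rewrite /om0 ler_pdivrMr ?sqrt3_gt0 // ler_peMr // sqrt3_ge1. Qed.
Lemma om0_per0 : om0 * per0 = 2 * pi.
Proof. by rewrite /om0 /per0; field; rewrite gt_eqF // sqrt3_gt0. Qed.
Lemma per0_ge2 : 2 <= per0.
Proof. by rewrite /per0 (le_trans (pi_ge2 R)) // ler_peMl ?pi_ge0 // sqrt3_ge1. Qed.
Lemma per0_gt0 : 0 < per0. Proof. by have := per0_ge2; lra. Qed.
End Constants.

Section Wave.
Context {R : realType}.
Variables (h : R) (phi psi : R -> R) (T : R).
Hypothesis h_range : - 6^-1 < h < 0.
Hypothesis wave : periodic_wave h phi psi T.

Let e := - h.
Let e0 : 0 < e. Proof. by rewrite /e; case/andP: h_range; lra. Qed.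
Let e1 : e < 6^-1. Proof. by rewrite /e; case/andP: h_range; lra. Qed.
(* With [w = v - u / 2] the system reads [u' = - 4 / 3 w], [w' = u - u ^ 2]. *)
Definition wav x := psi x - phi x / 2.
Let w := wav.

Lemma wave_T0 : 0 < T. Proof. by case: wave. Qed.
Lemma wave_per x : phi (x + T) = phi x. Proof. by case: wave => _ _ /(_ x)[]. Qed.
Lemma wav_per x : wav (x + T) = wav x.
Proof. by case: wave => _ _ /(_ x)[p1 p2] _ _; rewrite /wav p1 p2. Qed.

Lemma wave_perM n x : phi (x + n%:R * T) = phi x.
Proof.
elim: n => [|n IH]; first by rewrite mul0r addr0.
by rewrite -addn1 natrD mulrDl mul1r addrA wave_per.
Qed.
Lemma wav_perM n x : wav (x + n%:R * T) = wav x.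
Proof.
elim: n => [|n IH]; first by rewrite mul0r addr0.
by rewrite -addn1 natrD mulrDl mul1r addrA wav_per.
Qed.

Lemma dphi (x : R) : is_derive x 1 phi (- (4 / 3) * wav x).
Proof. by case: wave => /(_ x)[d _] _ _ _ _; apply: drE d _; rewrite /wav; field. Qed.
Lemma dwav (x : R) : is_derive x 1 wav (phi x - phi x ^+ 2).
Proof.
case: wave => /(_ x)[d1 d2] _ _ _ _.
by apply: drE (drB d2 (drM d1 (drC 2^-1 x))) _; field.
Qed.
Lemma phi_cont : continuous phi. Proof. exact: dr_continuous dphi. Qed.

Lemma wave_energy x : wav x ^+ 2 + 3 / 4 * phi x ^+ 2 - phi x ^+ 3 / 2 = 3 / 2 * e.
Proof.
case: wave => _ _ _ _ [oE _].
have : range (fun xi => (phi xi, psi xi)) (phi x, psi x) by exists x.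
rewrite oE => /connected_component_sub /=; rewrite /H_BF /= /e => <-.
by rewrite /wav; field.
Qed.

(** The saddle [u = 1] lies at energy [1/6], above the energy of the orbit, so [phi] cannot cross
    the value [1]; and an orbit lying entirely beyond it is not periodic. *)
Lemma phi_lt1 x : phi x < 1.
Proof.
have no1 z : phi z <> 1.
  move=> p1; have := wave_energy z; rewrite p1 !expr1n.
  have := sqr_ge0 (wav z); have := e1; lra.
rewrite ltNge; apply/negP => x1.
have all1 z : 1 <= phi z.
  rewrite leNgt; apply/negP => z1.
  have cw a b : {within `[a, b], continuous phi}.
    by apply: continuous_subspaceT; exact: phi_cont.
  have [c _] : exists2 c, c \in `[Num.min x z, Num.max x z] & phi c = 1.
    apply: IVT => //; first by rewrite ge_min !le_max !lexx ?orbT.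
    by case: (leP x z) => _; rewrite ge_min le_max (ltW z1) x1 ?orbT.
  exact: no1.
(* Periodicity of [wav] gives a point where [phi = phi ^+ 2], which is impossible if [phi] stays
   above [1]. *)
have [c _] := mean_value (ltW wave_T0) (fun z _ => dwav z).
have := wav_per 0; rewrite add0r => ->; rewrite subrr subr0 => /esym/eqP.
rewrite mulf_eq0 (gt_eqF wave_T0) orbF subr_eq0 => /eqP pc.
have : phi c < phi c ^+ 2.
  have p1 : 1 < phi c by rewrite lt_neqAle all1 andbT eq_sym; apply/eqP/no1.
  by rewrite expr2 ltr_pMl // (lt_trans ltr01).
by rewrite -pc ltxx.
Qed.

Lemma phi_sqr_le x : phi x ^+ 2 <= 6 * e.
Proof.
have := wave_energy x; have := sqr_ge0 (wav x); have := sqr_ge0 (phi x).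
have : 0 <= phi x ^+ 2 * (1 - phi x).
  by rewrite mulr_ge0 ?sqr_ge0 // subr_ge0 ltW // phi_lt1.
rewrite mulrBr mulr1 -exprSr; lra.
Qed.

Lemma wav_sqr_le x : wav x ^+ 2 <= 2 * e.
Proof.
have := wave_energy x; have := phi_sqr_le x; have := sqr_ge0 (phi x).
have : 0 <= phi x ^+ 2 * (1 - phi x).
  by rewrite mulr_ge0 ?sqr_ge0 // subr_ge0 ltW // phi_lt1.
rewrite mulrBr mulr1 -exprSr; have := e0; lra.
Qed.

(** This is a maximum of [phi]. Its height is bounded below by the square root of [2 * e], and it is
    the starting phase for the study of the period. *)
Lemma wave_top : exists c : R, [/\ wav c = 0, 0 < phi c & 2 * e <= phi c ^+ 2].
Proof.
have T0 := wave_T0.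
have [c ci cmax] : exists2 c, c \in `[0, T] & forall t, t \in `[0, T] -> phi t <= phi c.
  apply: EVT_max; first exact: ltW.
  by apply: continuous_subspaceT; exact: phi_cont.
have max2 t : 0 <= t <= 2 * T -> phi t <= phi c.
  move=> /andP[t0 t1]; have [tT|tT] := leP t T.
    by apply: cmax; rewrite in_itv /= t0.
  rewrite -[t](subrK T) wave_per; apply: cmax; rewrite in_itv /=.
  by apply/andP; split; lra.
(* A maximum at [0] is moved to [T], so that it is interior to a window of two periods and the
   derivative vanishes there. *)
have [d [dE di]] : exists d, phi d = phi c /\ 0 < d < 2 * T.
  move: ci; rewrite in_itv /= => /andP[c0 c1].
  have [c00|c00] := eqVneq c 0.
    by exists T; rewrite c00 -(wave_per 0) add0r; split => //; apply/andP; split; lra.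
  by exists c; split => //; apply/andP; split; [rewrite lt_neqAle eq_sym c00|lra].
have wd : wav d = 0.
  have D := dphi d.
  have D0 : is_derive d 1 phi 0.
    apply: (@derive1_at_max R phi 0 (2 * T) d).
    - by rewrite mulr_ge0 // ltW.
    - by move=> t _; have Dt := dphi t; exact: ex_derive.
    - by rewrite in_itv.
    - by move=> t; rewrite in_itv /= => /andP[/ltW t0 /ltW t1]; rewrite dE max2 ?t0.
  have : - (4 / 3) * wav d = 0.
    by rewrite -[LHS](@derive_val _ _ _ _ _ _ _ D) (@derive_val _ _ _ _ _ _ _ D0).
  lra.
have E := wave_energy d; rewrite wd expr0n /= add0r in E.
have pd0 : phi d != 0.
  apply/eqP => p0; move: E; rewrite p0 !expr0n /= mulr0 mul0r subr0.
  have := e0; lra.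
have [z /andP[z0 z1]] := mean_value (ltW T0) (fun z _ => dwav z).
have := wav_per 0; rewrite add0r => ->; rewrite subrr subr0 => /esym/eqP.
rewrite mulf_eq0 (gt_eqF T0) orbF subr_eq0 => /eqP pz.
have pz0 : 0 <= phi z by rewrite pz sqr_ge0.
have pd : 0 < phi d.
  by rewrite lt_neqAle eq_sym pd0 dE (le_trans pz0) // cmax // in_itv /= z0.
exists d; split => //.
have : 0 <= phi d ^+ 3 by rewrite exprn_ge0 // ltW.
lra.
Qed.

(** On [0 < u < 1] the energy profile [3/4 u^2 - u^3/2] is strictly increasing, so the energy
    determines the crossing of the positive axis. *)
Lemma top_unique a b : wav a = 0 -> wav b = 0 -> 0 < phi a -> 0 < phi b -> phi a = phi b.
Proof.
move=> wa wb pa pb; have Ea := wave_energy a; have Eb := wave_energy b.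
rewrite wa expr0n /= add0r in Ea; rewrite wb expr0n /= add0r in Eb.
have a1 := phi_lt1 a; have b1 := phi_lt1 b.
have : (phi a - phi b) * (3 / 4 * (phi a + phi b) - (phi a ^+ 2 + phi a * phi b + phi b ^+ 2) / 2) = 0.
  have : 3 / 4 * phi a ^+ 2 - phi a ^+ 3 / 2 - (3 / 4 * phi b ^+ 2 - phi b ^+ 3 / 2) = 0.
    by rewrite Ea Eb subrr.
  by move=> <-; field.
move/eqP; rewrite mulf_eq0 subr_eq0 => /orP[/eqP//|/eqP H].
have h1 : phi a ^+ 2 < phi a by rewrite expr2 gtr_pMl.
have h2 : phi b ^+ 2 < phi b by rewrite expr2 gtr_pMl.
have h3 : 2 * (phi a * phi b) <= phi a ^+ 2 + phi b ^+ 2.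
  by have := sqr_ge0 (phi a - phi b); rewrite sqrrB; lra.
lra.
Qed.

(** In coordinates [p], [q] rotating with frequency [om0] the linear part disappears. Only the
    quadratic term remains, and it is at most [om0 * (6 * e)], hence at most [12 * e]. *)
Lemma wave_close c x : wav c = 0 -> 0 <= x ->
  `|phi (c + x) - phi c * cos (om0 * x)| <= 24 * e * x /\
  `|om0 * wav (c + x) - phi c * sin (om0 * x)| <= 24 * e * x.
Proof.
move=> wc x0.
have om2 := @om0_sqr R.
have cd (t : R) : is_derive t 1 (fun s => cos (om0 * s)) (- (om0 * sin (om0 * t))).
  apply: drE (dr_comp (is_derive_cos _) (drM (drC (@om0 R) t) (drI t))) _.
  by rewrite mul0r add0r mulr1; ring.
have sd (t : R) : is_derive t 1 (fun s => sin (om0 * s)) (om0 * cos (om0 * t)).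
  apply: drE (dr_comp (is_derive_sin _) (drM (drC (@om0 R) t) (drI t))) _.
  by rewrite mul0r add0r mulr1; ring.
have sh (t : R) : is_derive t 1 (fun s => c + s) 1.
  by apply: drE (drD (drC c t) (drI t)) _; rewrite add0r.
have pd (t : R) : is_derive t 1 (fun s => phi (c + s)) (- om0 ^+ 2 * wav (c + t)).
  by apply: drE (dr_comp (dphi (c + t)) (sh t)) _; rewrite om2 mulr1.
have wd (t : R) : is_derive t 1 (fun s => om0 * wav (c + s))
    (om0 * (phi (c + t) - phi (c + t) ^+ 2)).
  by apply: drE (drM (drC (@om0 R) t) (dr_comp (dwav (c + t)) (sh t))) _; rewrite mulr1; ring.
pose p t := phi (c + t) * cos (om0 * t) + om0 * wav (c + t) * sin (om0 * t) - phi c.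
pose q t := om0 * wav (c + t) * cos (om0 * t) - phi (c + t) * sin (om0 * t).
have Dp (t : R) : is_derive t 1 p (- (om0 * phi (c + t) ^+ 2 * sin (om0 * t))).
  by apply: drE (drB (drD (drM (pd t) (cd t)) (drM (wd t) (sd t))) (drC (phi c) t)) _; ring.
have Dq (t : R) : is_derive t 1 q (- (om0 * phi (c + t) ^+ 2 * cos (om0 * t))).
  by apply: drE (drB (drM (wd t) (cd t)) (drM (pd t) (sd t))) _; ring.
have bd t s : `|s| <= 1 -> `|- (om0 * phi (c + t) ^+ 2 * s)| <= 12 * e.
  have b0 : 0 <= om0 * phi (c + t) ^+ 2.
    by apply: mulr_ge0; [exact: ltW (@om0_gt0 R)|exact: sqr_ge0].
  move=> s1; rewrite normrN normrM (ger0_norm b0).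
  apply: le_trans (_ : om0 * phi (c + t) ^+ 2 * 1 <= _).
    by rewrite ler_wpM2l.
  rewrite mulr1 (_ : 12 * e = 2 * (6 * e)); last by ring.
  by apply: ler_pM; rewrite ?sqr_ge0 ?(ltW (@om0_gt0 R)) ?om0_le2 ?phi_sqr_le.
have p0 : p 0 = 0 by rewrite /p !addr0 !mulr0 cos0 sin0 mulr1 mulr0 addr0 subrr.
have q0 : q 0 = 0 by rewrite /q !addr0 !mulr0 cos0 sin0 wc !mulr0 mul0r subrr.
have pb : `|p x| <= 12 * e * x.
  by apply: (normr_le_linear p0 Dp x0) => t _; apply: bd; exact: sin_max.
have qb : `|q x| <= 12 * e * x.
  by apply: (normr_le_linear q0 Dq x0) => t _; apply: bd; exact: cos_max.
have cs := cos2Dsin2 (om0 * x).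
have i1 : phi (c + x) - phi c * cos (om0 * x) = p x * cos (om0 * x) - q x * sin (om0 * x).
  have -> : p x * cos (om0 * x) - q x * sin (om0 * x) =
    phi (c + x) * (cos (om0 * x) ^+ 2 + sin (om0 * x) ^+ 2) - phi c * cos (om0 * x).
    by rewrite /p /q; ring.
  by rewrite cs mulr1.
have i2 : om0 * wav (c + x) - phi c * sin (om0 * x) = p x * sin (om0 * x) + q x * cos (om0 * x).
  have -> : p x * sin (om0 * x) + q x * cos (om0 * x) =
    om0 * wav (c + x) * (cos (om0 * x) ^+ 2 + sin (om0 * x) ^+ 2) - phi c * sin (om0 * x).
    by rewrite /p /q; ring.
  by rewrite cs mulr1.
have le1 a s : `|a| <= 12 * e * x -> `|s| <= 1 -> `|a * s| <= 12 * e * x.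
  by move=> ha hs; rewrite normrM (le_trans _ ha) // ler_piMr.
have j1 := le1 _ _ pb (cos_max (om0 * x)); have j2 := le1 _ _ qb (sin_max (om0 * x)).
have j3 := le1 _ _ pb (sin_max (om0 * x)); have j4 := le1 _ _ qb (cos_max (om0 * x)).
have -> : 24 * e * x = 12 * e * x + 12 * e * x by ring.
rewrite i1 i2; split; first exact: le_trans (ler_normB _ _) (lerD j1 j2).
exact: le_trans (ler_normD _ _) (lerD j3 j4).
Qed.

(** By uniqueness for the initial value problem [s] is a period, and [T] is the minimal one. *)
Lemma state_return a s : 0 < s -> phi (a + s) = phi a -> wav (a + s) = wav a -> T <= s.
Proof.
move=> s0 pa wa.
have fwd x : a <= x -> phi (x + s) = phi x /\ wav (x + s) = wav x.
  move=> ax.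
  (* The two real differences are stored in a complex matrix in order to reuse [matrix_gronwall]. *)
  pose Y t : 'M[R[i]]_2 := mx22 (phi (a + t + s) - phi (a + t))%:C (wav (a + t + s) - wav (a + t))%:C 0 0.
  pose dY t : 'M[R[i]]_2 := mx22 (- (4 / 3) * wav (a + t + s) - - (4 / 3) * wav (a + t))%:C
     ((phi (a + t + s) - phi (a + t + s) ^+ 2) - (phi (a + t) - phi (a + t) ^+ 2))%:C 0 0.
  have sh b (t : R) : is_derive t 1 (fun z => a + z + b) 1.
    by apply: drE (drD (drD (drC a t) (drI t)) (drC b t)) _; rewrite add0r addr0.
  have sh0 (t : R) : is_derive t 1 (fun z => a + z) 1.
    by apply: drE (drD (drC a t) (drI t)) _; rewrite add0r.
  have YD t : mder Y t (dY t).
    have d1 := cder_real (drB (dr_comp (dphi _) (sh s t)) (dr_comp (dphi _) (sh0 t))).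
    have d2 := cder_real (drB (dr_comp (dwav _) (sh s t)) (dr_comp (dwav _) (sh0 t))).
    rewrite !mulr1 in d1 d2.
    move=> i j; rewrite (_ : (fun _ => _) = fun t => (if i == 0 then (if j == 0 then
        (phi (a + t + s) - phi (a + t))%:C else (wav (a + t + s) - wav (a + t))%:C)
        else (if j == 0 then 0 else 0))); last by apply/funext => z; rewrite mxE.
    by rewrite mxE; case: (i == 0); case: (j == 0) => //; exact: cderC.
  have K0 : 0 <= 12 :> R by [].
  have xa : 0 <= x - a by rewrite subr_ge0.
  have [c c0 cP] := @matrix_gronwall R 2 2 (x - a) 12 xa K0.
  have Y0 : Y 0 = 0.
    rewrite /Y !addr0 pa wa !subrr; apply/matrixP => i j; rewrite !mxE.
    by case: (i == 0); case: (j == 0).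
  have : mnorm (Y (x - a)) <= 0.
    have := cP Y dY 0 (lexx _) YD _ (x - a); rewrite Y0 mnorm0 addr0 mulr0; apply; last first.
      by rewrite xa lexx.
    move=> t _; rewrite addr0 !mnorm22 !cabs0 !addr0 !cabs_real.
    set P := phi (a + t + s); set Q := phi (a + t).
    set W1 := wav (a + t + s); set W2 := wav (a + t).
    have -> : - (4 / 3) * W1 - - (4 / 3) * W2 = - (4 / 3) * (W1 - W2) by ring.
    have -> : P - P ^+ 2 - (Q - Q ^+ 2) = (P - Q) * (1 - (P + Q)) by ring.
    rewrite !normrM; have P2 := phi_sqr_le (a + t + s); have Q2 := phi_sqr_le (a + t).
    have PQ z : z ^+ 2 <= 6 * e -> `|z| <= 1.
      move=> hz; rewrite -(@ler_pXn2r _ 2) ?nnegrE // real_normK ?num_real //.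
      by rewrite expr1n (le_trans hz) //; have := e1; lra.
    have h1 : `|1 - (P + Q)| <= 3.
      have := PQ _ P2; have := PQ _ Q2; rewrite !ler_norml -/P -/Q => /andP[? ?] /andP[? ?].
      by apply/andP; split; lra.
    have h2 : `|P - Q| * `|1 - (P + Q)| <= `|P - Q| * 3 by rewrite ler_wpM2l.
    have h3 : `|- (4 / 3) : R| = 4 / 3 by rewrite normrN ger0_norm.
    rewrite h3; have := normr_ge0 (W1 - W2); have := normr_ge0 (P - Q); lra.
  move=> /mnorm_eq0 /matrixP YE.
  have xE : a + (x - a) = x by rewrite addrC subrK.
  have := YE 0 0; have := YE 0 1; rewrite !mxE /= xE => [[/eqP]] + [/eqP].
  by rewrite !subr_eq0 => /eqP -> /eqP ->.
case: wave => _ T0 _ min _; apply: min => // x.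
(* Uniqueness is available forward from [a] only; an arbitrary point is first moved there by whole
   periods. *)
have [n hn] : exists n : nat, a <= x + n%:R * T.
  exists (Num.truncn (`|a - x| / T)).+1.
  have q0 : 0 <= `|a - x| / T by rewrite divr_ge0 // ltW.
  have /andP[_] := truncn_itv q0; rewrite ltr_pdivrMr // => h1.
  have := ler_norm (a - x); lra.
have [f1 f2] := fwd _ hn.
have E : x + n%:R * T + s = x + s + n%:R * T by rewrite addrAC.
rewrite E wave_perM wave_perM in f1; rewrite E wav_perM wav_perM in f2.
by split => //; move: f2; rewrite /wav f1; lra.
Qed.
End Wave.

(** * Convergence of the period *)

Lemma cos_le_of_mid (R : realType) (a x : R) : 0 <= a -> a <= x -> x <= 2 * pi - a ->
  cos x <= cos a.
Proof.
move=> a0 ax xa.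
have cosle y : a <= y -> y <= pi -> cos y <= cos a.
  move=> ay yp; rewrite leNgt; apply/negP => h.
  have : y < a.
    by rewrite -(ltr_cos (x := y) (y := a)) // in_itv /=; apply/andP; split; lra.
  lra.
have [xp|xp] := leP x pi; first exact: cosle.
have -> : cos x = cos (2 * pi - x) :> R.
  have := cosD2pi (- x); rewrite cosN => <-; congr cos; rewrite mulr2n; ring.
by apply: cosle; lra.
Qed.

(** From its top the wave follows [A * cos (om0 * x)] with an error of order [A ^+ 2], negligible
    against the amplitude [A]. It must therefore return to its top close to [per0], and cannot do so
    earlier. *)
Lemma period_close (R : realType) (d : R) : 0 < d -> exists2 h0 : R, 0 < h0 &
  forall h phi psi T, - 6^-1 < h < 0 -> - h0 < h -> periodic_wave h phi psi T ->
  `|T - per0| <= d.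
Proof.
move=> d0; wlog dle : d d0 / d <= per0 / 8.
  move=> W; have [|dgt] := leP d (per0 / 8); first exact: W.
  have p8 : 0 < per0 / 8 :> R by rewrite divr_gt0 // per0_gt0.
  have [h0 h00 H] := W _ p8 (lexx _).
  exists h0 => // h phi psi T hr hh w.
  exact: le_trans (H h phi psi T hr hh w) (ltW dgt).
have P0 := @per0_gt0 R; have o0 := @om0_gt0 R.
have op := @om0_per0 R; have pi0 := @pi_gt0 R.
have od0 : 0 < om0 * d by rewrite mulr_gt0.
have od1 : om0 * d <= pi / 4.
  have := ler_wpM2l (ltW o0) dle; rewrite mulrA op; lra.
have s0 : 0 < sin (om0 * d) by apply: sin_gt0_pi; apply/andP; split; lra.
have c0 : 0 < cos (om0 * d) by apply: cos_gt0_pihalf; apply/andP; split; lra.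
have c1 : 0 < 1 - cos (om0 * d).
  rewrite subr_gt0 lt_neqAle cos_le1 andbT; apply/eqP => c1.
  have := cos2Dsin2 (om0 * d); rewrite c1 expr1n => /eqP.
  by rewrite -subr_eq0 addrAC subrr add0r sqrf_eq0 (gt_eqF s0).
pose k := Num.min (1 - cos (om0 * d)) (Num.min (sin (om0 * d)) (cos (om0 * d))).
have k0 : 0 < k by rewrite !lt_min c1 s0 c0.
have k1 : k <= 1 - cos (om0 * d) by rewrite ge_min lexx.
have k2 : k <= sin (om0 * d) by rewrite !ge_min lexx !orbT.
have k3 : k <= cos (om0 * d) by rewrite !ge_min lexx !orbT.
(* Up to time [2 * per0] the error [24 * e * x] is at most [24 * per0 * A ^+ 2], because
   [2 * e <= A ^+ 2]; for amplitudes below [b] this is less than [A * k]. *)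
pose b := k / (24 * per0).
have b0 : 0 < b by rewrite divr_gt0 // mulr_gt0.
exists (b ^+ 2 / 6); first by rewrite divr_gt0 // exprn_gt0.
move=> h phi psi T hr hh wave.
have [c [wc A0 A2]] := wave_top hr wave.
pose A := phi c.
have A0' : 0 < A by [].
have e0 : 0 < - h by case/andP: hr => _; lra.
have Ab : A < b.
  rewrite -(@ltr_pXn2r _ 2) ?nnegrE ?ltW // /A.
  have := phi_sqr_le hr wave c; move: hh; rewrite ltrNl; lra.
have err x : 0 <= x -> x <= 2 * per0 -> 24 * (- h) * x < A * k.
  move=> x0 x1; apply: le_lt_trans (_ : 24 * per0 * A ^+ 2 < _).
    have : 24 * (- h) * x <= 24 * (- h) * (2 * per0) by rewrite ler_wpM2l // mulr_ge0 // ltW.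
    have : per0 * (2 * - h) <= per0 * A ^+ 2 by rewrite ler_wpM2l // ltW.
    lra.
  rewrite expr2 mulrA mulrAC mulrC ltr_pM2l //.
  by rewrite mulrC -ltr_pdivlMr // mulr_gt0.
have close x : 0 <= x -> x <= 2 * per0 ->
    `|phi (c + x) - A * cos (om0 * x)| < A * k /\ `|om0 * wav phi psi (c + x) - A * sin (om0 * x)| < A * k.
  move=> x0 x1; have [q1 q2] := wave_close hr wave wc x0.
  by split; [apply: le_lt_trans q1 _|apply: le_lt_trans q2 _]; exact: err.
have Ak z : k <= z -> A * k <= A * z by move=> ?; rewrite ler_wpM2l // ltW.
have [Ak1 Ak2 Ak3] := And3 (Ak _ k1) (Ak _ k2) (Ak _ k3).
have sin2 x : sin (om0 * (per0 + x)) = sin (om0 * x) :> R.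
  by rewrite mulrDr op addrC -[RHS]sinD2pi mulr_natl.
have cos2 x : cos (om0 * (per0 + x)) = cos (om0 * x) :> R.
  by rewrite mulrDr op addrC -[RHS]cosD2pi mulr_natl.
have T0 := wave_T0 wave.
(* [wav] changes sign between [per0 - d] and [per0 + d]. At its zero [phi] is positive, so
   [top_unique] identifies the state with the initial one. *)
have upper : T <= per0 + d.
  have W1 : wav phi psi (c + (per0 - d)) < 0.
    have [|_] := close (per0 - d) ltac:(lra); first by lra.
    rewrite sin2 mulrN sinN ltr_norml => /andP[_ hq].
    by rewrite -(pmulr_rlt0 _ o0); lra.
  have W2 : 0 < wav phi psi (c + (per0 + d)).
    have [|_] := close (per0 + d) ltac:(lra); first by lra.
    rewrite sin2 ltr_norml => /andP[hq _].
    by rewrite -(pmulr_rgt0 _ o0); lra.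
  have [t ti wt] : exists2 t, t \in `[c + (per0 - d), c + (per0 + d)] & wav phi psi t = 0.
    apply: IVT; first by rewrite lerD2l; lra.
      by apply: continuous_subspaceT; apply: dr_continuous (dwav wave).
    by rewrite ge_min le_max (ltW W1) (ltW W2) orbT.
  pose s := t - c.
  have sE : c + s = t by rewrite /s addrC subrK.
  have [s1 s2] : per0 - d <= s /\ s <= per0 + d.
    by move: ti; rewrite in_itv /= /s => /andP[? ?]; split; lra.
  move: s sE s1 s2 => s sE s1 s2.
  have pt : 0 < phi t.
    have [|+ _] := close s ltac:(lra); first by lra.
    rewrite sE ltr_norml => /andP[hq _].
    have : cos (om0 * d) <= cos (om0 * s).
      rewrite -[s](_ : per0 + (s - per0) = _) ?cos2; last by rewrite addrC subrK.
      have n1 : `|om0 * (s - per0)| <= om0 * d.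
        by rewrite normrM (gtr0_norm o0) ler_wpM2l ?(ltW o0) // ler_norml; apply/andP; split; lra.
      by rewrite -[leRHS]cos_norm; apply: cos_le_of_mid => //; lra.
    move=> /(ler_wpM2l (ltW A0')) hc; lra.
  have pE := top_unique hr wave wc wt A0 pt.
  apply: le_trans s2.
  apply: (state_return hr wave (a := c)); first by lra.
    by rewrite sE.
  by rewrite sE wc.
(* A period of at most [d] would force a zero of [phi - phi ^+ 2] where [0 < phi < 1]. A period
   between [d] and [per0 - d] would bring [phi] back to [A] at a time when the cosine is well below
   [1]. *)
have lower : per0 - d <= T.
  rewrite leNgt; apply/negP => Td.
  have [TD|TD] := leP T d.
    have cT : c <= c + T by rewrite lerDl ltW.
    have [z /andP[z0 z1]] := mean_value cT (fun z _ => dwav wave z).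
    rewrite (wav_per wave) subrr => /esym/eqP; rewrite mulf_eq0 [c + T]addrC addrK (gt_eqF T0) orbF.
    have zE : c + (z - c) = z by rewrite addrC subrK.
    have pz : 0 < phi z.
      have [|+ _] := close (z - c) ltac:(lra); first by lra.
      rewrite zE ltr_norml => /andP[hq _].
      have : cos (om0 * d) <= cos (om0 * (z - c)).
        have i0 : 0 <= om0 * (z - c) by rewrite mulr_ge0 ?(ltW o0) //; lra.
        have i1 : om0 * (z - c) <= om0 * d by rewrite ler_wpM2l ?(ltW o0) //; lra.
        by apply: cos_le_of_mid => //; lra.
      move=> /(ler_wpM2l (ltW A0')) hc; lra.
    rewrite subr_eq0 expr2 -{1}[phi z]mulr1 => /eqP /(mulfI (lt0r_neq0 pz)) pz1.
    by have := phi_lt1 hr wave z; rewrite -pz1 ltxx.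
  have [|+ _] := close T (ltW T0); first by lra.
  rewrite (wave_per wave) -/A ltr_norml => /andP[_ hq].
  have : cos (om0 * T) <= cos (om0 * d).
    apply: cos_le_of_mid; [exact: ltW|by rewrite ler_wpM2l ?ltW|].
    have : om0 * T <= om0 * (per0 - d) by rewrite ler_wpM2l ?ltW.
    by rewrite mulrBr op.
  move=> /(ler_wpM2l (ltW A0')) hc; lra.
by rewrite ler_norml; apply/andP; split; lra.
Qed.

(** * Bloch eigenvalues lie in the spectrum *)

Section Integrals.
Context {R : realType}.
Local Notation leb := (@lebesgue_measure R).

Lemma integral_deriv (f F : R -> R) (a b : R) : continuous f ->
  (forall x : R, is_derive x 1 F (f x)) -> a <= b ->
  (\int[leb]_(x in `[a, b]) (f x)%:E = (F b - F a)%:E)%E.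
Proof.
move=> fc Fd; rewrite le_eqVlt => /orP[/eqP->|ab].
  by rewrite set_itv1 integral_set1 subrr.
have Fc : continuous F := dr_continuous Fd.
rewrite (continuous_FTC2 (F := F)) //.
- by apply: continuous_subspaceT.
- split; last 2 first.
  + by apply: cvg_at_right_filter; exact: Fc.
  + by apply: cvg_at_left_filter; exact: Fc.
  + by move=> x _; have H := Fd x; exact: ex_derive.
- by move=> x _; have H := Fd x; rewrite derive1E; exact: derive_val.
Qed.

Lemma Rintegral_deriv (f F : R -> R) (a b : R) : continuous f ->
  (forall x : R, is_derive x 1 F (f x)) -> a <= b ->
  \int[leb]_(x in `[a, b]) f x = F b - F a.
Proof. by move=> fc Fd ab; rewrite /Rintegral (integral_deriv fc Fd ab). Qed.

Lemma integral_supported_le (f : R -> R) (n c : R) : continuous f -> 0 <= n ->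
  (forall x, 0 <= f x) -> (forall x, f x <= c) -> (forall x, n < `|x| -> f x = 0) ->
  (\int[leb]_(x in [set: R]) (f x)%:E <= (c * (2 * n))%:E)%E.
Proof.
move=> fc n0 f0 fle fs.
have mf : measurable_fun setT f by exact: continuous_measurable_fun.
have -> : (\int[leb]_(x in [set: R]) (f x)%:E = \int[leb]_(x in `[(- n)%R, n]) (f x)%:E)%E.
  rewrite [RHS]integral_mkcond; apply: eq_integral => x _; rewrite patchE.
  case: ifPn => //; rewrite notin_setE /= in_itv /= => /negP; rewrite negb_and -!ltNge => xn.
  by rewrite fs // ltr_normr; move: xn => /orP[?|?]; apply/orP; [right|left]; lra.
apply: le_trans (_ : \int[leb]_(x in `[(- n)%R, n]) (cst c%:E x) <= _)%E.
  apply: ge0_le_integral => //=.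
  - by move=> x _; rewrite lee_fin.
  - by apply/measurable_EFinP; apply: measurable_funS mf.
  - by move=> x _; rewrite lee_fin.
rewrite integral_cst //= lebesgue_measure_itv /= lte_fin.
have [nn|nn] := ltP; first by rewrite -EFinD -EFinM lee_fin; apply: ler_wpM2l; [exact: le_trans (f0 0) (fle 0)|lra].
by rewrite mule0 lee_fin mulr_ge0 ?mulr_ge0 // (le_trans (f0 0) (fle 0)).
Qed.

Lemma integral_ge_deriv (f g F : R -> R) (a b : R) : continuous f -> continuous g ->
  (forall x : R, is_derive x 1 F (g x)) -> a <= b -> (forall x, 0 <= f x) ->
  (forall x, 0 <= g x) -> (forall x, a <= x <= b -> g x <= f x) ->
  ((F b - F a)%:E <= \int[leb]_(x in [set: R]) (f x)%:E)%E.
Proof.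
move=> fc gc Fd ab f0 g0 gf.
have mf : measurable_fun setT f by exact: continuous_measurable_fun.
have mg : measurable_fun setT g by exact: continuous_measurable_fun.
rewrite -(integral_deriv gc Fd ab).
apply: le_trans (_ : \int[leb]_(x in `[a, b]) (f x)%:E <= _)%E.
  apply: ge0_le_integral => //=.
  - by move=> x _; rewrite lee_fin.
  - by apply/measurable_EFinP; apply: measurable_funS mg.
  - by apply/measurable_EFinP; apply: measurable_funS mf.
apply: ge0_subset_integral => //; first by apply/measurable_EFinP.
by move=> x _; rewrite lee_fin.
Qed.
End Integrals.

Section BlochSpectrum.
Context {R : realType}.
Local Notation C := R[i].

Definition sqn (U : R -> 'cV[C]_2) (x : R) : R := \sum_(i < 2) cabs (U x i 0) ^+ 2.

Lemma sqn_cont U : mcont U -> continuous (sqn U).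
Proof.
move=> Uc; have E : sqn U = fun x =>
    (complex.Re (U x 0 0) * complex.Re (U x 0 0) + complex.Im (U x 0 0) * complex.Im (U x 0 0)) +
    (complex.Re (U x 1 0) * complex.Re (U x 1 0) + complex.Im (U x 1 0) * complex.Im (U x 1 0)).
  apply/funext => x; rewrite /sqn !big_ord_recl big_ord0 addr0 !cabsE -!expr2.
  by congr (_ + (_ + _)); congr (_ ^+ 2); congr (_ (U x _ _)); exact/val_inj.
have [r0 i0] := Uc 0 0; have [r1 i1] := Uc 1 0.
rewrite E => x.
exact: cvgD (cvgD (cvgM (r0 x) (r0 x)) (cvgM (i0 x) (i0 x))) (cvgD (cvgM (r1 x) (r1 x)) (cvgM (i1 x) (i1 x))).
Qed.

Lemma sqn_ge0 U x : 0 <= sqn U x.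
Proof. by apply: sumr_ge0 => i _; exact: sqr_ge0. Qed.

Lemma sqn_le U x : sqn U x <= mnorm (U x) ^+ 2.
Proof.
rewrite expr2 /sqn {1}/mnorm mulr_suml; apply: ler_sum => i _.
rewrite big_ord_recl big_ord0 addr0 expr2 ler_wpM2l ?cabs_ge0 //.
exact: cabs_le_mnorm.
Qed.

Lemma sqnZ (f : R -> C) U x : sqn (fun x => f x *: U x) x = cabs (f x) ^+ 2 * sqn U x.
Proof. by rewrite /sqn mulr_sumr; apply: eq_bigr => i _; rewrite mxE cabsM exprMn. Qed.

Lemma inL2_supported U (n : R) : mcont U -> 0 <= n ->
  (forall x, n < `|x| -> U x = 0) -> inL2 U.
Proof.
move=> Uc n0 Us; split.
  by move=> i; have [r s] := Uc i 0; split; apply: continuous_measurable_fun.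
have sUc := sqn_cont Uc.
have Us' x : n < `|x| -> sqn U x = 0.
  by move=> /Us U0; rewrite /sqn big1 // => i _; rewrite U0 mxE cabs0 expr0n.
have nn : - n <= n by lra.
have [c _ cmax] := EVT_max nn (continuous_subspaceT sUc).
have Ule x : sqn U x <= sqn U c.
  have [xn|/Us' ->] := leP `|x| n; last exact: sqn_ge0.
  by apply: cmax; rewrite in_itv /= -ler_norml.
apply: le_lt_trans (integral_supported_le sUc n0 (sqn_ge0 U) Ule Us') _.
exact: ltry.
Qed.

Lemma mder_inH1 (U dU : R -> 'cV[C]_2) : (forall x, mder U x (dU x)) -> mcont dU ->
  inL2 U -> inL2 dU -> inH1 U dU.
Proof.
move=> UD dUc LU LdU; split => // x y i xy; have [r s] := dUc i 0.
split; apply/esym.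
  by apply: (Rintegral_deriv (F := fun t => complex.Re (U t i 0)) r) => // t; case: (UD t i 0).
by apply: (Rintegral_deriv (F := fun t => complex.Im (U t i 0)) s) => // t; case: (UD t i 0).
Qed.

Lemma periodic_bounded (f : R -> R) (T : R) : 0 < T -> continuous f ->
  (forall x, f (x + T) = f x) -> exists M, forall x, f x <= M.
Proof.
move=> T0 fc fp.
have fpn n x : f (x + n%:R * T) = f x.
  elim: n => [|n IH]; first by rewrite mul0r addr0.
  by rewrite -addn1 natrD mulrDl mul1r addrA fp.
have [c _ cmax] : exists2 c, c \in `[0, T] & forall t, t \in `[0, T] -> f t <= f c.
  by apply: EVT_max; [exact: ltW|apply: continuous_subspaceT].
exists (f c).
have pos x : 0 <= x -> f x <= f c.
  move=> x0; have q0 : 0 <= x / T by rewrite divr_ge0 // ltW.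
  have := truncn_itv q0; set n := Num.truncn _ => /andP[h1 h2].
  rewrite ler_pdivlMr // in h1; rewrite ltr_pdivrMr // in h2.
  rewrite -[x](subrK (n%:R * T)) fpn; apply: cmax; rewrite in_itv /=.
  by rewrite -addn1 natrD mulrDl mul1r in h2; apply/andP; split; lra.
move=> x; pose n := (Num.truncn (`|x| / T)).+1.
rewrite -(fpn n); apply: pos.
have q0 : 0 <= `|x| / T by rewrite divr_ge0 // ltW.
have /andP[_] := truncn_itv q0; rewrite ltr_pdivrMr // -/n.
have := ler_norm (- x); rewrite normrN; lra.
Qed.

Lemma periodic_primitive (f F : R -> R) (T x0 : R) : 0 < T -> continuous f ->
  (forall x, 0 <= f x) -> (forall x, f (x + T) = f x) -> F 0 = 0 ->
  (forall x : R, is_derive x 1 F (f x)) -> f x0 != 0 ->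
  (forall N, F (N%:R * T) = N%:R * F T) /\ 0 < F T.
Proof.
move=> T0 fc f0 fper F0 FD fx0.
have FT x : F (x + T) - F x = F T.
  have D (z : R) : is_derive z 1 (fun t => F (t + T) - F t) 0.
    have sh : is_derive z 1 (fun t => t + T) 1.
      by apply: drE (drD (drI z) (drC T z)) _; rewrite addr0.
    by apply: drE (drB (dr_comp (FD _) sh) (FD z)) _; rewrite mulr1 fper subrr.
  by have := derive0_eq D x 0; rewrite add0r F0 subr0.
have Fmono a b : a <= b -> F a <= F b.
  by move=> ab; apply: nondecreasing_deriv ab (fun x _ => FD x) (fun x _ => f0 x).
split.
  elim=> [|N IH]; first by rewrite !mul0r F0.
  by rewrite -addn1 natrD !mulrDl !mul1r -IH -(FT (N%:R * T)); ring.
have F00 : 0 <= F T by rewrite -F0 Fmono // ltW.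
rewrite lt_neqAle F00 andbT; apply/eqP => FT0.
have sz : 0 < f x0 by rewrite lt_neqAle eq_sym fx0 f0.
have [d d0 dP'] : exists2 d : R, 0 < d & forall y, `|y - x0| < d -> 0 < f y.
  have /cvgrPdist_lt /(_ _ sz) := fc x0.
  move=> /nbhs_ballP[d d0 H]; exists d => // y yz.
  have : `|f x0 - f y| < f x0 by apply: H; rewrite /ball /= distrC.
  by rewrite ltr_norml => /andP[_]; lra.
pose r := Num.min (d / 2) T.
have r0 : 0 < r by rewrite lt_min divr_gt0.
have zr : x0 <= x0 + r by rewrite lerDl ltW.
have [c /andP[c1 c2] e] := mean_value zr (fun x _ => FD x).
have rd : r <= d / 2 by rewrite ge_min lexx.
have rT : r <= T by rewrite ge_min lexx orbT.
have sc : 0 < f c by apply: dP'; rewrite ltr_norml; apply/andP; split; lra.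
have h1 : 0 < F (x0 + r) - F x0 by rewrite e mulr_gt0 // addrC addKr.
have h2 : F (x0 + r) <= F (x0 + T) by apply: Fmono; rewrite lerD2l.
have := FT x0; rewrite -FT0; lra.
Qed.

(** The cutoff is the primitive [p] of the positive part, evaluated at [1 - x ^+ 2]. It is
    continuously differentiable, which suffices since the operator has order one. *)
Lemma cutoff : exists chi dchi : R -> R, exists b0 B : R,
  [/\ 0 < b0, 0 < B, continuous dchi & forall x : R, is_derive x 1 chi (dchi x)] /\
  [/\ forall x, 0 <= chi x <= B, forall x, `|dchi x| <= 2,
      forall x, `|x| <= 1 / 2 -> b0 <= chi x, forall x, 1 < `|x| -> chi x = 0 &
      forall x, 1 < `|x| -> dchi x = 0].
Proof.
pose m (t : R) := Num.max 0 t.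
have mE t : m t = (t + `|t|) / 2.
  rewrite /m; case: (leP 0 t) => t0; first by rewrite ger0_norm //; field.
  by rewrite ltr0_norm // subrr mul0r.
have mc : continuous m.
  rewrite (_ : m = fun t => (t + `|t|) / 2); last by apply/funext => t; exact: mE.
  move=> t; apply: cvgM; last exact: cvg_cst.
  by apply: cvgD; [exact: cvg_id|exact: norm_continuous].
have m0 t : 0 <= m t by rewrite /m le_max lexx.
have [p [p0 pD]] := antiderivative mc.
have pmono a b : a <= b -> p a <= p b.
  by move=> ab; apply: nondecreasing_deriv ab (fun x _ => pD x) (fun x _ => m0 x).
have pneg t : t <= 0 -> p t = 0.
  move=> t0; have [c /andP[_ c0]] := mean_value t0 (fun x _ => pD x).
  by rewrite p0 sub0r /m max_l // mul0r => /eqP; rewrite oppr_eq0 => /eqP.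
(* For [|x| <= 1/2] the argument [1 - x ^+ 2] is at least [3/4], so this value is the lower bound
   [b0]. *)
have p34 : 0 < p (3 / 4).
  have h : 3 / 8 <= 3 / 4 :> R by lra.
  have [c /andP[c1 c2] E] := mean_value h (fun x _ => pD x).
  have h0 : 0 <= p (3 / 8) by rewrite -p0; apply: pmono; lra.
  have : 0 < m c * (3 / 4 - 3 / 8).
    by rewrite mulr_gt0 //; [rewrite /m lt_max; apply/orP; right; lra|lra].
  rewrite -E; lra.
pose g (x : R) := 1 - x * x.
have gD (x : R) : is_derive x 1 g (- (2 * x)).
  by apply: drE (drB (drC 1 x) (drM (drI x) (drI x))) _; ring.
have gc : continuous g := dr_continuous gD.
have g1 x : g x <= 1 by rewrite /g gerBl -expr2 sqr_ge0.
have gneg x : 1 < `|x| -> g x <= 0.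
  by move=> x1; rewrite /g subr_le0 -expr2 -real_normK ?num_real // exprn_ege1 // ltW.
exists (fun x => p (g x)), (fun x => m (g x) * - (2 * x)), (p (3 / 4)), (p 1).
split; split => //.
- by apply: lt_le_trans p34 (pmono _ _ _); lra.
- move=> x; apply: cvgM; first by apply: (continuous_comp (gc x) (mc (g x))).
  by apply: cvgN; apply: cvgM; [exact: cvg_cst|exact: cvg_id].
- by move=> x; exact: dr_comp (pD _) (gD x).
- move=> x; rewrite pmono // andbT -(pneg 0 (lexx _)) //.
  have [gx|gx] := leP (g x) 0; first by rewrite !pneg.
  by rewrite pmono // ltW.
- move=> x; have [gx|gx] := leP (g x) 0; first by rewrite /m max_l // mul0r normr0.
  rewrite /m (max_r (ltW gx)) normrM normrN normrM (ger0_norm (ltW gx)) (ger0_norm (ler0n _ 2)).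
  have x1 : `|x| <= 1 by rewrite leNgt; apply/negP => /gneg; rewrite leNgt gx.
  have : g x * (2 * `|x|) <= 1 * (2 * 1).
    by apply: ler_pM; rewrite ?(ltW gx) ?mulr_ge0 // ler_wpM2l.
  by rewrite !mul1r mulr1.
- move=> x x1; apply: pmono; rewrite /g.
  have : `|x| ^+ 2 <= (1 / 2) ^+ 2 by rewrite ler_pXn2r ?nnegrE.
  by rewrite real_normK ?num_real // expr2; lra.
- by move=> x /gneg; exact: pneg.
- by move=> x /gneg gx; rewrite /m max_l // mul0r.
Qed.

(** A Weyl sequence: the Bloch solution is bounded, and cutting it off over a length [n] leaves a
    squared norm of order [n] against a squared residual of order [1 / n], since only the derivative
    of the cutoff survives. This contradicts the estimate from below contained in
    [resolvent_set]. *)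
Lemma bloch_spectrum (phi : R -> R) (T mu : R) (lam : C) (P : R -> 'cV[C]_2) :
  continuous phi -> 0 < T -> bloch phi T mu P (fun x => lam *: P x) ->
  (exists x, P x != 0) -> spectrum phi lam.
Proof.
move=> phic T0 [Pper [dP [PD PE]]] [x0 Px0] [_ [K HK]].
have PDm x : mder P x (dP x).
  by move=> i j; rewrite !ord1; exact: PD.
have Pc : mcont P := mder_mcont PDm.
have dPE x : dP x = a1inv *m (lam *: P x - a0 phi x *m P x) - (0 +i* mu) *: P x.
  rewrite (PE x) addrK mulmxA mul_a1inv_a1 mul1mx [dP x + _]addrC addrAC subrr add0r //.
have dPc : mcont dP.
  rewrite (_ : dP = fun x => a1inv *m (lam *: P x + - ((A0 + (phi x)%:C *: N0) *m P x)) + - ((0 +i* mu) *: P x)).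
    apply: mcontD; last by apply: mcontN; apply: mcontZ => //; exact: ccontC.
    apply: mcontM; first exact: mcontC.
    apply: mcontD; first by apply: mcontZ => //; exact: ccontC.
    apply: mcontN; apply: mcontM => //; apply: mcontD; first exact: mcontC.
    by apply: mcontZ; [exact: ccont_real|exact: mcontC].
  by apply/funext => x; rewrite dPE a0E.
pose E (x : R) := cexp ((0 +i* mu) * x%:C).
have ED x : cder E x ((0 +i* mu) * E x) by exact: cder_cexp.
have Ec : ccont E := cder_ccont ED.
have Eabs x : cabs (E x) = 1 by rewrite cabs_cexp cReM /= mul0r mulr0 subrr expR0.
pose Q x := E x *: P x.
pose dQ x := ((0 +i* mu) * E x) *: P x + E x *: dP x.
have QD x : mder Q x (dQ x) by exact: mderZ (ED x) (PDm x).
have Qc : mcont Q := mder_mcont QD.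
have dQc : mcont dQ.
  by apply: mcontD; apply: mcontZ => //; apply: ccontM => //; exact: ccontC.
have Qeq x : a1 *m dQ x + a0 phi x *m Q x = lam *: Q x.
  have -> : lam *: Q x = E x *: (lam *: P x) by rewrite /Q !scalerA mulrC.
  rewrite (PE x) /dQ /Q [_ * E x]mulrC -scalerA -scalerDr -!scalemxAr -scalerDr.
  by rewrite [_ + dP x]addrC.
have sQ x : sqn Q x = sqn P x by rewrite sqnZ Eabs expr1n mul1r.
have sQc : continuous (sqn Q) := sqn_cont Qc.
have Qper x : sqn Q (x + T) = sqn Q x by rewrite !sQ /sqn Pper.
have [M QM] := periodic_bounded T0 sQc Qper.
have [F [F0 FD]] := antiderivative sQc.
have [FN kap] : (forall N, F (N%:R * T) = N%:R * F T) /\ 0 < F T.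
  apply: (periodic_primitive T0 sQc (sqn_ge0 Q) Qper F0 FD (x0 := x0)).
  rewrite sQ; apply/eqP => s0; move/eqP: Px0; apply; apply/matrixP => i j; rewrite ord1 mxE.
  apply: cabs_eq0; apply/eqP; rewrite -sqrf_eq0 eq_le sqr_ge0 andbT -s0 /sqn (bigD1 i) //= lerDl.
  by apply: sumr_ge0 => k _; exact: sqr_ge0.
have [chi [dchi [b0 [B [[b00 B0 dchic chiD] [chi1 dchi1 chilow chis dchis]]]]]] := cutoff.
have chic : continuous chi := dr_continuous chiD.
have M0 : 0 <= M := le_trans (sqn_ge0 Q 0) (QM 0).
(* The factor two places the [N.+1] periods after [0] in the inner half of the support, where the
   cutoff is at least [b0]. *)
pose n (N : nat) : R := 2 * (N.+1%:R * T).
have n0 N : 0 < n N by rewrite mulr_gt0 // mulr_gt0 // ltr0n.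
pose c N (x : R) : C := (chi (x / n N))%:C.
pose dc N (x : R) : C := (dchi (x / n N) / n N)%:C.
have sc N (x : R) : is_derive x 1 (fun t => t / n N) (n N)^-1.
  by apply: drE (drM (drI x) (drC (n N)^-1 x)) _; rewrite mul1r mulr0 addr0.
have scc N : continuous (fun t : R => t / n N) := dr_continuous (sc N).
have cD N x : cder (c N) x (dc N x).
  by apply: cder_real; exact: dr_comp (chiD _) (sc N x).
have cc N : ccont (c N) := cder_ccont (cD N).
have dcc N : ccont (dc N).
  apply: ccont_real => x; apply: cvgM; last exact: cvg_cst.
  by apply: (continuous_comp (scc N x) (dchic _)).
have out N x : n N < `|x| -> 1 < `|x / n N|.
  by move=> xn; rewrite normrM (gtr0_norm (x := (n N)^-1)) ?invr_gt0 // ltr_pdivlMr // mul1r.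
pose U N x := c N x *: Q x.
pose dU N x := dc N x *: Q x + c N x *: dQ x.
have UD N x : mder (U N) x (dU N x) by exact: mderZ (cD N x) (QD x).
have Uc N : mcont (U N) := mder_mcont (UD N).
have dUc N : mcont (dU N) by apply: mcontD; exact: mcontZ.
have cabs_c N x : cabs (c N x) <= B.
  by have /andP[h1 h2] := chi1 (x / n N); rewrite cabs_real ger0_norm.
have cabs_dc N x : cabs (dc N x) <= 2 / n N.
  by rewrite cabs_real normrM (gtr0_norm (x := (n N)^-1)) ?invr_gt0 // ler_wpM2r ?invr_ge0 // ltW.
have cz N x : n N < `|x| -> c N x = 0 /\ dc N x = 0.
  by move=> /out xn; rewrite /c /dc chis ?dchis // mul0r.
have LU N : inL2 (U N).
  apply: (inL2_supported (n := n N)) => // [|x /cz[c0 _]]; first exact: ltW.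
  by rewrite /U c0 scale0r.
have LdU N : inL2 (dU N).
  apply: (inL2_supported (n := n N)) => // [|x /cz[c0 dc0]]; first exact: ltW.
  by rewrite /dU c0 dc0 !scale0r addr0.
have res N x : resL3 phi lam (U N) (dU N) x = dc N x *: (a1 *m Q x).
  rewrite /resL3 /opL3 /dU /U; move: (Q x) (dQ x) (Qeq x) => y z yz.
  rewrite mulmxDr -!scalemxAr.
  have -> : lam *: (c N x *: y) = c N x *: (lam *: y) by rewrite scalerA mulrC -scalerA.
  have H (u v t : 'cV[C]_2) : (u + v) + t - (v + t) = u by rewrite -[u + v + t]addrA addrK.
  by rewrite -yz scalerDr; exact: H.
have low N : ((b0 ^+ 2 * (N.+1%:R * F T))%:E <= sqnormL2 (U N))%E.
  have Gd (x : R) : is_derive x 1 (fun t => b0 ^+ 2 * F t) (b0 ^+ 2 * sqn Q x).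
    by apply: drE (drM (drC _ x) (FD x)) _; rewrite mul0r add0r.
  have := integral_ge_deriv (f := sqn (U N)) (g := fun x => b0 ^+ 2 * sqn Q x)
    (F := fun t => b0 ^+ 2 * F t) (a := 0) (b := N.+1%:R * T) (sqn_cont (Uc N)) _ Gd.
  rewrite F0 mulr0 subr0 FN; apply.
  - by move=> x; apply: cvgM; [exact: cvg_cst|exact: sQc].
  - by rewrite mulr_ge0 // ltW.
  - exact: sqn_ge0.
  - by move=> x; rewrite mulr_ge0 ?sqr_ge0 ?sqn_ge0.
  - move=> x /andP[x0' xN]; rewrite (sqnZ (c N) Q) ler_wpM2r ?sqn_ge0 //.
    rewrite ler_pXn2r ?nnegrE ?cabs_ge0 ?(ltW b00) // cabs_real.
    apply: le_trans (ler_norm _); apply: chilow.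
    rewrite normrM (gtr0_norm (x := (n N)^-1)) ?invr_gt0 // ler_pdivrMr // ger0_norm //.
    by rewrite /n; lra.
pose D := (2 * mnorm (@a1 R)) ^+ 2 * 8 * M.
have D0 : 0 <= D by rewrite mulr_ge0 // mulr_ge0 // sqr_ge0.
have upp N : (sqnormL2 (resL3 phi lam (U N) (dU N)) <= (D / n N)%:E)%E.
  pose V x := dc N x *: (a1 *m Q x).
  have VE : resL3 phi lam (U N) (dU N) = V by apply/funext => x; exact: res.
  have Vc : mcont V by apply: mcontZ => //; apply: mcontM => //; exact: mcontC.
  have Vle x : sqn V x <= (2 * mnorm (@a1 R) * (2 / n N)) ^+ 2 * M.
    rewrite (sqnZ (dc N)); apply: le_trans (_ : (2 / n N) ^+ 2 * (sqn (fun x => a1 *m Q x) x) <= _).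
      by rewrite ler_wpM2r ?sqn_ge0 // ler_pXn2r ?nnegrE ?cabs_ge0 // divr_ge0 // ltW.
    rewrite [X in _ <= X](_ : _ = (2 / n N) ^+ 2 * ((2 * mnorm (@a1 R)) ^+ 2 * M)); last by ring.
    rewrite ler_wpM2l ?sqr_ge0 //.
    apply: le_trans (sqn_le _ _) _.
    apply: le_trans (_ : (mnorm (@a1 R) * mnorm (Q x)) ^+ 2 <= _).
      by rewrite ler_pXn2r ?nnegrE ?mulr_ge0 ?mnorm_ge0 // mnormM.
    rewrite exprMn [leRHS](_ : _ = mnorm (@a1 R) ^+ 2 * (4 * M)); last by ring.
    rewrite ler_wpM2l ?sqr_ge0 //.
    have h1 : mnorm (Q x) = cabs (Q x 0 0) + cabs (Q x 1 0).
      rewrite /mnorm !big_ord_recl !big_ord0 !addr0; congr (cabs (Q x _ _) + cabs (Q x _ _)); exact/val_inj.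
    have h2 : sqn Q x = cabs (Q x 0 0) ^+ 2 + cabs (Q x 1 0) ^+ 2.
      rewrite /sqn !big_ord_recl big_ord0 addr0; congr (cabs (Q x _ _) ^+ 2 + cabs (Q x _ _) ^+ 2); exact/val_inj.
    have := QM x; rewrite h1 h2; have := sqr_ge0 (cabs (Q x 0 0) - cabs (Q x 1 0)).
    have := sqr_ge0 (cabs (Q x 0 0) + cabs (Q x 1 0)).
    rewrite !expr2; lra.
  have Vs x : n N < `|x| -> sqn V x = 0.
    by move=> /cz[_ dc0]; rewrite (sqnZ (dc N)) dc0 cabs0 expr0n mul0r.
  rewrite VE; apply: le_trans (integral_supported_le (sqn_cont Vc) (ltW (n0 N)) (sqn_ge0 V) Vle Vs) _.
  rewrite lee_fin le_eqVlt; apply/orP; left; apply/eqP; rewrite /D; field.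
  by rewrite gt_eqF.
have main N : b0 ^+ 2 * (N.+1%:R * F T) <= `|K| * (D / n N).
  rewrite -lee_fin; apply: le_trans (low N) _.
  apply: le_trans (HK (U N) (dU N) (mder_inH1 (UD N) (dUc N) (LU N) (LdU N))) _.
  apply: le_trans (_ : `|K|%:E * sqnormL2 (resL3 phi lam (U N) (dU N)) <= _)%E.
    apply: lee_wpmul2r; last by rewrite lee_fin ler_norm.
    by apply: integral_ge0 => x _; rewrite lee_fin; exact: sqn_ge0.
  by rewrite EFinM; apply: lee_wpmul2l; rewrite ?lee_fin.
pose z := `|K| * (D / n 0) / (b0 ^+ 2 * F T).
have bF : 0 < b0 ^+ 2 * F T by rewrite mulr_gt0 // exprn_gt0.
have z0 : 0 <= z by rewrite divr_ge0 ?(ltW bF) // mulr_ge0 // divr_ge0 // ltW.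
have /andP[_ ] := truncn_itv z0; set N := Num.truncn z.
rewrite /z ltr_pdivrMr // => hN.
have := main N; rewrite leNgt => /negP; apply.
apply: le_lt_trans (_ : `|K| * (D / n 0) < _); last by move: hN; rewrite [b0 ^+ 2 * (_ * _)]mulrCA.
rewrite ler_wpM2l // ler_wpM2l // lef_pV2 ?posrE // /n ler_wpM2l // ler_wpM2r ?(ltW T0) //.
by rewrite ler_nat.
Qed.
End BlochSpectrum.

(** * Algebraic multiplicity from a frame *)

Section TwoByTwo.
Context {R : realType}.
Local Notation C := R[i].

Definition tr2 (L : 'M[C]_2) : C := L 0 0 + L 1 1.
Definition det2 (L : 'M[C]_2) : C := L 0 0 * L 1 1 - L 0 1 * L 1 0.

(** Ordering the roots by their distance to [z] is what later selects the branch to be followed. *)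
Lemma quadratic_roots (t d z : C) : exists l1 l2 : C,
  [/\ l1 + l2 = t, l1 * l2 = d & cabs (l1 - z) <= cabs (l2 - z)].
Proof.
pose s := sqrtc (t ^+ 2 - 4 * d).
have sE : s ^+ 2 = t ^+ 2 - 4 * d by exact: sqr_sqrtc.
pose a := (t + s) / 2; pose b := (t - s) / 2.
have ab : a + b = t by rewrite /a /b; field.
have abd : a * b = d.
  have -> : a * b = (t ^+ 2 - s ^+ 2) / 4 by rewrite /a /b; field.
  by rewrite sE; field.
have [h|/ltW h] := leP (cabs (a - z)) (cabs (b - z)).
  by exists a, b.
by exists b, a; rewrite addrC mulrC.
Qed.

Lemma cv2_eq (u v : 'cV[C]_2) : u 0 0 = v 0 0 -> u 1 0 = v 1 0 -> u = v.
Proof.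
move=> h0 h1; apply/matrixP => i j; rewrite ord1.
case: (@splitP 1 1 i) => k; rewrite !ord1 => ik.
  by have -> : i = 0 by exact/val_inj.
by have -> : i = 1 by exact/val_inj.
Qed.
Lemma mulmx2E (A : 'M[C]_2) (v : 'cV[C]_2) i : (A *m v) i 0 = A i 0 * v 0 0 + A i 1 * v 1 0.
Proof.
rewrite mxE !big_ord_recl big_ord0 addr0.
by congr (A _ _ * v _ _ + A _ _ * v _ _); exact/val_inj.
Qed.

Lemma shift_mul (L : 'M[C]_2) (w : C) (v : 'cV[C]_2) : (L - w%:M) *m v = L *m v - w *: v.
Proof. by rewrite mulmxBl mul_scalar_mx. Qed.

Section Roots.
Variables (L : 'M[C]_2) (l1 l2 : C).
Hypotheses (trL : l1 + l2 = tr2 L) (detL : l1 * l2 = det2 L).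

Lemma cayley (v : 'cV[C]_2) : (L - l1%:M) *m ((L - l2%:M) *m v) = 0.
Proof.
apply: cv2_eq; rewrite [RHS]mxE !mulmx2E !mxE /= ?mulr1n ?mulr0n ?subr0 ?sub0r.
  have -> : L 1 1 = l1 + l2 - L 0 0 by rewrite trL /tr2; ring.
  have : det2 L = l1 * l2 by [].
  rewrite /det2 (_ : L 1 1 = l1 + l2 - L 0 0); last by rewrite trL /tr2; ring.
  move=> d; rewrite (_ : _ + _ = (- (L 0 0 * (l1 + l2 - L 0 0) - L 0 1 * L 1 0) + l1 * l2) * v 0 0).
    by rewrite d addNr mul0r.
  ring.
have -> : L 1 1 = l1 + l2 - L 0 0 by rewrite trL /tr2; ring.
have : det2 L = l1 * l2 by [].
rewrite /det2 (_ : L 1 1 = l1 + l2 - L 0 0); last by rewrite trL /tr2; ring.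
move=> d; rewrite (_ : _ + _ = (- (L 0 0 * (l1 + l2 - L 0 0) - L 0 1 * L 1 0) + l1 * l2) * v 1 0).
  by rewrite d addNr mul0r.
ring.
Qed.

Lemma shift_injective w (v : 'cV[C]_2) : w != l1 -> w != l2 -> (L - w%:M) *m v = 0 -> v = 0.
Proof.
move=> w1 w2; rewrite shift_mul => /eqP; rewrite subr_eq0 => /eqP Lv.
have S l : (L - l%:M) *m v = (w - l) *: v by rewrite shift_mul Lv scalerBl.
have := cayley v; rewrite S -scalemxAr S scalerA => /eqP; rewrite scalemx_eq0 => /orP[|/eqP//].
by rewrite mulf_eq0 !subr_eq0 (negPf w1) (negPf w2).
Qed.

Lemma root_eigenvector : exists2 v : 'cV[C]_2, v != 0 & L *m v = l1 *: v.
Proof.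
have [/eqP H|H] := eqVneq (L - l2%:M) 0.
  have E : L = l2%:M by apply/eqP; rewrite -subr_eq0.
  have l12 : l1 = l2.
    have := trL; rewrite /tr2 E !mxE /= mulr1n; by move/addIr.
  exists (delta_mx 0 0); last by rewrite E l12 mul_scalar_mx.
  by apply/eqP => /matrixP/(_ 0 0)/eqP; rewrite !mxE /= oner_eq0.
have [j Hj] : exists j, (L - l2%:M) *m (delta_mx j 0 : 'cV[C]_2) != 0.
  apply: contrapT => /forallNP N; move/eqP: H; apply.
  apply/matrixP => i j; have /negP/negPn/eqP := N j.
  by rewrite -colE => /matrixP/(_ i 0); rewrite !mxE.
exists ((L - l2%:M) *m delta_mx j 0) => //.
by apply/eqP; rewrite -subr_eq0 -shift_mul cayley.
Qed.

Lemma ker_line (v c : 'cV[C]_2) : l1 != l2 -> v != 0 -> L *m v = l1 *: v ->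
  L *m c = l1 *: c -> exists t, c = t *: v.
Proof.
move=> l12 v0 Lv Lc.
have d0 : v 0 0 * c 1 0 - v 1 0 * c 0 0 = 0.
  apply/eqP; apply/negPn/negP => d.
  have e i : L i 0 * v 0 0 + L i 1 * v 1 0 = l1 * v i 0.
    by rewrite -mulmx2E Lv mxE.
  have f i : L i 0 * c 0 0 + L i 1 * c 1 0 = l1 * c i 0.
    by rewrite -mulmx2E Lc mxE.
  have a0 : L 0 0 = l1.
    apply: (mulIf d); transitivity (c 1 0 * (L 0 0 * v 0 0 + L 0 1 * v 1 0) - v 1 0 * (L 0 0 * c 0 0 + L 0 1 * c 1 0)).
      by ring.
    by rewrite e f; ring.
  have a1' : L 1 1 = l1.
    apply: (mulIf d); transitivity (v 0 0 * (L 1 0 * c 0 0 + L 1 1 * c 1 0) - c 0 0 * (L 1 0 * v 0 0 + L 1 1 * v 1 0)).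
      by ring.
    by rewrite e f; ring.
  by move: trL; rewrite /tr2 a0 a1' => /addrI h; rewrite h eqxx in l12.
have [v00|v00] := eqVneq (v 0 0) 0.
  have v10 : v 1 0 != 0.
    by apply: contraNneq v0 => v10; apply/eqP/cv2_eq; rewrite [RHS]mxE.
  exists (c 1 0 / v 1 0); apply: cv2_eq; rewrite mxE; last by rewrite divfK.
  move: d0; rewrite v00 mulr0 mul0r sub0r => /eqP; rewrite oppr_eq0 mulf_eq0 (negPf v10) /=.
  by move/eqP.
exists (c 0 0 / v 0 0); apply: cv2_eq; rewrite mxE; first by rewrite divfK.
apply: (mulIf v00); rewrite mulrAC divfK //; apply/eqP; rewrite -subr_eq0 -d0; apply/eqP; ring.
Qed.

Fixpoint shift_pow w n (c : 'cV[C]_2) : 'cV[C]_2 :=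
  if n is n'.+1 then shift_pow w n' ((L - w%:M) *m c) else c.

(** By Cayley-Hamilton [(L - l1%:M) *m c] would be an eigenvector for both roots, so distinct roots
    admit no Jordan chain. *)
Lemma shift_pow_ker n c : l1 != l2 -> shift_pow l1 n c = 0 -> L *m c = l1 *: c.
Proof.
move=> l12; elim: n c => [|n IH] c /=.
  by move=> ->; rewrite mulmx0 scaler0.
move=> /IH; set b := (L - l1%:M) *m c => Lb.
have Lb2 : L *m b = l2 *: b.
  have := cayley c; rewrite -/b; have -> : (L - l1%:M) *m ((L - l2%:M) *m c) = (L - l2%:M) *m b.
    rewrite /b !shift_mul !mulmxBr -!scalemxAr.
    move: (L *m (L *m c)) (L *m c) => x y.
    apply/matrixP => i j; rewrite !mxE.
    by move: (x i j) (y i j) (c i j) => p q r; ring.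
  by rewrite shift_mul => /eqP; rewrite subr_eq0 => /eqP.
have : (l1 - l2) *: b = 0 by rewrite scalerBl -Lb Lb2 subrr.
move=> /eqP; rewrite scalemx_eq0 subr_eq0 (negPf l12) /= => /eqP b0.
by apply/eqP; rewrite -subr_eq0 -shift_mul -/b b0.
Qed.

Lemma shift_pow_inj w n c : w != l1 -> w != l2 -> shift_pow w n c = 0 -> c = 0.
Proof. by move=> w1 w2; elim: n c => [//|n IH] c /= /IH /shift_injective; exact. Qed.
End Roots.

End TwoByTwo.

Lemma scale_swap (R : realType) m n (a b : R[i]) (v : 'M[R[i]]_(m, n)) :
  a *: (b *: v) = b *: (a *: v).
Proof. by rewrite !scalerA mulrC. Qed.

(** * Generalized Bloch eigenfunctions as columns of a frame *)

Section FlowUnique.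
Context {R : realType}.
Local Notation C := R[i].

Lemma mder_opp_arg m n (F : R -> 'M[C]_(m, n)) (x : R) D : mder F (- x) D ->
  mder (fun t => F (- t)) x (- D).
Proof.
move=> h i j; have [h1 h2] := h i j; rewrite mxE; split; rewrite !ReImE.
  exact: (dr_opp_arg (f := fun t => complex.Re (F t i j))).
exact: (dr_opp_arg (f := fun t => complex.Im (F t i j))).
Qed.

Lemma flow_unique_line n (phi : R -> R) (P : R) (L : 'M[C]_n) (G Y Y' : R -> 'M[C]_(2, n)) :
  (forall x, `|phi x| <= P) -> flow phi L G Y -> flow phi L G Y' -> Y 0 = Y' 0 ->
  forall x, Y x = Y' x.
Proof.
move=> phiP hY hY' Y0 x; have [x0|x0] := leP 0 x; first exact: flow_unique phiP hY hY' Y0 x x0.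
have x0' : 0 <= - x by rewrite oppr_ge0 ltW.
have P0 : 0 <= P by exact: le_trans (normr_ge0 _) (phiP 0).
pose k := mnorm a1inv * (mnorm L + mnorm A0 + P * mnorm N0).
have k0 : 0 <= k by rewrite mulr_ge0 ?addr_ge0 ?mulr_ge0 ?mnorm_ge0.
have [c c0 cP] := @matrix_gronwall R 2 n (- x) k x0' k0.
pose D t := Y (- t) - Y' (- t).
have DD z : mder D z (- vf (phi (- z)) L 0 (D z)).
  by apply: mder_eq (mderB (mder_opp_arg (hY _)) (mder_opp_arg (hY' _))) _; rewrite opprK -(vfB _ _ (G (- z))) opprB addrC.
apply/eqP; rewrite -subr_eq0; apply/eqP; apply: mnorm_eq0.
have := cP _ _ 0 (lexx _) DD _ (- x); rewrite /D oppr0 opprK Y0 subrr mnorm0 addr0 mulr0; apply; last by rewrite x0' lexx.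
move=> t _; rewrite mnormN; apply: le_trans (mnorm_vf _ _ _ (phiP (- t))) _.
by rewrite mnorm0 mulr0.
Qed.

Lemma flow_shift n (phi : R -> R) (L : 'M[C]_n) (G Y : R -> 'M[C]_(2, n)) (T : R) :
  (forall x, phi (x + T) = phi x) -> flow phi L G Y ->
  flow phi L (fun x => G (x + T)) (fun x => Y (x + T)).
Proof.
move=> per h x i j.
have sh : is_derive x 1 (fun t : R => t + T) (1 : R).
  by apply: drE (drD (drI x) (drC T x)) _; rewrite addr0.
have [h1 h2] := h (x + T) i j; rewrite per in h1 h2.
split; first by apply: drE (dr_comp (g := fun t => t + T) h1 sh) _; rewrite mulr1.
by apply: drE (dr_comp (g := fun t => t + T) h2 sh) _; rewrite mulr1.
Qed.

Lemma flow_scale n (phi : R -> R) (L : 'M[C]_n) a (G Y : R -> 'M[C]_(2, n)) :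
  flow phi L G Y -> flow phi L (fun x => a *: G x) (fun x => a *: Y x).
Proof.
move=> h x; have := flow_lin a h (flow0 phi L) x; rewrite !addr0.
rewrite (_ : (fun x => a *: Y x + 0) = fun x => a *: Y x) //.
by apply/funext => t; rewrite addr0.
Qed.

Lemma flow_bloch_period n (phi : R -> R) (P T : R) (L : 'M[C]_n) (U : R -> 'M[C]_(2, n)) rho :
  (forall x, `|phi x| <= P) -> (forall x, phi (x + T) = phi x) ->
  flow phi L (fun=> 0) U -> U T = rho *: U 0 -> forall x, U (x + T) = rho *: U x.
Proof.
move=> phiP per h UT; apply: (flow_unique_line phiP (flow_shift per h)).
  apply: flow_ext (flow_scale rho h) => x; exact: scaler0.
by rewrite add0r.
Qed.
End FlowUnique.

Section BlochFlow.
Context {R : realType}.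
Local Notation C := R[i].
Variables (phi : R -> R) (Pb T mu : R).
Hypothesis phiP : forall x, `|phi x| <= Pb.
Hypothesis phiT : forall x, phi (x + T) = phi x.

Definition expi (k x : R) : C := cexp ((0 +i* k) * x%:C).
Lemma expiD k x y : expi k (x + y) = expi k x * expi k y.
Proof. by rewrite /expi -cexpD rmorphD mulrDr. Qed.
Lemma expiN k x : expi k (- x) * expi k x = 1.
Proof. by rewrite -expiD addNr /expi mulr0 cexp0. Qed.
Lemma expi0 k : expi k 0 = 1.
Proof. by rewrite /expi mulr0 cexp0. Qed.
Lemma cabs_expi k x : cabs (expi k x) = 1.
Proof. by rewrite cabs_cexp cReM /= mul0r mulr0 subrr expR0. Qed.
Lemma cder_expi k x : cder (expi k) x ((0 +i* k) * expi k x).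
Proof. exact: cder_cexp. Qed.
Lemma expi_neg k x : expi k (- x) = expi (- k) x.
Proof. by rewrite /expi; congr cexp; apply: complex_ext; rewrite !ReImE /=; ring. Qed.
Lemma cder_expiN k x : cder (fun t => expi k (- t)) x (- (0 +i* k) * expi k (- x)).
Proof.
rewrite (_ : (fun _ => _) = expi (- k)); last by apply/funext => t; exact: expi_neg.
apply: cder_eq (cder_expi _ _) _; rewrite expi_neg; congr (_ * _).
by apply: complex_ext => /=; rewrite ?oppr0.
Qed.

Definition bloch_eigenvalue (w : C) := exists2 P : R -> 'cV[C]_2,
  bloch phi T mu P (fun x => w *: P x) & exists x, P x != 0.

Lemma bloch_flow P Q w : bloch phi T mu P (fun x => Q x + w *: P x) ->
  flow phi (w%:M : 'M[C]_1) (fun x => expi mu x *: Q x) (fun x => expi mu x *: P x) /\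
  forall x, expi mu (x + T) *: P (x + T) = expi mu T *: (expi mu x *: P x).
Proof.
move=> [Pper [dP [PD PE]]]; split; last first.
  by move=> x; rewrite Pper expiD mulrC scalerA.
move=> x; have PDm : mder P x (dP x) by move=> i j; rewrite !ord1; exact: PD.
apply: mder_eq (mderZ (cder_expi mu x) PDm) _.
have := PE x; rewrite a0E => E.
have -> : vf (phi x) (w%:M : 'M[C]_1) (expi mu x *: Q x) (expi mu x *: P x) =
    expi mu x *: (a1inv *m ((Q x + w *: P x) - (A0 + (phi x)%:C *: N0) *m P x)).
  move: (expi mu x) (Q x) (P x) => a q p; rewrite /vf mul_mx_scalar [RHS]scalemxAr.
  congr (_ *m _); rewrite (addrC q) scalerBr scalerDr -scalemxAr.
  by rewrite (scale_swap w).
by rewrite E addrK mulmxA mul_a1inv_a1 mul1mx scalerDr scalerA addrC mulrC.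
Qed.

Lemma flow_bloch (L : 'M[C]_2) U (c : 'cV[C]_2) :
  flow phi L (fun=> 0) U -> U T = expi mu T *: U 0 ->
  bloch phi T mu (fun x => expi mu (- x) *: (U x *m c))
    (fun x => expi mu (- x) *: (U x *m (L *m c))).
Proof.
move=> UL UT; have Uper := flow_bloch_period phiP phiT UL UT.
split=> [x|].
  rewrite Uper -scalemxAl scalerA opprD expiD -mulrA expiN mulr1 //.
exists (fun x => (- (0 +i* mu) * expi mu (- x)) *: (U x *m c) +
   expi mu (- x) *: (vf (phi x) L 0 (U x) *m c)).
have D x : mder (fun x => expi mu (- x) *: (U x *m c)) x
    ((- (0 +i* mu) * expi mu (- x)) *: (U x *m c) + expi mu (- x) *: (vf (phi x) L 0 (U x) *m c)).
  by apply: mderZ (cder_expiN mu x) (mderMr c (UL x)).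
split=> [x i|x]; first exact: D.
rewrite scalerA mulNr scaleNr addrAC addNr add0r.
rewrite -!scalemxAr -scalerDr; congr (_ *: _).
by rewrite /vf addr0 a0E !mulmxA mul_a1_a1inv mul1mx mulmxBl -!mulmxA subrK.
Qed.

Variables (V L : 'M[C]_2) (U : R -> 'M[C]_2) (w : C).
Hypothesis UL : flow phi L (fun=> 0) U.
Hypothesis U0 : U 0 = V.
Hypothesis UT : U T = expi mu T *: V.
Hypothesis Vu : V \in unitmx.
Hypothesis contain : forall (d : 'cV[C]_2) Y,
  flow phi (w%:M : 'M[C]_1) (fun x => U x *m d) Y -> Y 0 = 0 -> Y T = 0 -> d = 0.

Let UT0 : U T = expi mu T *: U 0. Proof. by rewrite U0. Qed.

Lemma U_injective (c : 'cV[C]_2) : U 0 *m c = 0 -> c = 0.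
Proof. by rewrite U0 => /(congr1 (mulmx (invmx V))); rewrite mulKmx // mulmx0. Qed.

(** The frame conjugates [L^3_mu] near the chosen point to its matrix [L]: eigenfunction chains
    correspond to chains of coefficient vectors. The converse direction is an induction on the chain
    in which [contain] rules out everything outside the span of the columns. *)
Lemma in_ker_powP n P : in_ker_pow phi T mu w n P <->
  exists c, (forall x, P x = expi mu (- x) *: (U x *m c)) /\ shift_pow L w n c = 0.
Proof.
elim: n P => [|n IH] P /=.
  split=> [P0|[c [PE c0]] x]; last by rewrite PE c0 mulmx0 scaler0.
  by exists 0; split => // x; rewrite P0 mulmx0 scaler0.
split=> [[Q [PB /IH[c' [QE c'0]]]]|[c [PE cn]]]; last first.
  exists (fun x => expi mu (- x) *: (U x *m ((L - w%:M) *m c))).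
  split; last by apply/IH; exists ((L - w%:M) *m c).
  have -> : P = fun x => expi mu (- x) *: (U x *m c) by apply/funext.
  rewrite (_ : (fun xi => _ + _) = fun x => expi mu (- x) *: (U x *m (L *m c))).
    exact: (flow_bloch c UL UT0).
  apply/funext => x; rewrite shift_mul mulmxBr -scalemxAr scalerBr.
  by rewrite (scale_swap w) subrK.
have [F FT] := bloch_flow PB.
have G : flow phi (w%:M : 'M[C]_1) (fun x => U x *m c') (fun x => expi mu x *: P x).
  by apply: flow_ext F => x; rewrite QE scalerA mulrC expiN scale1r.
(* [p] matches the initial value, so that [Y] starts at zero. The Bloch condition makes it vanish at
   [T] as well, and [contain] then kills the forcing coefficient [d]. *)
pose p := invmx V *m P 0.
have Vp : V *m p = P 0 by rewrite /p mulKVmx.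
pose d := c' - (L - w%:M) *m p.
pose Y x := expi mu x *: P x - U x *m p.
have FY : flow phi (w%:M : 'M[C]_1) (fun x => U x *m d) Y.
  move=> x; apply: mder_eq (mderB (G x) (mderMr p (UL x))) _.
  have e1 (B : 'M[C]_2) : (U x *m L + 0 - B *m U x) *m p = U x *m (L *m p) - B *m (U x *m p).
    by rewrite addr0 mulmxBl !mulmxA.
  have e2 : U x *m d = U x *m c' - (U x *m (L *m p) - w *: (U x *m p)).
    by rewrite /d shift_mul !mulmxBr -scalemxAr.
  rewrite /vf -mulmxA e1 e2 -mulmxBr /Y !mul_mx_scalar; congr (_ *m _).
  rewrite mulmxBr scalerBr; move: (expi mu x *: P x) (U x *m p) (U x *m c') (U x *m (L *m p)).
  move=> y u v t; move: (_ *m y) (_ *m u) => ? ?.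
  by apply/matrixP => i j; rewrite !mxE; ring.
have Y0 : Y 0 = 0 by rewrite /Y expi0 scale1r U0 Vp subrr.
have YT : Y T = 0.
  have := FT 0; rewrite add0r expi0 scale1r => E.
  by rewrite /Y E UT -scalemxAl Vp subrr.
have d0 : d = 0 := contain FY Y0 YT.
have Yz x : Y x = 0.
  have H : flow phi (w%:M : 'M[C]_1) (fun x => U x *m d) (fun=> 0).
    by apply: flow_ext (flow0 _ _) => z; rewrite d0 mulmx0.
  exact: (@flow_unique_line _ 1 phi Pb _ _ Y (fun=> 0) phiP FY H Y0 x).
exists p; split.
  move=> x; have := Yz x; rewrite /Y => /eqP; rewrite subr_eq0 => /eqP <-.
  by rewrite scalerA expiN scale1r.
by move/eqP: d0; rewrite /d subr_eq0 => /eqP <-.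
Qed.

Lemma gen_eigenspaceP P : gen_eigenspace phi T mu w P <->
  exists c n, (forall x, P x = expi mu (- x) *: (U x *m c)) /\ shift_pow L w n c = 0.
Proof.
split=> [[n /in_ker_powP[c ?]]|[c [n ?]]]; first by exists c, n.
by exists n; apply/in_ker_powP; exists c.
Qed.

(** Through [gen_eigenspaceP] the generalized eigenspace at [w] is that of [L], whose dimension
    counts how often [w] is a root of the characteristic polynomial. *)
Lemma alg_mult_flow l1 l2 : l1 + l2 = tr2 L -> l1 * l2 = det2 L ->
  alg_mult phi T mu w ((l1 == w) + (l2 == w))%N.
Proof.
move=> trL detL.
have lin0 (c : 'cV[C]_2) : (forall x, expi mu (- x) *: (U x *m c) = 0) -> c = 0.
  by move=> /(_ 0); rewrite oppr0 expi0 scale1r; exact: U_injective.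
have one a b : a + b = tr2 L -> a * b = det2 L -> a = w -> b != w ->
    alg_mult phi T mu w 1.
  move=> tr det aw bw; have ab : a != b by rewrite aw eq_sym.
  have [v v0 Lv] := root_eigenvector tr det.
  exists (fun _ x => expi mu (- x) *: (U x *m v)); split.
    move=> c H i; rewrite ord1; have : c ord0 *: v = 0.
      apply: lin0 => x; have := H x; rewrite big_ord_recl big_ord0 addr0 => <-.
      by rewrite -scalemxAr scale_swap.
    by move/eqP; rewrite scalemx_eq0 (negPf v0) orbF => /eqP.
  apply/funext => P; apply/propext; split.
    move=> /gen_eigenspaceP[c [n [PE cn]]].
    have Lc : L *m c = a *: c.
      by apply: (shift_pow_ker tr det (n := n)) => //; rewrite aw.
    have [t ct] := ker_line tr ab v0 Lv Lc.
    exists (fun=> t) => x; rewrite big_ord_recl big_ord0 addr0 PE ct.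
    by rewrite -scalemxAr scale_swap.
  move=> [c PE]; apply/gen_eigenspaceP; exists (c ord0 *: v), 1%N; split.
    move=> x; rewrite PE big_ord_recl big_ord0 addr0.
    by rewrite -scalemxAr scale_swap.
  by rewrite /= shift_mul -scalemxAr Lv aw (scale_swap w) subrr.
have [w1|w1] := eqVneq l1 w; have [w2|w2] := eqVneq l2 w.
- exists (fun i x => expi mu (- x) *: (U x *m delta_mx i 0)); split.
    move=> c H.
    have : \col_i c i = 0.
      apply: lin0 => x; rewrite -[RHS](H x).
      rewrite [\col_i c i]matrix_sum_delta mulmx_sumr scaler_sumr.
      apply: eq_bigr => i _; rewrite big_ord_recl big_ord0 addr0 mxE.
      by rewrite -scalemxAr scale_swap.
    by move=> /matrixP E i; have := E i 0; rewrite !mxE.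
  apply/funext => P; apply/propext; split.
    move=> /gen_eigenspaceP[c [n [PE cn]]]; exists (fun i => c i 0) => x.
    rewrite PE {1}[c]matrix_sum_delta mulmx_sumr scaler_sumr.
    apply: eq_bigr => i _; rewrite big_ord_recl big_ord0 addr0.
    by rewrite -scalemxAr scale_swap.
  move=> [c PE]; apply/gen_eigenspaceP; exists (\col_i c i), 2%N; split.
    move=> x; rewrite PE [\col_i c i]matrix_sum_delta mulmx_sumr scaler_sumr.
    apply: eq_bigr => i _; rewrite big_ord_recl big_ord0 addr0 mxE.
    by rewrite -scalemxAr scale_swap.
  by have := cayley trL detL (\col_i c i); rewrite w1 w2 /=.
- exact: (one l1 l2).
- by apply: (one l2 l1) => //; rewrite ?(addrC l2) ?(mulrC l2).
exists (fun _ _ => 0); split; first by move=> c _ [].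
apply/funext => P; apply/propext; split.
  move=> /gen_eigenspaceP[c [n [PE cn]]]; exists (fun=> 0) => x.
  rewrite PE big_ord0 (shift_pow_inj trL detL _ _ cn) ?mulmx0 ?scaler0 //.
  by rewrite eq_sym.
  by rewrite eq_sym.
move=> [c PE]; apply/gen_eigenspaceP; exists 0, 0%N; split => // x.
by rewrite PE big_ord0 mulmx0 scaler0.
Qed.

Lemma flow_eigenvalue l : (exists2 c : 'cV[C]_2, c != 0 & L *m c = l *: c) ->
  bloch_eigenvalue l.
Proof.
move=> [c c0 Lc]; exists (fun x => expi mu (- x) *: (U x *m c)).
  have := flow_bloch c UL UT0; rewrite Lc.
  rewrite (_ : (fun x => _ *: (_ *m (l *: c))) = fun x => l *: (expi mu (- x) *: (U x *m c))) //.
  by apply/funext => x; rewrite -scalemxAr scale_swap.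
exists 0; rewrite oppr0 expi0 scale1r; apply: contra c0 => /eqP/U_injective->.
by rewrite eqxx.
Qed.

Lemma flow_spectrum l : 0 < T -> continuous phi -> (exists2 c : 'cV[C]_2, c != 0 & L *m c = l *: c) ->
  spectrum phi l.
Proof. by move=> T0 phic /flow_eigenvalue[P PF P0]; exact: (bloch_spectrum phic T0 PF P0). Qed.
End BlochFlow.

(** * Eigenvalues near a frame *)

Section LocalStructure.
Context {R : realType}.
Local Notation C := R[i].

Lemma expi_mul (k x : R) : expi k x = expi 1 (k * x).
Proof. by rewrite /expi; congr cexp; apply: complex_ext; rewrite !ReImE /=; ring. Qed.

Lemma cabs_expi_diff (a b : R) : cabs (expi 1 a - expi 1 b) <= 2 * `|a - b|.
Proof.
wlog ab : a b / b <= a.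
  move=> W; have [h|/ltW h] := leP b a; first exact: W.
  by rewrite cabs_distC distrC; exact: W.
have D x := cder_expi (R := R) 1 x.
have B x : cabs ((0 +i* 1) * expi 1 x) <= 1 :> R.
  by rewrite cabsM cabs_expi mulr1 cabs_imag normr1.
have P (f df : R -> R) : (forall x : R, is_derive x 1 f (df x)) ->
    (forall x, `|df x| <= 1) -> `|f a - f b| <= `|a - b|.
  move=> fd fle; have [x _ ->] := mean_value ab (fun x _ => fd x).
  by rewrite normrM ler_piMl.
apply: le_trans (cabs_le_ReIm _) _; rewrite !ReImE.
have h1 := P (fun x => complex.Re (expi 1 x)) (fun x => complex.Re ((0 +i* 1) * expi 1 x))
  (fun x => proj1 (D x)) (fun x => le_trans (Re_le_cabs _) (B x)).
have h2 := P (fun x => complex.Im (expi 1 x)) (fun x => complex.Im ((0 +i* 1) * expi 1 x))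
  (fun x => proj2 (D x)) (fun x => le_trans (Im_le_cabs _) (B x)).
by move: h1 h2; lra.
Qed.

(* [ga] is nonzero only at [mu0 = +-1], where the eigenvalue has a Jordan block. *)
Definition is_frame (mu0 : R) (z z' ga : C) (V : 'M[C]_2) (U0 : R -> 'M[C]_2) :=
  [/\ V \in unitmx, flow (fun=> 0) (mx22 z ga 0 z') (fun=> 0) U0, U0 0 = V &
      U0 per0 = expi mu0 per0 *: V] /\
  [/\ mcont U0, exists M, forall x, mnorm (U0 x) <= M,
      forcing_faithful U0 per0 (z%:M : 'M[C]_1) & forcing_faithful U0 per0 (z'%:M : 'M[C]_1)].

Lemma flow_mulr n p phi (L : 'M[C]_n) (L' : 'M[C]_p) G Y (c : 'M[C]_(n, p)) G' :
  flow phi L G Y -> (forall x, Y x *m (L *m c) + G x *m c = Y x *m (c *m L') + G' x) ->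
  flow phi L' G' (fun x => Y x *m c).
Proof.
move=> h H x; apply: mder_eq (mderMr c (h x)) _.
rewrite /vf -mulmxA; congr (_ *m _).
by rewrite mulmxBl mulmxDl -!mulmxA H.
Qed.

(** The first column decouples; once it vanishes, the coupling [ga] drops out of the equation for
    the second. *)
Lemma forcing_faithful_triangular (U0 : R -> 'M[C]_2) T z z' ga :
  forcing_faithful U0 T (z%:M : 'M[C]_1) -> forcing_faithful U0 T (z'%:M : 'M[C]_1) ->
  forcing_faithful U0 T (mx22 z ga 0 z').
Proof.
move=> N1 N2 Ga Y YF Y0 YT.
pose e0 : 'cV[C]_2 := delta_mx 0 0; pose e1 : 'cV[C]_2 := delta_mx 1 0.
have Le0 : mx22 z ga 0 z' *m e0 = e0 *m z%:M.
  by apply: cv2_eq; rewrite mulmx2E mul_mx_scalar !mxE /=; ring.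
have Le1 : mx22 z ga 0 z' *m e1 = ga *: e0 + e1 *m z'%:M.
  by apply: cv2_eq; rewrite mulmx2E mul_mx_scalar !mxE /=; ring.
have z0 (x : R) : `|(fun=> 0 : R) x| <= 0 by rewrite normr0.
have F0 : flow (fun=> 0) (z%:M : 'M[C]_1) (fun x => U0 x *m (Ga *m e0)) (fun x => Y x *m e0).
  by apply: flow_mulr YF _ => x; rewrite Le0 !mulmxA.
have G0 : Ga *m e0 = 0 by apply: N1 F0 _ _; rewrite ?Y0 ?YT mul0mx.
have Y00 x : Y x *m e0 = 0.
  apply: (@flow_unique_line _ 1 (fun=> 0) 0 _ _ (fun x => Y x *m e0) (fun=> 0) z0 F0 _ _ x).
    by apply: flow_ext (flow0 _ _) => t; rewrite G0 mulmx0.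
  by rewrite Y0 mul0mx.
have F1 : flow (fun=> 0) (z'%:M : 'M[C]_1) (fun x => U0 x *m (Ga *m e1)) (fun x => Y x *m e1).
  apply: flow_mulr YF _ => x.
  by rewrite Le1 mulmxDr -scalemxAr Y00 scaler0 add0r !mulmxA.
have G1 : Ga *m e1 = 0 by apply: N2 F1 _ _; rewrite ?Y0 ?YT mul0mx.
apply/matrixP => i j; rewrite [RHS]mxE.
have g0 : Ga i 0 = 0 by have /matrixP/(_ i 0) := G0; rewrite -colE !mxE.
have g1 : Ga i 1 = 0 by have /matrixP/(_ i 0) := G1; rewrite -colE !mxE.
case: (@splitP 1 1 j) => k; rewrite !ord1 => jk.
  by have -> : j = 0 by exact/val_inj.
by have -> : j = 1 by exact/val_inj.
Qed.

(** The product [(l1 - z) * (l2 - z)] is the characteristic polynomial at [z], of order [r], and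
    [l1] is the nearer root. At a double root, and in particular at a Jordan block, no better than a
    square root can be expected. *)
Lemma root_close (z z' ga : C) (L : 'M[C]_2) (r : R) l1 l2 : r <= 1 ->
  mnorm (L - mx22 z ga 0 z') <= r -> l1 + l2 = tr2 L -> l1 * l2 = det2 L ->
  cabs (l1 - z) <= cabs (l2 - z) ->
  cabs (l1 - z) ^+ 2 <= r * (cabs (z' - z) + cabs ga + 2) /\
  cabs (l2 - z') <= 2 * r + cabs (l1 - z).
Proof.
move=> r1 Lr tr det le12.
have e i j := le_trans (cabs_le_mnorm (L - mx22 z ga 0 z') i j) Lr.
have r0 : 0 <= r := le_trans (mnorm_ge0 _) Lr.
have e00 : cabs (L 0 0 - z) <= r by have := e 0 0; rewrite !mxE.
have e01 : cabs (L 0 1 - ga) <= r by have := e 0 1; rewrite !mxE.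
have e10 : cabs (L 1 0) <= r by have := e 1 0; rewrite !mxE /= subr0.
have e11 : cabs (L 1 1 - z') <= r by have := e 1 1; rewrite !mxE.
split; last first.
  have -> : l2 - z' = (L 0 0 - z) + (L 1 1 - z') - (l1 - z).
    have -> : l2 = L 0 0 + L 1 1 - l1 by rewrite -[L 0 0 + L 1 1]/(tr2 L) -tr; ring.
    by ring.
  have := cabsB ((L 0 0 - z) + (L 1 1 - z')) (l1 - z).
  have := cabsD (L 0 0 - z) (L 1 1 - z'); lra.
have -> : cabs (l1 - z) ^+ 2 = cabs (l1 - z) * cabs (l1 - z) by rewrite expr2.
apply: le_trans (ler_wpM2l (cabs_ge0 _) le12) _; rewrite -cabsM.
have -> : (l1 - z) * (l2 - z) = (L 0 0 - z) * ((L 1 1 - z') + (z' - z)) - ((L 0 1 - ga) + ga) * L 1 0.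
  have -> : (l1 - z) * (l2 - z) = l1 * l2 - (l1 + l2) * z + z ^+ 2 by ring.
  by rewrite tr det /tr2 /det2; ring.
apply: le_trans (cabsB _ _) _; rewrite !cabsM.
have h1 : cabs (L 0 0 - z) * cabs (L 1 1 - z' + (z' - z)) <= r * (1 + cabs (z' - z)).
  by apply: ler_pM; rewrite ?cabs_ge0 // (le_trans (cabsD _ _)) // lerD2r (le_trans e11).
have h2 : cabs (L 0 1 - ga + ga) * cabs (L 1 0) <= (1 + cabs ga) * r.
  by apply: ler_pM; rewrite ?cabs_ge0 // (le_trans (cabsD _ _)) // lerD2r (le_trans e01).
lra.
Qed.

Lemma near_per0 (t : R) : `|t - per0| <= 1 -> 0 <= t <= per0 + 1.
Proof. by rewrite ler_norml => /andP[h1 h2]; have := @per0_ge2 R => h3; apply/andP; split; lra. Qed.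

Variables (phi psi : R -> R -> R) (T : R -> R).
Hypothesis Hwave : forall h : R, - 6^-1 < h < 0 -> periodic_wave h (phi h) (psi h) (T h).

Lemma wave_small (eta : R) : 0 < eta -> exists2 h0 : R, 0 < h0 & forall h, - h0 < h < 0 ->
  [/\ - 6^-1 < h < 0, forall x, `|phi h x| <= eta & `|T h - per0| <= eta].
Proof.
move=> e0; have [h1 h10 H1] := period_close e0.
exists (Num.min (Num.min h1 6^-1) (eta ^+ 2 / 6)).
  by rewrite !lt_min h10 /= invr_gt0 ltr0n /= divr_gt0 // exprn_gt0.
move=> h /andP[hh h_neg].
have hr : - 6^-1 < h < 0.
  by rewrite h_neg andbT (le_lt_trans _ hh) // lerN2 !ge_min lexx orbT.
have hh1 : - h1 < h by rewrite (le_lt_trans _ hh) // lerN2 !ge_min lexx.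
have hh2 : - (eta ^+ 2 / 6) < h by rewrite (le_lt_trans _ hh) // lerN2 !ge_min lexx orbT.
split => //; last exact: (H1 h (phi h) (psi h) (T h) hr hh1 (Hwave hr)).
move=> x; have P := phi_sqr_le hr (Hwave hr) x.
rewrite -(@ler_pXn2r _ 2) ?nnegrE ?(ltW e0) // real_normK ?num_real //.
lra.
Qed.

Definition branch_at mu (z : C) (d : R) (V L : 'M[C]_2) U h :=
  [/\ flow (phi h) L (fun=> 0) U, U 0 = V, U (T h) = expi mu (T h) *: V &
      forall w, cabs (w - z) <= d -> forall (c : 'cV[C]_2) Y,
        flow (phi h) (w%:M : 'M[C]_1) (fun x => U x *m c) Y -> Y 0 = 0 -> Y (T h) = 0 -> c = 0].

(** This collects what the frame estimates give for all [(h, mu)] near [(0, mu0)]. The Lipschitz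
    constant in [mu] is uniform in [h]; the clause on [G] says that an approximate frame with
    residual [eps] has a matrix within [c * eps] of the true one; the last clause is the convergence
    to the frame of the rest state. *)
Lemma local_branch mu0 z z' ga V U0 : is_frame mu0 z z' ga V U0 ->
  exists (Lam : R -> R -> 'M[C]_2) (U : R -> R -> R -> 'M[C]_2) (d h0 c : R),
  [/\ 0 < d /\ 0 < h0,
    forall h mu, - h0 < h < 0 -> `|mu - mu0| < d ->
      branch_at mu z d V (Lam h mu) (U h mu) h,
    forall h mu mu', - h0 < h < 0 -> `|mu - mu0| < d -> `|mu' - mu0| < d ->
      mnorm (Lam h mu - Lam h mu') <= c * `|mu - mu'|,
    forall h mu L G Y eps, - h0 < h < 0 -> `|mu - mu0| < d ->
      mnorm (L - mx22 z ga 0 z') <= d -> flow (phi h) L G Y -> Y 0 = V ->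
      Y (T h) = expi mu (T h) *: V -> (forall x, mnorm (G x) <= eps) ->
      mnorm (Lam h mu - L) <= c * eps &
    forall r, 0 < r -> exists d' h0', [/\ 0 < d', 0 < h0' &
      forall h mu, - h0' < h < 0 -> `|mu - mu0| < d' ->
      mnorm (Lam h mu - mx22 z ga 0 z') <= r /\
      forall x, 0 <= x <= per0 + 1 -> mnorm (U h mu x - U0 x) <= r]].
Proof.
move=> [[Vu U0F U00 U0T] [U0c [M U0M] N1 N2]].
have per1 : 1 <= per0 :> R by have := @per0_ge2 R; lra.
have ND := forcing_faithful_triangular (ga := ga) N1 N2.
have [e1 e10 contain] := frame_contain per1 U0c U0M U0F U00 N1.
have [c c0 [e2 e20 uniq]] := frame_unique per1 U0c U0M U0F U00 ND.
have [k k0 close] := frame_close per1 U0M U0F U00.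
pose eta := Num.min (Num.min e1 e2) 1.
have eta0 : 0 < eta by rewrite !lt_min e10 e20 ltr01.
have eta1 : eta <= e1 by rewrite !ge_min lexx.
have eta2 : eta <= e2 by rewrite !ge_min lexx orbT.
have etale1 : eta <= 1 by rewrite !ge_min lexx orbT.
have rho_small (q : R) : 0 < q -> exists d h0, [/\ 0 < d, 0 < h0 &
    forall h mu, - h0 < h < 0 -> `|mu - mu0| < d ->
    cabs (expi mu (T h) - expi mu0 per0) <= q].
  move=> q0.
  pose d := Num.min 1 (q / 8 / (per0 + 1)).
  have P1 : 0 < per0 + 1 :> R by rewrite ltr_wpDl // ltW // per0_gt0.
  have d0 : 0 < d by rewrite lt_min ltr01 !divr_gt0.
  pose s := Num.min 1 (q / 8 / (`|mu0| + 1)).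
  have s0 : 0 < s by rewrite lt_min ltr01 !divr_gt0 // ltr_wpDl.
  have [h0 h00 H] := wave_small s0.
  exists d, h0; split => // h mu hh dmu; have [_ _ hT] := H h hh.
  rewrite [expi mu _]expi_mul [expi mu0 _]expi_mul.
  apply: le_trans (cabs_expi_diff _ _) _.
  have -> : mu * T h - mu0 * per0 = (mu - mu0) * T h + mu0 * (T h - per0) by ring.
  have t1 : `|T h| <= per0 + 1.
    have : `|T h - per0| <= 1 by apply: le_trans hT _; rewrite ge_min lexx.
    have := ler_normD (T h - per0) per0; rewrite subrK (gtr0_norm (@per0_gt0 R)); lra.
  have b1 : `|(mu - mu0) * T h| <= q / 8.
    rewrite normrM; apply: le_trans (_ : (q / 8 / (per0 + 1)) * (per0 + 1) <= _).
      apply: ler_pM => //; apply: ltW; apply: lt_le_trans dmu _; by rewrite ge_min lexx orbT.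
    by rewrite divfK // gt_eqF.
  have b2 : `|mu0 * (T h - per0)| <= q / 8.
    rewrite normrM; apply: le_trans (_ : (`|mu0| + 1) * (q / 8 / (`|mu0| + 1)) <= _).
      apply: ler_pM => //; first by rewrite lerDl.
      by apply: le_trans hT _; rewrite ge_min lexx orbT.
    by rewrite mulrC divfK // gt_eqF // ltr_wpDl.
  have := ler_normD ((mu - mu0) * T h) (mu0 * (T h - per0)); lra.
have ex (r : R) : 0 < r -> exists d h0, [/\ 0 < d, 0 < h0 & forall h mu, - h0 < h < 0 ->
    `|mu - mu0| < d -> [/\ - 6^-1 < h < 0, forall x, `|phi h x| <= eta,
       `|T h - per0| <= eta & exists L U,
       [/\ mnorm (L - mx22 z ga 0 z') <= r, flow (phi h) L (fun=> 0) U, U 0 = V &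
        U (T h) = expi mu (T h) *: V]]].
  move=> r0; have [e e0 He] := frame_exists per1 U0c U0M U0F U00 U0T ND r0.
  have m0 : 0 < Num.min e eta by rewrite lt_min e0.
  have [h1 h10 H1] := wave_small m0; have [d [h2 [d0 h20 H2]]] := rho_small e e0.
  exists d, (Num.min h1 h2); split => //; first by rewrite lt_min h10.
  move=> h mu /andP[hh hn] dmu.
  have hh1 : - h1 < h < 0 by rewrite hn andbT (le_lt_trans _ hh) // lerN2 ge_min lexx.
  have hh2 : - h2 < h < 0 by rewrite hn andbT (le_lt_trans _ hh) // lerN2 ge_min lexx orbT.
  have [hr ph pT] := H1 h hh1.
  have me : Num.min e eta <= e by rewrite ge_min lexx.
  have meta : Num.min e eta <= eta by rewrite ge_min lexx orbT.
  split => //.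
  - by move=> x; exact: le_trans (ph x) meta.
  - exact: le_trans pT meta.
  apply: He.
  - exact: phi_cont (Hwave hr).
  - by move=> x; exact: le_trans (ph x) me.
  - exact: le_trans pT me.
  - exact: H2.
have [d [h0 [d0 h00 H]]] := ex eta eta0.
(* One frame is fixed for each [(h, mu)], with default zero outside the range, so that its matrix
   becomes a function of [h] and [mu]. *)
have sel h mu : exists LU : 'M[C]_2 * (R -> 'M[C]_2), - h0 < h < 0 -> `|mu - mu0| < d ->
    [/\ mnorm (LU.1 - mx22 z ga 0 z') <= eta, flow (phi h) LU.1 (fun=> 0) LU.2, LU.2 0 = V &
        LU.2 (T h) = expi mu (T h) *: V].
  have [hh|hh] := boolP (- h0 < h < 0); last by exists (0, fun=> 0).
  have [dd|dd] := boolP (`|mu - mu0| < d); last by exists (0, fun=> 0).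
  by have [_ _ _ [L [U LU]]] := H h mu hh dd; exists (L, U).
have [LU LUP0] := choice (fun p : R * R => sel p.1 p.2).
have LUP h mu : - h0 < h < 0 -> `|mu - mu0| < d ->
    [/\ mnorm ((LU (h, mu)).1 - mx22 z ga 0 z') <= eta,
        flow (phi h) (LU (h, mu)).1 (fun=> 0) (LU (h, mu)).2, (LU (h, mu)).2 0 = V &
        (LU (h, mu)).2 (T h) = expi mu (T h) *: V] by exact: (LUP0 (h, mu)).
exists (fun h mu => (LU (h, mu)).1), (fun h mu => (LU (h, mu)).2).
pose K := mnorm (mx22 z ga 0 z') + 1.
have X0 : 0 <= per0 + 1 :> R by rewrite addr_ge0 // ltW // per0_gt0.
have K0 : 0 <= K by rewrite addr_ge0 ?mnorm_ge0.
have [c1 c10 distP] := @flow_dist R 2 (per0 + 1) K X0 K0.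
exists (Num.min d eta), h0, (c * (2 * (per0 + 1) * mnorm V + c1)).
have de (x : R) : x < Num.min d eta -> x < d by move=> /lt_le_trans; apply; rewrite ge_min lexx.
split.
- by rewrite lt_min d0 eta0.
- move=> h mu hh /de dd; have [_ ph pT _] := H h mu hh dd.
  have [L1 L2 L3 L4] := LUP h mu hh dd.
  split; [exact: L2|exact: L3|exact: L4|] => w wz cc Y YF Y0 YT.
  apply: (contain (phi h) (T h) _ _ w cc Y _ _ _ L2 L3 _ YF Y0 YT).
  + by move=> x; exact: le_trans (ph x) eta1.
  + exact: le_trans pT eta1.
  + exact: le_trans L1 eta1.
  + by apply: le_trans wz (le_trans _ eta1); rewrite ge_min lexx orbT.
- move=> h mu mu' hh /de dd /de dd'; have [_ ph pT _] := H h mu hh dd.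
  have [L1 L2 L3 L4] := LUP h mu hh dd; have [L1' L2' L3' L4'] := LUP h mu' hh dd'.
  have := uniq (phi h) (T h) _ _ _ _ (fun x => le_trans (ph x) eta2) (le_trans pT eta2)
    (le_trans L1 eta2) (le_trans L1' eta2) L2 L3 L2' L3'.
  move/le_trans; apply; apply: le_trans (_ : c * (2 * (per0 + 1) * mnorm V * `|mu - mu'|) <= _); last first.
    by rewrite mulrA ler_wpM2r // ler_wpM2l ?(ltW c0) // lerDl ltW.
  rewrite ler_wpM2l ?(ltW c0) // L4 L4' -scalerBl mnormZ.
  rewrite [leRHS]mulrAC; apply: ler_wpM2r; first exact: mnorm_ge0.
  rewrite (expi_mul mu) (expi_mul mu').
  apply: le_trans (cabs_expi_diff _ _) _; rewrite -mulrBl normrM.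
  rewrite [`|mu - mu'| * _]mulrC mulrA; apply: ler_wpM2r => //; apply: ler_wpM2l => //.
  have := ler_normD (T h - per0) per0; rewrite subrK (gtr0_norm (@per0_gt0 R)).
  by move/le_trans; apply; rewrite addrC lerD2l (le_trans pT).
- move=> h mu L G Y eps hh /de dd Le YF Y0 YT Geps; have [hr ph pT _] := H h mu hh dd.
  have [L1 L2 L3 L4] := LUP h mu hh dd.
  have {}Le : mnorm (L - mx22 z ga 0 z') <= eta by apply: le_trans Le _; rewrite ge_min lexx orbT.
  have z0 (x : R) : mnorm ((fun=> 0 : 'M[C]_2) x) <= 0 by rewrite mnorm0.
  have [Z [Z0 ZF]] := @flow_exists R 2 (phi h) L (fun=> 0) eta 0 (phi_cont (Hwave hr)) ph (mcontC _) z0 V.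
  have T01 : 0 <= T h <= per0 + 1.
    exact: near_per0 (le_trans pT etale1).
  have eps0 : 0 <= eps := le_trans (mnorm_ge0 _) (Geps 0).
  have YZ : mnorm (Y (T h) - Z (T h)) <= c1 * eps.
    have LK : mnorm L <= K.
      rewrite -[L](subrK (mx22 z ga 0 z')) (le_trans (mnormD _ _)) // /K addrC lerD2l.
      exact: le_trans Le etale1.
    have DF : flow (phi h) L G (fun x => Y x - Z x).
      have E1 : (fun x => Y x - Z x) = (fun x => -1 *: Z x + Y x).
        by apply/funext => x; rewrite scaleN1r addrC.
      by rewrite E1; apply: flow_ext (flow_lin (-1) ZF YF) => x; rewrite scaler0 add0r.
    have := @distP (phi h) L L G (fun=> 0) _ (fun=> 0) eps LK eps0 DF (flow0 _ L) _ (T h) T01.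
    rewrite /= !subr0 Y0 Z0 !subrr mnorm0 add0r; apply => t tX; split.
      exact: le_trans (ph t) etale1.
    by rewrite mul0mx mulmx0 mnorm0 mulr0 !add0r subr0; exact: Geps.
  have := uniq (phi h) (T h) _ _ _ _ (fun x => le_trans (ph x) eta2) (le_trans pT eta2)
    (le_trans L1 eta2) (le_trans Le eta2) L2 L3 ZF Z0.
  move/le_trans; apply; rewrite -mulrA ler_wpM2l ?(ltW c0) // L4 -YT.
  apply: le_trans YZ _; rewrite ler_wpM2r // lerDr mulr_ge0 ?mnorm_ge0 // mulr_ge0 //.
- move=> r r0.
pose r1 := Num.min eta (r / (k + 1)).
have k1 : 0 < k + 1 by rewrite ltr_wpDl // ltW.
have r10 : 0 < r1 by rewrite lt_min eta0 divr_gt0.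
have r1e : r1 <= eta by rewrite ge_min lexx.
have r1r : (k + 1) * r1 <= r by rewrite mulrC -ler_pdivlMr // ge_min lexx orbT.
have k1r : k * r1 <= r by apply: le_trans r1r; rewrite ler_wpM2r ?(ltW r10) // lerDl.
have r1r' : r1 <= r by apply: le_trans r1r; rewrite ler_peMl ?(ltW r10) // lerDr ltW.
have [d' [h0' [d0' h00' H']]] := ex r1 r10.
have [h3 h30 H3] := wave_small r10.
exists (Num.min d d'), (Num.min (Num.min h0 h0') h3); split.
- by rewrite lt_min d0.
- by rewrite !lt_min h00 h00'.
move=> h mu /andP[hh hn] dd.
have hh0 : - h0 < h < 0 by rewrite hn andbT (le_lt_trans _ hh) // lerN2 !ge_min lexx.
have hh1 : - h0' < h < 0 by rewrite hn andbT (le_lt_trans _ hh) // lerN2 !ge_min lexx !orbT.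
have hh3 : - h3 < h < 0 by rewrite hn andbT (le_lt_trans _ hh) // lerN2 !ge_min lexx !orbT.
have dd0 : `|mu - mu0| < d by apply: lt_le_trans dd _; rewrite ge_min lexx.
have dd1 : `|mu - mu0| < d' by apply: lt_le_trans dd _; rewrite ge_min lexx orbT.
have [_ ph pT [L' [U' [L1' L2' L3' L4']]]] := H' h mu hh1 dd1.
have [L1 L2 L3 L4] := LUP h mu hh0 dd0.
have [_ ph3 _] := H3 h hh3.
(* Uniqueness identifies the fixed choice with the frame found in the smaller ball, so it is the
   chosen branch itself that converges. *)
have E : (LU (h, mu)).1 = L'.
  apply/eqP; rewrite -subr_eq0; apply/eqP; apply: mnorm_eq0.
  have := uniq (phi h) (T h) _ _ _ _ (fun x => le_trans (ph x) eta2) (le_trans pT eta2)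
    (le_trans L1 eta2) (le_trans L1' (le_trans r1e eta2)) L2 L3 L2' L3'.
  by rewrite L4 L4' subrr mnorm0 mulr0.
have Lr : mnorm ((LU (h, mu)).1 - mx22 z ga 0 z') <= r1 by rewrite E.
split; first exact: le_trans Lr r1r'.
move=> x xX; apply: le_trans k1r.
apply: (close r1 (phi h) (LU (h, mu)).1 (LU (h, mu)).2 _ ph3 Lr L2 L3 x xX).
by rewrite (ltW r10) (le_trans r1e).
Qed.
End LocalStructure.

(** * Counting perturbed eigenvalues with multiplicity *)

Section Perturbed.
Context {R : realType}.
Local Notation C := R[i].
Variables (phi psi : R -> R -> R) (T : R -> R).
Hypothesis Hwave : forall h : R, - 6^-1 < h < 0 -> periodic_wave h (phi h) (psi h) (T h).

Lemma cvg_at_left0 (f : R -> R) (l : R) : (forall e, 0 < e -> exists2 h1 : R, 0 < h1 &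
  forall h, - h1 < h < 0 -> `|f h - l| <= e) -> f h @[h --> 0^'-] --> l.
Proof.
move=> H; apply/cvgrPdist_le => e e0; have [h1 h10 P] := H e e0.
near=> h; rewrite distrC; apply: P; apply/andP; split; near: h.
  by apply: nbhs_left_gt; rewrite oppr_lt0.
exact: nbhs_left_lt.
Unshelve. all: by end_near. Qed.

Lemma branch_roots mu0 z z' ga V U0 : is_frame mu0 z z' ga V U0 ->
  exists (l1 l2 : R -> C) (d h0 : R), [/\ 0 < d, 0 < h0,
    forall h w, - h0 < h < 0 -> cabs (w - z) <= d ->
      alg_mult (phi h) (T h) mu0 w ((l1 h == w) + (l2 h == w))%N,
    forall h, - h0 < h < 0 -> spectrum (phi h) (l1 h) /\ spectrum (phi h) (l2 h) &
    forall e, 0 < e -> exists2 h1 : R, 0 < h1 & forall h, - h1 < h < 0 ->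
      cabs (l1 h - z) <= e /\ cabs (l2 h - z') <= e].
Proof.
move=> FR; have [[Vu _ _ _] _] := FR.
have [Lam [U [d [h0 [c [[d0 h00] BR _ _ CL]]]]]] := local_branch Hwave FR.
have [l lP] := choice (fun h => quadratic_roots (tr2 (Lam h mu0)) (det2 (Lam h mu0)) z).
have [l' lP'] := choice lP.
have [h2 h20 H2] := wave_small Hwave ltr01.
have mm : `|mu0 - mu0| < d by rewrite subrr normr0.
have hm h : - Num.min h0 h2 < h < 0 -> - h0 < h < 0 /\ - h2 < h < 0.
  move=> /andP[hh hn]; rewrite hn !andbT.
  by split; rewrite (le_lt_trans _ hh) // lerN2 ge_min lexx ?orbT.
exists l, l', d, (Num.min h0 h2); split.
- exact: d0.
- by rewrite lt_min h00.
- move=> h w /hm[hh hh2] wz; have [hr ph _] := H2 h hh2.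
  have [B1 B2 B3 B4] := BR h mu0 hh mm; have [t1 t2 _] := lP' h.
  by apply: (alg_mult_flow ph (wave_per (Hwave hr)) B1 B2 B3 Vu (B4 w wz) t1 t2).
- move=> h /hm[hh hh2]; have [hr ph _] := H2 h hh2.
  have [B1 B2 B3 B4] := BR h mu0 hh mm; have [t1 t2 _] := lP' h.
  have S x : (exists2 c : 'cV[C]_2, c != 0 & Lam h mu0 *m c = x *: c) -> spectrum (phi h) x.
    by apply: (flow_spectrum ph (wave_per (Hwave hr)) B1 B2 B3 Vu (wave_T0 (Hwave hr)) (phi_cont (Hwave hr))).
  split; apply: S; first by have [v v0 Lv] := root_eigenvector t1 t2; exists v.
  rewrite addrC in t1; rewrite mulrC in t2.
  by have [v v0 Lv] := root_eigenvector t1 t2; exists v.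
move=> e e0; pose K := cabs (z' - z) + cabs ga + 2.
have K0 : 0 < K by rewrite ltr_wpDl // addr_ge0 ?cabs_ge0.
pose r := Num.min (Num.min 1 (e / 4)) ((e / 2) ^+ 2 / K).
have r0 : 0 < r by rewrite !lt_min ltr01 !divr_gt0 // exprn_gt0 // divr_gt0.
have r1 : r <= 1 by rewrite !ge_min lexx.
have r2 : r <= e / 4 by rewrite !ge_min lexx orbT.
have r3 : r * K <= (e / 2) ^+ 2 by rewrite -ler_pdivlMr // !ge_min lexx !orbT.
have [d' [h' [d'0 h'0 P]]] := CL r r0.
exists h' => // h hh; have [Lr _] := P h mu0 hh ltac:(by rewrite subrr normr0).
have [t1 t2 t3] := lP' h; have [q1 q2] := root_close r1 Lr t1 t2 t3.
have q3 : cabs (l h - z) <= e / 2.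
  rewrite -(@ler_pXn2r _ 2) ?nnegrE ?cabs_ge0 //; first exact: le_trans q1 r3.
  by rewrite divr_ge0 // ltW.
split; first by apply: le_trans q3 _; lra.
by apply: le_trans q2 _; lra.
Qed.

Lemma frame_perturbed2 mu0 z ga V U0 : is_frame mu0 z z ga V U0 -> perturbed phi T mu0 z 2.
Proof.
move=> /branch_roots[l1 [l2 [d [h0 [d0 h00 AM SP CV]]]]].
exists (fun i => if i == 0 then l1 else l2); split.
  move=> i; apply: cvg_at_left0 => e e0; have [h1 h10 P] := CV e e0.
  exists h1 => // h hh; have [p1 p2] := P h hh.
  by rewrite subr0 ger0_norm ?cabs_ge0 //; case: (i == 0).
have d2 : 0 < d / 2 by rewrite divr_gt0.
have [h1 h10 P] := CV (d / 2) d2.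
exists d, (Num.min h0 h1); split => //; first by rewrite lt_min h00.
move=> h /andP[hh hn].
have hh0 : - h0 < h < 0 by rewrite hn andbT (le_lt_trans _ hh) // lerN2 ge_min lexx.
have hh1 : - h1 < h < 0 by rewrite hn andbT (le_lt_trans _ hh) // lerN2 ge_min lexx orbT.
have [p1 p2] := P h hh1; have [s1 s2] := SP h hh0.
split.
  by move=> i; case: (i == 0); split => //; [apply: le_lt_trans p1 _|apply: le_lt_trans p2 _]; lra.
move=> w wz; have := AM h w hh0 (ltW wz).
by rewrite -sum1dep_card big_mkcond !big_ord_recl big_ord0 /= addn0; case: (l1 h == w); case: (l2 h == w).
Qed.

Lemma frame_perturbed1 mu0 z z' ga V U0 : z' != z -> is_frame mu0 z z' ga V U0 ->
  perturbed phi T mu0 z 1.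
Proof.
move=> zz /branch_roots[l1 [l2 [d [h0 [d0 h00 AM SP CV]]]]].
exists (fun=> l1); split.
  move=> i; apply: cvg_at_left0 => e e0; have [h1 h10 P] := CV e e0.
  by exists h1 => // h hh; have [p1 p2] := P h hh; rewrite subr0 ger0_norm ?cabs_ge0.
have zz0 : 0 < cabs (z' - z) by rewrite cabs_gt0 // subr_eq0.
(* In this disc only [l1] is counted: the second root is close to [z'] and stays outside. *)
pose r := Num.min d (cabs (z' - z) / 2).
have r0 : 0 < r by rewrite lt_min d0 divr_gt0.
have r2 : 0 < r / 2 by rewrite divr_gt0.
have [h1 h10 P] := CV (r / 2) r2.
exists r, (Num.min h0 h1); split => //; first by rewrite lt_min h00.
move=> h /andP[hh hn].
have hh0 : - h0 < h < 0 by rewrite hn andbT (le_lt_trans _ hh) // lerN2 ge_min lexx.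
have hh1 : - h1 < h < 0 by rewrite hn andbT (le_lt_trans _ hh) // lerN2 ge_min lexx orbT.
have [p1 p2] := P h hh1; have [s1 s2] := SP h hh0.
split; first by split => //; apply: le_lt_trans p1 _; lra.
move=> w wz.
have wd : cabs (w - z) <= d by apply: le_trans (ltW wz) _; rewrite ge_min lexx.
have l2w : (l2 h == w) = false.
  apply/negP => /eqP l2w; have rz : r <= cabs (z' - z) / 2 by rewrite ge_min lexx orbT.
  have := cabs_triangle w z' z; rewrite [cabs (z' - w)]cabs_distC.
  rewrite -l2w in wz *; lra.
have := AM h w hh0 wd; rewrite l2w addn0.
by rewrite -sum1dep_card big_mkcond !big_ord_recl big_ord0 /= addn0; case: (l1 h == w).
Qed.
End Perturbed.

(** * Modes of the rest state *)

Section ConstantCoefficients.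
Context {R : realType}.
Local Notation C := R[i].

Definition ii : C := 0 +i* 1.
Lemma ii_sqr : ii * ii = -1. Proof. by apply: complex_ext; rewrite !ReImE /=; ring. Qed.
Lemma ii_neq0 : ii != 0.
Proof. by apply/eqP => /(congr1 (@complex.Im R)) /eqP; rewrite /= oner_eq0. Qed.
Lemma iiE (k : R) : 0 +i* k = ii * k%:C.
Proof. by apply: complex_ext; rewrite !ReImE /=; ring. Qed.

(* [symb k z] is the symbol of the linearization at the rest state minus [z];
   it is singular exactly when [disp k z = 0]. *)
Definition symb (k z : C) : 'M[C]_2 := (ii * k) *: a1 + A0 - z%:M.
Definition disp (k z : C) : C := z ^+ 2 - ii * k * z + 3 / 4 * k ^+ 2 - 1.

Lemma symbE k z : symb k z = mx22 (ii * k / 2 + 1 - z) (- (ii * k)) (- (ii * k)) (ii * k / 2 - 1 - z).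
Proof.
rewrite [LHS]mx22E /symb /a1 /A0.
by apply: mx22_eq; rewrite !mxE /= ?halfC ?mulr1n ?mulr0n; ring.
Qed.

(* The solution of [p' = i kap p + e ^ (i k x)] with [p 0 = 0]. *)
Definition duhamel (kap : C) (k x : R) : C :=
  if k%:C == kap then x%:C * cexp (ii * kap * x%:C)
  else (expi k x - cexp (ii * kap * x%:C)) / (ii * (k%:C - kap)).
Lemma duhamel0 kap k : duhamel kap k 0 = 0.
Proof. by rewrite /duhamel; case: ifP => _; rewrite ?mul0r // expi0 mulr0 cexp0 subrr mul0r. Qed.
Lemma cder_duhamel kap k x : cder (duhamel kap k) x (ii * kap * duhamel kap k x + expi k x).
Proof.
rewrite /duhamel; have [kE|kE] := eqVneq k%:C kap.
  apply: cder_eq (cderM (cder_real (drI x)) (cder_cexp (ii * kap) x)) _.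
  by rewrite rmorph1 mul1r [expi k x]/expi iiE kE; ring.
apply: cder_eq (cderM (cderB (cder_expi k x) (cder_cexp (ii * kap) x)) (cderC _ x)) _.
rewrite mulr0 addr0 iiE; move: (expi k x) (cexp _) => a b; field.
by rewrite ii_neq0 subr_eq0 kE.
Qed.

(** Subtracting the explicit particular solution leaves a multiple of an exponential that starts at
    zero. *)
Lemma scalar_resonance (kap : C) (k1 k2 : R) (g1 g2 : C) (p : R -> C) (S : R) :
  p 0 = 0 -> p S = 0 ->
  (forall x, cder p x (ii * kap * p x + (g1 * expi k1 x + g2 * expi k2 x))) ->
  g1 * duhamel kap k1 S + g2 * duhamel kap k2 S = 0.
Proof.
move=> p0 pS pD.
pose q x := p x - (g1 * duhamel kap k1 x + g2 * duhamel kap k2 x).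
have qD x : cder q x (ii * kap * q x).
  apply: cder_eq (cderB (pD x) (cderD (cderZ g1 (cder_duhamel kap k1 x)) (cderZ g2 (cder_duhamel kap k2 x)))) _.
  by rewrite /q; ring.
pose E x := cexp (- (ii * kap) * x%:C).
have ED x : cder E x (- (ii * kap) * E x) by exact: cder_cexp.
have Z x : cder (fun t => q t * E t) x 0.
  by apply: cder_eq (cderM (qD x) (ED x)) _; ring.
have q0 : q 0 = 0 by rewrite /q p0 !duhamel0 !mulr0 addr0 subrr.
have : q S * E S = 0 by rewrite (cder0_eq Z S 0) q0 mul0r.
move=> /eqP; rewrite mulf_eq0 (negPf (cexp_neq0 _)) orbF /q pS sub0r oppr_eq0.
by move/eqP.
Qed.

Definition forcing (d1 d2 : C) (k1 k2 : R) (v1 v2 : 'cV[C]_2) (x : R) : 'cV[C]_2 :=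
  (d1 * expi k1 x) *: v1 + (d2 * expi k2 x) *: v2.

Definition dot (y : 'rV[C]_2) (v : 'cV[C]_2) : C := (y *m v) 0 0.
Lemma dotD y u v : dot y (u + v) = dot y u + dot y v.
Proof. by rewrite /dot mulmxDr mxE. Qed.
Lemma dotZ y a v : dot y (a *: v) = a * dot y v.
Proof. by rewrite /dot -scalemxAr mxE. Qed.
Lemma dotA y (M : 'M[C]_2) v : dot (y *m M) v = dot y (M *m v).
Proof. by rewrite /dot mulmxA. Qed.

(** Pairing with a left null vector [y] of the symbol turns the system into one scalar equation for
    [y *m a1 *m P], with exponent [i kap]. *)
Lemma left_mode (lam kap : C) y d1 d2 k1 k2 v1 v2 P (S : R) :
  y *m symb kap lam = 0 ->
  flow (fun=> 0) (lam%:M : 'M[C]_1) (forcing d1 d2 k1 k2 v1 v2) P -> P 0 = 0 -> P S = 0 ->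
  d1 * dot y v1 * duhamel kap k1 S + d2 * dot y v2 * duhamel kap k2 S = 0.
Proof.
move=> yS PF P0 PS.
apply: (scalar_resonance (p := fun x => dot (y *m a1) (P x))).
- by rewrite P0 /dot mulmx0 mxE.
- by rewrite PS /dot mulmx0 mxE.
move=> x; have D := mderMl (y *m a1) (PF x) 0 0.
apply: cder_eq D _.
rewrite /vf scale0r addr0 mulmxA -[y *m a1 *m a1inv]mulmxA mul_a1_a1inv mulmx1 mul_mx_scalar.
rewrite -/(dot _ _) !dotD -[- (A0 *m P x)]scaleN1r !dotZ.
have E : dot y (A0 *m P x) = lam * dot y (P x) - ii * kap * dot (y *m a1) (P x).
  have : dot (y *m symb kap lam) (P x) = 0 by rewrite yS /dot mul0mx mxE.
  rewrite dotA /symb mulmxBl mulmxDl -scalemxAl mul_scalar_mx -[- (lam *: _)]scaleN1r.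
  by rewrite !dotD !dotZ -!dotA => H; apply/eqP; rewrite -subr_eq0 -H; apply/eqP; ring.
by rewrite E; ring.
Qed.

Variable mu0 : R.
Definition congr_mode (k : R) := expi k per0 = expi mu0 per0 :> C.

Lemma duhamel_same (k : R) : duhamel k%:C k per0 != 0.
Proof.
rewrite /duhamel eqxx mulf_neq0 ?cexp_neq0 //.
by apply/eqP => /(congr1 (@complex.Re R)) /eqP; rewrite /= gt_eqF // per0_gt0.
Qed.
Lemma duhamel_other (k k' : R) : congr_mode k -> congr_mode k' -> k != k' ->
  duhamel k%:C k' per0 = 0.
Proof.
move=> hk hk' kk; rewrite /duhamel ifF; last first.
  by apply/negP => /eqP/complexI e; rewrite e eqxx in kk.
by rewrite -iiE -/(expi k per0) hk hk' subrr mul0r.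
Qed.
Lemma duhamel_neq0 (kap : C) (k : R) : congr_mode k -> cexp (ii * kap * per0%:C) != expi mu0 per0 ->
  duhamel kap k per0 != 0.
Proof.
move=> hk nk; have kk : k%:C != kap.
  by apply/eqP => e; move: nk; rewrite -e -iiE -/(expi k per0) hk eqxx.
rewrite /duhamel (negPf kk) mulf_neq0 // ?invr_neq0 ?mulf_neq0 ?ii_neq0 ?subr_eq0 //.
by rewrite hk eq_sym.
Qed.

(** The second row of the adjugate of [symb kap lam]; [null_row'] is the first. Both forms serve
    because rows of one kind for different [kap] become proportional at [lam = 1], and those of the
    other kind at [lam = -1]. *)
Definition null_row (kap lam : C) : 'rV[C]_2 :=
  \row_j (if j == 0 then ii * kap else ii * kap / 2 + 1 - lam).
Definition null_row' (kap lam : C) : 'rV[C]_2 :=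
  \row_j (if j == 0 then ii * kap / 2 - 1 - lam else ii * kap).

Lemma rv2_eq (u v : 'rV[C]_2) : u 0 0 = v 0 0 -> u 0 1 = v 0 1 -> u = v.
Proof.
move=> h0 h1; apply/matrixP => i j; rewrite ord1.
case: (@splitP 1 1 j) => k; rewrite !ord1 => ik.
  by have -> : j = 0 by exact/val_inj.
by have -> : j = 1 by exact/val_inj.
Qed.
Lemma rowmul2E (y : 'rV[C]_2) (M : 'M[C]_2) j : (y *m M) 0 j = y 0 0 * M 0 j + y 0 1 * M 1 j.
Proof.
rewrite mxE !big_ord_recl big_ord0 addr0.
by congr (y _ _ * M _ _ + y _ _ * M _ _); exact/val_inj.
Qed.
Lemma dotE (y : 'rV[C]_2) (v : 'cV[C]_2) : dot y v = y 0 0 * v 0 0 + y 0 1 * v 1 0.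
Proof.
rewrite /dot mxE !big_ord_recl big_ord0 addr0.
by congr (y _ _ * v _ _ + y _ _ * v _ _); exact/val_inj.
Qed.

Lemma disp_prod kap lam : disp kap lam = 0 ->
  (ii * kap / 2 + 1 - lam) * (ii * kap / 2 - 1 - lam) = (ii * kap) * (ii * kap).
Proof.
move=> D; have -> : (ii * kap / 2 + 1 - lam) * (ii * kap / 2 - 1 - lam) =
    (ii * ii) * kap ^+ 2 / 4 - ii * kap * lam + lam ^+ 2 - 1 by field.
have E : lam ^+ 2 = ii * kap * lam - 3 / 4 * kap ^+ 2 + 1.
  by apply/eqP; rewrite -subr_eq0; apply/eqP; rewrite -D /disp; ring.
have -> : ii * kap * (ii * kap) = (ii * ii) * kap ^+ 2 by ring.
by rewrite E ii_sqr; field.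
Qed.

Lemma null_rowP kap lam : disp kap lam = 0 -> null_row kap lam *m symb kap lam = 0.
Proof.
move=> /disp_prod D; rewrite symbE.
apply: rv2_eq; rewrite rowmul2E !mxE /=; first by ring.
by rewrite D; ring.
Qed.
Lemma null_rowP' kap lam : disp kap lam = 0 -> null_row' kap lam *m symb kap lam = 0.
Proof.
move=> /disp_prod D; rewrite symbE.
apply: rv2_eq; rewrite rowmul2E !mxE /=; last by ring.
by rewrite [_ * (_ + 1 - lam)]mulrC D; ring.
Qed.

Lemma null_rows (ka kb lam : C) : ka != kb -> disp ka lam = 0 -> disp kb lam = 0 ->
  exists ya yb : 'rV[C]_2, [/\ ya *m symb ka lam = 0, yb *m symb kb lam = 0 &
    forall c, dot ya c = 0 -> dot yb c = 0 -> c = 0].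
Proof.
move=> kab Da Db.
have solve (p q r s : C) (c : 'cV[C]_2) : p * s - q * r != 0 ->
    p * c 0 0 + q * c 1 0 = 0 -> r * c 0 0 + s * c 1 0 = 0 -> c = 0.
  move=> d e1 e2; apply: cv2_eq; rewrite [RHS]mxE.
    apply: (mulfI d); rewrite mulr0.
    transitivity (s * (p * c 0 0 + q * c 1 0) - q * (r * c 0 0 + s * c 1 0)); first by ring.
    by rewrite e1 e2 !mulr0 subrr.
  apply: (mulfI d); rewrite mulr0.
  transitivity (p * (r * c 0 0 + s * c 1 0) - r * (p * c 0 0 + q * c 1 0)); first by ring.
  by rewrite e1 e2 !mulr0 subrr.
have [l1|l1] := eqVneq lam 1.
  have lN1 : 1 + lam != 0 by rewrite l1 -(natrD _ 1 1) pnatr_eq0.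
  exists (null_row' ka lam), (null_row' kb lam); split; try exact: null_rowP'.
  move=> c; rewrite !dotE !mxE /=; apply: solve.
  rewrite (_ : _ - _ = ii * (1 + lam) * (ka - kb)); last by ring.
  by rewrite !mulf_neq0 ?ii_neq0 ?subr_eq0.
exists (null_row ka lam), (null_row kb lam); split; try exact: null_rowP.
move=> c; rewrite !dotE !mxE /=; apply: solve.
rewrite (_ : _ - _ = ii * (1 - lam) * (ka - kb)); last by ring.
by rewrite !mulf_neq0 ?ii_neq0 ?subr_eq0 // eq_sym.
Qed.

(* The second root of [disp k lam = 0] in [k]. *)
Definition partner (k lam : C) : C := 4 / 3 * ii * lam - k.
Lemma disp_partner k lam : disp k lam = 0 -> disp (partner k lam) lam = 0.
Proof.
move=> D; have -> : disp (partner k lam) lam = disp k lam + (ii * ii + 1) * (- (4 / 3) * lam ^+ 2) + (ii * ii + 1) * (16 / 12 * lam ^+ 2).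
  rewrite /disp /partner.
  have -> : 3 / 4 * (4 / 3 * ii * lam - k) ^+ 2 = 4 / 3 * (ii * ii) * lam ^+ 2 - 2 * ii * lam * k + 3 / 4 * k ^+ 2 by field.
  have -> : ii * (4 / 3 * ii * lam - k) * lam = 4 / 3 * (ii * ii) * lam ^+ 2 - ii * k * lam by ring.
  by field.
by rewrite D ii_sqr addNr !mul0r !addr0.
Qed.

(* Simple eigenvalues: one of the two modes is not a Bloch function of quasi-momentum [mu0]. *)
Lemma faithful_same_mode (lam : C) (k : R) d1 d2 v1 v2 P :
  congr_mode k -> disp k%:C lam = 0 ->
  cexp (ii * partner k%:C lam * per0%:C) != expi mu0 per0 ->
  flow (fun=> 0) (lam%:M : 'M[C]_1) (forcing d1 d2 k k v1 v2) P -> P 0 = 0 -> P per0 = 0 ->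
  d1 *: v1 + d2 *: v2 = 0.
Proof.
move=> hk D nk PF P0 PT.
have kk : k%:C != partner k%:C lam.
  by apply/eqP => e; move: nk; rewrite -e -iiE -/(expi k per0) hk eqxx.
have [ya [yb [Ya Yb inj]]] := null_rows kk D (disp_partner D).
apply: inj; rewrite dotD !dotZ.
  have := left_mode Ya PF P0 PT; rewrite -mulrDl => /eqP; rewrite mulf_eq0.
  by rewrite (negPf (duhamel_same k)) orbF => /eqP.
have := left_mode Yb PF P0 PT; rewrite -mulrDl => /eqP; rewrite mulf_eq0.
by rewrite (negPf (duhamel_neq0 hk nk)) orbF => /eqP.
Qed.

Lemma symb_null_dot (ka kb lam : C) (y : 'rV[C]_2) (v : 'cV[C]_2) z :
  y *m symb kb lam = 0 -> symb ka z *m v = 0 ->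
  ii * (kb - ka) * dot (y *m a1) v + (z - lam) * dot y v = 0.
Proof.
move=> Y W; have h1 : dot (y *m symb kb lam) v = 0 by rewrite Y /dot mul0mx mxE.
have h2 : dot y (symb ka z *m v) = 0 by rewrite W /dot mulmx0 mxE.
move: h1 h2; rewrite dotA /symb !mulmxBl !mulmxDl -!scalemxAl !mul_scalar_mx.
rewrite -![- (_ *: v)]scaleN1r !dotD !dotZ -!dotA => h1 h2.
by rewrite -[RHS](subrr 0) -{1}h1 -h2; ring.
Qed.

(** Here the columns belong to different eigenvalues. Testing against [k1] isolates [d1], since
    distinct congruent modes are orthogonal over a period. Testing against the partner of [k1]
    yields [d2 = 0] unless its null row [yb] annihilates [v2]; in that case [yb *m a1] would
    annihilate both columns. *)
Lemma faithful_two_modes (lam z' : C) (k1 k2 : R) d1 d2 v1 v2 P :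
  congr_mode k1 -> congr_mode k2 -> k1 != k2 -> disp k1%:C lam = 0 ->
  cexp (ii * partner k1%:C lam * per0%:C) != expi mu0 per0 ->
  symb k1%:C lam *m v1 = 0 -> symb k2%:C z' *m v2 = 0 ->
  (forall y : 'rV[C]_2, dot y v1 = 0 -> dot y v2 = 0 -> y = 0) ->
  dot (null_row k1%:C lam) v1 != 0 ->
  flow (fun=> 0) (lam%:M : 'M[C]_1) (forcing d1 d2 k1 k2 v1 v2) P -> P 0 = 0 -> P per0 = 0 ->
  d1 = 0 /\ d2 = 0.
Proof.
move=> h1 h2 k12 D nk S1 S2 inj y1v1 PF P0 PT.
have d10 : d1 = 0.
  have := left_mode (null_rowP D) PF P0 PT.
  rewrite (duhamel_other h1 h2 k12) mulr0 addr0 => /eqP.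
  by rewrite !mulf_eq0 (negPf y1v1) (negPf (duhamel_same k1)) !orbF => /eqP.
split => //.
pose kb := partner k1%:C lam.
have kk : k1%:C != kb.
  by apply/eqP => e; move: nk; rewrite -/kb -e -iiE -/(expi k1 per0) h1 eqxx.
have [ya [yb [Ya Yb rinj]]] := null_rows kk D (disp_partner D).
have yb0 : yb != 0.
  apply/eqP => yb0.
  pose c : 'cV[C]_2 := \col_i (if i == 0 then - ya 0 1 else ya 0 0).
  have c0 : c = 0 by apply: rinj; rewrite dotE ?yb0 !mxE /=; ring.
  have ya0 : ya = 0.
    apply: rv2_eq; rewrite [RHS]mxE.
      by have /matrixP/(_ 1 0) := c0; rewrite !mxE.
    by have /matrixP/(_ 0 0) := c0; rewrite !mxE /= => /eqP; rewrite oppr_eq0 => /eqP.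
  have : delta_mx 0 0 = 0 :> 'cV[C]_2 by apply: rinj; rewrite ?ya0 ?yb0 /dot mul0mx mxE.
  by move=> /matrixP/(_ 0 0)/eqP; rewrite !mxE /= oner_eq0.
have := left_mode Yb PF P0 PT; rewrite d10 !mul0r add0r => /eqP.
rewrite !mulf_eq0 (negPf (duhamel_neq0 h2 nk)) orbF => /orP[/eqP//|/eqP ybv2].
have k2b : kb - k2%:C != 0.
  by apply/eqP => /eqP; rewrite subr_eq0 => /eqP e; move: nk; rewrite -/kb e -iiE -/(expi k2 per0) h2 eqxx.
have e1 : dot (yb *m a1) v1 = 0.
  have := symb_null_dot Yb S1; rewrite subrr mul0r addr0 => /eqP.
  by rewrite !mulf_eq0 (negPf ii_neq0) subr_eq0 eq_sym (negPf kk) => /eqP.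
have e2 : dot (yb *m a1) v2 = 0.
  have := symb_null_dot Yb S2; rewrite ybv2 mulr0 addr0 => /eqP.
  by rewrite !mulf_eq0 (negPf ii_neq0) (negPf k2b) => /eqP.
have := inj _ e1 e2 => /(congr1 (fun y => y *m a1inv)).
by rewrite -mulmxA mul_a1_a1inv mulmx1 mul0mx => /eqP; rewrite (negPf yb0).
Qed.

Lemma faithful_resonant (lam : C) (k1 k2 : R) d1 d2 v1 v2 P :
  congr_mode k1 -> congr_mode k2 -> k1 != k2 -> disp k1%:C lam = 0 -> disp k2%:C lam = 0 ->
  dot (null_row k1%:C lam) v1 != 0 -> dot (null_row k2%:C lam) v2 != 0 ->
  flow (fun=> 0) (lam%:M : 'M[C]_1) (forcing d1 d2 k1 k2 v1 v2) P -> P 0 = 0 -> P per0 = 0 ->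
  d1 = 0 /\ d2 = 0.
Proof.
move=> h1 h2 k12 D1 D2 n1 n2 PF P0 PT; split.
  have := left_mode (null_rowP D1) PF P0 PT.
  rewrite (duhamel_other h1 h2 k12) mulr0 addr0 => /eqP.
  by rewrite !mulf_eq0 (negPf n1) (negPf (duhamel_same k1)) !orbF => /eqP.
have k21 : k2 != k1 by rewrite eq_sym.
have := left_mode (null_rowP D2) PF P0 PT.
rewrite (duhamel_other h2 h1 k21) mulr0 add0r => /eqP.
by rewrite !mulf_eq0 (negPf n2) (negPf (duhamel_same k2)) !orbF => /eqP.
Qed.

Definition frame_sol (k1 k2 : R) (V : 'M[C]_2) (x : R) : 'M[C]_2 :=
  V *m mx22 (expi k1 x) 0 0 (expi k2 x).

Lemma frame_sol_forcing k1 k2 V x (d : 'cV[C]_2) :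
  frame_sol k1 k2 V x *m d = forcing (d 0 0) (d 1 0) k1 k2 (col 0 V) (col 1 V) x.
Proof.
rewrite /frame_sol -mulmxA /forcing; apply/matrixP => i j; rewrite ord1.
rewrite mulmx2E !mulmx2E !mxE /=; ring.
Qed.

Lemma mulmx22E p q (M : 'M[C]_(p, 2)) (N : 'M[C]_(2, q)) i j :
  (M *m N) i j = M i 0 * N 0 j + M i 1 * N 1 j.
Proof.
rewrite mxE !big_ord_recl big_ord0 addr0.
by congr (M _ _ * N _ _ + M _ _ * N _ _); exact/val_inj.
Qed.

Lemma unit_det2 (V : 'M[C]_2) : det2 V != 0 -> V \in unitmx.
Proof.
move=> d; have : V *m ((det2 V)^-1 *: mx22 (V 1 1) (- V 0 1) (- V 1 0) (V 0 0)) = 1%:M.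
  rewrite -scalemxAr mx22_1 [LHS]mx22E.
  by apply: mx22_eq; rewrite mxE mulmx22E !mxE /= /det2; rewrite /det2 in d; field.
by move/mulmx1_unit; case.
Qed.

Lemma frame_sol_flow (k1 k2 : R) (V : 'M[C]_2) (z z' ga : C) : (ga = 0 \/ k1 = k2) ->
  a1 *m V *m mx22 (ii * k1%:C) 0 0 (ii * k2%:C) + A0 *m V = V *m mx22 z ga 0 z' ->
  flow (fun=> 0) (mx22 z ga 0 z') (fun=> 0) (frame_sol k1 k2 V).
Proof.
move=> gk EV.
pose D x := mx22 (expi k1 x) 0 0 (expi k2 x) : 'M[C]_2.
have DD x : mder D x (mx22 (ii * k1%:C) 0 0 (ii * k2%:C) *m D x).
  have E1 := cder_expi k1 x; have E2 := cder_expi k2 x.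
  rewrite iiE in E1; rewrite iiE in E2.
  rewrite /D mx22_mul !mul0r !mulr0 !add0r !addr0.
  move=> i j; rewrite (_ : (fun _ => _) = fun t => (if i == 0 then (if j == 0 then expi k1 t else 0)
     else (if j == 0 then 0 else expi k2 t))); last by apply/funext => t; rewrite mxE.
  by rewrite mxE; case: (i == 0); case: (j == 0) => //; exact: cderC.
move=> x; apply: mder_eq (mderMl V (DD x)) _.
  rewrite /vf addr0 scale0r addr0 /frame_sol -/(D x).
  have C1 : D x *m mx22 z ga 0 z' = mx22 z ga 0 z' *m D x.
    by rewrite /D !mx22_mul; apply: mx22_eq; rewrite ?mulr0 ?mul0r ?addr0 ?add0r //;
       [ring|case: gk => ->; ring|ring].
  rewrite -[V *m D x *m _]mulmxA C1 !mulmxA -mulmxBl -EV addrK -!mulmxA.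
  by rewrite [a1inv *m _]mulmxA mul_a1inv_a1 mul1mx.
Qed.

Lemma is_frameI (k1 k2 : R) (V : 'M[C]_2) (z z' ga : C) :
  congr_mode k1 -> congr_mode k2 -> det2 V != 0 -> (ga = 0 \/ k1 = k2) ->
  a1 *m V *m mx22 (ii * k1%:C) 0 0 (ii * k2%:C) + A0 *m V = V *m mx22 z ga 0 z' ->
  (forall d1 d2 P, flow (fun=> 0) (z%:M : 'M[C]_1) (forcing d1 d2 k1 k2 (col 0 V) (col 1 V)) P ->
     P 0 = 0 -> P per0 = 0 -> d1 = 0 /\ d2 = 0) ->
  (forall d1 d2 P, flow (fun=> 0) (z'%:M : 'M[C]_1) (forcing d1 d2 k1 k2 (col 0 V) (col 1 V)) P ->
     P 0 = 0 -> P per0 = 0 -> d1 = 0 /\ d2 = 0) ->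
  is_frame mu0 z z' ga V (frame_sol k1 k2 V).
Proof.
move=> h1 h2 dV gk EV N1 N2.
pose D x := mx22 (expi k1 x) 0 0 (expi k2 x) : 'M[C]_2.
have F := frame_sol_flow gk EV.
have D0 : D 0 = 1%:M by rewrite /D !expi0 mx22_1.
have DT : D per0 = expi mu0 per0 *: 1%:M.
  by rewrite /D h1 h2 mx22_1 mx22_scale !mulr0 !mulr1.
split; split => //.
- exact: unit_det2.
- by rewrite /frame_sol -/(D 0) D0 mulmx1.
- by rewrite /frame_sol -/(D per0) DT -scalemxAr mulmx1.
- exact: mder_mcont F.
- exists (mnorm V * 2) => x; rewrite (le_trans (mnormM _ _)) // ler_wpM2l ?mnorm_ge0 //.
  by rewrite mnorm22 !cabs_expi cabs0 addr0 add0r.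
- move=> d Y YF Y0 YT; have [|e1 e2] := N1 (d 0 0) (d 1 0) Y _ Y0 YT.
    by apply: flow_ext YF => x; rewrite frame_sol_forcing.
  by apply: cv2_eq; rewrite [RHS]mxE.
- move=> d Y YF Y0 YT; have [|e1 e2] := N2 (d 0 0) (d 1 0) Y _ Y0 YT.
    by apply: flow_ext YF => x; rewrite frame_sol_forcing.
  by apply: cv2_eq; rewrite [RHS]mxE.
Qed.
End ConstantCoefficients.

(** * Dispersion relation of the rest state *)

Section Dispersion.
Context {R : realType}.
Local Notation C := R[i].

Lemma expi_2piM (m : int) : expi 1 (2 * pi * m%:~R) = 1 :> C.
Proof.
have H (n : nat) : expi 1 (2 * pi * n%:R) = 1 :> C.
  elim: n => [|n IH]; first by rewrite mulr0 expi0.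
  have -> : 2 * pi * n.+1%:R = 2 * pi * n%:R + 2 * pi :> R by rewrite -natr1; ring.
  rewrite expiD IH mul1r /expi cexpE !ReImE /=.
  have -> : 0 * (2 * pi) - 1 * 0 = 0 :> R by ring.
  have -> : 0 * 0 + 1 * (2 * pi) = pi *+ 2 :> R by ring.
  by rewrite expR0 cos2pi sin2pi mulr0 mulr1.
case: m => n; first exact: H.
rewrite NegzE rmorphN mulrN; have := expiN (R := R) 1 (2 * pi * n.+1%:R).
by rewrite H mulr1.
Qed.

Lemma expi_eq1 (x : R) : expi 1 x = 1 :> C -> exists m : int, x = 2 * pi * m%:~R.
Proof.
have p0 : 0 < 2 * pi :> R by rewrite mulr_gt0 // pi_gt0.
move=> E; pose m := Num.floor (x / (2 * pi)); exists m.
pose y := x - 2 * pi * m%:~R.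
have Ey : expi 1 y = 1 :> C.
  by rewrite /y expiD E -mulrN -rmorphN expi_2piM mul1r.
have y0 : 0 <= y.
  by rewrite subr_ge0 mulrC -ler_pdivlMr // floor_le_tmp.
have y1 : y < 2 * pi.
  have := floorD1_gt (x / (2 * pi)); rewrite -/m ltr_pdivrMr // rmorphD /= /y; lra.
have c1 : cos y = 1.
  have := congr1 (@complex.Re R) Ey; rewrite /expi cexpE !ReImE /=.
  have -> : 0 * y - 1 * 0 = 0 :> R by ring.
  have -> : 0 * 0 + 1 * y = y :> R by ring.
  by rewrite expR0 mul1r.
have yE : x = 2 * pi * m%:~R + y by rewrite /y; ring.
move: y0; rewrite le_eqVlt => /orP[/eqP y0|y0]; first by rewrite yE -y0 addr0.
exfalso; move: c1; have -> : y = y / 2 + y / 2 by lra.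
rewrite cosD -!expr2 cos2sin2 => c1.
have : 0 < sin (y / 2) by apply: sin_gt0_pi; apply/andP; split; lra.
move=> /(exprn_gt0 2); lra.
Qed.

Lemma congr_mode_shift (mu0 : R) (m : int) : congr_mode mu0 (mu0 + 2 * m%:~R / Num.sqrt 3).
Proof.
rewrite /congr_mode (expi_mul (_ + _)) mulrDl expiD -(expi_mul mu0).
have -> : 2 * m%:~R / Num.sqrt 3 * per0 = 2 * pi * m%:~R :> R.
  by rewrite -om0_per0 /om0; field; rewrite gt_eqF // sqrt3_gt0.
by rewrite expi_2piM mulr1.
Qed.

Lemma congr_modeP (mu0 k : R) : congr_mode mu0 k -> exists m : int, k = mu0 + 2 * m%:~R / Num.sqrt 3.
Proof.
rewrite /congr_mode => E.
have [|m mE] := @expi_eq1 ((k - mu0) * per0).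
  have e1 : expi 1 (k * per0) = expi 1 (mu0 * per0) :> C by rewrite -(expi_mul k) -(expi_mul mu0).
  by rewrite mulrBl expiD e1 mulrC; exact: expiN.
exists m; have p0 : per0 != 0 :> R by rewrite gt_eqF // per0_gt0.
have s0 : Num.sqrt 3 != 0 :> R by rewrite gt_eqF // sqrt3_gt0.
have -> : 2 * m%:~R / Num.sqrt 3 = (k - mu0) * per0 / per0 :> R.
  by rewrite mE -om0_per0 /om0; field; rewrite p0 s0.
by rewrite mulfK //; ring.
Qed.

(** This is [-1/2] times the derivative of [disp k z] in [z]. At [lambda_ j mu] it is minus the
    signed square root, so it vanishes exactly at [mu = 1] and [mu = -1]. *)
Definition bb (k z : C) : C := ii * k / 2 - z.
Lemma bb_sqr k z : disp k z = 0 -> bb k z ^+ 2 = 1 - k ^+ 2.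
Proof.
move=> D; have -> : bb k z ^+ 2 = disp k z + (ii * ii + 1) * k ^+ 2 / 4 + 1 - k ^+ 2.
  by rewrite /bb /disp; field.
by rewrite D ii_sqr addNr !mul0r !add0r.
Qed.

Definition mode (k z : C) : 'cV[C]_2 :=
  \col_i (if i == 0 then ii * k else bb k z + 1).

Lemma mode_kernel k z : disp k z = 0 -> symb k z *m mode k z = 0.
Proof.
move=> /disp_prod D; rewrite symbE.
apply: cv2_eq; rewrite mulmx2E !mxE /= /bb; first by ring.
have -> : ii * k / 2 - z + 1 = ii * k / 2 + 1 - z by ring.
by rewrite [_ * (_ + 1 - z)]mulrC D; ring.
Qed.

Lemma dot_mode k z : disp k z = 0 -> dot (null_row k z) (mode k z) = 2 * bb k z * (bb k z + 1).
Proof.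
move=> D; rewrite dotE !mxE /=.
have := bb_sqr D; rewrite /bb => E.
have -> : ii * k / 2 + 1 - z = bb k z + 1 by rewrite /bb; ring.
have -> : ii * k * (ii * k) + (bb k z + 1) * (ii * k / 2 - z + 1) =
  (ii * ii) * k ^+ 2 + bb k z ^+ 2 + 2 * bb k z + 1 by rewrite /bb; ring.
rewrite ii_sqr (bb_sqr D).
have -> : 2 * bb k z * (bb k z + 1) = 2 * bb k z ^+ 2 + 2 * bb k z by ring.
by rewrite (bb_sqr D); ring.
Qed.

Definition sgn (j : 'I_2) : C := if j == 0 then 1 else -1.
Lemma lambdaE j (mu : R) : lambda_ j mu = ii * mu%:C / 2 + sgn j * csqrt1m mu.
Proof.
have E : 0 +i* (mu / 2) = ii * mu%:C / 2 :> C.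
  by rewrite iiE -halfC -mulrA -rmorphM.
by rewrite /lambda_ /sgn; case: (j == 0); rewrite /lambda1 /lambda2 E ?mul1r ?mulN1r.
Qed.

Lemma csqrt1m_sqr (mu : R) : csqrt1m mu ^+ 2 = 1 - mu%:C ^+ 2 :> C.
Proof.
rewrite /csqrt1m; case: ifP => h.
  rewrite -!rmorphXn /= sqr_sqrtr ?rmorphB ?rmorph1 ?rmorphXn //.
  by rewrite subr_ge0 -real_normK ?num_real // exprn_ile1.
rewrite iiE exprMn [ii ^+ 2]expr2 ii_sqr mulN1r -!rmorphXn /= sqr_sqrtr ?rmorphB ?rmorph1 ?rmorphXn ?opprB //.
rewrite subr_ge0 -[mu ^+ 2]real_normK ?num_real // exprn_ege1 // ltW // ltNge h //.
Qed.

Lemma sgn_sqr j : sgn j ^+ 2 = 1. Proof. by rewrite /sgn; case: ifP => _; rewrite ?expr1n ?sqrrN ?expr1n. Qed.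

Lemma bb_lambda j (mu : R) : bb mu%:C (lambda_ j mu) = - (sgn j * csqrt1m mu).
Proof. by rewrite /bb lambdaE; ring. Qed.

Lemma disp_lambda j (mu : R) : disp mu%:C (lambda_ j mu) = 0.
Proof.
have -> : disp mu%:C (lambda_ j mu) = (bb mu%:C (lambda_ j mu)) ^+ 2 - (ii * ii + 1) * mu%:C ^+ 2 / 4 + mu%:C ^+ 2 - 1.
  by rewrite /bb /disp; field.
rewrite bb_lambda sqrrN exprMn sgn_sqr csqrt1m_sqr ii_sqr addNr; ring.
Qed.

Lemma disp_roots (mu : R) z : disp mu%:C z = 0 -> exists j, z = lambda_ j mu.
Proof.
move=> /bb_sqr E; have : (bb mu%:C z - csqrt1m mu) * (bb mu%:C z + csqrt1m mu) = 0.
  by rewrite -subr_sqr E csqrt1m_sqr subrr.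
move=> /eqP; rewrite mulf_eq0 subr_eq0 addr_eq0 => /orP[/eqP h|/eqP h].
  by exists 1; rewrite lambdaE /sgn /= -h /bb; ring.
exists 0; rewrite lambdaE /sgn /=.
have -> : csqrt1m mu = - bb mu%:C z by rewrite h opprK.
by rewrite /bb; ring.
Qed.

Lemma csqrt1m_neq0 (mu : R) : mu != 1 -> mu != -1 -> csqrt1m mu != 0 :> C.
Proof.
move=> h1 h2; apply/eqP => E; have := csqrt1m_sqr mu; rewrite E expr0n /=.
have -> : 1 - mu%:C ^+ 2 = (1 - mu ^+ 2)%:C :> C by rewrite rmorphB rmorph1 rmorphXn.
move=> /esym/complexI/eqP; rewrite subr_eq0 eq_sym sqrf_eq1.
by rewrite (negPf h1) (negPf h2).
Qed.

Lemma csqrt1m_small (mu : R) : `|mu| < 1 -> exists2 s : R, 0 < s & csqrt1m mu = s%:C /\ s ^+ 2 = 1 - mu ^+ 2.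
Proof.
move=> h; have p : 0 < 1 - mu ^+ 2.
  by rewrite subr_gt0 -[mu ^+ 2]real_normK ?num_real // exprn_ilt1.
exists (Num.sqrt (1 - mu ^+ 2)); first by rewrite sqrtr_gt0.
by rewrite /csqrt1m (ltW h) sqr_sqrtr ?(ltW p).
Qed.

Lemma csqrt1m_large (mu : R) : 1 < `|mu| -> exists2 s : R, 0 < s & csqrt1m mu = 0 +i* s /\ s ^+ 2 = mu ^+ 2 - 1.
Proof.
move=> h; have p : 0 < mu ^+ 2 - 1.
  by rewrite subr_gt0 -[mu ^+ 2]real_normK ?num_real // exprn_egt1.
exists (Num.sqrt (mu ^+ 2 - 1)); first by rewrite sqrtr_gt0.
by rewrite /csqrt1m leNgt h /= sqr_sqrtr ?(ltW p).
Qed.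

(* An eigenvalue off the imaginary axis has a growing or decaying second mode. *)
Lemma partner_unstable (mu0 k : R) (z : C) : complex.Re z != 0 ->
  cexp (ii * partner k%:C z * per0%:C) != expi mu0 per0.
Proof.
move=> rz; apply/eqP => /(congr1 (@cabs R)); rewrite cabs_expi cabs_cexp.
have -> : complex.Re (ii * partner k%:C z * per0%:C) = - (4 / 3) * complex.Re z * per0.
  have -> : ii * partner k%:C z * per0%:C = (ii * ii * (4 / 3) * z - ii * k%:C) * per0%:C.
    by rewrite /partner; ring.
  rewrite ii_sqr -iiE.
  have -> : (4 / 3 : C) = (4 / 3 : R)%:C by rewrite rmorphM /= fmorphV !rmorph_nat.
  by rewrite !ReImE /=; ring.
move/eqP; rewrite -expR0 (inj_eq (@expR_inj R)); apply/negP.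
apply: mulf_neq0; last by rewrite gt_eqF // per0_gt0.
by apply: mulf_neq0 => //; rewrite oppr_eq0 gt_eqF.
Qed.
End Dispersion.

(** * Frames of the rest state for every quasi-momentum *)

Section Frames.
Context {R : realType}.
Local Notation C := R[i].

Definition modes (k1 z1 k2 z2 : C) : 'M[C]_2 :=
  mx22 (ii * k1) (ii * k2) (bb k1 z1 + 1) (bb k2 z2 + 1).

Lemma col0_mx22 (a b c d : C) : col 0 (mx22 a b c d) = \col_i (if i == 0 then a else c).
Proof. by apply: cv2_eq; rewrite !mxE. Qed.
Lemma col1_mx22 (a b c d : C) : col 1 (mx22 a b c d) = \col_i (if i == 0 then b else d).
Proof. by apply: cv2_eq; rewrite !mxE. Qed.
Lemma modes_col0 k1 z1 k2 z2 : col 0 (modes k1 z1 k2 z2) = mode k1 z1.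
Proof. by rewrite /modes col0_mx22. Qed.
Lemma modes_col1 k1 z1 k2 z2 : col 1 (modes k1 z1 k2 z2) = mode k2 z2.
Proof. by rewrite /modes col1_mx22. Qed.

Lemma modes_eq k1 z1 k2 z2 : disp k1 z1 = 0 -> disp k2 z2 = 0 ->
  a1 *m modes k1 z1 k2 z2 *m mx22 (ii * k1) 0 0 (ii * k2) + A0 *m modes k1 z1 k2 z2 =
  modes k1 z1 k2 z2 *m mx22 z1 0 0 z2.
Proof.
move=> /disp_prod E1 /disp_prod E2; rewrite /a1 /A0 /modes !mx22_mul mx22_add halfC.
rewrite /bb; apply: mx22_eq; rewrite ?mulr0 ?mul0r ?addr0 ?add0r ?mul1r.
- by field.
- by field.
- apply/eqP; rewrite -subr_eq0; apply/eqP.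
  transitivity ((ii * k1 / 2 + 1 - z1) * (ii * k1 / 2 - 1 - z1) - ii * k1 * (ii * k1)); first by field.
  by rewrite E1 subrr.
- apply/eqP; rewrite -subr_eq0; apply/eqP.
  transitivity ((ii * k2 / 2 + 1 - z2) * (ii * k2 / 2 - 1 - z2) - ii * k2 * (ii * k2)); first by field.
  by rewrite E2 subrr.
Qed.

Lemma row_inj (V : 'M[C]_2) (y : 'rV[C]_2) : det2 V != 0 ->
  dot y (col 0 V) = 0 -> dot y (col 1 V) = 0 -> y = 0.
Proof.
move=> /unit_det2 Vu; rewrite !dotE !mxE => h0 h1.
have E : y *m V = 0 by apply: rv2_eq; rewrite rowmul2E [RHS]mxE.
by rewrite -[y](mulmxK Vu) E mul0mx.
Qed.

Lemma col_inj (V : 'M[C]_2) (d1 d2 : C) : det2 V != 0 ->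
  d1 *: col 0 V + d2 *: col 1 V = 0 -> d1 = 0 /\ d2 = 0.
Proof.
move=> /unit_det2 Vu E; pose d : 'cV[C]_2 := \col_i (if i == 0 then d1 else d2).
have Vd : V *m d = 0.
  apply: cv2_eq; rewrite mulmx2E !mxE /= [V _ _ * d1]mulrC [V _ _ * d2]mulrC.
    by have /matrixP/(_ 0 0) := E; rewrite !mxE.
  by have /matrixP/(_ 1 0) := E; rewrite !mxE.
have d0 : d = 0 by rewrite -[d](mulKmx Vu) Vd mulmx0.
by split; [have /matrixP/(_ 0 0) := d0 | have /matrixP/(_ 1 0) := d0]; rewrite !mxE.
Qed.

Lemma forcingC (d1 d2 : C) k1 k2 v1 v2 x : forcing d1 d2 k1 k2 v1 v2 x = forcing d2 d1 k2 k1 v2 v1 x.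
Proof. by rewrite /forcing addrC. Qed.

Lemma flow_forcingC z d1 d2 k1 k2 v1 v2 P :
  flow (fun=> 0) (z%:M : 'M[C]_1) (forcing d1 d2 k1 k2 v1 v2) P ->
  flow (fun=> 0) (z%:M : 'M[C]_1) (forcing d2 d1 k2 k1 v2 v1) P.
Proof. by apply: flow_ext => x; rewrite forcingC. Qed.

Lemma congr_mode_refl (mu : R) : congr_mode mu mu. Proof. by []. Qed.

Lemma frame_simple (mu : R) (z z' : C) (V : 'M[C]_2) :
  det2 V != 0 -> disp mu%:C z = 0 -> disp mu%:C z' = 0 ->
  complex.Re z != 0 -> complex.Re z' != 0 ->
  a1 *m V *m mx22 (ii * mu%:C) 0 0 (ii * mu%:C) + A0 *m V = V *m mx22 z 0 0 z' ->
  is_frame mu z z' 0 V (frame_sol mu mu V).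
Proof.
move=> dV D D' rz rz' EV.
apply: is_frameI; rewrite ?congr_mode_refl //; first by left.
  move=> d1 d2 P PF P0 PT; apply: (col_inj dV).
  exact: (faithful_same_mode (congr_mode_refl mu) D (partner_unstable mu mu rz) PF P0 PT).
move=> d1 d2 P PF P0 PT; apply: (col_inj dV).
exact: (faithful_same_mode (congr_mode_refl mu) D' (partner_unstable mu mu rz') PF P0 PT).
Qed.

Definition other (j : 'I_2) : 'I_2 := if j == 0 then 1 else 0.
Lemma sgn_other j : sgn (other j) = - sgn j :> C.
Proof. by rewrite /other /sgn; case: (j == 0) => //=; rewrite opprK. Qed.
Lemma sgnE j : exists2 e : R, sgn j = e%:C :> C & e ^+ 2 = 1.
Proof.
by rewrite /sgn; case: (j == 0); [exists 1|exists (-1)]; rewrite ?expr1n ?sqrrN ?expr1n ?rmorphN ?rmorph1.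
Qed.

Lemma sgn_neq0 j : sgn j != 0 :> C.
Proof. by apply/eqP => E; have := sgn_sqr (R := R) j; rewrite E expr0n /= => /esym/eqP; rewrite oner_eq0. Qed.

Lemma Re_lambda_small j (mu : R) : `|mu| < 1 -> complex.Re (lambda_ j mu) != 0.
Proof.
move=> h; have [s s0 [E _]] := csqrt1m_small h; have [e Ee e2] := sgnE j.
rewrite lambdaE E Ee -rmorphM -halfC -mulrA -rmorphM -iiE !ReImE /= add0r mulf_neq0 ?(gt_eqF s0) //.
by apply/eqP => e0; move: e2; rewrite e0 expr0n /= => /esym/eqP; rewrite oner_eq0.
Qed.

Lemma frame_inner j (mu : R) : `|mu| < 1 -> mu != 0 ->
  let V := modes mu%:C (lambda_ j mu) mu%:C (lambda_ (other j) mu) in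
  is_frame mu (lambda_ j mu) (lambda_ (other j) mu) 0 V (frame_sol mu mu V).
Proof.
move=> h mu0 V; apply: frame_simple; rewrite ?disp_lambda ?Re_lambda_small //.
  have -> : det2 V = 2 * ii * mu%:C * (sgn j * csqrt1m mu).
    by rewrite /det2 /V !mxE /= !bb_lambda sgn_other; ring.
  rewrite !mulf_neq0 ?ii_neq0 ?sgn_neq0 ?pnatr_eq0 //.
    by apply/eqP => /(congr1 (@complex.Re R))/eqP; rewrite /= (negPf mu0).
  by apply: csqrt1m_neq0; apply/eqP => E; move: h; rewrite E ?normrN normr1 ltxx.
exact: modes_eq (disp_lambda _ _) (disp_lambda _ _).
Qed.

Lemma lambda0 j : lambda_ j 0 = sgn j :> C.
Proof.
have [|s s0 [E s2]] := @csqrt1m_small R 0; first by rewrite normr0.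
rewrite lambdaE rmorph0 mulr0 mul0r add0r E.
suff -> : s = 1 by rewrite rmorph1 mulr1.
have : s ^+ 2 == 1 by rewrite s2 expr0n /= subr0.
by rewrite sqrf_eq1 => /orP[/eqP //|/eqP sN]; move: s0; rewrite sN oppr_gt0 ltr10.
Qed.

(** At [mu = 0] the vector [mode] is zero for the eigenvalue [1], so the frame is built from the
    coordinate vectors instead. *)
Lemma frame_zero j : exists V, is_frame (0 : R) (lambda_ j 0) (lambda_ (other j) 0) 0 V (frame_sol 0 0 V).
Proof.
have h : `|0 : R| < 1 by rewrite normr0.
pose V : 'M[C]_2 := if j == 0 then 1%:M else mx22 0 1 1 0.
exists V; apply: frame_simple; try exact: disp_lambda; try exact: Re_lambda_small.
  rewrite /V /det2; case: (j == 0); by rewrite !mxE /= ?mulr1n ?mulr0n ?mulr1 ?mulr0 ?subr0 ?sub0r ?oppr_eq0 ?oner_eq0.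
rewrite rmorph0 mulr0 [X in _ *m X + _](_ : _ = 0); last first.
  by rewrite [LHS]mx22E [RHS]mx22E; apply: mx22_eq; rewrite !mxE.
rewrite mulmx0 add0r !lambda0 sgn_other /V /sgn; case: (j == 0).
  by rewrite mulmx1 mul1mx.
by rewrite opprK /A0 !mx22_mul; apply: mx22_eq; ring.
Qed.

(** Congruence would mean [16 = 3 * m ^+ 2] for an integer [m], but [3] does not divide [16]. *)
Lemma not_congr_other_mode (e : R) : e ^+ 2 = 1 -> ~ congr_mode e (- (5 / 3) * e).
Proof.
move=> e2 /congr_modeP[m E].
have m3 : (4 * e) ^+ 2 = (3 * (m%:~R / Num.sqrt 3)) ^+ 2.
  rewrite -mulrA in E; have -> : 4 * e = - (3 * (m%:~R / Num.sqrt 3)) by lra.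
  by rewrite sqrrN.
have {}m3 : (4 * e) ^+ 2 = 3 ^+ 2 * (m%:~R ^+ 2 / 3) by rewrite m3 !exprMn exprVn sqrt3_sqr.
have {}m3 : (Posz 16)%:~R = (m ^+ 2 * 3)%:~R :> R.
  by rewrite rmorphM rmorphXn /=; move: m3; rewrite exprMn e2 mulr1; lra.
move/eqP: m3; rewrite eqr_int => /eqP m3.
have : (3 %| Posz 16)%Z by apply/dvdzP; exists (m ^+ 2); rewrite m3.
by [].
Qed.

(** At a branch point the symbol has the single null vector [(i e, 1)]. The column [(1, 0)]
    completes a Jordan chain with coupling [- i e]. The other mode with this eigenvalue is
    [- 5/3 e], excluded by [not_congr_other_mode]. *)
Lemma frame_one (e : R) : e ^+ 2 = 1 ->
  let V := mx22 (ii * e%:C) 1 1 0 in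
  is_frame e (ii * e%:C / 2) (ii * e%:C / 2) (- (ii * e%:C)) V (frame_sol e e V).
Proof.
move=> e2 V; have e2C : e%:C ^+ 2 = 1 :> C by rewrite -rmorphXn e2 rmorph1.
have D : disp e%:C (ii * e%:C / 2) = 0.
  rewrite /disp (_ : _ - _ = (ii * ii + 1) * (- (e%:C ^+ 2) / 4) + (e%:C ^+ 2 - 1)); last by field.
  by rewrite ii_sqr e2C addNr mul0r subrr addr0.
have dV : det2 V != 0.
  by rewrite /det2 /V !mxE /= mulr0 sub0r mulr1 oppr_eq0 oner_eq0.
have NC : cexp (ii * partner e%:C (ii * e%:C / 2) * per0%:C) != expi e per0.
  have -> : ii * partner e%:C (ii * e%:C / 2) = 0 +i* (- (5 / 3) * e).
    rewrite iiE /partner; congr (_ * _).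
    have -> : 4 / 3 * ii * (ii * e%:C / 2) - e%:C = (2 / 3 * (ii * ii) - 1) * e%:C by field.
    have -> : (- (5 / 3) * e)%:C = - (5 / 3) * e%:C :> C.
      by rewrite rmorphM rmorphN rmorphM /= fmorphV !rmorph_nat.
    by rewrite ii_sqr; field.
  rewrite -/(expi _ per0); apply/eqP; exact: not_congr_other_mode.
have EV : a1 *m V *m mx22 (ii * e%:C) 0 0 (ii * e%:C) + A0 *m V =
    V *m mx22 (ii * e%:C / 2) (- (ii * e%:C)) 0 (ii * e%:C / 2).
  have q : (ii * e%:C) * (ii * e%:C) = -1.
    by rewrite mulrACA ii_sqr -expr2 e2C mulr1.
  rewrite /a1 /A0 /V !mx22_mul mx22_add halfC; move: (ii * e%:C) q => a q.
  apply: mx22_eq.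
  - by ring.
  - apply/eqP; rewrite -subr_eq0; apply/eqP; transitivity (a * a + 1); first by field.
    by rewrite q addNr.
  - apply/eqP; rewrite -subr_eq0; apply/eqP; transitivity (- (a * a + 1)); first by field.
    by rewrite q addNr oppr0.
  - by ring.
apply: is_frameI; rewrite ?congr_mode_refl //; first by right.
  move=> d1 d2 P PF P0 PT; apply: (col_inj dV).
  exact: (faithful_same_mode (congr_mode_refl e) D NC PF P0 PT).
move=> d1 d2 P PF P0 PT; apply: (col_inj dV).
exact: (faithful_same_mode (congr_mode_refl e) D NC PF P0 PT).
Qed.

Lemma bb_large j (mu : R) : 1 < `|mu| -> exists2 t : R, t != 0 & bb mu%:C (lambda_ j mu) = ii * t%:C.
Proof.
move=> h; have [s s0 [E _]] := csqrt1m_large h; have [e Ee e2] := sgnE j.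
exists (- (e * s)); last by rewrite bb_lambda Ee E iiE rmorphN rmorphM; ring.
rewrite oppr_eq0 mulf_neq0 ?(gt_eqF s0) //.
by apply/eqP => e0; move: e2; rewrite e0 expr0n /= => /esym/eqP; rewrite oner_eq0.
Qed.

Lemma real_complex_neq0 (a : R) : a != 0 -> a%:C != 0 :> C.
Proof. by move=> h; apply/eqP => /(congr1 (@complex.Re R))/eqP; rewrite /= (negPf h). Qed.

Lemma real_imag_neq0 (a b : R) : a != 0 \/ b != 0 -> a%:C + ii * b%:C != 0.
Proof.
move=> h; apply/eqP => E.
have ra := congr1 (@complex.Re R) E; have rb := congr1 (@complex.Im R) E.
rewrite -iiE !ReImE /= addr0 in ra; rewrite -iiE !ReImE /= add0r in rb.
by case: h; rewrite ?ra ?rb eqxx.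
Qed.

Lemma dot_mode_large j (mu : R) : 1 < `|mu| ->
  dot (null_row mu%:C (lambda_ j mu)) (mode mu%:C (lambda_ j mu)) != 0.
Proof.
move=> h; have [t t0 E] := bb_large j h.
rewrite dot_mode ?disp_lambda // E mulf_neq0 ?mulf_neq0 ?ii_neq0 ?pnatr_eq0 //.
  exact: real_complex_neq0.
by rewrite addrC -[1]/(1%:C); apply: real_imag_neq0; left; rewrite oner_eq0.
Qed.

Lemma lambda_eq_of_disp (k mu : R) j : disp k%:C (lambda_ j mu) = 0 -> exists j', lambda_ j' k = lambda_ j mu.
Proof. by move=> /disp_roots[j' E]; exists j'. Qed.

Lemma partner_large j (mu : R) : 1 < `|mu| -> exists2 k : R, partner mu%:C (lambda_ j mu) = k%:C & k != mu.
Proof.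
move=> h; have [s s0 [E s2]] := csqrt1m_large h; have [e Ee e2] := sgnE j.
exists (- (4 / 3) * (mu / 2 + e * s) - mu).
  rewrite /partner lambdaE Ee E iiE.
  have -> : 4 / 3 * ii * (ii * mu%:C / 2 + e%:C * (ii * s%:C)) - mu%:C =
     (ii * ii) * (4 / 3) * (mu%:C / 2 + e%:C * s%:C) - mu%:C by ring.
  rewrite ii_sqr rmorphB rmorphM rmorphD !rmorphM rmorphN rmorphM /= !fmorphV !rmorph_nat; ring.
apply/eqP => q; have : (e * s) ^+ 2 = 4 * mu ^+ 2.
  have -> : e * s = - 2 * mu by lra.
  by rewrite exprMn sqrrN; congr (_ * _); rewrite -natrX.
rewrite exprMn e2 mul1r s2 => q2; have := sqr_ge0 mu; lra.
Qed.

(** The second eigenvalue over the same [mu] may itself be resonant and is no safe choice for the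
    second column. A congruent mode inside the unit interval is taken: its eigenvalue is off the
    imaginary axis, hence distinct from [lambda_ j mu] and never resonant. *)
Lemma frame_outer j (mu : R) : 1 < `|mu| -> ~ resonant j mu -> exists m : int,
  let k := mu + 2 * m%:~R / Num.sqrt 3 in let V := modes mu%:C (lambda_ j mu) k%:C (lambda_ 1 k) in
  [/\ `|k| < 1, k != mu & is_frame mu (lambda_ j mu) (lambda_ 1 k) 0 V (frame_sol mu k V)].
Proof.
(* Rounding to the nearest point of the lattice of spacing [2 / sqrt 3] gives
   [|k| <= 1 / sqrt 3]. *)
move=> h nres; pose m := - Num.floor (mu * Num.sqrt 3 / 2 + 2^-1); exists m => k V.
have s3 : 0 < Num.sqrt 3 :> R by exact: sqrt3_gt0.
have hk : `|k| < 1.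
  have kE : k = (mu * Num.sqrt 3 / 2 + m%:~R) * (2 / Num.sqrt 3) by rewrite /k; field; rewrite gt_eqF.
  have f1 := floor_le_tmp (mu * Num.sqrt 3 / 2 + 2^-1).
  have f2 := floorD1_gt (mu * Num.sqrt 3 / 2 + 2^-1); rewrite rmorphD /= in f2.
  have q : `|mu * Num.sqrt 3 / 2 + m%:~R| <= 2^-1.
    rewrite ler_norml /m rmorphN /=; move: f1 f2; set b := mu * Num.sqrt 3 / 2; set a := (Num.floor _)%:~R => f1 f2; clearbody a b.
    by apply/andP; split; lra.
  have o : 0 < 2 / Num.sqrt 3 :> R by rewrite divr_gt0.
  have o2 : 2 / Num.sqrt 3 < 2 :> R.
    rewrite ltr_pdivrMr // ltr_pMr // -(@ltr_pXn2r _ 2) ?nnegrE ?(ltW s3) //.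
    by rewrite sqrt3_sqr expr1n ltr1n.
  rewrite kE normrM (gtr0_norm o); apply: le_lt_trans (ler_wpM2r (ltW o) q) _; lra.
have kmu : k != mu by apply/eqP => E; move: h; rewrite -E ltNge (ltW hk).
have muk : mu != k by rewrite eq_sym.
have [t t0 b1E] := bb_large j h.
have [s s0 [sE _]] := csqrt1m_small hk.
have b2E : bb k%:C (lambda_ 1 k) = s%:C by rewrite bb_lambda /sgn /= mulN1r opprK sE.
have dV : det2 V != 0.
  have -> : det2 V = ii * ((mu * (s + 1) - k)%:C + ii * (- k * t)%:C).
    rewrite /det2 /V !mxE /= b1E b2E !(rmorphM, rmorphB, rmorphN, rmorphD, rmorph1) /=; ring.
  rewrite mulf_neq0 ?ii_neq0 //; apply: real_imag_neq0.
  have [k0|k0] := eqVneq k 0; [left|right; by rewrite mulf_neq0 ?oppr_eq0].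
  rewrite k0 subr0 mulf_neq0 //; last by rewrite gt_eqF // addr_gt0.
  by rewrite -k0.
have D1 := disp_lambda j mu; have D2 := disp_lambda 1 k.
have ck : congr_mode mu k by exact: congr_mode_shift.
have NC : cexp (ii * partner mu%:C (lambda_ j mu) * per0%:C) != expi mu per0.
  have [k' pE k'mu] := partner_large j h.
  rewrite pE -iiE -/(expi k' per0); apply/eqP => /congr_modeP[n E]; apply: nres.
  have [j' jE] : exists j', lambda_ j' k' = lambda_ j mu.
    by apply: lambda_eq_of_disp; rewrite -pE; exact: disp_partner.
  exists j', n; rewrite -E; split => //.
  by apply/eqP => n0; move: k'mu; rewrite E n0 mulr0 mul0r addr0 eqxx.
have S1 := mode_kernel D1; have S2 := mode_kernel D2.
have d1N := dot_mode_large j h.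
have d2N : dot (null_row k%:C (lambda_ 1 k)) (mode k%:C (lambda_ 1 k)) != 0.
  rewrite dot_mode // b2E mulf_neq0 ?mulf_neq0 ?pnatr_eq0 //.
    by apply: real_complex_neq0; rewrite gt_eqF.
  by rewrite -[1]/(1%:C) -rmorphD; apply: real_complex_neq0; rewrite gt_eqF // addr_gt0.
split => //; apply: is_frameI; rewrite ?congr_mode_refl //; first by left.
- exact: modes_eq.
- move=> d1 d2 P; rewrite modes_col0 modes_col1 => PF P0 PT.
  apply: (faithful_two_modes (congr_mode_refl mu) ck muk D1 NC S1 S2 _ d1N PF P0 PT) => y y1 y2.
  by apply: (row_inj dV); rewrite ?modes_col0 ?modes_col1.
move=> d1 d2 P; rewrite modes_col0 modes_col1 => /flow_forcingC PF P0 PT.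
have rz : complex.Re (lambda_ 1 k) != 0 by exact: Re_lambda_small.
have [|-> ->] := faithful_two_modes ck (congr_mode_refl mu) kmu D2 (partner_unstable mu k rz) S2 S1 _ d2N PF P0 PT.
  by move=> y y1 y2; apply: (row_inj dV); rewrite ?modes_col0 ?modes_col1.
by [].
Qed.

(** The difference of the two relations is linear in [z] after division by [t - k], so a shared
    eigenvalue is imaginary; substituting it back leaves a real relation between the modes. *)
Lemma common_root (t k : R) z : t != k -> disp t%:C z = 0 -> disp k%:C z = 0 ->
  z = ii * (- (3 / 4) * (t + k))%:C /\ 9 / 16 * (t + k) ^+ 2 + 3 / 4 * (t * k) + 1 = 0.
Proof.
move=> tk D1 D2.
have tkC : t%:C - k%:C != 0 :> C by rewrite -rmorphB; apply: real_complex_neq0; rewrite subr_eq0.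
have zE : z = ii * (- (3 / 4) * (t + k))%:C.
  have : (t%:C - k%:C) * (3 / 4 * (t%:C + k%:C) - ii * z) = 0.
    by rewrite -[RHS](subrr 0) -{1}D1 -D2 /disp; field.
  move=> /eqP; rewrite mulf_eq0 (negPf tkC) subr_eq0 => /eqP E.
  have -> : z = - (ii * (ii * z)) by rewrite mulrA ii_sqr; ring.
  rewrite -E rmorphM rmorphN rmorphM rmorphD /= fmorphV !rmorph_nat; ring.
split => //; move: D1; rewrite zE /disp.
set a := - (3 / 4) * (t + k).
have -> : (ii * a%:C) ^+ 2 - ii * t%:C * (ii * a%:C) + 3 / 4 * t%:C ^+ 2 - 1 =
  (ii * ii) * (a%:C ^+ 2 - t%:C * a%:C) + 3 / 4 * t%:C ^+ 2 - 1 by ring.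
have -> : (ii * ii) * (a%:C ^+ 2 - t%:C * a%:C) + 3 / 4 * t%:C ^+ 2 - 1 =
   (- (a ^+ 2 - t * a) + 3 / 4 * t ^+ 2 - 1)%:C.
  by rewrite ii_sqr !(rmorphB, rmorphD, rmorphN, rmorphM, rmorph1, rmorphXn) /= ?fmorphV ?rmorph_nat; ring.
move=> /complexI E; apply: oppr_inj; rewrite oppr0 -[RHS]E /a; by field.
Qed.

(** A shared eigenvalue is imaginary, which excludes modes inside the unit interval. The case
    [|k| = 1] is excluded by arithmetic. *)
Lemma resonantP j (mu : R) : mu != 1 -> mu != -1 -> resonant j mu ->
  exists (j' : 'I_2) (m : int), let k := mu + 2 * m%:~R / Num.sqrt 3 in
  [/\ m != 0, mu != k, 1 < `|mu| /\ 1 < `|k| & lambda_ j' k = lambda_ j mu].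
Proof.
move=> mu1 muN1 [j' [m [m0 E]]]; exists j', m => k.
have s0 : 2 / Num.sqrt 3 != 0 :> R by rewrite mulf_neq0 ?invr_eq0 ?gt_eqF // sqrt3_gt0.
have kmu : mu != k.
  rewrite -subr_eq0 /k opprD addrA subrr sub0r oppr_eq0 mulrAC mulf_neq0 //.
  by rewrite intr_eq0.
have [zE _] := common_root kmu (disp_lambda j mu) (eq_ind _ (fun z => disp k%:C z = 0) (disp_lambda j' k) _ E).
have Rz : complex.Re (lambda_ j mu) = 0 by rewrite zE -iiE.
have mu1' : 1 < `|mu|.
  rewrite lt_neqAle leNgt; apply/andP; split.
    apply/eqP => /esym n1; have : mu ^+ 2 = 1 by rewrite -real_normK ?num_real // n1 expr1n.
    by move=> /eqP; rewrite sqrf_eq1 (negPf mu1) (negPf muN1).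
  by apply/negP => /(Re_lambda_small j); rewrite Rz eqxx.
have k1 : 1 < `|k|.
  rewrite lt_neqAle leNgt; apply/andP; split; last first.
    by apply/negP => /(Re_lambda_small j'); rewrite E Rz eqxx.
  apply/eqP => /esym n1; have k2 : k ^+ 2 = 1 by rewrite -real_normK ?num_real // n1 expr1n.
  have : congr_mode k mu.
    by have := congr_mode_shift k (- m); rewrite rmorphN /= mulrN mulNr /k addrK.
  (* Were [k] a branch point, [mu] would be its partner [- 5/3 k], which is never congruent to
     it. *)
  suff -> : mu = - (5 / 3) * k by exact: not_congr_other_mode.
  have bk : bb k%:C (lambda_ j' k) = 0.
    by apply/eqP; rewrite -sqrf_eq0 (bb_sqr (disp_lambda j' k)) -rmorphXn k2 rmorph1 subrr.
  have zk : lambda_ j' k = ii * (k / 2)%:C.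
    by move: bk; rewrite /bb => /eqP; rewrite subr_eq0 => /eqP <-; rewrite rmorphM /= halfC; ring.
  have := zk; rewrite E zE => /(mulfI ii_neq0)/complexI; lra.
by split.
Qed.

Lemma frame_resonant j (mu : R) j' (m : int) : let k := mu + 2 * m%:~R / Num.sqrt 3 in
  mu != k -> 1 < `|mu| -> 1 < `|k| -> lambda_ j' k = lambda_ j mu ->
  let V := modes mu%:C (lambda_ j mu) k%:C (lambda_ j mu) in
  is_frame mu (lambda_ j mu) (lambda_ j mu) 0 V (frame_sol mu k V).
Proof.
move=> k muk h hk E V.
have ck : congr_mode mu k by exact: congr_mode_shift.
have D1 := disp_lambda j mu; have := disp_lambda j' k; rewrite E => D2.
have d1N := dot_mode_large j h; have d2N := dot_mode_large j' hk; rewrite E in d2N.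
have dV : det2 V != 0.
  have [t t0 b1E] := bb_large j h; have [t' t'0 b2E] := bb_large j' hk; rewrite E in b2E.
  have -> : det2 V = ii * ((mu - k)%:C + ii * (mu * t' - k * t)%:C).
    rewrite /det2 /V !mxE /= b1E b2E !(rmorphM, rmorphB, rmorphN, rmorphD, rmorph1) /=; ring.
  by rewrite mulf_neq0 ?ii_neq0 //; apply: real_imag_neq0; left; rewrite subr_eq0.
apply: is_frameI; rewrite ?congr_mode_refl //; first by left.
- exact: modes_eq.
- move=> d1 d2 P; rewrite modes_col0 modes_col1 => PF P0 PT.
  exact: (faithful_resonant (congr_mode_refl mu) ck muk D1 D2 d1N d2N PF P0 PT).
- move=> d1 d2 P; rewrite modes_col0 modes_col1 => PF P0 PT.
  exact: (faithful_resonant (congr_mode_refl mu) ck muk D1 D2 d1N d2N PF P0 PT).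
Qed.
End Frames.

(** * Eigenvalue counts and instability *)

Section PartOne.
Context {R : realType}.
Local Notation C := R[i].
Variables (phi psi : R -> R -> R) (T : R -> R).
Hypothesis Hwave : forall h : R, - 6^-1 < h < 0 -> periodic_wave h (phi h) (psi h) (T h).

Lemma lambda_other_neq j (mu : R) : mu != 1 -> mu != -1 -> lambda_ (other j) mu != lambda_ j mu :> C.
Proof.
move=> h1 h2; rewrite -subr_eq0 !lambdaE sgn_other.
have -> : ii * mu%:C / 2 + - sgn j * csqrt1m mu - (ii * mu%:C / 2 + sgn j * csqrt1m mu) =
  (-2) * (sgn j * csqrt1m mu) by ring.
by rewrite !mulf_neq0 ?oppr_eq0 ?pnatr_eq0 ?sgn_neq0 ?csqrt1m_neq0.
Qed.

Lemma Re_lambda_large j (mu : R) : 1 < `|mu| -> complex.Re (lambda_ j mu) = 0.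
Proof.
move=> h; have [s s0 [E _]] := csqrt1m_large h; have [e Ee e2] := sgnE (R := R) j.
rewrite lambdaE E Ee -halfC -mulrA -rmorphM -iiE !ReImE /=; ring.
Qed.

Lemma neq1_norm (mu : R) : mu != 1 -> mu != -1 -> `|mu| != 1.
Proof.
move=> h1 h2; apply/eqP => n1; have : mu ^+ 2 = 1 by rewrite -real_normK ?num_real // n1 expr1n.
by move=> /eqP; rewrite sqrf_eq1 (negPf h1) (negPf h2).
Qed.

Lemma perturbed_nonresonant (mu : R) (j : 'I_2) : mu != 1 -> mu != -1 -> ~ resonant j mu ->
  perturbed phi T mu (lambda_ j mu) 1.
Proof.
move=> h1 h2 nres.
have [hlt|hgt|heq] := ltgtP `|mu| 1; last by have := neq1_norm h1 h2; rewrite heq eqxx.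
  have oj := lambda_other_neq j h1 h2.
  have [m0|m0] := eqVneq mu 0.
    by rewrite m0; have [V FR] := frame_zero j (R := R); rewrite m0 in oj; exact: (frame_perturbed1 Hwave oj FR).
  exact: (frame_perturbed1 Hwave oj (frame_inner j hlt m0)).
have [m [hk kmu FR]] := frame_outer hgt nres.
apply: (frame_perturbed1 Hwave _ FR).
by apply/eqP => E; have := Re_lambda_small 1 hk; rewrite E Re_lambda_large ?eqxx.
Qed.

Lemma perturbed_resonant (mu : R) (j : 'I_2) : mu != 1 -> mu != -1 -> resonant j mu ->
  perturbed phi T mu (lambda_ j mu) 2.
Proof.
move=> h1 h2 /(resonantP h1 h2)[j' [m [m0 kmu [n1 n2] E]]].
exact: (frame_perturbed2 Hwave (frame_resonant kmu n1 n2 E)).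
Qed.

Lemma perturbed_branch_point (e : R) : e ^+ 2 = 1 -> perturbed phi T e (0 +i* (e / 2)) 2.
Proof.
move=> e2; have -> : 0 +i* (e / 2) = ii * e%:C / 2 by rewrite iiE rmorphM /= halfC mulrA.
exact: (frame_perturbed2 Hwave (frame_one e2)).
Qed.

Lemma perturbed_spectrum mu z n : perturbed phi T mu z n.+1 -> 0 < complex.Re z ->
  exists2 h0 : R, 0 < h0 & forall h, - h0 < h < 0 -> spectrally_unstable (phi h).
Proof.
move=> [lam [cv [r [h0 [r0 h00 P]]]]] rz.
have /cvgrPdist_lt/(_ _ rz) := cv ord0.
case/nbhs_ballP => d /= d0 dP.
exists (Num.min h0 d); first by rewrite lt_min h00.
move=> h /andP[hh hn].
have hh0 : - h0 < h < 0 by rewrite hn andbT (le_lt_trans _ hh) // lerN2 ge_min lexx.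
have hd : - d < h by rewrite (le_lt_trans _ hh) // lerN2 ge_min lexx orbT.
have [P1 _] := P h hh0; have [_ sp] := P1 ord0.
exists (lam ord0 h) => //.
have : ball (0 : R) d h by rewrite /ball /= sub0r normrN ltr0_norm //; lra.
move=> /dP/(_ hn); rewrite /= sub0r normrN ger0_norm ?cabs_ge0 // => q.
have := Re_le_cabs (lam ord0 h - z); rewrite ler_norml !ReImE => /andP[q1 _].
lra.
Qed.
End PartOne.

(** * Continuous branches of eigenvalues *)

Section Curves.
Context {R : realType}.
Local Notation C := R[i].
Variable mu0 : R.

(* Joint limits as [h] tends to [0-] and [mu] to [mu0]. *)
Definition tends (F : R -> R -> C) (l : C) := forall r : R, 0 < r -> exists2 d : R, 0 < d &
  forall h mu, - d < h < 0 -> `|mu - mu0| < d -> cabs (F h mu - l) <= r.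

Lemma tends_ext F G l : (forall h mu, F h mu = G h mu) -> tends F l -> tends G l.
Proof. by move=> E H r r0; have [d d0 P] := H r r0; exists d => // h mu h1 h2; rewrite -E; exact: P. Qed.

Lemma tendsC l : tends (fun _ _ => l) l.
Proof. by move=> r r0; exists 1 => // h mu _ _; rewrite subrr cabs0 ltW. Qed.

Lemma near_and (d1 d2 : R) h mu : - Num.min d1 d2 < h < 0 -> `|mu - mu0| < Num.min d1 d2 ->
  [/\ - d1 < h < 0, - d2 < h < 0, `|mu - mu0| < d1 & `|mu - mu0| < d2].
Proof.
move=> /andP[h1 h2]; rewrite lt_min => /andP[m1 m2]; rewrite h2 !andbT; split => //.
  by rewrite (le_lt_trans _ h1) // lerN2 ge_min lexx.
by rewrite (le_lt_trans _ h1) // lerN2 ge_min lexx orbT.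
Qed.

Lemma tends2 F G l m (r s : R) : 0 < r -> 0 < s -> tends F l -> tends G m -> exists2 d : R, 0 < d &
  forall h mu, - d < h < 0 -> `|mu - mu0| < d -> cabs (F h mu - l) <= r /\ cabs (G h mu - m) <= s.
Proof.
move=> r0 s0 HF HG; have [d1 d10 P1] := HF r r0; have [d2 d20 P2] := HG s s0.
exists (Num.min d1 d2); first by rewrite lt_min d10.
by move=> h mu h1 h2; have [? ? ? ?] := near_and h1 h2; split; [exact: P1|exact: P2].
Qed.

Lemma tendsD F G l m : tends F l -> tends G m -> tends (fun h mu => F h mu + G h mu) (l + m).
Proof.
move=> HF HG r r0; have r2 : 0 < r / 2 by rewrite divr_gt0.
have [d d0 P] := tends2 r2 r2 HF HG; exists d => // h mu h1 h2; have [p q] := P h mu h1 h2.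
have -> : F h mu + G h mu - (l + m) = (F h mu - l) + (G h mu - m) by ring.
have := cabsD (F h mu - l) (G h mu - m); lra.
Qed.

Lemma tends_bounded F l : tends F l -> exists2 d : R, 0 < d &
  forall h mu, - d < h < 0 -> `|mu - mu0| < d -> cabs (F h mu) <= cabs l + 1.
Proof.
move=> HF; have [d d0 P] := HF 1 ltr01; exists d => // h mu h1 h2.
have := P h mu h1 h2; have := cabsD (F h mu - l) l; rewrite subrK; lra.
Qed.

Lemma tendsM F G l m : tends F l -> tends G m -> tends (fun h mu => F h mu * G h mu) (l * m).
Proof.
move=> HF HG r r0; pose K := cabs l + cabs m + 1.
have K0 : 0 < K by rewrite ltr_wpDl // addr_ge0 ?cabs_ge0.
pose q := Num.min 1 (r / (2 * K)).
have q0 : 0 < q by rewrite lt_min ltr01 !divr_gt0 // mulr_gt0.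
have q1 : q <= 1 by rewrite ge_min lexx.
have qr : K * q <= r / 2.
  have : q <= r / (2 * K) by rewrite ge_min lexx orbT.
  move=> /(ler_wpM2l (ltW K0)) /le_trans; apply.
  by rewrite le_eqVlt; apply/orP; left; apply/eqP; field; rewrite gt_eqF.
have [d d0 P] := tends2 q0 q0 HF HG; exists d => // h mu h1 h2; have [a b] := P h mu h1 h2.
have -> : F h mu * G h mu - l * m =
  (F h mu - l) * (G h mu - m) + (l * (G h mu - m) + m * (F h mu - l)) by ring.
apply: le_trans (cabsD _ _) _; apply: le_trans (lerD (lexx _) (cabsD _ _)) _; rewrite !cabsM.
have c1 : cabs (F h mu - l) * cabs (G h mu - m) <= 1 * q.
  by apply: ler_pM; rewrite ?cabs_ge0 // (le_trans a).
have c2 : cabs l * cabs (G h mu - m) <= cabs l * q by rewrite ler_wpM2l ?cabs_ge0.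
have c3 : cabs m * cabs (F h mu - l) <= cabs m * q by rewrite ler_wpM2l ?cabs_ge0.
have : K * q = cabs l * q + cabs m * q + q by rewrite /K; ring.
move: qr c1 c2 c3 r0; rewrite mul1r; lra.
Qed.

Lemma tendsN F l : tends F l -> tends (fun h mu => - F h mu) (- l).
Proof.
move=> H; rewrite -mulN1r; apply: tends_ext (tendsM (tendsC (-1)) H) => h mu; exact: mulN1r.
Qed.
Lemma tendsB F G l m : tends F l -> tends G m -> tends (fun h mu => F h mu - G h mu) (l - m).
Proof. by move=> HF /tendsN; exact: tendsD. Qed.
Lemma tendsZ c F l : tends F l -> tends (fun h mu => c * F h mu) (c * l).
Proof. exact: tendsM (tendsC c). Qed.

Lemma tendsV F l : l != 0 -> tends F l -> tends (fun h mu => (F h mu)^-1) l^-1.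
Proof.
move=> l0 H r r0; have c0 : 0 < cabs l by rewrite cabs_gt0.
pose q := Num.min (cabs l / 2) (r * cabs l ^+ 2 / 2).
have q0 : 0 < q by rewrite lt_min !divr_gt0 // mulr_gt0 // exprn_gt0.
have q1 : q <= cabs l / 2 by rewrite ge_min lexx.
have q2 : q <= r * cabs l ^+ 2 / 2 by rewrite ge_min lexx orbT.
have [d d0 P] := H q q0; exists d => // h mu h1 h2; have a := P h mu h1 h2.
have F1 : cabs l / 2 <= cabs (F h mu).
  have := cabsB (F h mu) (F h mu - l); rewrite opprB addrCA subrr addr0; lra.
have F0 : F h mu != 0.
  by apply/eqP => E; move: F1; rewrite E cabs0; lra.
have -> : (F h mu)^-1 - l^-1 = - (F h mu - l) / (F h mu * l) by field; rewrite F0 l0.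
have FL : 0 < cabs (F h mu * l) by rewrite cabs_gt0 // mulf_neq0.
rewrite cabsM cabsN cabsV ler_pdivrMr // cabsM.
have : r * (cabs l / 2 * cabs l) <= r * (cabs (F h mu) * cabs l).
  by rewrite ler_wpM2l ?(ltW r0) // ler_wpM2r // ltW.
apply: le_trans; apply: le_trans a _; apply: le_trans q2 _.
by rewrite le_eqVlt; apply/orP; left; apply/eqP; field.
Qed.

Lemma tends_mu : tends (fun _ mu => mu%:C) mu0%:C.
Proof. by move=> r r0; exists r => // h mu _ h2; rewrite -rmorphB cabs_real ltW. Qed.

Definition tends_mx (F : R -> R -> 'M[C]_2) (L : 'M[C]_2) := forall i j, tends (fun h mu => F h mu i j) (L i j).

Lemma tends_mxP F L : tends_mx F L -> forall r : R, 0 < r -> exists2 d : R, 0 < d &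
  forall h mu, - d < h < 0 -> `|mu - mu0| < d -> mnorm (F h mu - L) <= r.
Proof.
move=> H r r0; have r4 : 0 < r / 4 by rewrite divr_gt0.
have [d1 d10 P1] := tends2 r4 r4 (H 0 0) (H 0 1); have [d2 d20 P2] := tends2 r4 r4 (H 1 0) (H 1 1).
exists (Num.min d1 d2); first by rewrite lt_min d10.
move=> h mu h1 h2; have [a1' a2 a3 a4] := near_and h1 h2.
have [p1 p2] := P1 h mu a1' a3; have [p3 p4] := P2 h mu a2 a4.
by rewrite [_ - _]mx22E mnorm22 !mxE; lra.
Qed.

Lemma tends_mx22 a b c d a' b' c' d' : tends a a' -> tends b b' -> tends c c' -> tends d d' ->
  tends_mx (fun h mu => mx22 (a h mu) (b h mu) (c h mu) (d h mu)) (mx22 a' b' c' d').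
Proof.
move=> ta tb tc td i j; rewrite mxE.
apply: (tends_ext (F := fun h mu => if i == 0 then (if j == 0 then a h mu else b h mu) else (if j == 0 then c h mu else d h mu))).
  by move=> h mu; rewrite mxE.
by case: (i == 0); case: (j == 0).
Qed.

Lemma tends_mxM F G L M : tends_mx F L -> tends_mx G M -> tends_mx (fun h mu => F h mu *m G h mu) (L *m M).
Proof.
move=> HF HG i j; rewrite mulmx22E.
apply: (tends_ext (F := fun h mu => F h mu i 0 * G h mu 0 j + F h mu i 1 * G h mu 1 j)).
  by move=> h mu; rewrite mulmx22E.
by apply: tendsD; apply: tendsM.
Qed.
Lemma tends_mxC L : tends_mx (fun _ _ => L) L. Proof. by move=> i j; exact: tendsC. Qed.

(** Explicit entries make the inverse a rational expression, whose limit follows from the rules for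
    [tends]. *)
Definition inv22 (V : 'M[C]_2) : 'M[C]_2 := mx22 (V 1 1 / det2 V) (- V 0 1 / det2 V) (- V 1 0 / det2 V) (V 0 0 / det2 V).
Lemma inv22P V : det2 V != 0 -> V *m inv22 V = 1%:M /\ inv22 V *m V = 1%:M.
Proof.
move=> d; have E : V *m inv22 V = 1%:M.
  rewrite mx22_1 [LHS]mx22E; apply: mx22_eq; rewrite mulmx22E !mxE /= /det2; rewrite /det2 in d;
  by field.
by split=> //; exact: mulmx1C.
Qed.

Lemma tends_det2 F L : tends_mx F L -> tends (fun h mu => det2 (F h mu)) (det2 L).
Proof. by move=> H; apply: tendsB; apply: tendsM. Qed.

Lemma tends_inv22 F L : det2 L != 0 -> tends_mx F L -> tends_mx (fun h mu => inv22 (F h mu)) (inv22 L).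
Proof.
move=> d H; have D := tendsV d (tends_det2 H).
by apply: tends_mx22; apply: tendsM => //; apply: tendsN.
Qed.

(** In contrast to [root_close] the bound is linear in [e]: the gap between the diagonal entries
    dominates the perturbation, so the product of the two distances can be divided by it. *)
Lemma root_gap (a b t d l1 l2 : C) (E : 'M[C]_2) (g e : R) : 0 < g -> 32 * e <= g -> g <= cabs (a - b) ->
  (forall i j, cabs (E i j) <= e) ->
  l1 + l2 = tr2 (mx22 a 0 0 b + E) -> l1 * l2 = det2 (mx22 a 0 0 b + E) ->
  cabs (l1 - a) <= cabs (l2 - a) -> cabs (l1 - a) <= 3 * e /\ cabs (l2 - b) <= 5 * e.
Proof.
move=> g0 eg gG Ee tr det le12.
have e0 : 0 <= e := le_trans (cabs_ge0 _) (Ee 0 0).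
set G := cabs (a - b) in gG.
have G0 : 0 < G by exact: lt_le_trans gG.
have trE : l1 + l2 = a + b + (E 0 0 + E 1 1) by rewrite tr /tr2 !mxE /=; ring.
have detE : l1 * l2 = (a + E 0 0) * (b + E 1 1) - E 0 1 * E 1 0 by rewrite det /det2 !mxE /=; ring.
have sE : cabs (E 0 0 + E 1 1) <= 2 * e.
  have := cabsD (E 0 0) (E 1 1); have := Ee 0 0; have := Ee 1 1; lra.
have p : (l1 - a) * (l2 - a) = E 0 0 * (b - a) + (E 0 0 * E 1 1 - E 0 1 * E 1 0).
  have -> : (l1 - a) * (l2 - a) = l1 * l2 - (l1 + l2) * a + a ^+ 2 by ring.
  by rewrite trE detE; ring.
have ee (i j k l : 'I_2) : cabs (E i j * E k l) <= e * e.
  by rewrite cabsM; apply: ler_pM; rewrite ?cabs_ge0.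
have pc : cabs (l1 - a) * cabs (l2 - a) <= e * G + 2 * (e * e).
  rewrite -cabsM p; have h1 := cabsD (E 0 0 * (b - a)) (E 0 0 * E 1 1 - E 0 1 * E 1 0).
  have h2 := cabsB (E 0 0 * E 1 1) (E 0 1 * E 1 0).
  have h3 : cabs (E 0 0 * (b - a)) <= e * G.
    by rewrite cabsM [cabs (b - a)]cabs_distC -/G ler_wpM2r ?(ltW G0).
  have := ee 0 0 1 1; have := ee 0 1 1 0; lra.
have l2G : G - 2 * e <= 2 * cabs (l2 - a).
  have : G <= cabs (l1 - a) + cabs (l2 - a) + 2 * e.
    rewrite /G; have -> : a - b = (E 0 0 + E 1 1) - ((l1 - a) + (l2 - a)).
      have -> : (l1 - a) + (l2 - a) = l1 + l2 - 2 * a by ring.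
      by rewrite trE; ring.
    have := cabsB (E 0 0 + E 1 1) ((l1 - a) + (l2 - a)); have := cabsD (l1 - a) (l2 - a); lra.
  lra.
have x0 := cabs_ge0 (l1 - a).
have l1e : cabs (l1 - a) <= 3 * e.
  have h1 : cabs (l1 - a) * (G - 2 * e) <= 2 * (e * G + 2 * (e * e)).
    have := ler_wpM2l x0 l2G; lra.
  have h2 : e * e <= e * G / 32 by have := ler_wpM2l e0 (le_trans eg gG); lra.
  have h3 : cabs (l1 - a) * (G * (15 / 16)) <= cabs (l1 - a) * (G - 2 * e).
    by apply: ler_wpM2l => //; lra.
  have h4 : cabs (l1 - a) * G <= (3 * e) * G by have := mulr_ge0 e0 (ltW G0); lra.
  by move: h4; rewrite ler_pM2r.
split=> //.
have -> : l2 - b = (E 0 0 + E 1 1) - (l1 - a).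
  have -> : l2 = a + b + (E 0 0 + E 1 1) - l1 by rewrite -trE; ring.
  by ring.
have := cabsB (E 0 0 + E 1 1) (l1 - a); lra.
Qed.
End Curves.

Section LocalCurve.
Context {R : realType}.
Local Notation C := R[i].
Variables (phi psi : R -> R -> R) (T : R -> R).
Hypothesis Hwave : forall h : R, - 6^-1 < h < 0 -> periodic_wave h (phi h) (psi h) (T h).

Definition cont_at (F : R -> C) (mu : R) := forall r : R, 0 < r -> exists2 d : R, 0 < d &
  forall mu', `|mu' - mu| < d -> cabs (F mu' - F mu) <= r.

Lemma tr2_conj (W Wi L : 'M[C]_2) : Wi *m W = 1%:M -> tr2 (W *m L *m Wi) = tr2 L.
Proof.
have trM (A B : 'M[C]_2) : tr2 (A *m B) = tr2 (B *m A) by rewrite /tr2 !mulmx22E; ring.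
by move=> E; rewrite trM mulmxA E mul1mx.
Qed.
Lemma det2M (A B : 'M[C]_2) : det2 (A *m B) = det2 A * det2 B.
Proof. by rewrite /det2 !mulmx22E; ring. Qed.
Lemma det2_conj (W Wi L : 'M[C]_2) : Wi *m W = 1%:M -> det2 (W *m L *m Wi) = det2 L.
Proof. by move=> E; rewrite det2M mulrC -det2M mulmxA E mul1mx. Qed.

Lemma conj_sub (W Wi L D : 'M[C]_2) : W *m Wi = 1%:M ->
  D + W *m (L - Wi *m D *m W) *m Wi = W *m L *m Wi.
Proof.
move=> E; rewrite mulmxBr mulmxBl -!mulmxA E mulmx1 (mulmxA W Wi D) E mul1mx.
by rewrite addrC subrK.
Qed.

Lemma unit_det2_neq0 (V : 'M[C]_2) : V \in unitmx -> det2 V != 0.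
Proof.
move=> Vu; have := det2M V (invmx V); rewrite mulmxV // => E; apply/eqP => V0.
by move: E => /eqP; rewrite V0 mul0r /det2 !mxE /= mulr1n mulr0n mulr0 subr0 mulr1 oner_eq0.
Qed.

(** The left-hand side is the modulus of the characteristic polynomial of [L] at [l]; that of [L']
    vanishes there, and the coefficients differ by a multiple of [r]. *)
Lemma root_perturbation (L L' : 'M[C]_2) (l1 l2 l : C) (r B : R) :
  l1 + l2 = tr2 L -> l1 * l2 = det2 L -> l ^+ 2 - tr2 L' * l + det2 L' = 0 ->
  mnorm (L - L') <= r -> mnorm L <= B -> mnorm L' <= B -> cabs l <= B ->
  cabs (l - l1) * cabs (l - l2) <= 6 * B * r.
Proof.
move=> tr det root Lr LB LB' lB; rewrite -cabsM.
have e i j : cabs (L i j - L' i j) <= r.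
  by have := le_trans (cabs_le_mnorm (L - L') i j) Lr; rewrite !mxE.
have b i j := le_trans (cabs_le_mnorm L i j) LB.
have b' i j := le_trans (cabs_le_mnorm L' i j) LB'.
have B0 : 0 <= B := le_trans (cabs_ge0 _) lB.
have r0 : 0 <= r := le_trans (mnorm_ge0 _) Lr.
have -> : (l - l1) * (l - l2) = (- l) * (L 0 0 - L' 0 0) + (- l) * (L 1 1 - L' 1 1)
   + (L 0 0 - L' 0 0) * L 1 1 + L' 0 0 * (L 1 1 - L' 1 1)
   - (L 0 1 - L' 0 1) * L 1 0 - L' 0 1 * (L 1 0 - L' 1 0).
  have -> : (l - l1) * (l - l2) = l ^+ 2 - (l1 + l2) * l + l1 * l2 by ring.
  by rewrite tr det -[LHS]subr0 -root /tr2 /det2; ring.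
have m1 (x y : C) : cabs x <= B -> cabs y <= r -> cabs (x * y) <= B * r.
  by move=> h1 h2; rewrite cabsM; apply: ler_pM; rewrite ?cabs_ge0.
have m2 (x y : C) : cabs x <= r -> cabs y <= B -> cabs (x * y) <= B * r.
  by move=> h1 h2; rewrite mulrC; exact: m1.
have lN : cabs (- l) <= B by rewrite cabsN.
have -> : 6 * B * r = B * r + B * r + B * r + B * r + B * r + B * r by ring.
do 2 (apply: le_trans (cabsB _ _) _; apply: lerD; last by [apply: m2|apply: m1]).
do 3 (apply: le_trans (cabsD _ _) _; apply: lerD; last by [apply: m2|apply: m1]).
exact: m1.
Qed.

(* The eigenvalue is the root of the characteristic polynomial closest to [la]; it
   depends continuously on [mu] because the other root stays away. *)
Lemma local_curve mu0 z z' V U0 (la lb : R -> R -> C) (V' : R -> R -> 'M[C]_2) (ep g : R -> R) :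
  is_frame mu0 z z' 0 V U0 -> tends mu0 la z -> tends mu0 lb z' -> tends_mx mu0 V' V ->
  (exists2 d : R, 0 < d & forall h mu, - d < h < 0 -> `|mu - mu0| < d ->
    [/\ cont_at (la h) mu, 0 < g h, g h <= cabs (la h mu - lb h mu) &
      exists G Y, [/\ flow (phi h) (mx22 (la h mu) 0 0 (lb h mu)) G Y, Y 0 = V' h mu,
        Y (T h) = expi mu (T h) *: V' h mu & forall x, mnorm (G x) <= ep h]]) ->
  (forall r, 0 < r -> exists2 d : R, 0 < d & forall h, - d < h < 0 -> ep h <= r * g h) ->
  exists (l : R -> R -> C) (d K : R), [/\ 0 < d, 0 < K & forall h mu, - d < h < 0 -> `|mu - mu0| < d ->
    [/\ bloch_eigenvalue (phi h) (T h) mu (l h mu), cont_at (l h) mu &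
        cabs (l h mu - la h mu) <= K * ep h]].
Proof.
move=> FR tla tlb tV [d1 d10 H1] small.
have [Lam [U [d [h0 [c [[d0 h00] BR LIP APP _]]]]]] := local_branch Hwave FR.
have [[Vu _ _ _] _] := FR.
have dV := unit_det2_neq0 Vu; have [VV VV'] := inv22P dV.
(* The true frames start at the fixed [V], the approximate ones at [V' h mu]. Right multiplication
   by [W] passes from the second normalization to the first and conjugates the diagonal matrix
   [D]. *)
pose W h mu := inv22 (V' h mu) *m V; pose Wi h mu := inv22 V *m V' h mu.
pose D h mu := mx22 (la h mu) 0 0 (lb h mu).
have tW : tends_mx mu0 W 1%:M by rewrite -VV'; apply: tends_mxM; [exact: tends_inv22|exact: tends_mxC].
have tWi : tends_mx mu0 Wi 1%:M by rewrite -VV'; apply: tends_mxM; [exact: tends_mxC|].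
have tD : tends_mx mu0 D (mx22 z 0 0 z') by apply: tends_mx22 => //; exact: tendsC.
have tL : tends_mx mu0 (fun h mu => Wi h mu *m D h mu *m W h mu) (mx22 z 0 0 z').
  by have := tends_mxM (tends_mxM tWi tD) tW; rewrite mul1mx mulmx1.
have WE h mu : W h mu = inv22 (V' h mu) *m V by [].
have WiE h mu : Wi h mu = inv22 V *m V' h mu by [].
clearbody W Wi.
have [d2 d20 H2] := tends_mxP tW ltr01; have [d3 d30 H3] := tends_mxP tWi ltr01.
have [d4 d40 H4] := tends_mxP tL d0.
have dV0 : 0 < cabs (det2 V) / 2 by rewrite divr_gt0 // cabs_gt0.
have [d5 d50 H5] := tends_det2 tV dV0.
pose KW := mnorm (1%:M : 'M[C]_2) + 1.
have KW0 : 0 < KW by rewrite ltr_wpDl // mnorm_ge0.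
have [c' [c'0 APP']] : exists c' : R, 0 < c' /\ forall h mu L G Y eps, - h0 < h < 0 -> `|mu - mu0| < d ->
      mnorm (L - mx22 z 0 0 z') <= d -> flow (phi h) L G Y -> Y 0 = V ->
      Y (T h) = expi mu (T h) *: V -> (forall x, mnorm (G x) <= eps) ->
      mnorm (Lam h mu - L) <= c' * eps.
  exists (`|c| + 1); split; first by rewrite ltr_wpDl.
  move=> h mu L G Y eps q1 q2 q3 q4 q5 q6 q7; apply: le_trans (APP h mu L G Y eps q1 q2 q3 q4 q5 q6 q7) _.
  have eps0 : 0 <= eps := le_trans (mnorm_ge0 _) (q7 0).
  by rewrite ler_wpM2r // (le_trans (ler_norm c)) // lerDl.
pose K1 := KW * (c' * KW) * KW.
have K10 : 0 < K1 by rewrite !mulr_gt0.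
have r10 : 0 < (32 * K1)^-1 by rewrite invr_gt0 mulr_gt0.
have [d6 d60 H6] := small _ r10.
have [h6 h60 W6] := wave_small Hwave ltr01.
pose dd := Num.min (Num.min (Num.min d h0) (Num.min d1 d2)) (Num.min (Num.min d3 d4) (Num.min d5 (Num.min d6 h6))).
have dd0 : 0 < dd by rewrite !lt_min d0 h00 d10 d20 d30 d40 d50 d60.
have sub (e : R) : dd <= e -> forall h mu, - dd < h < 0 -> `|mu - mu0| < dd -> - e < h < 0 /\ `|mu - mu0| < e.
  by move=> de h mu /andP[q1 q2] q3; rewrite q2 andbT; split; [rewrite (le_lt_trans _ q1) // lerN2|exact: lt_le_trans q3 de].
have [l lP] := choice (fun p : R * R => quadratic_roots (tr2 (Lam p.1 p.2)) (det2 (Lam p.1 p.2)) (la p.1 p.2)).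
have [l' lP'] := choice lP.
have core h mu : - dd < h < 0 -> `|mu - mu0| < dd ->
   [/\ cabs (l (h, mu) - la h mu) <= 3 * (K1 * ep h), cabs (l' (h, mu) - lb h mu) <= 5 * (K1 * ep h) &
       32 * (K1 * ep h) <= g h].
  move=> hh mm.
  have [ha ma] := sub d ltac:(by rewrite !ge_min lexx ?orbT) h mu hh mm.
  have [hb _] := sub h0 ltac:(by rewrite !ge_min lexx ?orbT) h mu hh mm.
  have [hc mc] := sub d1 ltac:(by rewrite !ge_min lexx ?orbT) h mu hh mm.
  have [hd md] := sub d2 ltac:(by rewrite !ge_min lexx ?orbT) h mu hh mm.
  have [he me] := sub d3 ltac:(by rewrite !ge_min lexx ?orbT) h mu hh mm.
  have [hf mf] := sub d4 ltac:(by rewrite !ge_min lexx ?orbT) h mu hh mm.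
  have [hg mg] := sub d5 ltac:(by rewrite !ge_min lexx ?orbT) h mu hh mm.
  have [hi _] := sub d6 ltac:(by rewrite !ge_min lexx ?orbT) h mu hh mm.
  have [_ g0 gap [G [Y [YF Y0 YT Gep]]]] := H1 h mu hc mc.
  have ep0 : 0 <= ep h := le_trans (mnorm_ge0 _) (Gep 0).
  have dV' : det2 (V' h mu) != 0.
    apply/eqP => E; have := H5 h mu hg mg; rewrite E sub0r cabsN.
    by move: dV0; clear -Hwave; lra.
  have [Q1 Q2] := inv22P dV'.
  have WWi : W h mu *m Wi h mu = 1%:M.
    by rewrite WE WiE -!mulmxA (mulmxA V) VV mul1mx Q2.
  have WiW : Wi h mu *m W h mu = 1%:M by exact: mulmx1C.
  have Wb (A : 'M[C]_2) : mnorm (A - 1%:M) <= 1 -> mnorm A <= KW.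
    by move=> A1; rewrite -[A](subrK 1%:M) (le_trans (mnormD _ _)) // addrC /KW lerD2l.
  have nW := Wb _ (H2 h mu hd md); have nWi := Wb _ (H3 h mu he me).
  have nGW x : mnorm (G x *m W h mu) <= KW * ep h.
    rewrite (le_trans (mnormM _ _)) // mulrC; apply: ler_pM; rewrite ?mnorm_ge0 //.
  have ZF : flow (phi h) (Wi h mu *m D h mu *m W h mu) (fun x => G x *m W h mu) (fun x => Y x *m W h mu).
    apply: flow_mulr YF _ => x; congr (_ + _).
    by rewrite -[in RHS]mulmxA [in RHS](mulmxA (W h mu)) WWi mul1mx.
  have Z0 : Y 0 *m W h mu = V by rewrite Y0 WE mulmxA Q1 mul1mx.
  have ZT : Y (T h) *m W h mu = expi mu (T h) *: V by rewrite YT -scalemxAl WE mulmxA Q1 mul1mx.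
  have LL := APP' h mu _ _ _ _ hb ma (H4 h mu hf mf) ZF Z0 ZT nGW.
  pose E := W h mu *m (Lam h mu - Wi h mu *m D h mu *m W h mu) *m Wi h mu.
  have nE : mnorm E <= K1 * ep h.
    have -> : K1 * ep h = KW * (c' * (KW * ep h)) * KW by rewrite /K1; ring.
    rewrite (le_trans (mnormM _ _)) //; apply: ler_pM; rewrite ?mnorm_ge0 //.
    by rewrite (le_trans (mnormM _ _)) //; apply: ler_pM; rewrite ?mnorm_ge0.
  have EE : D h mu + E = W h mu *m Lam h mu *m Wi h mu.
    exact: conj_sub.
  have [t1 t2 t3] := lP' (h, mu); rewrite /= in t1 t2 t3.
  have s32 : 32 * (K1 * ep h) <= g h.
    have q : (32 * K1)^-1 * g h = g h / (32 * K1) by rewrite mulrC.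
    have := H6 h hi; rewrite q ler_pdivlMr ?mulr_gt0 // => q'.
    by have -> : 32 * (K1 * ep h) = ep h * (32 * K1) by ring.
  split=> //.
    have [] := @root_gap R (la h mu) (lb h mu) 0 0 (l (h, mu)) (l' (h, mu)) E (g h) (K1 * ep h) g0 s32 gap
      (fun i j => le_trans (cabs_le_mnorm _ _ _) nE) => //.
      by rewrite -/(D h mu) EE tr2_conj.
    by rewrite -/(D h mu) EE det2_conj.
  have [] := @root_gap R (la h mu) (lb h mu) 0 0 (l (h, mu)) (l' (h, mu)) E (g h) (K1 * ep h) g0 s32 gap
      (fun i j => le_trans (cabs_le_mnorm _ _ _) nE) => //.
    by rewrite -/(D h mu) EE tr2_conj.
  by rewrite -/(D h mu) EE det2_conj.
exists (fun h mu => l (h, mu)), dd, (3 * K1); split => //; first by rewrite mulr_gt0.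
move=> h mu hh mm; have [c1 c2 c3] := core h mu hh mm.
have [ha ma] := sub d ltac:(by rewrite !ge_min lexx ?orbT) h mu hh mm.
have [hb _] := sub h0 ltac:(by rewrite !ge_min lexx ?orbT) h mu hh mm.
have [hc mc] := sub d1 ltac:(by rewrite !ge_min lexx ?orbT) h mu hh mm.
have [t1 t2 _] := lP' (h, mu); rewrite /= in t1 t2.
split; last by rewrite -mulrA.
  have [B1 B2 B3 _] := BR h mu hb ma.
  have [v v0 Lv] := root_eigenvector t1 t2.
  have [hi _] := sub h6 ltac:(by rewrite !ge_min lexx ?orbT) h mu hh mm.
  have [hr ph _] := W6 h hi.
  by apply: (flow_eigenvalue ph (wave_per (Hwave hr)) B1 B2 B3 Vu); exists v.
(* Continuity is a statement at fixed [h]. The gap [g h] may be tiny, but it does not depend on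
   [mu], and it keeps the root at [mu'] away from the second root at [mu]; [root_perturbation] then
   bounds its distance to the first. *)
have [lac g0 gap _] := H1 h mu hc mc.
move=> r r0.
pose B := mnorm (Lam h mu) + `|c| + cabs (la h mu) + g h + 1.
have B0 : 0 < B by rewrite ltr_wpDl // !addr_ge0 ?mnorm_ge0 ?cabs_ge0 ?(ltW g0).
have g4 : 0 < g h / 4 by rewrite divr_gt0.
have [da da0 Ha] := lac (g h / 4) g4.
pose q := r * (g h / 2) / (6 * B * (`|c| + 1)).
have c10 : 0 < `|c| + 1 by rewrite ltr_wpDl.
have q0 : 0 < q by rewrite divr_gt0 ?mulr_gt0 // divr_gt0.
pose db := dd - `|mu - mu0|.
have db0 : 0 < db by rewrite subr_gt0.
exists (Num.min (Num.min 1 da) (Num.min db q)); first by rewrite !lt_min ltr01 da0 db0.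
move=> mu'; rewrite !lt_min => /andP[/andP[m1 ma'] /andP[mb mq]].
have mm' : `|mu' - mu0| < dd.
  have := ler_normD (mu' - mu) (mu - mu0); rewrite addrA subrK.
  by move: mb; rewrite /db; clear -Hwave; lra.
have [e1 e2 e3] := core h mu' hh mm'.
have [_ ma''] := sub d ltac:(by rewrite !ge_min lexx ?orbT) h mu' hh mm'.
have LLm : mnorm (Lam h mu - Lam h mu') <= `|c| * `|mu' - mu|.
  apply: le_trans (LIP h mu mu' hb ma ma'') _; rewrite distrC ler_wpM2r // ler_norm //.
have [s1 s2 _] := lP' (h, mu'); rewrite /= in s1 s2.
have root : l (h, mu') ^+ 2 - tr2 (Lam h mu') * l (h, mu') + det2 (Lam h mu') = 0.
  by rewrite -s1 -s2; ring.
have la' := Ha mu' ma'.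
have LB : mnorm (Lam h mu) <= B.
  by rewrite /B; move: (cabs_ge0 (la h mu)) (normr_ge0 c) g0; clear -Hwave; lra.
have LB' : mnorm (Lam h mu') <= B.
  have w1 : mnorm (Lam h mu') <= mnorm (Lam h mu) + `|c| * `|mu' - mu|.
    rewrite -[Lam h mu'](subKr (Lam h mu)) (le_trans (mnormB _ _)) // lerD2l //.
  have w2 : `|c| * `|mu' - mu| <= `|c| by rewrite ler_piMr // ltW.
  by move: w1 w2; rewrite /B; move: (cabs_ge0 (la h mu)) g0; clear -Hwave; lra.
have lB : cabs (l (h, mu')) <= B.
  have w1 := cabsD (l (h, mu') - la h mu') ((la h mu' - la h mu) + la h mu).
  have w2 := cabsD (la h mu' - la h mu) (la h mu).
  have w3 : (l (h, mu') - la h mu') + ((la h mu' - la h mu) + la h mu) = l (h, mu') by ring.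
  rewrite w3 in w1; move: w1 w2 e1 e3 la' g0 (mnorm_ge0 (Lam h mu)) (normr_ge0 c); rewrite /B; clear -Hwave; lra.
have RP := root_perturbation t1 t2 root LLm LB LB' lB.
have far : g h / 2 <= cabs (l (h, mu') - l' (h, mu)).
  have w1 : la h mu - lb h mu = (l (h, mu') - l' (h, mu)) - (l (h, mu') - la h mu')
     - (la h mu' - la h mu) + (l' (h, mu) - lb h mu) by ring.
  have w2 := cabsD ((l (h, mu') - l' (h, mu)) - (l (h, mu') - la h mu') - (la h mu' - la h mu)) (l' (h, mu) - lb h mu).
  have w3 := cabsB ((l (h, mu') - l' (h, mu)) - (l (h, mu') - la h mu')) (la h mu' - la h mu).
  have w4 := cabsB (l (h, mu') - l' (h, mu)) (l (h, mu') - la h mu').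
  rewrite -w1 in w2; move: w2 w3 w4 gap e1 c2 c3 la' g0; clear -Hwave; lra.
have g2 : 0 < g h / 2 by rewrite divr_gt0.
rewrite -(ler_pM2r g2); apply: le_trans (ler_wpM2l (cabs_ge0 _) far) _; apply: le_trans RP _.
have -> : r * (g h / 2) = 6 * B * ((`|c| + 1) * q).
  by rewrite /q; field; rewrite !gt_eqF.
apply: ler_wpM2l; first by rewrite mulr_ge0 // ltW.
by apply: ler_pM => //; [rewrite lerDl | exact: ltW].
Qed.
End LocalCurve.

(** * Curves away from resonances *)

Section NonresonantCurves.
Context {R : realType}.
Local Notation C := R[i].
Variables (phi psi : R -> R -> R) (T : R -> R).
Hypothesis Hwave : forall h : R, - 6^-1 < h < 0 -> periodic_wave h (phi h) (psi h) (T h).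

Lemma csqrt1m_ge0 (a : R) : 0 <= complex.Re (csqrt1m a) /\ 0 <= complex.Im (csqrt1m a).
Proof. by rewrite /csqrt1m; case: ifP => _ /=; split; rewrite ?sqrtr_ge0. Qed.

(* Both square roots lie in the closed first quadrant, so their difference is
   at most their sum in modulus. *)
Lemma csqrt1m_holder (a b : R) : cabs (csqrt1m a - csqrt1m b) ^+ 2 <= `|a ^+ 2 - b ^+ 2|.
Proof.
have E : (csqrt1m a - csqrt1m b) * (csqrt1m a + csqrt1m b) = (b ^+ 2 - a ^+ 2)%:C.
  by rewrite -subr_sqr !csqrt1m_sqr rmorphB !rmorphXn /=; ring.
rewrite -normrN opprB -cabs_real -E cabsM expr2 ler_wpM2l ?cabs_ge0 //.
have [ra ia] := csqrt1m_ge0 a; have [rb ib] := csqrt1m_ge0 b.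
move: (csqrt1m a) (csqrt1m b) ra ia rb ib => [x y] [x' y'] /= ra ia rb ib.
rewrite /cabs /=.
apply: ler_wsqrtr; apply: lerD.
  by have := mulr_ge0 ra rb; nra.
by have := mulr_ge0 ia ib; nra.
Qed.

Lemma lambda_continuous j (k0 r : R) : 0 < r -> exists2 d : R, 0 < d &
  forall k, `|k - k0| < d -> cabs (lambda_ j k - lambda_ j k0) <= r.
Proof.
move=> r0; pose M := 2 * `|k0| + 1.
have M0 : 0 < M by rewrite ltr_wpDl // mulr_ge0.
pose d := Num.min 1 (Num.min r ((r / 2) ^+ 2 / M)).
have r2 : 0 < r / 2 by rewrite divr_gt0.
have d0 : 0 < d by rewrite !lt_min ltr01 r0 divr_gt0 // exprn_gt0.
exists d => // k; rewrite !lt_min => /andP[k1 /andP[kr kM]].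
have h1 : cabs (csqrt1m k - csqrt1m k0) <= r / 2.
  rewrite -(@ler_pXn2r _ 2) ?nnegrE ?cabs_ge0 ?(ltW r2) //.
  apply: le_trans (csqrt1m_holder _ _) _; rewrite subr_sqr normrM.
  move: kM; rewrite ltr_pdivlMr // => /ltW; apply: le_trans; rewrite ler_wpM2l //.
  have := ler_normD (k - k0) (2 * k0); rewrite normrM normr_nat.
  have -> : k - k0 + 2 * k0 = k + k0 by ring.
  rewrite /M; lra.
have -> : lambda_ j k - lambda_ j k0 = ii * ((k - k0) / 2)%:C + sgn j * (csqrt1m k - csqrt1m k0).
  by rewrite !lambdaE rmorphM rmorphB /= halfC; ring.
apply: le_trans (cabsD _ _) _; rewrite -iiE cabs_imag cabsM.
have -> : cabs (sgn j) = 1 :> R.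
  by rewrite /sgn; case: (j == 0); rewrite ?cabsN -[1]/(1%:C) cabs_real normr1.
rewrite mul1r normrM (gtr0_norm (x := 2^-1)) //; lra.
Qed.

Lemma lambda_cont_at j (k0 : R) : cont_at (lambda_ j) k0.
Proof. by move=> r r0; exact: lambda_continuous. Qed.

Lemma tends_lambda mu0 j (k : R -> R -> R) k0 : tends mu0 (fun h mu => (k h mu)%:C) k0%:C ->
  tends mu0 (fun h mu => lambda_ j (k h mu)) (lambda_ j k0).
Proof.
move=> H r r0; have [d d0 P] := lambda_continuous j k0 r0.
have d2 : 0 < d / 2 by rewrite divr_gt0.
have [e e0 Q] := H _ d2; exists e => // h mu h1 h2; apply: P.
have := Q h mu h1 h2; rewrite -rmorphB cabs_real; lra.
Qed.

Lemma tends_T mu0 : tends mu0 (fun h _ => (T h)%:C) per0%:C.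
Proof.
move=> r r0; have [d d0 P] := wave_small Hwave r0; exists d => // h mu h1 _.
by have [_ _] := P h h1; rewrite -rmorphB cabs_real.
Qed.

Definition freq (h : R) : R := 2 * pi / T h.
Lemma tends_freq mu0 : tends mu0 (fun h _ => (freq h)%:C) (om0)%:C.
Proof.
have p0 : per0%:C != 0 :> C by rewrite real_complex_neq0 // gt_eqF // per0_gt0.
have := tendsZ (2 * pi)%:C (tendsV p0 (@tends_T mu0)).
have -> : (2 * pi)%:C * per0%:C^-1 = om0%:C :> C.
  rewrite -om0_per0 rmorphM /= mulfK //.
by apply: tends_ext => h mu; rewrite /freq [in RHS]rmorphM /= fmorphV.
Qed.

(** For [h < 0] the congruent modes are spaced by [2 * pi / T h]. With this exact spacing the
    approximate frames satisfy the Bloch condition without error. *)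
Definition shifted (m : int) (h mu : R) : R := mu + m%:~R * freq h.
Lemma tends_shifted m mu0 : tends mu0 (fun h mu => (shifted m h mu)%:C) (mu0 + 2 * m%:~R / Num.sqrt 3)%:C.
Proof.
have := tendsD (@tends_mu R mu0) (tendsZ (m%:~R)%:C (tends_freq mu0)).
have -> : mu0%:C + m%:~R%:C * om0%:C = (mu0 + 2 * m%:~R / Num.sqrt 3)%:C :> C.
  by rewrite /om0 rmorphD !rmorphM /=; ring.
by apply: tends_ext => h mu; rewrite /shifted [RHS]rmorphD /= [in RHS]rmorphM.
Qed.

Lemma expi_shifted m h mu : T h != 0 -> expi (shifted m h mu) (T h) = expi mu (T h) :> C.
Proof.
move=> T0; rewrite expi_mul mulrDl expiD -(expi_mul mu).
have -> : m%:~R * freq h * T h = 2 * pi * m%:~R by rewrite /freq; field.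
by rewrite expi_2piM mulr1.
Qed.

Lemma tends_bb (mu0 : R) F G (k z : C) : tends mu0 F k -> tends mu0 G z -> tends mu0 (fun h mu => bb (F h mu) (G h mu)) (bb k z).
Proof.
move=> tF tG; have := tendsB (tendsZ (ii / 2) tF) tG.
have -> : ii / 2 * k - z = bb k z by rewrite /bb; ring.
by apply: tends_ext => h mu; rewrite /bb; ring.
Qed.

Lemma tends_modes (mu0 : R) F1 G1 F2 G2 (k1 z1 k2 z2 : C) :
  tends mu0 F1 k1 -> tends mu0 G1 z1 -> tends mu0 F2 k2 -> tends mu0 G2 z2 ->
  tends_mx mu0 (fun h mu => modes (F1 h mu) (G1 h mu) (F2 h mu) (G2 h mu)) (modes k1 z1 k2 z2).
Proof.
move=> t1 t2 t3 t4; apply: tends_mx22; try exact: tendsZ.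
  by apply: tendsD; [exact: tends_bb|exact: tendsC].
by apply: tendsD; [exact: tends_bb|exact: tendsC].
Qed.

(** The neighbourhood of radius [d] does not shrink with [r], so the uniform convergence survives a
    finite gluing. *)
Definition good_at j (mu0 : R) := exists (l : R -> R -> C) (d : R), [/\ 0 < d,
  forall h mu, - d < h < 0 -> `|mu - mu0| < d ->
    bloch_eigenvalue (phi h) (T h) mu (l h mu) /\ cont_at (l h) mu &
  forall r, 0 < r -> exists2 h1 : R, 0 < h1 & forall h mu, - h1 < h < 0 -> `|mu - mu0| < d ->
    cabs (l h mu - lambda_ j mu) <= r].

Lemma residual_flow (p : R -> R) (L : 'M[C]_2) (Y dY : R -> 'M[C]_2) :
  (forall x, mder Y x (dY x)) ->
  flow p L (fun x => a1 *m dY x + (A0 + (p x)%:C *: N0) *m Y x - Y x *m L) Y.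
Proof.
move=> D x; apply: mder_eq (D x) _; rewrite /vf.
set A := _ *m Y x; set B := Y x *m L.
have -> : B + (a1 *m dY x + A - B) - A = a1 *m dY x.
  by move: (a1 *m dY x) A B => P A B; apply/matrixP => i j; rewrite !mxE; ring.
by rewrite mulmxA mul_a1inv_a1 mul1mx.
Qed.

Lemma sqrt_small (K r : R) : 0 <= K -> 0 < r -> exists2 d : R, 0 < d & forall h, - d < h < 0 ->
  K * Num.sqrt (- h) <= r.
Proof.
move=> K0 r0; have K1 : 0 < K + 1 by rewrite ltr_wpDl.
exists ((r / (K + 1)) ^+ 2); first by rewrite exprn_gt0 // divr_gt0.
move=> h /andP[h1 h2].
have : Num.sqrt (- h) <= r / (K + 1).
  rewrite -(@ler_pXn2r _ 2) ?nnegrE ?sqrtr_ge0 ?divr_ge0 ?(ltW r0) ?(ltW K1) // sqr_sqrtr; lra.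
rewrite ler_pdivlMr // mulrC mulrDl mul1r; have := sqrtr_ge0 (- h); lra.
Qed.

(** The modes of the rest state leave the residual [phi *: (N0 *m Y)], of order [|h|^(1/2)]. This
    suffices because the gap to the second eigenvalue stays bounded below. *)
Lemma local_modes mu0 j j2 (m : int) U0 : let k0 := mu0 + 2 * m%:~R / Num.sqrt 3 in
  let V := modes mu0%:C (lambda_ j mu0) k0%:C (lambda_ j2 k0) in
  is_frame mu0 (lambda_ j mu0) (lambda_ j2 k0) 0 V U0 -> lambda_ j mu0 != lambda_ j2 k0 ->
  good_at j mu0.
Proof.
move=> k0 V FR zz.
have tk := tends_shifted m mu0; rewrite -/k0 in tk.
pose la (h mu : R) := lambda_ j mu; pose lb h mu := lambda_ j2 (shifted m h mu).
have tla : tends mu0 la (lambda_ j mu0) by exact: tends_lambda (@tends_mu R mu0).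
have tlb : tends mu0 lb (lambda_ j2 k0) by exact: tends_lambda tk.
pose V' h mu := modes mu%:C (la h mu) (shifted m h mu)%:C (lb h mu).
have tV : tends_mx mu0 V' V by exact: tends_modes (@tends_mu R mu0) tla tk tlb.
pose KV := mnorm V + 1.
have KV0 : 0 < KV by rewrite ltr_wpDl // mnorm_ge0.
pose K := 3 * mnorm (@N0 R) * (KV * 2).
have K0 : 0 <= K by rewrite !mulr_ge0 ?mnorm_ge0 // ltW.
pose ep h := K * Num.sqrt (- h).
pose gap := cabs (lambda_ j mu0 - lambda_ j2 k0) / 2.
have gap0 : 0 < gap by rewrite divr_gt0 // cabs_gt0 // subr_eq0.
have [d1 d10 H1] := tends_mxP tV ltr01.
have [d2 d20 H2] := tendsB tla tlb gap0.
have [d3 d30 H3] := wave_small Hwave ltr01.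
have loc : exists2 d : R, 0 < d & forall h mu, - d < h < 0 -> `|mu - mu0| < d ->
    [/\ cont_at (la h) mu, 0 < (fun=> gap) h, (fun=> gap) h <= cabs (la h mu - lb h mu) &
      exists G Y, [/\ flow (phi h) (mx22 (la h mu) 0 0 (lb h mu)) G Y, Y 0 = V' h mu,
        Y (T h) = expi mu (T h) *: V' h mu & forall x, mnorm (G x) <= ep h]].
  exists (Num.min d1 (Num.min d2 d3)); first by rewrite !lt_min d10 d20.
  move=> h mu h1 h2; have [ha hb ma mb] := near_and h1 h2; have [hc hd mc md] := near_and hb mb.
  have [hr _ _] := H3 h hd.
  have T0 : T h != 0 by rewrite gt_eqF // (wave_T0 (Hwave hr)).
  split => //.
  - exact: lambda_cont_at.
  - have := H2 h mu hc mc; rewrite cabs_distC => q.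
    have := cabsD (la h mu - lb h mu) ((lambda_ j mu0 - lambda_ j2 k0) - (la h mu - lb h mu)).
    by rewrite addrCA subrr addr0; move: q; rewrite /gap; clear -Hwave; lra.
  pose Y := frame_sol mu (shifted m h mu) (V' h mu).
  have YF : flow (fun=> 0) (mx22 (la h mu) 0 0 (lb h mu)) (fun=> 0) Y.
    by apply: frame_sol_flow; [left|exact: modes_eq (disp_lambda _ _) (disp_lambda _ _)].
  exists (fun x => (phi h x)%:C *: (N0 *m Y x)), Y; split.
  - move=> x; apply: mder_eq (YF x) _; rewrite /vf scale0r addr0 addr0.
    rewrite mulmxDl -scalemxAl; congr (_ *m _).
    move: (Y x *m _) (A0 *m Y x) (_ *: (N0 *m Y x)) => a b c.
    by apply/matrixP => i k; rewrite !mxE; ring.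
  - by rewrite /Y /frame_sol !expi0 -mx22_1 mulmx1.
  - by rewrite /Y /frame_sol expi_shifted // -[in RHS](mulmx1 (V' h mu)) mx22_1 scalemxAr mx22_scale !mulr0 mulr1.
  move=> x; rewrite mnormZ cabs_real.
  have YB : mnorm (Y x) <= KV * 2.
    rewrite (le_trans (mnormM _ _)) //; apply: ler_pM; rewrite ?mnorm_ge0 //.
      rewrite -[V' h mu](subrK V) (le_trans (mnormD _ _)) // addrC /KV lerD2l; exact: H1.
    by rewrite mnorm22 !cabs_expi cabs0 addr0 add0r.
  have pB : `|phi h x| <= 3 * Num.sqrt (- h).
    have e0 : 0 <= - h by move: hr => /andP[_]; clear -Hwave; lra.
    rewrite -(@ler_pXn2r _ 2) ?nnegrE ?mulr_ge0 ?sqrtr_ge0 // real_normK ?num_real // exprMn sqr_sqrtr //.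
    have := phi_sqr_le hr (Hwave hr) x; move: e0; clear -Hwave; lra.
  rewrite /ep /K; have -> : 3 * mnorm (@N0 R) * (KV * 2) * Num.sqrt (- h) =
     (3 * Num.sqrt (- h)) * (mnorm (@N0 R) * (KV * 2)) by ring.
  apply: ler_pM; rewrite ?mnorm_ge0 //.
  by rewrite (le_trans (mnormM _ _)) // ler_wpM2l ?mnorm_ge0.
have small r : 0 < r -> exists2 d : R, 0 < d & forall h, - d < h < 0 -> ep h <= r * (fun=> gap) h.
  by move=> r0; apply: sqrt_small => //; rewrite mulr_gt0.
have [l [d [K' [d0 K'0 P]]]] := local_curve Hwave FR tla tlb tV loc small.
exists l, d; split => //.
  by move=> h mu h1 h2; have [p1 p2 _] := P h mu h1 h2.
move=> r r0; have KK : 0 <= K' * K by rewrite mulr_ge0 // ltW.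
have [h1 h10 Q] := sqrt_small KK r0.
exists (Num.min d h1); first by rewrite lt_min d0.
move=> h mu /andP[ha hb] mm.
have [_ _ p3] := P h mu ltac:(by rewrite hb andbT (le_lt_trans _ ha) // lerN2 ge_min lexx) mm.
apply: le_trans p3 _; rewrite /ep mulrA; apply: Q.
by rewrite hb andbT (le_lt_trans _ ha) // lerN2 ge_min lexx orbT.
Qed.

Lemma local_nonresonant j mu0 : mu0 != 1 -> mu0 != -1 -> mu0 != 0 -> ~ resonant j mu0 -> good_at j mu0.
Proof.
move=> h1 h2 h0 nres.
have [hlt|hgt|heq] := ltgtP `|mu0| 1; last by have := neq1_norm h1 h2; rewrite heq eqxx.
  have FR := frame_inner j hlt h0.
  have E : mu0 = mu0 + 2 * (0 : int)%:~R / Num.sqrt 3 by rewrite mulr0 mul0r addr0.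
  apply: (@local_modes mu0 j (other j) 0 (frame_sol mu0 mu0 (modes mu0%:C (lambda_ j mu0) mu0%:C (lambda_ (other j) mu0)))).
    by rewrite -E.
  by rewrite -E eq_sym lambda_other_neq.
have [m [hk kmu FR]] := frame_outer hgt nres.
apply: local_modes FR _.
apply/eqP => E; have := Re_lambda_small 1 hk; rewrite -E Re_lambda_large ?eqxx //.
Qed.
End NonresonantCurves.

(** * Second-order expansion at a crossing *)

Section SecondOrderMode.
Context {R : realType}.
Local Notation C := R[i].

Section Coefficients.
Variables k z : C.
(* These values cancel the terms of degree at most two in [scalar_residual]. The
   dispersion relation is then [disp = cX * e] with [e = - h], so the eigenvalue
   moves by [cc * e] to first order. *)
Definition cm : C := 3 / 2 * ii * k + z.
Definition cp : C := - 2 * (1 + z) / (1 + 4 / 3 * (cm * cm)).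
Definition cr : C := - (4 / 3) * cm * cp.
Definition cX : C := - 2 * (1 + z) * (1 + cp).
Definition cs : C := (cX - cm * z * cr) / (4 + 4 / 3 * (cm * cm)).
Definition ct : C := - (z * cr / 2) - 2 / 3 * cm * cs.
Definition cc : C := - cX / (2 * bb k z).
End Coefficients.

(* [modeF] approximates the periodic factor of the first component as a polynomial
   in the wave [x = phi] and [y = psi - phi / 2], where [x' = - 4 / 3 y] and
   [y' = x - x ^ 2]; [modeF1] and [modeF2] are its exact derivatives. *)
Definition modeF (p r s t x y : C) : C := 1 + p * x + r * y + s * (x * x) + t * (x * y).
Definition modeF1 (p r s t x y : C) : C :=
  - (4 / 3) * p * y + r * (x - x * x) - 8 / 3 * s * (x * y) + t * (- (4 / 3) * (y * y) + x * x - x * (x * x)).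
Definition modeF2 (p r s t x y : C) : C :=
  - (4 / 3) * p * (x - x * x) + r * (- (4 / 3) * y + 8 / 3 * (x * y))
  - 8 / 3 * s * (- (4 / 3) * (y * y) + x * x - x * (x * x))
  + t * (- (16 / 3) * (x * y) + 20 / 3 * (x * x * y)).

Definition remainder (p r s t m X c z e x y : C) : C :=
  x * (x * x) * (2 * s - m * t + X / 3 - 2 * (1 + z) * s) + x * x * y * (5 * t - 2 * (1 + z) * t)
  + c * e * modeF1 p r s t x y - X * e * (modeF p r s t x y - 1)
  - (c * e) * (c * e) * modeF p r s t x y - 2 * (c * e) * x * modeF p r s t x y.

(** The left side is [- disp] with [i k] replaced by [i k + d/dx], applied to [modeF], together with
    the potential term. The first integral turns [X * e] into quadratic terms. No [y * y] occurs in
    [modeF] since the first integral expresses it by the other monomials; [X] supplies the unknown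
    that is then missing. *)
Lemma scalar_residual (k z e x y : C) : let p := cp k z in let r := cr k z in let s := cs k z in
  let t := ct k z in let m := cm k z in let X := cX k z in let c := cc k z in
  disp k z = 0 -> 1 + 4 / 3 * (m * m) != 0 -> 4 + 4 / 3 * (m * m) != 0 -> bb k z != 0 ->
  e = 2 / 3 * (y * y) + x * x / 2 - x * (x * x) / 3 ->
  3 / 4 * modeF2 p r s t x y + (m + c * e) * modeF1 p r s t x y
  - disp k (z + c * e) * modeF p r s t x y - 2 * (1 + z + c * e) * x * modeF p r s t x y =
  remainder p r s t m X c z e x y.
Proof.
move=> p r s t m X c D d1 d2 b0 eE.
have H1 : p * (1 + 4 / 3 * (m * m)) = - 2 * (1 + z) by rewrite /p /cp divfK.
have H2 : s * (4 + 4 / 3 * (m * m)) = X - m * z * r by rewrite /s /cs divfK.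
have rE : r = - (4 / 3) * m * p by [].
have tE : t = - (z * r / 2) - 2 / 3 * m * s by [].
have XE : X = - 2 * (1 + z) * (1 + p) by [].
have cE : 2 * bb k z * c = - X by rewrite /c /cc -/X mulrC divfK // mulf_neq0 ?pnatr_eq0.
have dE : disp k (z + c * e) = X * e + (c * e) * (c * e).
  have -> : disp k (z + c * e) = disp k z - (2 * bb k z * c) * e + (c * e) * (c * e) by rewrite /disp /bb; field.
  by rewrite D cE; ring.
(* The identities [b1] to [b5] are the vanishing coefficients of [x], [y], [x * x], [x * y] and
   [y * y]; they are proved in the order in which they depend on each other. *)
have b1 : - p + m * r - 2 * (1 + z) = 0.
  have -> : - p + m * r - 2 * (1 + z) = - (p * (1 + 4 / 3 * (m * m))) - 2 * (1 + z) by rewrite rE; field.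
  by rewrite H1; ring.
have b2 : - r - 4 / 3 * m * p = 0 by rewrite rE; ring.
have b4 : 2 * r - 4 * t - 8 / 3 * m * s - 2 * (1 + z) * r = 0 by rewrite tE; field.
have b5 : 8 / 3 * s - 4 / 3 * m * t - 2 / 3 * X = 0.
  have -> : 8 / 3 * s - 4 / 3 * m * t - 2 / 3 * X = 2 / 3 * (s * (4 + 4 / 3 * (m * m)) - (X - m * z * r)).
    by rewrite tE; field.
  by rewrite H2 subrr mulr0.
have b3 : p - 2 * s - m * r + m * t - X / 2 - 2 * (1 + z) * p = 0.
  have -> : p - 2 * s - m * r + m * t - X / 2 - 2 * (1 + z) * p =
    - (- p + m * r - 2 * (1 + z)) + (- 2 * (1 + z) * (1 + p) - X) - 3 / 4 * (8 / 3 * s - 4 / 3 * m * t - 2 / 3 * X) by field.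
  by rewrite b1 b5 -XE subrr; ring.
rewrite dE /remainder.
clearbody p r s t m X c.
set F := modeF p r s t x y; set F1 := modeF1 p r s t x y.
have -> : 3 / 4 * modeF2 p r s t x y + (m + c * e) * F1 - (X * e + c * e * (c * e)) * F - 2 * (1 + z + c * e) * x * F =
   (3 / 4 * modeF2 p r s t x y + m * F1 - X * e - 2 * (1 + z) * x * F)
   + c * e * F1 - X * e * (F - 1) - (c * e) * (c * e) * F - 2 * (c * e) * x * F by ring.
do 4 congr (_ + _); rewrite {1}eE.
rewrite -[RHS]addr0 -[X in _ = _ + X](_ : x * (- p + m * r - 2 * (1 + z)) + y * (- r - 4 / 3 * m * p)
  + x * x * (p - 2 * s - m * r + m * t - X / 2 - 2 * (1 + z) * p)
  + x * y * (2 * r - 4 * t - 8 / 3 * m * s - 2 * (1 + z) * r)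
  + y * y * (8 / 3 * s - 4 / 3 * m * t - 2 / 3 * X) = 0); last first.
  by rewrite b1 b2 b3 b4 b5 !mulr0 !addr0.
by rewrite /F /F1 /modeF /modeF1 /modeF2; field.
Qed.

(** The first row of the system plus twice the second contains neither the derivative of the second
    component nor the potential. Solving this algebraic equation, with first component [i k f],
    gives [modeG]. *)
Definition modeG (k lam f f1 : C) : C := ii * k * (- (3 / 4) * (ii * k * f + f1) + (1 - lam) / 2 * f) / (1 + lam).

(* The second component is determined by the first, which reduces both rows of
   the system to one scalar equation. *)
Lemma vector_residual (k lam x f f1 f2 : C) : 1 + lam != 0 ->
  let res := ii * k / (1 + lam) * (3 / 4 * f2 + (cm k lam) * f1 - disp k lam * f - 2 * (1 + lam) * x * f) in
  2^-1 * (ii * k * (ii * k * f + f1)) - (ii * k * modeG k lam f f1 + modeG k lam f1 f2)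
    + (1 - 2 * x - lam) * (ii * k * f) = res /\
  - (ii * k * (ii * k * f + f1)) + 2^-1 * (ii * k * modeG k lam f f1 + modeG k lam f1 f2)
    + x * (ii * k * f) - (1 + lam) * modeG k lam f f1 = - (res / 2).
Proof.
move=> l1 res; rewrite /res /modeG /cm.
have -> : disp k lam = lam ^+ 2 - ii * k * lam - 3 / 4 * (ii * k) * (ii * k) - 1.
  have -> : 3 / 4 * (ii * k) * (ii * k) = (ii * ii) * (3 / 4 * k ^+ 2) by ring.
  by rewrite ii_sqr /disp; ring.
have -> : 3 / 2 * ii * k = 3 / 2 * (ii * k) by ring.
move: (ii * k) => a; split; by field.
Qed.

Lemma cabs_nat (n : nat) : cabs (n%:R : C) = n%:R.
Proof. by rewrite -(rmorph_nat (real_complex R)) cabs_real normr_nat. Qed.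

Lemma cabs_frac (n m : nat) : cabs (n%:R / m%:R : C) = n%:R / m%:R.
Proof. by rewrite cabsM cabsV !cabs_nat. Qed.

Lemma cabs_leD (u v : C) (A B : R) : cabs u <= A -> cabs v <= B -> cabs (u + v) <= A + B.
Proof. by move=> h1 h2; apply: le_trans (cabsD _ _) _; exact: lerD. Qed.
Lemma cabs_leB (u v : C) (A B : R) : cabs u <= A -> cabs v <= B -> cabs (u - v) <= A + B.
Proof. by move=> h1 h2; apply: le_trans (cabsB _ _) _; exact: lerD. Qed.
Lemma cabs_leM (u v : C) (A B : R) : cabs u <= A -> cabs v <= B -> cabs (u * v) <= A * B.
Proof. by move=> h1 h2; rewrite cabsM; apply: ler_pM; rewrite ?cabs_ge0. Qed.
Lemma cabs_leN (u : C) (A : R) : cabs u <= A -> cabs (- u) <= A.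
Proof. by rewrite cabsN. Qed.
Lemma cabs_frac_le (n m : nat) : cabs (n%:R / m%:R : C) <= n%:R / m%:R.
Proof. by rewrite cabs_frac. Qed.
Lemma cabs_inv_nat_le (m : nat) : cabs (m%:R^-1 : C) <= m%:R^-1.
Proof. by rewrite cabsV cabs_nat. Qed.
Lemma cabs_nat_le (n : nat) : cabs (n%:R : C) <= n%:R.
Proof. by rewrite cabs_nat. Qed.

Section Bounds.
Variables (p r s t m X c z e x y : C) (B a : R).
Hypotheses (B1 : 1 <= B) (a0 : 0 <= a) (a1' : a <= 1).
Hypotheses (pB : cabs p <= B) (rB : cabs r <= B) (sB : cabs s <= B) (tB : cabs t <= B)
  (mB : cabs m <= B) (XB : cabs X <= B) (cB : cabs c <= B) (zB : cabs (1 + z) <= B).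
Hypotheses (xa : cabs x <= a) (ya : cabs y <= a) (ea : cabs e <= a * a).

Let B0 : 0 <= B. Proof. exact: le_trans ler01 B1. Qed.
Let aa : a * a <= a. Proof. by rewrite ler_piMr. Qed.
Let aa0 : 0 <= a * a. Proof. exact: mulr_ge0. Qed.

Lemma modeF_close : cabs (modeF p r s t x y - 1) <= 4 * B * a.
Proof.
have -> : modeF p r s t x y - 1 = p * x + r * y + s * (x * x) + t * (x * y) by rewrite /modeF; ring.
apply: le_trans (cabs_leD (cabs_leD (cabs_leD (cabs_leM pB xa) (cabs_leM rB ya)) (cabs_leM sB (cabs_leM xa xa))) (cabs_leM tB (cabs_leM xa ya))) _.
have := ler_wpM2l B0 aa; lra.
Qed.

Lemma modeF_bound : cabs (modeF p r s t x y) <= 5 * B.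
Proof.
have := cabsD (modeF p r s t x y - 1) 1; rewrite subrK [cabs 1](cabs_nat 1).
rewrite mulr1n; have := modeF_close; have := ler_wpM2l B0 a1'; move: B1; lra.
Qed.

Lemma modeF1_bound : cabs (modeF1 p r s t x y) <= 12 * B * a.
Proof.
have aaa : a * (a * a) <= a by apply: le_trans aa; rewrite ler_wpM2l.
apply: le_trans (cabs_leD (cabs_leB (cabs_leD (cabs_leM (cabs_leM (cabs_leN (cabs_frac_le 4 3)) pB) ya) (cabs_leM rB (cabs_leB xa (cabs_leM xa xa))))
  (cabs_leM (cabs_leM (cabs_frac_le 8 3) sB) (cabs_leM xa ya)))
  (cabs_leM tB (cabs_leB (cabs_leD (cabs_leM (cabs_leN (cabs_frac_le 4 3)) (cabs_leM ya ya)) (cabs_leM xa xa)) (cabs_leM xa (cabs_leM xa xa))))) _.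
have := ler_wpM2l B0 aa; have := ler_wpM2l B0 aaa; have := mulr_ge0 B0 a0; lra.
Qed.

(** Every term has degree at least three in the wave when [e] counts as degree two. *)
Lemma remainder_bound : cabs (remainder p r s t m X c z e x y) <= 50 * B ^+ 3 * a ^+ 3.
Proof.
have h1 := cabs_leM (cabs_leM xa (cabs_leM xa xa)) (cabs_leB (cabs_leD (cabs_leB (cabs_leM (cabs_nat_le 2) sB) (cabs_leM mB tB)) (cabs_leM XB (cabs_inv_nat_le 3))) (cabs_leM (cabs_leM (cabs_nat_le 2) zB) sB)).
have h2 := cabs_leM (cabs_leM (cabs_leM xa xa) ya) (cabs_leB (cabs_leM (cabs_nat_le 5) tB) (cabs_leM (cabs_leM (cabs_nat_le 2) zB) tB)).
have h3 := cabs_leM (cabs_leM cB ea) modeF1_bound.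
have h4 := cabs_leM (cabs_leM XB ea) modeF_close.
have h5 := cabs_leM (cabs_leM (cabs_leM cB ea) (cabs_leM cB ea)) modeF_bound.
have h6 := cabs_leM (cabs_leM (cabs_leM (cabs_nat_le 2) (cabs_leM cB ea)) xa) modeF_bound.
apply: le_trans (cabs_leB (cabs_leB (cabs_leB (cabs_leD (cabs_leD h1 h2) h3) h4) h5) h6) _.
pose q := a ^+ 3.
have q0 : 0 <= q by rewrite exprn_ge0.
have BB : B <= B ^+ 3.
  by rewrite -[leLHS]expr1 ler_weXn2l.
have BB2 : B ^+ 2 <= B ^+ 3 by rewrite ler_weXn2l.
have qa : a * q <= q by rewrite ler_piMl.
have e1 : 12 * B * a = 12 * (B * a) by ring.
apply: (@le_trans _ _ ((7 + 3^-1) * B * q + 31 * B ^+ 2 * q + 5 * B ^+ 3 * (a * q))).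
  by rewrite le_eqVlt; apply/orP; left; apply/eqP; rewrite /q; field.
have k1 := ler_wpM2r q0 BB; have k2 := ler_wpM2r q0 BB2.
have B30 : 0 <= B ^+ 3 by rewrite exprn_ge0.
have k3 := ler_wpM2l B30 qa; have k4 := mulr_ge0 B30 q0.
rewrite -/q; lra.
Qed.
End Bounds.
End SecondOrderMode.

Section ModeLimits.
Context {R : realType}.
Local Notation C := R[i].

Ltac tends_tac := repeat match goal with
  | H : ?G |- ?G => exact H
  | |- tends _ (fun _ _ => ?c) _ => exact (tendsC _ c)
  | |- tends _ (fun h mu => @?a h mu + @?b h mu) _ => apply: tendsD
  | |- tends _ (fun h mu => @?a h mu * @?b h mu) _ => apply: tendsM
  | |- tends _ (fun h mu => - @?a h mu) _ => apply: tendsN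
  end.

Section Limits.
Variables (mu0 : R) (K Z : R -> R -> C) (k z : C).
Hypotheses (tK : tends mu0 K k) (tZ : tends mu0 Z z).
Lemma tends_cm : tends mu0 (fun h mu => cm (K h mu) (Z h mu)) (cm k z).
Proof. by rewrite /cm; tends_tac. Qed.
Hypothesis d1 : 1 + 4 / 3 * (cm k z * cm k z) != 0.
Lemma tends_cp : tends mu0 (fun h mu => cp (K h mu) (Z h mu)) (cp k z).
Proof. by have := tends_cm; rewrite /cp => t; apply: tendsM; [|apply: tendsV => //]; tends_tac. Qed.
Lemma tends_cr : tends mu0 (fun h mu => cr (K h mu) (Z h mu)) (cr k z).
Proof. by have := tends_cm; have := tends_cp; rewrite /cr => t1 t2; tends_tac. Qed.
Lemma tends_cX : tends mu0 (fun h mu => cX (K h mu) (Z h mu)) (cX k z).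
Proof. by have := tends_cp; rewrite /cX => t1; tends_tac. Qed.
Hypothesis d2 : 4 + 4 / 3 * (cm k z * cm k z) != 0.
Lemma tends_cs : tends mu0 (fun h mu => cs (K h mu) (Z h mu)) (cs k z).
Proof.
have t1 := tends_cm; have t2 := tends_cr; have t3 := tends_cX; rewrite /cs.
by apply: tendsM; [|apply: tendsV => //]; tends_tac.
Qed.
Lemma tends_ct : tends mu0 (fun h mu => ct (K h mu) (Z h mu)) (ct k z).
Proof. by have t1 := tends_cm; have t2 := tends_cr; have t3 := tends_cs; rewrite /ct; tends_tac. Qed.
Hypothesis b0 : bb k z != 0.
Lemma tends_cc : tends mu0 (fun h mu => cc (K h mu) (Z h mu)) (cc k z).
Proof.
have t1 := tends_cX; have t2 := tends_bb tK tZ; rewrite /cc.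
apply: tendsM; first by tends_tac.
by apply: tendsV; [rewrite mulf_neq0 ?pnatr_eq0|tends_tac].
Qed.
End Limits.

Lemma tends_modeF mu0 (p r s t x y : R -> R -> C) (p' r' s' t' x' y' : C) :
  tends mu0 p p' -> tends mu0 r r' -> tends mu0 s s' -> tends mu0 t t' -> tends mu0 x x' -> tends mu0 y y' ->
  tends mu0 (fun h mu => modeF (p h mu) (r h mu) (s h mu) (t h mu) (x h mu) (y h mu)) (modeF p' r' s' t' x' y') /\
  tends mu0 (fun h mu => modeF1 (p h mu) (r h mu) (s h mu) (t h mu) (x h mu) (y h mu)) (modeF1 p' r' s' t' x' y').
Proof. by move=> *; rewrite /modeF /modeF1; split; tends_tac. Qed.

Lemma tends_modeG mu0 (k l f f1 : R -> R -> C) (k' l' f' f1' : C) : 1 + l' != 0 ->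
  tends mu0 k k' -> tends mu0 l l' -> tends mu0 f f' -> tends mu0 f1 f1' ->
  tends mu0 (fun h mu => modeG (k h mu) (l h mu) (f h mu) (f1 h mu)) (modeG k' l' f' f1').
Proof. by move=> l0 *; rewrite /modeG; apply: tendsM; [|apply: tendsV => //]; tends_tac. Qed.

Lemma cont_at_tends (F : R -> C) mu : tends mu (fun _ nu => F nu) (F mu) -> cont_at F mu.
Proof.
move=> H r r0; have [d d0 P] := H r r0; exists d => // nu nd; apply: (P (- (d / 2))) => //.
by apply/andP; split; lra.
Qed.

Lemma tends_ev mu0 F l (r : R) : 0 < r -> tends mu0 F l -> exists2 d : R, 0 < d &
  forall h mu, - d < h < 0 -> `|mu - mu0| < d -> cabs (F h mu - l) <= r.
Proof. by move=> r0 H; exact: H. Qed.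

Lemma tends_neq0 mu0 F (l : C) : l != 0 -> tends mu0 F l -> exists2 d : R, 0 < d &
  forall h mu, - d < h < 0 -> `|mu - mu0| < d -> F h mu != 0.
Proof.
move=> l0 H; have c0 : 0 < cabs l by rewrite cabs_gt0.
have [d d0 P] := H (cabs l / 2) ltac:(by rewrite divr_gt0); exists d => // h mu h1 h2.
by apply/eqP => E; have := P h mu h1 h2; rewrite E sub0r cabsN; lra.
Qed.

Definition ev (mu0 : R) (P : R -> R -> Prop) := exists2 d : R, 0 < d &
  forall h mu, - d < h < 0 -> `|mu - mu0| < d -> P h mu.
Lemma ev_and mu0 P Q : ev mu0 P -> ev mu0 Q -> ev mu0 (fun h mu => P h mu /\ Q h mu).
Proof.
move=> [d1 d10 H1] [d2 d20 H2]; exists (Num.min d1 d2); first by rewrite lt_min d10.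
by move=> h mu h1 h2; have [? ? ? ?] := near_and h1 h2; split; [exact: H1|exact: H2].
Qed.
Lemma ev_imp mu0 (P Q : R -> R -> Prop) : (forall h mu, P h mu -> Q h mu) -> ev mu0 P -> ev mu0 Q.
Proof. by move=> PQ [d d0 H]; exists d => // h mu h1 h2; exact/PQ/H. Qed.

(** Listing the coefficient families lets all of them share one bound [B]. *)
Definition all_le (B : R) (s : seq (R -> R -> C)) h mu := foldr (fun F P => cabs (F h mu) <= B /\ P) True s.
Lemma tends_all_le mu0 (s : seq (R -> R -> C)) : foldr (fun F P => (exists l, tends mu0 F l) /\ P) True s ->
  exists2 B : R, 1 <= B & ev mu0 (all_le B s).
Proof.
elim: s => [|F s IH] /=; first by exists 1 => //; exists 1.
move=> [[l Fl] /IH[B B1 H]]; exists (B + cabs l).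
  by rewrite (le_trans B1) // lerDl cabs_ge0.
apply: ev_imp (ev_and (tends_bounded Fl) H) => h mu [h1 h2]; split.
  by apply: le_trans h1 _; rewrite addrC lerD2r.
elim: s {IH H} h2 => //= G s IH [g1 g2]; split; last exact: IH.
by apply: le_trans g1 _; rewrite lerDl cabs_ge0.
Qed.

Lemma cder_modeF (p r s t : C) (xf yf : R -> C) a :
  cder xf a (- (4 / 3) * yf a) -> cder yf a (xf a - xf a * xf a) ->
  cder (fun u => modeF p r s t (xf u) (yf u)) a (modeF1 p r s t (xf a) (yf a)) /\
  cder (fun u => modeF1 p r s t (xf u) (yf u)) a (modeF2 p r s t (xf a) (yf a)).
Proof.
move=> dx dy; have dxx := cderM dx dx; have dxy := cderM dx dy; have dyy := cderM dy dy.
split.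
  apply: cder_eq (cderD (cderD (cderD (cderD (cderC 1 a) (cderZ p dx)) (cderZ r dy)) (cderZ s dxx)) (cderZ t dxy)) _.
  by rewrite /modeF1; field.
apply: cder_eq (cderD (cderB (cderD (cderZ (- (4 / 3) * p) dy) (cderZ r (cderB dx dxx)))
  (cderZ (8 / 3 * s) dxy)) (cderZ t (cderB (cderD (cderZ (- (4 / 3)) dyy) dxx) (cderM dx dxx)))) _.
by rewrite /modeF2; field.
Qed.

Lemma cder_modeG (k l : C) (f f1 : R -> C) a f2 : cder f a (f1 a) -> cder f1 a f2 ->
  cder (fun u => modeG k l (f u) (f1 u)) a (modeG k l (f1 a) f2).
Proof.
move=> d1 d2; rewrite /modeG.
apply: cder_eq (cderM (cderZ (ii * k) (cderD (cderZ (- (3 / 4)) (cderD (cderZ (ii * k) d1) d2)) (cderZ ((1 - l) / 2) d1))) (cderC _ a)) _.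
by rewrite mulr0 addr0.
Qed.

Lemma modeG0 (k z : C) : disp k z = 0 -> 1 + z != 0 -> modeG k z 1 0 = bb k z + 1.
Proof.
move=> D z1; apply: (mulIf z1); rewrite /modeG divfK // /bb.
apply/eqP; rewrite -subr_eq0; apply/eqP.
transitivity (disp k z - (3 / 4) * (ii * ii + 1) * k ^+ 2); last by rewrite D ii_sqr addNr mulr0 mul0r subrr.
by rewrite /disp; field.
Qed.

Lemma mder22 (f11 f12 f21 f22 : R -> C) x a b c d : cder f11 x a -> cder f12 x b -> cder f21 x c -> cder f22 x d ->
  mder (fun t => mx22 (f11 t) (f12 t) (f21 t) (f22 t)) x (mx22 a b c d).
Proof.
move=> h1 h2 h3 h4 i j; rewrite (_ : (fun _ => _) = fun t => (if i == 0 then (if j == 0 then f11 t else f12 t)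
     else (if j == 0 then f21 t else f22 t))); last by apply/funext => t; rewrite mxE.
by rewrite mxE; case: (i == 0); case: (j == 0).
Qed.
End ModeLimits.

(** * One column of the second-order frame *)

Section ModeColumn.
Context {R : realType}.
Local Notation C := R[i].

Definition lam2 (k z e : C) : C := z + cc k z * e.

Definition mode_ok (B : R) (e k z : C) : Prop :=
  [/\ disp k z = 0, 1 + 4 / 3 * (cm k z * cm k z) != 0 /\ 4 + 4 / 3 * (cm k z * cm k z) != 0,
      bb k z != 0, 1 + lam2 k z e != 0 &
  [/\ cabs (cp k z) <= B /\ cabs (cr k z) <= B, cabs (cs k z) <= B /\ cabs (ct k z) <= B,
      cabs (cm k z) <= B /\ cabs (cX k z) <= B, cabs (cc k z) <= B /\ cabs (1 + z) <= B &
      cabs (ii * k / (1 + lam2 k z e)) <= B]].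

Section Limit.
Variables (mu0 k0 : R) (j : 'I_2) (k : R -> R -> R).
Hypothesis tk : tends mu0 (fun h mu => (k h mu)%:C) k0%:C.
Let z0 : C := lambda_ j k0.
Let Z h mu : C := lambda_ j (k h mu).
Hypotheses (d1 : 1 + 4 / 3 * (cm k0%:C z0 * cm k0%:C z0) != 0)
  (d2 : 4 + 4 / 3 * (cm k0%:C z0 * cm k0%:C z0) != 0) (b0 : bb k0%:C z0 != 0) (z1 : 1 + z0 != 0).

Lemma tends_e : tends mu0 (fun h _ => (- h)%:C) 0.
Proof.
move=> r r0; exists r => // h mu /andP[h1 h2] _; rewrite subr0 cabs_real ger0_norm; lra.
Qed.

Lemma tends_lam2 : tends mu0 (fun h mu => lam2 (k h mu)%:C (Z h mu) (- h)%:C) z0.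
Proof.
have tz := tends_lambda j tk; have tc := tends_cc tk tz d1 b0.
have := tendsD tz (tendsM tc tends_e); rewrite mulr0 addr0.
by apply: tends_ext.
Qed.

Lemma mode_okP : exists2 B : R, 1 <= B &
  ev mu0 (fun h mu => mode_ok B (- h)%:C (k h mu)%:C (Z h mu)).
Proof.
have tz := tends_lambda j tk; have tm := tends_cm tk tz; have tp := tends_cp tk tz d1.
have tr := tends_cr tk tz d1; have tX := tends_cX tk tz d1; have ts := tends_cs tk tz d1 d2.
have tt := tends_ct tk tz d1 d2; have tc := tends_cc tk tz d1 b0; have tl := tends_lam2.
have t1 := tendsD (tendsC mu0 1) tz; have t1l := tendsD (tendsC mu0 1) tl.
have tq := tendsM (tendsZ ii tk) (tendsV z1 t1l).
have mm := tendsZ (4 / 3) (tendsM tm tm).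
have n1 := tends_neq0 d1 (tendsD (tendsC mu0 1) mm).
have n2 := tends_neq0 d2 (tendsD (tendsC mu0 4) mm).
have n3 := tends_neq0 b0 (tends_bb tk tz); have n4 := tends_neq0 z1 t1l.
have [|B B1 H] := @tends_all_le R mu0 [:: (fun h mu => cp (k h mu)%:C (Z h mu)); (fun h mu => cr (k h mu)%:C (Z h mu));
  (fun h mu => cs (k h mu)%:C (Z h mu)); (fun h mu => ct (k h mu)%:C (Z h mu)); (fun h mu => cm (k h mu)%:C (Z h mu));
  (fun h mu => cX (k h mu)%:C (Z h mu)); (fun h mu => cc (k h mu)%:C (Z h mu)); (fun h mu => 1 + Z h mu);
  (fun h mu => ii * (k h mu)%:C * (1 + lam2 (k h mu)%:C (Z h mu) (- h)%:C)^-1)].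
  by do 9 (split; first by eexists; eassumption).
exists B => //; apply: ev_imp (ev_and (ev_and n1 n2) (ev_and (ev_and n3 n4) H)) => h mu.
move=> [[m1 m2] [[m3 m4] [b1 [b2 [b3 [b4 [b5 [b6 [b7 [b8 [b9 _]]]]]]]]]]].
by split=> //; exact: disp_lambda.
Qed.
End Limit.

Section Column.
Variables (h : R) (phi psi : R -> R) (T : R) (k : R) (z : C) (B : R).
Hypotheses (h_range : - 6^-1 < h < 0) (wave : periodic_wave h phi psi T).
Let e : C := (- h)%:C.
Hypotheses (B1 : 1 <= B) (ok : mode_ok B e k%:C z) (hs : 9 * (- h) <= 1).

Let xf x : C := (phi x)%:C.
Let yf x : C := (wav phi psi x)%:C.
Let F x := modeF (cp k%:C z) (cr k%:C z) (cs k%:C z) (ct k%:C z) (xf x) (yf x).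
Let F1 x := modeF1 (cp k%:C z) (cr k%:C z) (cs k%:C z) (ct k%:C z) (xf x) (yf x).
Let F2 x := modeF2 (cp k%:C z) (cr k%:C z) (cs k%:C z) (ct k%:C z) (xf x) (yf x).
Let lam := lam2 k%:C z e.
Definition colU x : C := ii * k%:C * F x.
Definition colW x : C := modeG k%:C lam (F x) (F1 x).
Definition colU' x : C := ii * k%:C * (ii * k%:C * F x + F1 x).
Definition colW' x : C := ii * k%:C * modeG k%:C lam (F x) (F1 x) + modeG k%:C lam (F1 x) (F2 x).

Lemma energy_complex x : e = 2 / 3 * (yf x * yf x) + xf x * xf x / 2 - xf x * (xf x * xf x) / 3.
Proof.
have := wave_energy wave x => E.
have -> : 2 / 3 * (yf x * yf x) + xf x * xf x / 2 - xf x * (xf x * xf x) / 3 =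
  (2 / 3 * (wav phi psi x * wav phi psi x) + phi x * phi x / 2 - phi x * (phi x * phi x) / 3)%:C.
  by rewrite /xf /yf !(rmorphB, rmorphD, rmorphM) /= ?fmorphV ?rmorph_nat; ring.
rewrite /e; congr (_%:C); move: E; rewrite !exprS expr0 !mulr1; lra.
Qed.

Lemma col_derivatives x : cder (fun t => expi k t * colU t) x (expi k x * colU' x) /\
  cder (fun t => expi k t * colW t) x (expi k x * colW' x).
Proof.
have dx : cder xf x (- (4 / 3) * yf x).
  apply: cder_eq (cder_real (dphi wave x)) _.
  by rewrite rmorphM rmorphN rmorphM /= fmorphV !rmorph_nat.
have dy : cder yf x (xf x - xf x * xf x).
  by apply: cder_eq (cder_real (dwav wave x)) _; rewrite rmorphB rmorphXn expr2.
have [dF dF1] := cder_modeF (cp k%:C z) (cr k%:C z) (cs k%:C z) (ct k%:C z) dx dy.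
have dE := cder_expi k x; rewrite iiE in dE.
split.
  apply: cder_eq (cderM dE (cderZ (ii * k%:C) dF)) _.
  by rewrite /colU' -/(F x) -/(F1 x); ring.
apply: cder_eq (cderM dE (cder_modeG k%:C lam dF dF1)) _.
by rewrite /colW' -/(F x) -/(F1 x) -/(F2 x); ring.
Qed.

Lemma col_residual x : exists res : C, [/\ cabs res <= 50 * B ^+ 4 * (3 * Num.sqrt (- h)) ^+ 3,
  2^-1 * colU' x - colW' x + (1 - 2 * xf x - lam) * colU x = res &
  - colU' x + 2^-1 * colW' x + xf x * colU x - (1 + lam) * colW x = - (res / 2)].
Proof.
have [D [n1 n2] n3 n4 [[p1 p2] [p3 p4] [p5 p6] [p7 p8] p9]] := ok.
have SR := scalar_residual D n1 n2 n3 (energy_complex x).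
have [VR1 VR2] := vector_residual k%:C (xf x) (F x) (F1 x) (F2 x) n4.
exists (ii * k%:C / (1 + lam) * remainder (cp k%:C z) (cr k%:C z) (cs k%:C z) (ct k%:C z) (cm k%:C z) (cX k%:C z)
  (cc k%:C z) z e (xf x) (yf x)).
have E : 3 / 4 * F2 x + cm k%:C lam * F1 x - disp k%:C lam * F x - 2 * (1 + lam) * xf x * F x =
   remainder (cp k%:C z) (cr k%:C z) (cs k%:C z) (ct k%:C z) (cm k%:C z) (cX k%:C z)
  (cc k%:C z) z e (xf x) (yf x).
  rewrite -SR.
  have -> : cm k%:C lam = cm k%:C z + cc k%:C z * e by rewrite /cm /lam /lam2 addrA.
  by rewrite /lam /lam2 [1 + (z + _)]addrA.
split; last first.
- by rewrite -E -VR2 /colU' /colW' /colU /colW.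
- by rewrite -E -VR1 /colU' /colW' /colU /colW.
have e0 : 0 <= - h by move: h_range => /andP[_]; lra.
(* Since [a ^+ 2 = 9 * (- h)], this dominates [phi], whose square is at most [6 * (- h)], as well as
   [wav]. *)
pose a := 3 * Num.sqrt (- h).
have a0 : 0 <= a by rewrite mulr_ge0 // sqrtr_ge0.
have a2 : a ^+ 2 = 9 * - h by rewrite exprMn sqr_sqrtr // -natrX.
have a1' : a <= 1 by rewrite -(@ler_pXn2r _ 2) ?nnegrE // a2 expr1n.
have xa : cabs (xf x) <= a.
  rewrite cabs_real -(@ler_pXn2r _ 2) ?nnegrE // real_normK ?num_real // a2.
  have := phi_sqr_le h_range wave x; lra.
have ya : cabs (yf x) <= a.
  rewrite cabs_real -(@ler_pXn2r _ 2) ?nnegrE // real_normK ?num_real // a2.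
  have := wav_sqr_le h_range wave x; lra.
have ea : cabs e <= a * a by rewrite -expr2 a2 cabs_real ger0_norm //; lra.
have RB := remainder_bound B1 a0 a1' p1 p2 p3 p4 p5 p6 p7 p8 xa ya ea.
apply: le_trans (cabs_leM p9 RB) _; rewrite -/a.
by rewrite le_eqVlt; apply/orP; left; apply/eqP; ring.
Qed.
End Column.
End ModeColumn.

(** * Two columns and the splitting of their shifts *)

Section TwoModes.
Context {R : realType}.
Local Notation C := R[i].

Lemma system22 (u l1 l2 a b c d a' b' c' d' : C) :
  a1 *m mx22 a' b' c' d' + (A0 + u *: N0) *m mx22 a b c d - mx22 a b c d *m mx22 l1 0 0 l2 =
  mx22 (2^-1 * a' - c' + (1 - 2 * u - l1) * a) (2^-1 * b' - d' + (1 - 2 * u - l2) * b)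
       (- a' + 2^-1 * c' + u * a - (1 + l1) * c) (- b' + 2^-1 * d' + u * b - (1 + l2) * d).
Proof.
have -> : A0 + u *: N0 = mx22 (1 - 2 * u) 0 u (-1).
  by rewrite [LHS]mx22E; apply: mx22_eq; rewrite !mxE /=; ring.
have opp (p q r s : C) : - mx22 p q r s = mx22 (- p) (- q) (- r) (- s).
  by rewrite [LHS]mx22E; apply: mx22_eq; rewrite !mxE.
rewrite /a1 halfC !mx22_mul opp !mx22_add.
by apply: mx22_eq; ring.
Qed.

Definition second_order_frame (h : R) (phi psi : R -> R) (k1 k2 : R) (z1 z2 : C) (x : R) : 'M[C]_2 :=
  mx22 (expi k1 x * colU phi psi k1 z1 x) (expi k2 x * colU phi psi k2 z2 x)
       (expi k1 x * colW h phi psi k1 z1 x) (expi k2 x * colW h phi psi k2 z2 x).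

Lemma two_mode_flow (h : R) (phi psi : R -> R) (T : R) (k1 k2 : R) (z1 z2 : C) (B : R) :
  - 6^-1 < h < 0 -> periodic_wave h phi psi T -> 1 <= B -> 9 * (- h) <= 1 ->
  mode_ok B (- h)%:C k1%:C z1 -> mode_ok B (- h)%:C k2%:C z2 ->
  exists2 G, flow phi (mx22 (lam2 k1%:C z1 (- h)%:C) 0 0 (lam2 k2%:C z2 (- h)%:C)) G
      (second_order_frame h phi psi k1 k2 z1 z2) &
    forall x, mnorm (G x) <= 3 * (50 * B ^+ 4 * (3 * Num.sqrt (- h)) ^+ 3).
Proof.
move=> hr wv B1 hs ok1 ok2.
pose dY x : 'M[C]_2 := mx22 (expi k1 x * colU' phi psi k1 z1 x) (expi k2 x * colU' phi psi k2 z2 x)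
       (expi k1 x * colW' h phi psi k1 z1 x) (expi k2 x * colW' h phi psi k2 z2 x).
have D x : mder (second_order_frame h phi psi k1 k2 z1 z2) x (dY x).
  have [a b] := col_derivatives k1 z1 wv x; have [c d] := col_derivatives k2 z2 wv x.
  exact: mder22.
eexists; first exact: residual_flow D.
move=> x; have [r1 [b1 e1 f1]] := col_residual hr wv B1 ok1 hs x.
have [r2 [b2 e2 f2]] := col_residual hr wv B1 ok2 hs x.
set rho := 50 * _ * _ in b1 b2 *.
rewrite [X in mnorm X](_ : _ = mx22 (expi k1 x * r1) (expi k2 x * r2) (expi k1 x * - (r1 / 2)) (expi k2 x * - (r2 / 2))).
  rewrite mnorm22 !(cabsM (expi _ _)) !cabs_expi !mul1r !cabsN !(cabsM _ 2^-1) cabsV (cabs_nat 2).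
  by move: b1 b2 => q1 q2; lra.
rewrite /dY /second_order_frame system22 -f1 -f2 -e1 -e2.
by apply: mx22_eq; ring.
Qed.

Lemma second_order_frame_period (h : R) (phi psi : R -> R) (T : R) (k1 k2 mu : R) (z1 z2 : C) :
  periodic_wave h phi psi T -> expi k1 T = expi mu T :> C -> expi k2 T = expi mu T :> C ->
  second_order_frame h phi psi k1 k2 z1 z2 T = expi mu T *: second_order_frame h phi psi k1 k2 z1 z2 0.
Proof.
move=> wv E1 E2; have p0 : phi T = phi 0 by have := wave_per wv 0; rewrite add0r.
have w0 : wav phi psi T = wav phi psi 0 by have := wav_per wv 0; rewrite add0r.
rewrite /second_order_frame mx22_scale E1 E2 !expi0 !mul1r /colU /colW p0 w0.
by [].
Qed.

(* The first-order shifts of the two crossing branches have different real parts. *)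
Lemma shift_split (k1 k2 : R) (z : C) : k1 != k2 -> k1 + k2 != 0 -> disp k1%:C z = 0 -> disp k2%:C z = 0 ->
  bb k1%:C z != 0 -> bb k2%:C z != 0 ->
  [/\ complex.Re (cc k1%:C z - cc k2%:C z) != 0, 1 + z != 0,
   1 + 4 / 3 * (cm k1%:C z * cm k1%:C z) != 0 /\ 4 + 4 / 3 * (cm k1%:C z * cm k1%:C z) != 0 &
   1 + 4 / 3 * (cm k2%:C z * cm k2%:C z) != 0 /\ 4 + 4 / 3 * (cm k2%:C z * cm k2%:C z) != 0].
Proof.
move=> k12 A0 D1 D2 b1 b2; have [zE res] := common_root k12 D1 D2.
set A := k1 + k2 in zE res A0; pose nu := - (3 / 4) * A.
have nuE : z = ii * nu%:C by exact: zE.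
pose D := 3 + 3 * A ^+ 2.
have D0 : 0 < D by rewrite ltr_pwDl // mulr_ge0 // sqr_ge0.
have A20 : 0 < A ^+ 2 by rewrite exprn_even_gt0.
(* The resonance relation expresses [k1 * k2], and with it the squared difference, by the sum
   [A]. *)
have sq : 3 / 4 * (k1 - k2) ^+ 2 = 3 * A ^+ 2 + 4.
  have : 4 * (k1 * k2) = A ^+ 2 - (k1 - k2) ^+ 2 by rewrite /A; ring.
  move: res; set P := k1 * k2; set S := (k1 - k2) ^+ 2; set Q := A ^+ 2; lra.
have mmE : (4 / 3 : C) * (ii * (3 / 4 * (k1 - k2))%:C * (ii * (3 / 4 * (k1 - k2))%:C)) = (- D - 1)%:C.
  have -> : (4 / 3 : C) * (ii * (3 / 4 * (k1 - k2))%:C * (ii * (3 / 4 * (k1 - k2))%:C)) =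
     (ii * ii) * (3 / 4 * (k1 - k2) ^+ 2)%:C.
    rewrite !(rmorphM, rmorphXn, rmorphB) /= ?fmorphV ?rmorph_nat; by field.
  rewrite ii_sqr sq mulN1r -rmorphN; congr (_%:C); rewrite /D; ring.
have m1E : cm k1%:C z = ii * (3 / 4 * (k1 - k2))%:C.
  rewrite /cm nuE /nu /A !(rmorphM, rmorphB, rmorphD, rmorphN) /= ?fmorphV ?rmorph_nat; by field.
have m2E : cm k2%:C z = - (ii * (3 / 4 * (k1 - k2))%:C).
  rewrite /cm nuE /nu /A !(rmorphM, rmorphB, rmorphD, rmorphN) /= ?fmorphV ?rmorph_nat; by field.
have nu0 : nu != 0 by rewrite mulf_neq0 // oppr_eq0 mulf_neq0 ?invr_eq0 ?pnatr_eq0.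
clearbody nu; clear zE.
have mm1 : 4 / 3 * (cm k1%:C z * cm k1%:C z) = (- D - 1)%:C by rewrite m1E.
have mm2 : 4 / 3 * (cm k2%:C z * cm k2%:C z) = (- D - 1)%:C by rewrite m2E mulrNN.
have n1 : 1 + (- D - 1)%:C = (- D)%:C :> C by rewrite rmorphB rmorph1; ring.
have n4 : 4 + (- D - 1)%:C = (3 - D)%:C :> C by rewrite !rmorphB rmorphN rmorph1 rmorph_nat; ring.
have D1' : (- D)%:C != 0 :> C by rewrite real_complex_neq0 // oppr_eq0 gt_eqF.
have D4' : (3 - D)%:C != 0 :> C.
  by rewrite real_complex_neq0 // lt_eqF // /D; lra.
have z1 : 1 + z != 0 by rewrite nuE -[1]/(1%:C); apply: real_imag_neq0; left; rewrite oner_eq0.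
split; rewrite ?mm1 ?mm2 ?n1 ?n4 //.
(* The values [cm] at the two modes are opposite and [cp] depends on their square only, so both
   shifts have the same numerator [N] and differ through [bb]. *)
pose N := (1 + z) * (1 + cp k1%:C z).
have cpE : cp k2%:C z = cp k1%:C z by rewrite /cp mm1 mm2.
pose be1 := k1 / 2 - nu; pose be2 := k2 / 2 - nu.
have bb1 : bb k1%:C z = ii * be1%:C by rewrite /bb nuE /be1 rmorphB rmorphM /= halfC; ring.
have bb2 : bb k2%:C z = ii * be2%:C by rewrite /bb nuE /be2 rmorphB rmorphM /= halfC; ring.
have be10 : be1 != 0 by apply: contraNneq b1 => e; rewrite bb1 e mulr0.
have be20 : be2 != 0 by apply: contraNneq b2 => e; rewrite bb2 e mulr0.
have be12 : be1 != be2.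
  by apply: contraNneq k12; rewrite /be1 /be2 => e; apply/eqP; lra.
have c1E : cc k1%:C z = N * (- ii * (be1^-1)%:C).
  have i2 : ii^-1 = - ii :> C by apply: (mulIf (ii_neq0 (R := R))); rewrite mulVf ?ii_neq0 // mulNr ii_sqr opprK.
  rewrite /cc /cX bb1 -/N -i2 fmorphV /N; field.
  by rewrite ii_neq0 real_complex_neq0.
have c2E : cc k2%:C z = N * (- ii * (be2^-1)%:C).
  have i2 : ii^-1 = - ii :> C by apply: (mulIf (ii_neq0 (R := R))); rewrite mulVf ?ii_neq0 // mulNr ii_sqr opprK.
  rewrite /cc /cX bb2 cpE -i2 fmorphV /N; field.
  by rewrite ii_neq0 real_complex_neq0.
have NE : N = (1 + ii * nu%:C) + (2 / D)%:C * ((1 - nu ^+ 2)%:C + ii * (2 * nu)%:C).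
  have cE : cp k1%:C z = (2 / D)%:C * (1 + z).
    rewrite /cp mm1 n1 rmorphN !rmorphM /= fmorphV rmorph_nat; field.
    by rewrite real_complex_neq0 // gt_eqF.
  rewrite /N cE nuE.
  have -> : (1 + ii * nu%:C) * (1 + (2 / D)%:C * (1 + ii * nu%:C)) =
     (1 + ii * nu%:C) + (2 / D)%:C * (1 + (ii * ii) * nu%:C ^+ 2 + 2 * ii * nu%:C) by ring.
  rewrite ii_sqr; congr (_ + _ * _); rewrite rmorphB rmorph1 rmorphXn rmorphM /= rmorph_nat; ring.
have ImN : complex.Im N = nu * (1 + 4 / D).
  by rewrite NE -!iiE !ReImE /=; ring.
(* Both [bb] are imaginary, so the difference of the real parts is the imaginary part of [N] times
   [be1^-1 - be2^-1]. The imaginary part is [nu * (1 + 4 / D)], nonzero because [A] is. *)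
rewrite c1E c2E; clearbody N be1 be2; rewrite -mulrBr -mulrBr -rmorphB mulrA.
have -> : complex.Re (N * - ii * (be1^-1 - be2^-1)%:C) = complex.Im N * (be1^-1 - be2^-1).
  by rewrite !ReImE /=; ring.
rewrite ImN; apply: mulf_neq0.
  by apply: mulf_neq0 => //; rewrite gt_eqF // addr_gt0 // divr_gt0.
by rewrite subr_eq0 (inj_eq invr_inj).
Qed.
End TwoModes.

(** * Curves through resonances *)

Section ResonantCurves.
Context {R : realType}.
Local Notation C := R[i].
Variables (phi psi : R -> R -> R) (T : R -> R).
Hypothesis Hwave : forall h : R, - 6^-1 < h < 0 -> periodic_wave h (phi h) (psi h) (T h).

Lemma tends_wave mu0 : tends mu0 (fun h _ => (phi h 0)%:C) 0 /\ tends mu0 (fun h _ => (wav (phi h) (psi h) 0)%:C) 0.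
Proof.
have P r : 0 < r -> exists2 d : R, 0 < d & forall h, - d < h < 0 -> - 6^-1 < h < 0 /\ 3 * Num.sqrt (- h) <= r.
  move=> r0; have [d d0 Q] := sqrt_small (K := 3) (ler0n _ _) r0.
  exists (Num.min d 6^-1); first by rewrite lt_min d0 invr_gt0 ltr0n.
  move=> h /andP[h1 h2]; rewrite h2 !andbT; split; first by rewrite (le_lt_trans _ h1) // lerN2 ge_min lexx orbT.
  by apply: Q; rewrite h2 andbT (le_lt_trans _ h1) // lerN2 ge_min lexx.
have sq (u h : R) : - 6^-1 < h < 0 -> u ^+ 2 <= 6 * - h -> `|u| <= 3 * Num.sqrt (- h).
  move=> /andP[_ h0] hu; have e0 : 0 <= - h by lra.
  rewrite -(@ler_pXn2r _ 2) ?nnegrE ?mulr_ge0 ?sqrtr_ge0 // real_normK ?num_real // exprMn sqr_sqrtr //.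
  by move: hu; clear -Hwave e0; lra.
split=> r r0; have [d d0 Q] := P r r0; exists d => // h mu h1 _; rewrite subr0 cabs_real; have [hr hs] := Q h h1.
  by apply: le_trans hs; apply: sq => //; exact: phi_sqr_le hr (Hwave hr) 0.
apply: le_trans hs; apply: sq => //.
have := wav_sqr_le hr (Hwave hr) 0; move: hr => /andP[_]; clear -Hwave; lra.
Qed.

Lemma tends_column mu0 j (k : R -> R -> R) (k0 : R) : tends mu0 (fun h mu => (k h mu)%:C) k0%:C ->
  let z := lambda_ j k0 in
  1 + 4 / 3 * (cm k0%:C z * cm k0%:C z) != 0 -> 4 + 4 / 3 * (cm k0%:C z * cm k0%:C z) != 0 ->
  bb k0%:C z != 0 -> 1 + z != 0 ->
  tends mu0 (fun h mu => expi (k h mu) 0 * colU (phi h) (psi h) (k h mu) (lambda_ j (k h mu)) 0) (ii * k0%:C) /\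
  tends mu0 (fun h mu => expi (k h mu) 0 * colW h (phi h) (psi h) (k h mu) (lambda_ j (k h mu)) 0) (bb k0%:C z + 1).
Proof.
move=> tk z d1 d2 b0 z1; have [tx ty] := tends_wave mu0; have tz := tends_lambda j tk; rewrite -/z in tz.
have [tF tF1] := tends_modeF (tends_cp tk tz d1) (tends_cr tk tz d1) (tends_cs tk tz d1 d2) (tends_ct tk tz d1 d2) tx ty.
have F0 (p r s t : C) : modeF p r s t 0 0 = 1 by rewrite /modeF !mulr0 !addr0.
have F10 (p r s t : C) : modeF1 p r s t 0 0 = 0.
  by rewrite /modeF1; ring.
rewrite F0 in tF; rewrite F10 in tF1.
split.
  have := tendsM (tendsZ ii tk) tF; rewrite mulr1; apply: tends_ext => h mu.
  by rewrite expi0 mul1r.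
have tl := tends_lam2 tk d1 b0; rewrite -/z in tl.
have := tends_modeG z1 tk tl tF tF1; rewrite modeG0 ?disp_lambda //.
by apply: tends_ext => h mu; rewrite expi0 mul1r.
Qed.

(** The gap between the approximate eigenvalues is only of order [|h|], so a residual of order
    [|h|^(3/2)] is fed into [local_curve]. The gap sits in the real parts and therefore holds for
    all nearby [mu], including those where the imaginary parts cross. *)
Lemma local_resonant j (mu0 : R) : mu0 != 1 -> mu0 != -1 -> (forall n : int, mu0 != n%:~R / Num.sqrt 3) ->
  resonant j mu0 -> good_at phi T j mu0.
Proof.
move=> n1 nN1 nk /(resonantP n1 nN1)[j' [m [m0 kmu [mu1 k1] E]]].
pose k0 := mu0 + 2 * m%:~R / Num.sqrt 3; rewrite -/k0 in kmu k1 E.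
pose z : C := lambda_ j mu0.
(* A vanishing sum would mean [mu0 = - m / sqrt 3], one of the excluded points. *)
have A0 : mu0 + k0 != 0.
  apply: contraNneq (nk (- m)) => e; apply/eqP; rewrite rmorphN /= mulNr.
  by move: e; rewrite /k0 -mulrA; lra.
have Dz1 : disp mu0%:C z = 0 by exact: disp_lambda.
have Dz2 : disp k0%:C z = 0 by rewrite /z -E; exact: disp_lambda.
have b1 : bb mu0%:C z != 0.
  by have [t t0 ->] := bb_large j mu1; rewrite mulf_neq0 ?ii_neq0 ?real_complex_neq0.
have b2 : bb k0%:C z != 0.
  by have [t t0 tE] := bb_large j' k1; rewrite E in tE; rewrite tE mulf_neq0 ?ii_neq0 ?real_complex_neq0.
have [Rc z1 [d11 d12] [d21 d22]] := shift_split kmu A0 Dz1 Dz2 b1 b2.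
have FR := frame_resonant kmu mu1 k1 E.
have t1 := @tends_mu R mu0; have t2 := tends_shifted Hwave m mu0; rewrite -/k0 in t2.
pose sh (h mu : R) : R := shifted T m h mu.
pose la (h mu : R) : C := lam2 mu%:C (lambda_ j mu) (- h)%:C.
pose lb (h mu : R) : C := lam2 (sh h mu)%:C (lambda_ j' (sh h mu)) (- h)%:C.
have tla : tends mu0 la z by exact: (tends_lam2 t1 d11 b1).
have e21 : 1 + 4 / 3 * (cm k0%:C (lambda_ j' k0) * cm k0%:C (lambda_ j' k0)) != 0 by rewrite E.
have e22 : 4 + 4 / 3 * (cm k0%:C (lambda_ j' k0) * cm k0%:C (lambda_ j' k0)) != 0 by rewrite E.
have eb2 : bb k0%:C (lambda_ j' k0) != 0 by rewrite E.
have ez2 : 1 + lambda_ j' k0 != 0 by rewrite E.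
have tlb : tends mu0 lb z by have := tends_lam2 t2 e21 eb2; rewrite E.
pose V' (h mu : R) := second_order_frame h (phi h) (psi h) mu (sh h mu) (lambda_ j mu) (lambda_ j' (sh h mu)) 0.
have tV : tends_mx mu0 V' (modes mu0%:C z k0%:C z).
  have [u1 u2] := tends_column t1 d11 d12 b1 z1.
  have [u3 u4] := tends_column t2 e21 e22 eb2 ez2.
  rewrite E in u4.
  exact: (tends_mx22 u1 u3 u2 u4).
have [B1 B11 ok1] := mode_okP t1 d11 d12 b1 z1.
have [B2 B21 ok2] := mode_okP t2 e21 e22 eb2 ez2.
have okW (B B' : R) e k w : B <= B' -> mode_ok B e k w -> mode_ok B' e k w.
  move=> BB [q1 q2 q3 q4 [[q5 q6] [q7 q8] [q9 q10] [q11 q12] q13]].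
  by split=> //; split; [split|split|split|split|]; exact: le_trans BB.
pose B := B1 + B2.
have BB1 : B1 <= B by rewrite /B lerDl; lra.
have BB2 : B2 <= B by rewrite /B lerDr; lra.
have B1' : 1 <= B by exact: le_trans BB1.
have tcd := tendsB (tends_cc t1 (tends_lambda j t1) d11 b1) (tends_cc t2 (tends_lambda j' t2) e21 eb2).
rewrite E -/z in tcd.
pose g0 := `|complex.Re (cc mu0%:C z - cc k0%:C z)| / 2.
have g00 : 0 < g0 by rewrite divr_gt0 // normr_gt0.
have ecd := tends_ev g00 tcd.
have [d [d0 [d1 [dk [d9 evs]]]]] : exists d : R, [/\ 0 < d, True & True] /\ (d <= `|mu0| - 1 /\ (d <= 9^-1 /\ (d <= 6^-1 /\
   forall h mu, - d < h < 0 -> `|mu - mu0| < d -> [/\ mode_ok B (- h)%:C mu%:C (lambda_ j mu),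
     mode_ok B (- h)%:C (sh h mu)%:C (lambda_ j' (sh h mu)), 1 < `|sh h mu| &
     g0 <= `|complex.Re (cc mu%:C (lambda_ j mu) - cc (sh h mu)%:C (lambda_ j' (sh h mu)))| ]))).
  have k10 : 0 < (`|k0| - 1) / 2 by rewrite divr_gt0 // subr_gt0.
  have [d' d'0 H] := ev_and (ev_and ok1 ok2) (ev_and (tends_ev k10 t2) ecd).
  exists (Num.min (Num.min d' (`|mu0| - 1)) (Num.min 9^-1 6^-1)); split.
    by split => //; rewrite !lt_min d'0 subr_gt0 mu1 !invr_gt0 !ltr0n.
  split; first by rewrite !ge_min lexx orbT.
  split; first by rewrite !ge_min lexx !orbT.
  split; first by rewrite !ge_min lexx !orbT.
  move=> h mu /andP[h1 h2] hm.
  have HH : (mode_ok B1 (- h)%:C mu%:C (lambda_ j mu) /\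
     mode_ok B2 (- h)%:C (sh h mu)%:C (lambda_ j' (sh h mu))) /\
     (cabs ((sh h mu)%:C - k0%:C) <= (`|k0| - 1) / 2 /\
      cabs (cc mu%:C (lambda_ j mu) - cc (sh h mu)%:C (lambda_ j' (sh h mu)) - (cc mu0%:C z - cc k0%:C z)) <= g0).
    apply: H.
      by rewrite h2 andbT (le_lt_trans _ h1) // lerN2 !ge_min lexx.
    by apply: lt_le_trans hm _; rewrite !ge_min lexx.
  case: HH => [[ok_1 ok_2] [ok_3 ok_4]].
  split; [exact: okW ok_1|exact: okW ok_2| |].
    rewrite -rmorphB cabs_real in ok_3.
    have := ler_normB (sh h mu) (sh h mu - k0); rewrite opprB addrCA subrr addr0.
    by move: ok_3 k10; clear -Hwave; lra.
  have gE : `|complex.Re (cc mu0%:C z - cc k0%:C z)| = 2 * g0 by rewrite /g0 mulrC divfK.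
  move: ok_4 gE; set X := cc mu%:C _ - _; set Y := cc mu0%:C z - _ => ok_4 gE.
  have q := le_trans (Re_le_cabs _) ok_4; clearbody X Y; rewrite cReD cReN in q.
  have := ler_normB (complex.Re X) (complex.Re X - complex.Re Y); rewrite opprB addrCA subrr addr0.
  by move: q gE; clear -Hwave; lra.
have [d00 _ _] := d0; clear d0.
pose ep (h : R) : R := 3 * (50 * B ^+ 4 * (3 * Num.sqrt (- h)) ^+ 3).
pose g (h : R) : R := g0 * - h.
have inner mu : `|mu - mu0| < d -> 1 < `|mu|.
  move=> hm; have := ler_normB mu (mu - mu0); rewrite opprB addrCA subrr addr0.
  by move: hm d1; clear -Hwave; lra.
have loc : exists2 d : R, 0 < d & forall h mu, - d < h < 0 -> `|mu - mu0| < d ->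
    [/\ cont_at (la h) mu, 0 < g h, g h <= cabs (la h mu - lb h mu) &
      exists G Y, [/\ flow (phi h) (mx22 (la h mu) 0 0 (lb h mu)) G Y, Y 0 = V' h mu,
        Y (T h) = expi mu (T h) *: V' h mu & forall x, mnorm (G x) <= ep h]].
  exists d => // h mu /[dup] hh /andP[h1 h2] hm; have [ok_1 ok_2 ok_3 ok_4] := evs h mu hh hm.
  have hr : - 6^-1 < h < 0 by rewrite h2 andbT; move: h1 d9; clear -Hwave; lra.
  have T0 : T h != 0 by rewrite gt_eqF // (wave_T0 (Hwave hr)).
  have mu1' := inner mu hm.
  split.
  - have [_ [c1 _] c2 _ _] := ok_1.
    apply: cont_at_tends; have tm := @tends_mu R mu; have tz := tends_lambda j tm.
    exact: tendsD tz (tendsM (tends_cc tm tz c1 c2) (tendsC _ _)).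
  - by rewrite /g mulr_gt0 // oppr_gt0.
  - apply: le_trans (Re_le_cabs _) => /=.
    have -> : la h mu - lb h mu = (lambda_ j mu - lambda_ j' (sh h mu)) +
       (- h)%:C * (cc mu%:C (lambda_ j mu) - cc (sh h mu)%:C (lambda_ j' (sh h mu))).
      by rewrite /la /lb /lam2; ring.
    (* Outside the unit interval the eigenvalues of the rest state are imaginary, so only the shifts
       contribute to the real part. *)
    rewrite cReD cReD cReN !Re_lambda_large // oppr0 addr0 add0r.
    rewrite cReM /= mul0r subr0 normrM /g mulrC ger0_norm ?oppr_ge0 ?(ltW h2) //.
    by rewrite ler_wpM2l // oppr_ge0 ltW.
  have [|G GF Gb] := two_mode_flow hr (Hwave hr) B1' _ ok_1 ok_2.
    by move: h1 dk; clear -Hwave; lra.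
  exists G, (second_order_frame h (phi h) (psi h) mu (sh h mu) (lambda_ j mu) (lambda_ j' (sh h mu))); split => //.
  by apply: second_order_frame_period (Hwave hr) _ _; rewrite ?expi_shifted.
pose Kc := 3 * (50 * B ^+ 4 * 27).
have epE (h : R) : h < 0 -> ep h = Kc * Num.sqrt (- h) * - h.
  move=> h0; have e0 : 0 <= - h by rewrite oppr_ge0 ltW.
  rewrite /ep /Kc exprMn (exprS (Num.sqrt _)) sqr_sqrtr //; ring.
have B0 : 0 <= B by exact: le_trans ler01 B1'.
have K0 : 0 <= Kc by rewrite /Kc mulr_ge0 // mulr_ge0 // mulr_ge0 // exprn_ge0.
clearbody Kc.
have small r : 0 < r -> exists2 d : R, 0 < d & forall h, - d < h < 0 -> ep h <= r * g h.
  move=> r0; have [d' d'0 Q] := sqrt_small K0 (mulr_gt0 r0 g00); exists d' => // h /[dup] hh /andP[_ h2].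
  by rewrite epE // /g mulrA ler_wpM2r ?oppr_ge0 ?(ltW h2) // Q.
have [l [d' [K' [d'0 K'0 P]]]] := local_curve Hwave FR tla tlb tV loc small.
pose dd := Num.min d d'.
have dd0 : 0 < dd by rewrite lt_min d00.
have sub h mu : - dd < h < 0 -> `|mu - mu0| < dd -> [/\ - d < h < 0, - d' < h < 0, `|mu - mu0| < d & `|mu - mu0| < d'].
  exact: near_and.
exists l, dd; split => //.
  by move=> h mu h1 h2; have [_ q1 _ q2] := sub h mu h1 h2; have [p1 p2 _] := P h mu q1 q2.
move=> r r0.
have KK : 0 <= K' * Kc + B by rewrite addr_ge0 // mulr_ge0 // ltW.
have [h1 h10 Q] := sqrt_small KK r0.
exists (Num.min dd h1); first by rewrite lt_min dd0.
move=> h mu /andP[ha hb] hm.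
have hdd : - dd < h < 0 by rewrite hb andbT (le_lt_trans _ ha) // lerN2 ge_min lexx.
have hh1 : - h1 < h < 0 by rewrite hb andbT (le_lt_trans _ ha) // lerN2 ge_min lexx orbT.
have [q1 q2 q3 q4] := sub h mu hdd hm; have [_ _ p3] := P h mu q2 q4.
have [[_ _ _ _ [_ _ _ [ccB _] _]] _ _ _] := evs h mu q1 q3.
have e0 : 0 <= - h by rewrite oppr_ge0 ltW.
have sle : - h <= Num.sqrt (- h).
  have s1 : Num.sqrt (- h) <= 1.
    rewrite -(@ler_pXn2r _ 2) ?nnegrE ?sqrtr_ge0 // sqr_sqrtr // expr1n.
    by move: q1 dk => /andP[]; clear -Hwave; lra.
  by rewrite -{1}(sqr_sqrtr e0) expr2 ler_piMr ?sqrtr_ge0.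
have w1 : cabs (la h mu - lambda_ j mu) <= B * - h.
  have -> : la h mu - lambda_ j mu = cc mu%:C (lambda_ j mu) * (- h)%:C by rewrite /la /lam2; ring.
  by rewrite cabsM cabs_real ger0_norm // ler_wpM2r.
have w2 : cabs (l h mu - lambda_ j mu) <= cabs (l h mu - la h mu) + cabs (la h mu - lambda_ j mu).
  have -> : l h mu - lambda_ j mu = (l h mu - la h mu) + (la h mu - lambda_ j mu) by ring.
  exact: cabsD.
have w3 : K' * ep h <= K' * Kc * Num.sqrt (- h).
  rewrite epE // -[leRHS]mulrA; apply: ler_wpM2l; first exact: ltW.
  apply: ler_piMr; first by rewrite mulr_ge0 // sqrtr_ge0.
  by move: q1 dk => /andP[]; clear -Hwave; lra.
have w4 := ler_wpM2l B0 sle; have w5 := Q h hh1; rewrite mulrDl in w5.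
apply: le_trans w2 _; apply: le_trans (lerD p3 w1) _.
apply: le_trans (lerD w3 w4) w5.
Qed.
End ResonantCurves.

(** * Gluing branches *)

Section Gluing.
Context {R : realType}.
Local Notation C := R[i].
Variables (phi psi : R -> R -> R) (T : R -> R).
Hypothesis Hwave : forall h : R, - 6^-1 < h < 0 -> periodic_wave h (phi h) (psi h) (T h).

Lemma not_alg_mult0 (p : R -> R) (S mu : R) w : bloch_eigenvalue p S mu w -> ~ alg_mult p S mu w 0.
Proof.
move=> [P PB [x Px]] [B [_ E]].
have : gen_eigenspace p S mu w P.
  exists 1%N; exists (fun=> 0); split=> //.
  by rewrite (_ : (fun xi => 0 + w *: P xi) = (fun xi => w *: P xi)) //; apply/funext => t; rewrite add0r.
rewrite E => -[c cP]; move: Px; rewrite cP big_ord0 eqxx //.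
Qed.

(** By (i) exactly one eigenvalue is counted in a fixed disc about [lambda_ j mu]; any other value
    there has multiplicity zero. *)
Lemma eigenvalue_unique j (mu : R) : mu != 1 -> mu != -1 -> ~ resonant j mu ->
  exists r h0 : R, [/\ 0 < r, 0 < h0 & forall h w w', - h0 < h < 0 ->
    bloch_eigenvalue (phi h) (T h) mu w -> bloch_eigenvalue (phi h) (T h) mu w' ->
    cabs (w - lambda_ j mu) < r -> cabs (w' - lambda_ j mu) < r -> w = w'].
Proof.
move=> n1 nN1 nres.
have [lam [_ [r [h0 [r0 h00 P]]]]] := perturbed_nonresonant Hwave n1 nN1 nres.
exists r, h0; split => // h w w' hh ew ew' wr wr'.
have [_ am] := P h hh.
suff H v : bloch_eigenvalue (phi h) (T h) mu v -> cabs (v - lambda_ j mu) < r -> v = lam ord0 h by rewrite (H w) // (H w').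
move=> ev vr; have := am v vr; have [//|ne] := eqVneq v (lam ord0 h).
rewrite (_ : [set i | lam i h == v]%SET = finset.set0) ?cards0; first by move/(not_alg_mult0 ev).
apply/setP => i; rewrite !inE; apply: contraNF ne => /eqP <-; apply/eqP; congr (lam _ _).
by apply/val_inj; case: i => -[].
Qed.

(* Resonant quasi-momenta are roots of countably many quadratics. *)
Lemma nonresonant_point j (a b : R) : a < b -> (forall t, a < t < b -> t != 1 /\ t != -1) ->
  exists2 t, a < t < b & ~ resonant j t.
Proof.
move=> ab n1; apply: contrapT => H.
pose s (m : int) : R := 2 * m%:~R / Num.sqrt 3.
(* Completing the square in the resonance relation gives [(t + s/2)^2 = s^2/16 - 1/3]; the boolean
   is the sign of the root. *)
pose f (p : int * bool) := - (s p.1 / 2) + (-1) ^+ p.2 * Num.sqrt (s p.1 ^+ 2 / 16 - 3^-1).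
have sub : `]a, b[%classic `<=` range f.
  move=> t /=; rewrite in_itv /= => tab; have [t1 tN1] := n1 t tab.
  have res : resonant j t by apply: contrapT => nr; apply: H; exists t.
  have [j' [m [m0 kmu _ E]]] := resonantP t1 tN1 res.
  have D2 := disp_lambda j' (t + 2 * m%:~R / Num.sqrt 3); rewrite E in D2.
  have [_] := common_root kmu (disp_lambda j t) D2; rewrite -/(s m) => eq.
  have sqE : (t + s m / 2) ^+ 2 = s m ^+ 2 / 16 - 3^-1.
    have -> : (t + s m / 2) ^+ 2 = (9 / 16 * (t + (t + s m)) ^+ 2 + 3 / 4 * (t * (t + s m)) + 1) / 3 + s m ^+ 2 / 16 - 3^-1 by field.
    by rewrite eq mul0r add0r.
  exists (m, t + s m / 2 < 0) => //; rewrite /f /= -sqE sqrtr_sqr.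
  case: ltrP => [l0|l0]; first by rewrite ltr0_norm // expr1; ring.
  by rewrite ger0_norm // expr0; ring.
have cnt : countable `]a, b[%classic.
  apply: sub_countable (subset_card_le sub) _.
  exact: sub_countable (card_image_le _ _) (countableP _).
have := countable_lebesgue_measure0 cnt; rewrite lebesgue_measure_itv /= lte_fin ab -EFinB => -[] /eqP.
by rewrite subr_eq0 gt_eqF.
Qed.

(** Continuity is relative to the segment, so that pieces can be cut and joined at their end
    points. *)
Definition curve_on j (s t : R) := exists2 l : R -> R -> C,
  exists2 h0 : R, 0 < h0 & forall h mu, - h0 < h < 0 -> s <= mu <= t ->
    bloch_eigenvalue (phi h) (T h) mu (l h mu) /\
    forall r : R, 0 < r -> exists2 d : R, 0 < d & forall mu', s <= mu' <= t -> `|mu' - mu| < d ->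
      cabs (l h mu' - l h mu) <= r
  & forall r : R, 0 < r -> exists2 h1 : R, 0 < h1 & forall h mu, - h1 < h < 0 -> s <= mu <= t ->
      cabs (l h mu - lambda_ j mu) <= r.

Lemma curve_restrict j s t s' t' : curve_on j s t -> s <= s' -> t' <= t -> curve_on j s' t'.
Proof.
move=> [l [h0 h00 P] Q] ss tt.
have sub mu : s' <= mu <= t' -> s <= mu <= t.
  by move=> /andP[m1 m2]; rewrite (le_trans ss m1) (le_trans m2 tt).
exists l.
  exists h0 => // h mu hh /sub mm; have [p1 p2] := P h mu hh mm; split=> // r r0.
  by have [d d0 D] := p2 r r0; exists d => // mu' /sub; exact: D.
by move=> r r0; have [h1 h10 H] := Q r r0; exists h1 => // h mu hh /sub; exact: H.
Qed.

(** At the nonresonant joint both pieces are Bloch eigenvalues close to [lambda_ j t], and there is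
    only one such eigenvalue. *)
Lemma curve_glue j s t u : t != 1 -> t != -1 -> ~ resonant j t -> s <= t -> t <= u ->
  curve_on j s t -> curve_on j t u -> curve_on j s u.
Proof.
move=> n1 nN1 nres st tu [l1 [h1 h10 P1] Q1] [l2 [h2 h20 P2] Q2].
have [rho [h3 [rho0 h30 U]]] := eigenvalue_unique n1 nN1 nres.
have rho2 : 0 < rho / 2 by rewrite divr_gt0.
have [h4 h40 C1] := Q1 _ rho2; have [h5 h50 C2] := Q2 _ rho2.
pose l h mu := if mu <= t then l1 h mu else l2 h mu.
have t1 : s <= t <= t by rewrite st lexx.
have t2 : t <= t <= u by rewrite tu lexx.
pose h0 := Num.min (Num.min h1 h2) (Num.min h3 (Num.min h4 h5)).
have h00 : 0 < h0 by rewrite !lt_min h10 h20 h30 h40.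
have sub e : h0 <= e -> forall h, - h0 < h < 0 -> - e < h < 0.
  by move=> he h /andP[q1 q2]; rewrite q2 andbT (le_lt_trans _ q1) // lerN2.
have l12 h : - h0 < h < 0 -> l1 h t = l2 h t.
  move=> hh; have [e1 _] := P1 h t (sub h1 ltac:(by rewrite !ge_min lexx ?orbT) h hh) t1.
  have [e2 _] := P2 h t (sub h2 ltac:(by rewrite !ge_min lexx ?orbT) h hh) t2.
  apply: U e1 e2 _ _; first exact: (sub h3 ltac:(by rewrite !ge_min lexx ?orbT)).
    by apply: le_lt_trans (C1 h t (sub h4 ltac:(by rewrite !ge_min lexx ?orbT) h hh) t1) _; lra.
  by apply: le_lt_trans (C2 h t (sub h5 ltac:(by rewrite !ge_min lexx ?orbT) h hh) t2) _; lra.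
have lr h mu : - h0 < h < 0 -> t <= mu -> l h mu = l2 h mu.
  move=> hh tm; rewrite /l; case: (leP mu t) => // mt.
  by have -> : mu = t by [apply/eqP; rewrite eq_le mt tm]; exact: l12.
exists l.
  exists h0 => // h mu hh /andP[m1 m2].
  have hh1 := sub h1 ltac:(by rewrite !ge_min lexx ?orbT) h hh.
  have hh2 := sub h2 ltac:(by rewrite !ge_min lexx ?orbT) h hh.
  split.
    rewrite /l; case: (leP mu t) => mt; first by have [] := P1 h mu hh1 ltac:(by rewrite m1 mt).
    by have [] := P2 h mu hh2 ltac:(by rewrite m2 ltW).
  move=> r r0; have [mt|mt|mt] := ltgtP mu t.
  - have [_ /(_ r r0)[d d0 D]] := P1 h mu hh1 ltac:(by rewrite m1 ltW).
    exists (Num.min d (t - mu)); first by rewrite lt_min d0 subr_gt0.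
    move=> mu' /andP[m1' m2']; rewrite lt_min => /andP[dd dt].
    have mt' : mu' <= t by move: (le_lt_trans (ler_norm _) dt); lra.
    by rewrite /l mt' (ltW mt); apply: D => //; rewrite m1' mt'.
  - have [_ /(_ r r0)[d d0 D]] := P2 h mu hh2 ltac:(by rewrite m2 ltW).
    exists (Num.min d (mu - t)); first by rewrite lt_min d0 subr_gt0.
    move=> mu' /andP[m1' m2']; rewrite lt_min => /andP[dd dt].
    have mt' : t <= mu'.
      by rewrite distrC in dt; move: (le_lt_trans (ler_norm _) dt); lra.
    rewrite (lr h mu' hh mt') (lr h mu hh (ltW mt)).
    by apply: D => //; rewrite m2' mt'.
  have [_ /(_ r r0)[d d0 D]] := P1 h t hh1 t1; have [_ /(_ r r0)[d' d'0 D']] := P2 h t hh2 t2.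
  rewrite mt; exists (Num.min d d'); first by rewrite lt_min d0.
  move=> mu' /andP[m1' m2']; rewrite lt_min => /andP[dd dd'].
  have [mt'|/ltW mt'] := leP mu' t.
    rewrite /l mt' lexx.
    by apply: D => //; rewrite m1' mt'.
  rewrite (lr h mu' hh mt') (lr h t hh (lexx t)).
  by apply: D' => //; rewrite m2' mt'.
move=> r r0; have [h6 h60 D] := Q1 r r0; have [h7 h70 D'] := Q2 r r0.
exists (Num.min h6 h7); first by rewrite lt_min h60.
move=> h mu /andP[q1 q2] /andP[m1 m2]; rewrite /l; case: (leP mu t) => mt.
  by apply: D; rewrite ?m1 ?mt // q2 andbT (le_lt_trans _ q1) // lerN2 ge_min lexx.
apply: D'; last by rewrite m2 ltW.
by rewrite q2 andbT (le_lt_trans _ q1) // lerN2 ge_min lexx orbT.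
Qed.

Lemma good_curve j mu0 : good_at phi T j mu0 -> exists2 d : R, 0 < d & curve_on j (mu0 - d) (mu0 + d).
Proof.
move=> [l [d [d0 P Q]]]; exists (d / 2); first by rewrite divr_gt0.
have near mu : mu0 - d / 2 <= mu <= mu0 + d / 2 -> `|mu - mu0| < d.
  by move=> /andP[m1 m2]; rewrite ltr_norml; apply/andP; split; lra.
exists l.
  exists d => // h mu hh /near mm; have [p1 p2] := P h mu hh mm; split=> // r r0.
  by have [e e0 D] := p2 r r0; exists e => // mu' _; exact: D.
by move=> r r0; have [h1 h10 D] := Q r r0; exists h1 => // h mu hh /near; exact: D.
Qed.

(** The supremum [s] of the end points reachable from [a] must be [b]: a local curve about [s]
    continues beyond it. *)
Lemma curve_interval j (a b : R) : a <= b -> (forall t, a <= t <= b -> t != 1 /\ t != -1) ->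
  (forall t, a <= t <= b -> good_at phi T j t) -> curve_on j a b.
Proof.
move=> ab n1 G.
pose S : set R := [set t | a <= t <= b /\ curve_on j a t].
have Sa : S a.
  split; first by rewrite lexx ab.
  have [d d0 D] := good_curve (G a ltac:(by rewrite lexx ab)).
  by apply: curve_restrict D _ _; lra.
have Sb : ubound S b by move=> t [/andP[]].
have hs : has_sup S by split; [exists a|exists b].
pose s := sup S.
have as_ : a <= s by apply: ub_le_sup => //; exists b.
have sb : s <= b by apply: ge_sup => //; exists a.
have [d d0 D] := good_curve (G s ltac:(by rewrite as_ sb)).
pose u := Num.min b (s + d).
have ub : u <= b by rewrite ge_min lexx.
have usd : u <= s + d by rewrite ge_min lexx orbT.
have su : s <= u by rewrite le_min sb lerDl ltW.
have Cu : curve_on j a u.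
  have [sda|asd] := leP (s - d) a; first exact: curve_restrict D sda usd.
  have [t St st] := sup_adherent d0 hs; rewrite -/s in st.
  have ts : t <= s by apply: ub_le_sup => //; exists b.
  (* [s] may be resonant, and then the pieces need not agree there. The joint is moved to a
     nonresonant point slightly to the left, where both pieces are defined. *)
  have [t' /andP[t1 t2] nres] : exists2 t', s - d < t' < t & ~ resonant j t'.
    by apply: nonresonant_point => // x /andP[x1 x2]; apply: n1; apply/andP; split; lra.
  have [m1 mN1] := n1 t' ltac:(by apply/andP; split; lra).
  case: St => _ Ct; apply: (curve_glue m1 mN1 nres _ _ (curve_restrict Ct (lexx _) (ltW t2))); try lra.
  by apply: curve_restrict D _ _ => //; exact: ltW.
have [bu|ub'] := leP b u; first exact: curve_restrict Cu (lexx _) bu.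
have : u <= s by apply: ub_le_sup; [exists b|split=> //; rewrite ub (le_trans as_ su)].
have : u = s + d by move: ub'; rewrite /u minElt; case: (ltP b (s + d)) => //; rewrite ltxx.
lra.
Qed.
End Gluing.

Section Curves.
Context {R : realType}.
Local Notation C := R[i].

Lemma within_continuousP (I : set R) (f : R -> R) :
  (forall x, I x -> forall r : R, 0 < r -> exists2 d : R, 0 < d & forall y, I y -> `|y - x| < d -> `|f y - f x| <= r) ->
  {within I, continuous f}.
Proof.
move=> H; apply/subspace_continuousP => x Ix; apply/cvgrPdist_le => r r0.
have [d d0 D] := H x Ix r r0.
rewrite /within /=; apply/nbhs_ballP; exists d => //= y; rewrite /ball /= => xy Iy.
by rewrite distrC; apply: D => //; rewrite distrC.
Qed.

Lemma continuous_curveP (I : set R) (c : R -> C) :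
  (forall x, I x -> forall r : R, 0 < r -> exists2 d : R, 0 < d & forall y, I y -> `|y - x| < d -> cabs (c y - c x) <= r) ->
  continuous_curve I c.
Proof.
move=> H; split; apply: within_continuousP => x Ix r r0; have [d d0 D] := H x Ix r r0; exists d => // y Iy xy.
  by rewrite -cReN -cReD; apply: le_trans (Re_le_cabs _) (D y Iy xy).
by rewrite -cImN -cImD; apply: le_trans (Im_le_cabs _) (D y Iy xy).
Qed.

Lemma hausdorff_dist_le (I : set R) (f g : R -> C) (r : R) : 0 < r ->
  (forall x, I x -> cabs (f x - g x) < r) -> (0 <= hausdorff_dist (f @` I) (g @` I) <= r%:E)%E.
Proof.
move=> r0 H; apply/andP; split.
  by apply/ereal_infP => _ [e [e0 _] <-]; rewrite lee_fin ltW.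
apply: ereal_inf_lbound; exists r => //; split=> //; split=> _ [x Ix <-].
  by exists (g x); [exists x|exact: H].
by exists (f x); [exists x|exact: H].
Qed.

Lemma hausdorff_cvg (I : set R) (l : R -> R -> C) (g : R -> C) :
  (forall r : R, 0 < r -> exists2 h1 : R, 0 < h1 & forall h mu, - h1 < h < 0 -> I mu -> cabs (l h mu - g mu) <= r) ->
  hausdorff_dist (l h @` I) (g @` I) @[h --> 0^'-] --> (0 : \bar R).
Proof.
move=> H.
have K (r : R) : 0 < r -> exists2 h1 : R, 0 < h1 & forall h, - h1 < h < 0 ->
    (0 <= hausdorff_dist (l h @` I) (g @` I) <= r%:E)%E.
  move=> r0; have r2 : 0 < r / 2 by rewrite divr_gt0.
  have [h1 h10 P] := H _ r2; exists h1 => // h hh; apply: hausdorff_dist_le => // x Ix.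
  by apply: le_lt_trans (P h x hh Ix) _; lra.
apply/fine_cvgP; split.
  have [h1 h10 P] := K 1 ltr01.
  near=> h; have /P/andP[p1 p2] : - h1 < h < 0.
    apply/andP; split; near: h; last exact: nbhs_left_lt.
    by apply: nbhs_left_gt; rewrite oppr_lt0.
  by rewrite ge0_fin_numE //; apply: le_lt_trans p2 (ltry _).
apply: cvg_at_left0 => e e0; have [h1 h10 P] := K e e0.
exists h1 => // h /P/andP[p1 p2] /=.
have fin : hausdorff_dist (l h @` I) (g @` I) \is a fin_num.
  by rewrite ge0_fin_numE //; apply: le_lt_trans p2 (ltry _).
by rewrite subr0 ger0_norm ?fine_ge0 // -lee_fin fineK.
Unshelve. all: by end_near. Qed.

(** A connected set avoiding all [k / sqrt 3] lies between two consecutive ones, hence is bounded.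
    Its points approximate every point of the hull, so the distance conditions pass to the hull. *)
Lemma interval_hull (I : set R) : connected I ->
  (exists2 d : R, 0 < d & forall mu (k : int), I mu -> d <= `|mu - k%:~R / Num.sqrt 3|) ->
  I !=set0 -> exists a b : R, [/\ a <= b, forall mu, I mu -> a <= mu <= b &
    forall t, a <= t <= b -> forall e : R, 0 < e -> exists2 mu, I mu & `|t - mu| < e].
Proof.
move=> /connected_intervalP itv [d d0 dP] [x0 Ix0].
have s0 : 0 < Num.sqrt 3 :> R by exact: sqrt3_gt0.
have out (k : int) : ~ I (k%:~R / Num.sqrt 3).
  by move=> Ik; have := dP _ k Ik; rewrite subrr normr0 leNgt d0.
pose m := Num.floor (x0 * Num.sqrt 3).
have m1 : m%:~R / Num.sqrt 3 <= x0 by rewrite ler_pdivrMr // floor_le_tmp.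
have m2 : x0 <= (m + 1)%:~R / Num.sqrt 3 by rewrite ler_pdivlMr // ltW // floorD1_gt.
have lbI : lbound I (m%:~R / Num.sqrt 3).
  move=> y Iy; rewrite leNgt; apply/negP => ym; apply: (out m).
  by apply: itv Iy Ix0 _ _; rewrite (ltW ym) m1.
have ubI : ubound I ((m + 1)%:~R / Num.sqrt 3).
  move=> y Iy; rewrite leNgt; apply/negP => ym; apply: (out (m + 1)).
  by apply: itv Ix0 Iy _ _; rewrite (ltW ym) m2.
have hi : has_inf I by split; [exists x0|exists (m%:~R / Num.sqrt 3)].
have hs : has_sup I by split; [exists x0|exists ((m + 1)%:~R / Num.sqrt 3)].
have io mu : I mu -> inf I <= mu <= sup I.
  by move=> Im; rewrite ge_inf ?ub_le_sup //; [case: hs|case: hi].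
exists (inf I), (sup I); split=> //.
  by have /andP[h1 h2] := io x0 Ix0; exact: le_trans h2.
move=> t /andP[t1 t2] e e0.
have [x Ix xt] := inf_adherent e0 hi; have [y Iy yt] := sup_adherent e0 hs.
have [xe|xe] := ltP (t - e) x.
  by exists x => //; rewrite ltr_norml; apply/andP; split; lra.
have [ye|ye] := ltP y (t + e).
  by exists y => //; rewrite ltr_norml; apply/andP; split; lra.
exists t; last by rewrite subrr normr0.
by apply: itv Ix Iy _ _; apply/andP; split; lra.
Qed.

Variables (phi psi : R -> R -> R) (T : R -> R).
Hypothesis Hwave : forall h : R, - 6^-1 < h < 0 -> periodic_wave h (phi h) (psi h) (T h).

Lemma eigenvalue_in_spectrum h mu w : - 6^-1 < h < 0 -> bloch_eigenvalue (phi h) (T h) mu w -> spectrum (phi h) w.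
Proof.
by move=> hr [P PB P0]; exact: (bloch_spectrum (phi_cont (Hwave hr)) (wave_T0 (Hwave hr)) PB P0).
Qed.

Lemma perturbed_curves (I : set R) : connected I ->
  (exists2 d : R, 0 < d & forall mu (k : int), I mu -> d <= `|mu - k%:~R / Num.sqrt 3|) ->
  (exists2 d : R, 0 < d & forall mu, I mu -> d <= `|mu - 1| /\ d <= `|mu + 1|) ->
  forall j : 'I_2, perturbed_curve phi I (lambda_ j).
Proof.
move=> conn dk dm j.
have [I0|/set0P ne] := eqVneq I set0.
  (* Over the empty set any family will do. *)
  exists (fun _ mu => lambda_ j mu); split; last first.
    by apply: hausdorff_cvg => r r0; exists 1 => // h mu _; rewrite I0.
  by exists 1 => // h _; split=> [|mu]; [apply: continuous_curveP => x|]; rewrite I0.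
have [a [b [ab Iab near]]] := interval_hull conn dk ne.
have [d d0 dP] := dk; have [d' d'0 dP'] := dm.
have nk t (k : int) : a <= t <= b -> t != k%:~R / Num.sqrt 3.
  move=> /near/(_ d d0)[mu Im tm]; apply: contraTneq tm => ->.
  by rewrite distrC -leNgt; exact: dP.
have n1 t : a <= t <= b -> t != 1 /\ t != -1.
  move=> /near/(_ d' d'0)[mu Im tm]; have [q1 q2] := dP' mu Im.
  split; apply: contraTneq tm => ->; rewrite distrC -leNgt //.
  by rewrite opprK.
have G t : a <= t <= b -> good_at phi T j t.
  move=> tab; have [t1 tN1] := n1 t tab.
  have [res|nres] := pselect (resonant j t).
    by apply: (local_resonant Hwave t1 tN1) => // n; exact: nk.
  (* The excluded point with [k = 0] supplies [t != 0], where the columns of [modes] become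
     dependent. *)
  apply: (local_nonresonant Hwave t1 tN1) => //.
  by have := nk t 0 tab; rewrite mul0r.
have [l [h0 h00 P] Q] := curve_interval Hwave ab n1 G.
exists l; split; last first.
  apply: hausdorff_cvg => r r0; have [h1 h10 H] := Q r r0; exists h1 => // h mu hh /Iab; exact: H.
exists (Num.min h0 6^-1); first by rewrite lt_min h00 invr_gt0 ltr0n.
move=> h /andP[q1 q2].
have hh0 : - h0 < h < 0 by rewrite q2 andbT (le_lt_trans _ q1) // lerN2 ge_min lexx.
have hr : - 6^-1 < h < 0 by rewrite q2 andbT (le_lt_trans _ q1) // lerN2 ge_min lexx orbT.
split.
  apply: continuous_curveP => x /Iab xab r r0; have [_ /(_ r r0)[e e0 E]] := P h x hh0 xab.
  by exists e => // y /Iab; exact: E.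
by move=> mu /Iab mab; have [ev _] := P h mu hh0 mab; exact: eigenvalue_in_spectrum ev.
Qed.
End Curves.

Unset Implicit Arguments.

Theorem proposition5p5 (R : realType) (phi psi : R -> R -> R) (T : R -> R)
  (Hwave : forall h : R, - 6^-1 < h < 0 ->
     periodic_wave h (phi h) (psi h) (T h)) :
  [/\ forall (mu : R) (j : 'I_2), mu != 1 -> mu != -1 -> ~ resonant j mu ->
        perturbed phi T mu (lambda_ j mu) 1,
      forall (mu : R) (j : 'I_2), mu != 1 -> mu != -1 -> resonant j mu ->
        perturbed phi T mu (lambda_ j mu) 2,
      perturbed phi T 1 (0 +i* 2^-1) 2 &
      perturbed phi T (-1) (0 -i* 2^-1) 2] /\
  (forall I : set R, connected I -> closed I ->
     (exists2 d : R, 0 < d &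
        forall mu (k : int), I mu -> d <= `|mu - k%:~R / Num.sqrt 3|) ->
     (exists2 d : R, 0 < d &
        forall mu, I mu -> d <= `|mu - 1| /\ d <= `|mu + 1|) ->
     forall j : 'I_2, perturbed_curve phi I (lambda_ j)) /\
  (exists2 h0 : R, 0 < h0 &
     forall h, - h0 < h < 0 -> spectrally_unstable (phi h)).
Proof.
split; last split.
- split.
  + exact: perturbed_nonresonant Hwave.
  + exact: perturbed_resonant Hwave.
  + have := perturbed_branch_point Hwave (expr1n R 2).
    by rewrite div1r.
  + have := perturbed_branch_point Hwave (etrans (sqrrN 1) (expr1n R 2)).
    by rewrite mulN1r.
- by move=> I conn _ dk dm j; exact: (perturbed_curves Hwave conn dk dm j).
have n1 : (0 : R) != 1 by rewrite eq_sym oner_eq0.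
have nN1 : (0 : R) != -1 by rewrite eq_sym oppr_eq0 oner_eq0.
have re : 0 < complex.Re (lambda_ ord0 0 : R[i]) by rewrite lambda0 /sgn /= ltr01.
(* Either count provides an eigenvalue tending to [lambda_1 (0) = 1], so it does not have to be
   decided whether [0] is resonant. *)
have [res|nres] := pselect (resonant ord0 (0 : R)).
  exact: perturbed_spectrum (perturbed_resonant Hwave n1 nN1 res) re.
exact: perturbed_spectrum (perturbed_nonresonant Hwave n1 nN1 nres) re.
Qed.
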